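(* (1)(a) Let $(V,m)$ be an $L_\infty$-algebra. Then the sequence $V\xrightarrow{\ \mathbf f\ }\overline{\mathrm{CE}}(V,V)\xrightarrow{\ g\ }\mathrm{CE}(V,V)$ is a homotopy fiber sequence of $L_\infty$-algebras. (1)(b) Let $(V,m)$ be a cyclic $L_\infty$-algebra. Then the sequence $V\xrightarrow{\ \mathbf f\ }\overline{\mathrm{CE}}(V)\xrightarrow{\ g\ }\mathrm{CE}(V)$ is a homotopy fiber sequence of $L_\infty$-algebras. (2)(a) Let $(V,m)$ be an $A_\infty$-algebra. Then the sequence $V\xrightarrow{\ \mathbf f\ }\overline{\mathrm{Hoch}}(V,V)\xrightarrow{\ g\ }\mathrm{Hoch}(V,V)$ is a homotopy fiber sequence of $L_\infty$-algebras. (2)(b) Let $(V,m)$ be a cyclic $A_\infty$-algebra. Then the sequence $V\xrightarrow{\ \mathbf f\ }\overline{\mathrm{CHoch}}(V,V)\xrightarrow{\ g\ }\mathrm{CHoch}(V,V)$ is a homotopy fiber sequence of $L_\infty$-algebras. Here in each case $g$ is the inclusion of dglas and $\mathbf f=(f_r)_{r\ge1}$ is the $L_\infty$-map given, for $w_i,x_i\in\Pi V$ and $n\ge 1$, by $f_r(w_1,\ldots,w_r)(x_1,\ldots,x_n)=m_{r+n}(w_1,\ldots,w_r,x_1,\ldots,x_n)$ in the $L_\infty$-cases (1), and by $f_r(w_1,\ldots,w_r)(x_1,\ldots,x_n)=\sum_{\sigma\in S_r}m_{r+n}(\sigma(w_1\otimes\cdots\otimes w_r)\,|\,x_1,\ldots,x_n)$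 in the $A_\infty$-cases (2).
   Context: Conventions. All vector spaces are $\mathbb Z/2$-graded over a field $\mathbf k$ of characteristic $0$; $\Pi$ is parity reversion; unmarked $\otimes$ is over $\mathbf k$; the Koszul sign rule is used throughout (in particular the dual of a homogeneous map $f$ is $f^*(\phi)=(-1)^{|f||\phi|}\phi\circ f$). A formal space is an inverse limit of finite-dimensional spaces, and maps from/into formal spaces are continuous; $V^*$ is formal for $V$ discrete and $V^{**}=V$. dga, cdga, dgla mean $\mathbb Z/2$-graded differential graded (commutative, Lie) algebras. $\hat T$, $\hat S$ denote completed tensor and symmetric algebras. $S_n$ acts on $n$-th tensor powers by permuting factors. $L_\infty$/$A_\infty$-algebras. An $L_\infty$-structure on $V$ is a continuous odd derivation $m$ of $\hat S\Pi V^*$ with $m^2=0$ and no constant term (the component of $m|_{\Pi V^*}$ in $S^0$ vanishes); an $A_\infty$-structure is the same with $\hat T\Pi V^*$. The duals of the components of $m|_{\Pi V^*}$ are the structure maps $m_i:S^i\Pi V\to\Pi V$ (resp. $m_i:T^i\Pi V\to\Pi V$), $i\ge1$; in the $L_\infty$ case $(S^n\Pi V)^*=((\Pi V^* )^{\hat\otimes n})^{S_n}$ is identified with the coinvariants $S^n\Pi V^*$ by $x_1\otimes\cdots\otimes x_n\mapsto\frac1{n!}x_1\otimes\cdots\otimes x_n$. An $A_\infty$-algebra is regarded as an $L_\infty$-algebra by composing $m:\Pi V^*\to\hat T\Pi V^*$ with the projection $\hat T\Pi V^*\to\hat S\Pi V^*$. If $V$ has a graded symmetric non-degenerate inner product $\langle,\rangle$,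 the structure is cyclic if all $\langle m_i(x_1,\ldots,x_i),x_{i+1}\rangle$ are invariant under cyclic permutations of $x_1,\ldots,x_{i+1}\in\Pi V$ (with Koszul signs). In the $A_\infty$ formula, $m_{r+n}(w_{1},\ldots,w_{r}|x_1,\ldots,x_n):=\sum\pm m_{r+n}(z_1,\ldots,z_{r+n})$, the sum over all $\binom{r+n}{r}$ shuffles of the two sequences, with Koszul signs. Complexes. $\mathrm{CE}(V,V)=\mathrm{Der}(\hat S\Pi V^* )$ and $\mathrm{Hoch}(V,V)=\mathrm{Der}(\hat T\Pi V^* )$ (continuous derivations), dglas with commutator bracket and differential $[m,-]$; $\overline{\mathrm{CE}}(V,V)$, $\overline{\mathrm{Hoch}}(V,V)$ are the sub-dglas of derivations with no constant term. By dualization, elements are identified with (possibly infinite) families of graded-symmetric (resp. arbitrary) multilinear maps $(\Pi V)^{\otimes n}\to\Pi V$, with $n\ge0$ for the full and $n\ge1$ for the truncated complexes. For cyclic $V$, $\mathrm{CE}(V)$, $\overline{\mathrm{CE}}(V)$, $\mathrm{CHoch}(V,V)$, $\overline{\mathrm{CHoch}}(V,V)$ are the sub-dglas of $\mathrm{CE}(V,V)$, $\overline{\mathrm{CE}}(V,V)$, $\mathrm{Hoch}(V,V)$, $\overline{\mathrm{Hoch}}(V,V)$ consisting of cyclically invariant cochains $c$, i.e. those with $\langle c(x_1,\ldots,x_n),x_{n+1}\rangle$ cyclically invariant (symplectic derivations). $L_\infty$-maps. An $L_\infty$-map $V\to W$ is a continuous cdga map $(\hat S\Pi W^*,m_W)\to(\hat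 S\Pi V^*,m_V)$; for $W$ a dgla (viewed as an $L_\infty$-algebra) this amounts to a family of even graded-symmetric maps $f_r:(\Pi V)^{\otimes r}\to\Pi W$, $r\ge1$, such that the corresponding odd element $x$ of $(\hat S\Pi V^* )_+\otimes W\cong\mathrm{Hom}(\bigoplus_{r\ge1}S^r\Pi V,W)$ satisfies $(m_V+d_W)x+\frac12[x,x]=0$. It is an $L_\infty$-quasi-isomorphism if its linear part is a quasi-isomorphism. The formulas in the claim do define $L_\infty$-maps into the indicated dglas. Homotopy fiber sequences. For a dgla map $f:\mathfrak g\to\mathfrak h$ let $\mathbf k[z,dz]$ be the polynomial de Rham algebra of the interval, $\mathfrak h[z,dz]=\mathfrak h\otimes\mathbf k[z,dz]$, and $H_f=\{(g,h)\in\mathfrak g\oplus\mathfrak h[z,dz]: h|_{z=0}=0,\ h|_{z=1}=f(g)\}$, with the projection $H_f\to\mathfrak g$. The sequence $H_f\to\mathfrak g\to\mathfrak h$, and any 3-term sequence of dglas homotopy equivalent to it, is a homotopy fiber sequence of dglas. A sequence $\mathfrak a\to\mathfrak g\to\mathfrak h$ of $L_\infty$-algebras and $L_\infty$-maps is a homotopy fiber sequence if it is $L_\infty$-quasi-isomorphic (connected by a zigzag of morphisms of 3-term sequences whose components are $L_\infty$-quasi-isomorphisms) to a homotopy fiber sequence of dglas. *)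

(* Defs.v *)
From HB Require Import structures.
From mathcomp Require Import all_boot all_order all_algebra.
From mathcomp Require Import boolp classical_sets functions.
From mathcomp Require Import ring.
From Stdlib Require Import Relation_Operators.
Set Implicit Arguments.
Unset Strict Implicit.
Unset Printing Implicit Defensive.
Import GRing.Theory.
Local Open Scope ring_scope.

Definition mklin (k : fieldType) (V W : lmodType k) (f : V -> W)
    (Hf : linear f) : {linear V -> W} :=
  HB.pack f (GRing.isLinear.Build k V W *:%R f Hf).

Record submodule (k : fieldType) (V : lmodType k) := Submodule {
  smem :> V -> Prop;
  smem0 : smem 0;
  smemP : forall (a : k) (x y : V), smem x -> smem y -> smem (a *: x + y) }.

Record sub_of (k : fieldType) (V : lmodType k) (S : submodule V) :=
  SubOf { sub_val : V; sub_valP : `[< S sub_val >] }.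

Section SubOf.
Variables (k : fieldType) (V : lmodType k) (S : submodule V).

HB.instance Definition _ := [isSub for @sub_val k V S].
HB.instance Definition _ := [Choice of sub_of S by <:].

Fact sub_of_closed : submod_closed (fun x : V => `[< S x >]).
Proof.
split; first by apply/asboolP; exact: smem0.
by move=> a x y /asboolP Sx /asboolP Sy; apply/asboolP; exact: smemP.
Qed.

HB.instance Definition _ :=
  GRing.SubChoice_isSubLmodule.Build k V _ (sub_of S) sub_of_closed.

Lemma smemV (x : sub_of S) : S (val x).
Proof. exact/asboolP/(valP x). Qed.

Definition insub_of (x : V) (Sx : S x) : sub_of S := SubOf (asboolT Sx).

Lemma smemD (x y : V) : S x -> S y -> S (x + y).
Proof. by move=> Sx Sy; rewrite -[x]scale1r; exact: smemP. Qed.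
Lemma smemZ a (x : V) : S x -> S (a *: x).
Proof. by move=> Sx; rewrite -[_ *: _]addr0; apply: smemP => //; exact: smem0. Qed.
Lemma smemN (x : V) : S x -> S (- x).
Proof. by move=> Sx; rewrite -scaleN1r; exact: smemZ. Qed.
Lemma smemB (x y : V) : S x -> S y -> S (x - y).
Proof. by move=> Sx /smemN; exact: smemD. Qed.

End SubOf.

(* [prt a] is the projection to the component of parity [a] ([true] is odd). *)
Record superspace (k : fieldType) := Superspace {
  spc :> lmodType k;
  prt : bool -> {linear spc -> spc};
  prtK : forall a b x, prt a (prt b x) = if a == b then prt b x else 0;
  prtD : forall x, prt false x + prt true x = x }.
Arguments prt {k s}.

Definition homog (k : fieldType) (V : superspace k) (a : bool) (x : V) : Prop :=
  prt a x = x.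

(* x |-> (-1)^|x| x *)
Definition gr (k : fieldType) (V : superspace k) (x : V) : V :=
  prt false x - prt true x.

Definition Pi (k : fieldType) (V : superspace k) : superspace k :=
  @Superspace k V (fun a => prt (~~ a))
    (fun a b x => ltac:(by rewrite prtK; case: a; case: b))
    (fun x => ltac:(by rewrite addrC prtD)).

Section SuperTheory.
Variables (k : fieldType) (V : superspace k).
Implicit Types (x y : V) (a b : bool).

Lemma homog_prt a x : homog a (prt a x).
Proof. by rewrite /homog prtK eqxx. Qed.
Lemma homog_prtN a b x : homog b x -> prt a x = if a == b then x else 0.
Proof. by move=> <-; rewrite prtK; case: eqP => // ->. Qed.
Lemma gr_linear : linear (@gr k V).
Proof. by move=> c x y; rewrite /gr !(linearP (prt _)) scalerBr opprD addrACA. Qed.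
Lemma gr_homog a x : homog a x -> gr x = (-1) ^+ a *: x.
Proof.
by move=> hx; rewrite /gr !(homog_prtN _ hx); case: a hx => _ /=;
  rewrite ?sub0r ?subr0 ?expr1 ?expr0 ?scaleN1r ?scale1r.
Qed.
Lemma prt_gr a x : prt a (gr x) = (-1) ^+ a *: prt a x.
Proof.
rewrite /gr linearB /= !prtK; case: a => /=;
  by rewrite ?sub0r ?subr0 ?expr1 ?expr0 ?scaleN1r ?scale1r.
Qed.
Lemma homog_scale a c x : homog a x -> homog a (c *: x).
Proof. by rewrite /homog linearZ /= => ->. Qed.
Lemma homogD a x y : homog a x -> homog a y -> homog a (x + y).
Proof. by rewrite /homog linearD /= => -> ->. Qed.
Lemma homog0 a : homog a (0 : V).
Proof. by rewrite /homog linear0. Qed.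
Lemma homogN a x : homog a x -> homog a (- x).
Proof. by rewrite /homog linearN /= => ->. Qed.
Lemma homogB a x y : homog a x -> homog a y -> homog a (x - y).
Proof. by move=> hx /homogN; exact: homogD. Qed.
Lemma homog_gr a x : homog a x -> homog a (gr x).
Proof. by move=> hx; rewrite (gr_homog hx); exact: homog_scale. Qed.
Lemma grK x : gr (gr x) = x.
Proof.
by rewrite {1}/gr !prt_gr expr0 expr1 scale1r scaleN1r opprK prtD.
Qed.
End SuperTheory.

HB.instance Definition _ (k : fieldType) (V : superspace k) :=
  GRing.isLinear.Build k V V *:%R (@gr k V) (@gr_linear k V).

Section SubSuper.
Variables (k : fieldType) (V : superspace k) (S : submodule V).
Hypothesis Sprt : forall a x, S x -> S (prt a x).

Definition sub_prt a (x : sub_of S) : sub_of S := insub_of (Sprt a (smemV x)).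

Fact sub_prt_linear a : linear (sub_prt a).
Proof. by move=> c x y; apply: val_inj; rewrite !linearP /= linearP. Qed.

Definition subsuper : superspace k :=
  @Superspace k (sub_of S) (fun a => mklin (sub_prt_linear a))
   (fun a b x => ltac:(by apply: val_inj; rewrite /= prtK; case: eqP; rewrite ?linear0))
   (fun x => ltac:(by apply: val_inj; rewrite linearD /= prtD)).
End SubSuper.

Inductive flavour := Com | Ass.

Section Words.
Variables (k : fieldType) (U : superspace k).
Implicit Types (f g : seq U -> k^o) (s t : seq U).

(* A function [f] on words is the family of its restrictions to the words of
   length n.  Multilinear families are the elements of the completed tensor
   algebra of U^*, i.e. of the dual of the tensor algebra of U; graded symmetric
   multilinear families are the elements of the completed symmetric algebra,
   (S^n U)^* being the S_n-invariants of the n-th completed tensor power. *)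
Definition multilinear f := forall s1 s2 (a : k) (x y : U),
  f (s1 ++ (a *: x + y) :: s2) = a * f (s1 ++ x :: s2) + f (s1 ++ y :: s2).

Definition graded_symmetric f := forall s1 s2 (a b : bool) (x y : U),
  homog a x -> homog b y ->
  f (s1 ++ x :: y :: s2) = (-1) ^+ (a && b) * f (s1 ++ y :: x :: s2).

Definition formal_mem (c : flavour) f :=
  multilinear f /\ (c = Com -> graded_symmetric f).

(* Component of parity [b] of a multilinear family: the restriction to the
   homogeneous words of total parity [b], extended by 0 and multilinearity. *)
Fixpoint wprt (b : bool) s f : k :=
  if s is x :: s' then
    wprt b s' (fun t => f (prt false x :: t)) +
    wprt (~~ b) s' (fun t => f (prt true x :: t))
  else if b then 0 else f [::].

(* Products, with (f (x) g)(A (x) B) = (-1)^(|g||A|) f(A) g(B).  Since g(B) is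
   nonzero only for |g| = |B|, on a homogeneous word s the value is
     [Ass]  sum over s = A ++ B of               (-1)^(|A||B|) f(A) g(B),
     [Com]  sum over unshuffles (A, B) of s of   eps (-1)^(|A||B|) f(A) g(B),
   eps being the Koszul sign of s -> A ++ B.  The recursion decides whether the
   first letter x belongs to A or to B, and in the first case records the sign
   (-1)^(|x||B|) as an application of [gr] to B.  For [Com] this is the product
   of the symmetric algebra of coinvariants, transported to invariants by the
   inverse x1...xn |-> sum over S_n of the map x1 (x)...(x) xn |-> x1...xn / n!. *)
Fixpoint wmul (c : flavour) s f g : k :=
  if s is x :: s' then
    (if c is Com then wmul c s' f (fun t => g (x :: t)) else f [::] * g s) +
    wmul c s' (fun t => f (prt false x :: t)) g +
    wmul c s' (fun t => f (prt true x :: t)) (fun t => g (map (@gr k U) t))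
  else f [::] * g [::].

Lemma ml_cons f x : multilinear f -> multilinear (fun t => f (x :: t)).
Proof. by move=> mf s1 s2 a y z; exact: (mf (x :: s1)). Qed.
Lemma ml_hd f a x y s : multilinear f ->
  f ((a *: x + y) :: s) = a * f (x :: s) + f (y :: s).
Proof. by move=> mf; exact: (mf [::]). Qed.
Lemma ml_hd0 f s : multilinear f -> f (0 :: s) = 0.
Proof.
move=> mf; have := ml_hd 1 0 0 s mf.
rewrite scaler0 addr0 mul1r => /eqP.
by rewrite -subr_eq0 opprD addNKr oppr_eq0 => /eqP.
Qed.
Lemma ml_gr f : multilinear f -> multilinear (fun t => f (map (@gr k U) t)).
Proof. by move=> mf s1 s2 a y z; rewrite !map_cat /= linearP; exact: mf. Qed.
Lemma ml_hdD f x y s : multilinear f -> f ((x + y) :: s) = f (x :: s) + f (y :: s).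
Proof. by move=> mf; rewrite -[x]scale1r ml_hd // mul1r scale1r. Qed.
Lemma ml_hdZ f a x s : multilinear f -> f ((a *: x) :: s) = a * f (x :: s).
Proof. by move=> mf; rewrite -[_ *: _]addr0 ml_hd // (ml_hd0 s mf) addr0. Qed.
Lemma ml_prt f x s : multilinear f ->
  f (prt false x :: s) + f (prt true x :: s) = f (x :: s).
Proof. by move=> mf; rewrite -ml_hdD // prtD. Qed.

Lemma sy_cons f x : graded_symmetric f -> graded_symmetric (fun t => f (x :: t)).
Proof. by move=> mf s1 s2 a b y z; exact: (mf (x :: s1)). Qed.
Lemma sy_gr f : graded_symmetric f -> graded_symmetric (fun t => f (map (@gr k U) t)).
Proof.
move=> sf s1 s2 a b x y hx hy; rewrite !map_cat /=.
by apply: sf; exact: homog_gr.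
Qed.
Lemma sy_hd f a b x y s : graded_symmetric f -> homog a x -> homog b y ->
  f (x :: y :: s) = (-1) ^+ (a && b) * f (y :: x :: s).
Proof. by move=> sf hx hy; exact: (sf [::]). Qed.

Lemma ml_lin a f g : multilinear f -> multilinear g ->
  multilinear (fun s => a * f s + g s : k^o).
Proof.
by move=> mf mg s1 s2 c x y; rewrite mf mg; ring.
Qed.
Lemma sy_lin a f g : graded_symmetric f -> graded_symmetric g ->
  graded_symmetric (fun s => a * f s + g s : k^o).
Proof.
move=> mf mg s1 s2 c d x y hx hy; rewrite (mf _ _ _ _ _ _ hx hy) (mg _ _ _ _ _ _ hx hy).
by rewrite mulrDr mulrCA.
Qed.

Lemma wprt_ext b s f g : f =1 g -> wprt b s f = wprt b s g.
Proof.
elim: s b f g => [|x s IH] b f g fg /=; first by rewrite fg.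
by congr (_ + _); apply: IH => t; rewrite fg.
Qed.
Lemma wprt_lin b s a f g :
  wprt b s (fun t => a * f t + g t) = a * wprt b s f + wprt b s g.
Proof.
elim: s b f g => [|x s IH] b f g /=; first by case: b; rewrite ?mulr0 ?addr0.
by rewrite !IH mulrDr addrACA.
Qed.
Lemma wprt0 b s f : (forall t, f t = 0) -> wprt b s f = 0.
Proof.
elim: s b f => [|x s IH] b f f0 /=; first by case: b.
by rewrite !IH ?addr0.
Qed.
Lemma wprtZ b s a f : wprt b s (fun t => a * f t) = a * wprt b s f.
Proof.
transitivity (wprt b s (fun t => a * f t + 0)); first by apply: wprt_ext => t; rewrite addr0.
by rewrite (wprt_lin _ _ _ f (fun=> 0)) [X in _ + X]wprt0 ?addr0.
Qed.
Lemma wprt_homog b a x s f : multilinear f -> homog a x ->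
  wprt b (x :: s) f = wprt (a (+) b) s (fun t => f (x :: t)).
Proof.
move=> mf hx /=; rewrite !(homog_prtN _ hx); case: a hx => _ /=.
  by rewrite wprt0 ?add0r // => t; exact: ml_hd0.
by rewrite [X in _ + X]wprt0 ?addr0 // => t; exact: ml_hd0.
Qed.

Lemma ml_wprt b f : multilinear f -> multilinear (fun s => wprt b s f : k^o).
Proof.
move=> mf s1; elim: s1 b f mf => [|z s1 IH] b f mf s2 a x y /=.
  rewrite mulrDr addrACA -!wprt_lin.
  by congr (_ + _); apply: wprt_ext => t; rewrite linearP ml_hd.
rewrite mulrDr addrACA -!IH //; exact: ml_cons.
Qed.
Lemma sy_wprt b f : multilinear f -> graded_symmetric f ->
  graded_symmetric (fun s => wprt b s f : k^o).
Proof.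
move=> mf sf s1; elim: s1 b f mf sf => [|z s1 IH] b f mf sf s2 p q x y hx hy.
  rewrite [[::] ++ _]/= [[::] ++ _]/= (wprt_homog _ _ mf hx) (wprt_homog _ _ mf hy).
  rewrite (wprt_homog _ _ (ml_cons x mf) hy) (wprt_homog _ _ (ml_cons y mf) hx).
  rewrite addbCA -wprtZ; apply: wprt_ext => t.
  by rewrite (sy_hd _ sf hx hy).
rewrite /= mulrDr; congr (_ + _); apply: IH => //; by [apply: ml_cons|apply: sy_cons].
Qed.
Lemma wprtD f s : multilinear f -> wprt false s f + wprt true s f = f s.
Proof.
elim: s f => [|x s IH] f mf /=; first by rewrite addr0.
rewrite addrACA [X in _ + X]addrC !IH ?ml_prt //; exact: ml_cons.
Qed.
Lemma wprtK a b s f : multilinear f ->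
  wprt a s (fun t => wprt b t f) = if a == b then wprt b s f else 0.
Proof.
elim: s a b f => [|x s IH] a b f mf; first by case: a; case: b.
rewrite [LHS]/=.
transitivity (wprt a s (fun t => wprt b t (fun u => f (prt false x :: u))) +
   wprt (~~ a) s (fun t => wprt (~~ b) t (fun u => f (prt true x :: u)))).
  by congr (_ + _); apply: wprt_ext => t; rewrite -/(wprt b (_ :: t) f)
   (wprt_homog _ _ mf (homog_prt _ _)).
rewrite !IH; try exact: ml_cons.
by rewrite (inj_eq negb_inj); case: eqP => // _; rewrite addr0.
Qed.

Lemma wmul_ext c s f f' g g' : f =1 f' -> g =1 g' ->
  wmul c s f g = wmul c s f' g'.
Proof.
elim: s f f' g g' => [|x s IH] f f' g g' ff gg /=; first by rewrite ff gg.
by congr (_ + _ + _); rewrite ?ff ?gg //; case: c {IH} (IH) => IH; rewrite ?ff ?gg //;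
   apply: IH => t; rewrite ?ff ?gg.
Qed.
Lemma wmul_linl c s a f f' g :
  wmul c s (fun t => a * f t + f' t) g = a * wmul c s f g + wmul c s f' g.
Proof.
elim: s f f' g => [|x s IH] f f' g /=; first by rewrite mulrDl mulrA.
rewrite !IH !mulrDr [RHS]addrACA; congr (_ + _).
rewrite [RHS]addrACA; congr (_ + _).
by case: c {IH} (IH) => IH; rewrite ?IH // mulrDl mulrA.
Qed.
Lemma wmul_linr c s a f g g' :
  wmul c s f (fun t => a * g t + g' t) = a * wmul c s f g + wmul c s f g'.
Proof.
elim: s f g g' => [|x s IH] f g g' /=; first by rewrite mulrDr mulrCA.
rewrite !IH !mulrDr [RHS]addrACA; congr (_ + _).
rewrite [RHS]addrACA; congr (_ + _).
by case: c {IH} (IH) => IH; rewrite ?IH // mulrCA.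
Qed.
Lemma wmul0l c s f g : (forall t, f t = 0) -> wmul c s f g = 0.
Proof.
elim: s f g => [|x s IH] f g f0 /=; first by rewrite f0 mul0r.
rewrite ![wmul _ _ (fun _ => _) _]IH // !addr0.
by case: c {IH} (IH) => IH; rewrite ?IH // f0 mul0r.
Qed.
Lemma wmulZl c s a f g : wmul c s (fun t => a * f t) g = a * wmul c s f g.
Proof.
transitivity (wmul c s (fun t => a * f t + 0) g); first by apply: wmul_ext => t //; rewrite addr0.
by rewrite (wmul_linl _ _ _ f (fun=> 0)) [X in _ + X]wmul0l ?addr0.
Qed.
Lemma wmul0r c s f g : (forall t, g t = 0) -> wmul c s f g = 0.
Proof.
elim: s f g => [|x s IH] f g f0 /=; first by rewrite f0 mulr0.
rewrite !(IH _ _ _) // !addr0.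
by case: c {IH} (IH) => IH; rewrite ?IH // f0 mulr0.
Qed.
Lemma wmulZr c s a f g : wmul c s f (fun t => a * g t) = a * wmul c s f g.
Proof.
transitivity (wmul c s f (fun t => a * g t + 0)); first by apply: wmul_ext => t //; rewrite addr0.
by rewrite (wmul_linr _ _ _ _ g (fun=> 0)) [X in _ + X]wmul0r ?addr0.
Qed.

Lemma ml_wmul c f g : multilinear f -> multilinear g ->
  multilinear (fun s => wmul c s f g : k^o).
Proof.
move=> mf mg s1; elim: s1 f g mf mg => [|z s1 IH] f g mf mg s2 a x y.
  rewrite /= !mulrDr [RHS]addrACA; congr (_ + _); last first.
    by rewrite -wmul_linl; apply: wmul_ext => // t; rewrite linearP ml_hd.
  rewrite [RHS]addrACA; congr (_ + _); last first.
    by rewrite -wmul_linl; apply: wmul_ext => // t; rewrite linearP ml_hd.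
  case: c; last by rewrite ml_hd // mulrDr mulrCA.
  by rewrite -wmul_linr; apply: wmul_ext => // t; rewrite ml_hd.
rewrite /= !mulrDr [RHS]addrACA; congr (_ + _); last first.
  by apply: IH; [exact: ml_cons | exact: ml_gr].
rewrite [RHS]addrACA; congr (_ + _); last by apply: IH; first exact: ml_cons.
case: c {IH} (IH) => IH; first by apply: IH => //; exact: ml_cons.
by rewrite (mg (z :: s1)) mulrDr mulrCA.
Qed.

Let tw (a : bool) (g : seq U -> k^o) : seq U -> k^o :=
  fun t => g (if a then map (@gr k U) t else t).

Let wmul_homog a x s f g : multilinear f -> homog a x ->
  wmul Com (x :: s) f g = wmul Com s f (fun t => g (x :: t)) +
    wmul Com s (fun t => f (x :: t)) (tw a g).
Proof.
move=> mf hx; rewrite /= !(homog_prtN _ hx) -addrA; congr (_ + _).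
case: a hx => _ /=.
  by rewrite wmul0l ?add0r // => t; exact: ml_hd0.
by rewrite [X in _ + X]wmul0l ?addr0 // => t; exact: ml_hd0.
Qed.

Let twC a b x t (g : seq U -> k^o) : multilinear g -> homog b x ->
  tw a g (x :: t) = (-1) ^+ (a && b) * tw a (fun t => g (x :: t)) t.
Proof.
rewrite /tw => mg hx; case: a => /=; last by rewrite expr0 mul1r.
by rewrite (gr_homog hx) ml_hdZ.
Qed.

Lemma sy_wmul f g : multilinear f -> multilinear g ->
  graded_symmetric f -> graded_symmetric g ->
  graded_symmetric (fun s => wmul Com s f g : k^o).
Proof.
move=> mf mg sf sg s1.
elim: s1 f g mf mg sf sg => [|z s1 IH] f g mf mg sf sg s2 p q x y hx hy.
  have two a b u v : homog a u -> homog b v -> wmul Com (u :: v :: s2) f g =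
      wmul Com s2 f (fun t => g (u :: v :: t)) +
      wmul Com s2 (fun t => f (v :: t)) (tw b (fun t => g (u :: t))) +
      (wmul Com s2 (fun t => f (u :: t)) (fun t => tw a g (v :: t)) +
       wmul Com s2 (fun t => f (u :: v :: t)) (tw b (tw a g))).
    move=> hu hv; rewrite (wmul_homog _ _ mf hu) (wmul_homog _ _ mf hv).
    by rewrite (wmul_homog _ _ (ml_cons u mf) hv).
  rewrite [LHS](two p q x y hx hy) (two q p y x hy hx).
  have e0 : wmul Com s2 f (fun t => g (x :: y :: t)) =
    (-1) ^+ (p && q) * wmul Com s2 f (fun t => g (y :: x :: t)).
    by rewrite -wmulZr; apply: wmul_ext => // t; rewrite (sy_hd _ sg hx hy).
  have e1 : wmul Com s2 (fun t => f (x :: t)) (fun t => tw p g (y :: t)) =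
    (-1) ^+ (p && q) * wmul Com s2 (fun t => f (x :: t)) (tw p (fun t => g (y :: t))).
    by rewrite -wmulZr; apply: wmul_ext => // t; exact: twC.
  have e2 : wmul Com s2 (fun t => f (y :: t)) (fun t => tw q g (x :: t)) =
    (-1) ^+ (p && q) * wmul Com s2 (fun t => f (y :: t)) (tw q (fun t => g (x :: t))).
    by rewrite -wmulZr; apply: wmul_ext => // t; rewrite andbC; exact: twC.
  have e3 : wmul Com s2 (fun t => f (x :: y :: t)) (tw q (tw p g)) =
    (-1) ^+ (p && q) * wmul Com s2 (fun t => f (y :: x :: t)) (tw p (tw q g)).
    rewrite -wmulZl; apply: wmul_ext => t; first by rewrite (sy_hd _ sf hx hy).
    by rewrite /tw; case: (p); case: (q).
  rewrite e0 e1 e2 e3; have := signrMK (p && q) : forall z : k, _.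
  set e := (-1) ^+ _; move=> eK.
  rewrite !mulrDr !eK -!addrA; congr (_ + _).
  by rewrite addrCA.
rewrite /= !mulrDr; congr (_ + _ + _); apply: IH => //;
  by [apply: ml_cons|apply: sy_cons|apply: ml_gr|apply: sy_gr].
Qed.
End Words.

Section Formal.
Variables (k : fieldType) (c : flavour) (U : superspace k).

Fact formal_mem0 : @formal_mem k U c 0.
Proof.
split=> [s1 s2 a x y|_ s1 s2 a b x y _ _].
  by change (0 = a * 0 + 0 :> k); rewrite mulr0 addr0.
by change (0 = (-1) ^+ (a && b) * 0 :> k); rewrite mulr0.
Qed.
Fact formal_memP (a : k) (f g : seq U -> k^o) :
  formal_mem c f -> formal_mem c g -> formal_mem c (a *: f + g).
Proof.
by move=> [mf sf] [mg sg]; split=> [|e]; [apply: ml_lin|apply: sy_lin; auto].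
Qed.

Definition formal_sub : submodule _ := Submodule formal_mem0 formal_memP.

Definition ev (f : sub_of formal_sub) (s : seq U) : k := val f s.

Lemma evP f g : ev f =1 ev g -> f = g.
Proof. by move=> fg; apply: val_inj; apply: funext. Qed.
Lemma ev_ml f : multilinear (ev f). Proof. by case: (smemV f). Qed.
Lemma ev_sy f : c = Com -> graded_symmetric (ev f).
Proof. by case: (smemV f). Qed.
Lemma ev_lin (a : k) f g s : ev (a *: f + g) s = a * ev f s + ev g s.
Proof. by rewrite /ev linearP. Qed.
Lemma ev0 s : ev 0 s = 0. Proof. by rewrite /ev raddf0. Qed.

Lemma evD f g s : ev (f + g) s = ev f s + ev g s.
Proof. by rewrite /ev linearD. Qed.
Lemma evZ a f s : ev (a *: f) s = a * ev f s.
Proof. by rewrite /ev linearZ. Qed.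
Lemma evN f s : ev (- f) s = - ev f s.
Proof. by rewrite /ev linearN. Qed.

Fact fprt_subproof b f : formal_mem c (fun s => wprt b s (ev f) : k^o).
Proof.
by split=> [|e]; [apply: ml_wprt|apply: sy_wprt];
  try exact: ev_ml; exact: ev_sy.
Qed.
Definition fprt b f : sub_of formal_sub :=
  @insub_of _ _ formal_sub _ (fprt_subproof b f).
Lemma ev_fprt b f s : ev (fprt b f) s = wprt b s (ev f).
Proof. by []. Qed.
Fact fprt_linear b : linear (fprt b).
Proof.
move=> a f g; apply: evP => s; rewrite ev_lin !ev_fprt -wprt_lin.
by apply: wprt_ext => t; exact: ev_lin.
Qed.
Fact fprtK a b f : fprt a (fprt b f) = if a == b then fprt b f else 0.
Proof.
apply: evP => s; rewrite !ev_fprt wprtK; last exact: ev_ml.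
by case: eqP; rewrite ?ev0.
Qed.
Fact fprtD f : fprt false f + fprt true f = f.
Proof.
apply: evP => s; rewrite -[fprt _ _ in LHS]scale1r ev_lin !ev_fprt mul1r.
exact/wprtD/ev_ml.
Qed.

Definition formal : superspace k :=
  @Superspace k (sub_of formal_sub) (fun b => mklin (fprt_linear b)) fprtK fprtD.

Fact fmul_subproof (f g : formal) : formal_mem c (fun s => wmul c s (ev f) (ev g) : k^o).
Proof.
split; first by apply: ml_wmul; exact: ev_ml.
by move=> e; rewrite [X in wmul X]e; apply: sy_wmul; by [exact: ev_ml|exact: ev_sy].
Qed.
Definition fmul (f g : formal) : formal :=
  @insub_of _ _ formal_sub _ (fmul_subproof f g).
Lemma fmul_linl a f f' g : fmul (a *: f + f') g = a *: fmul f g + fmul f' g.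
Proof.
apply: evP => s; rewrite ev_lin /ev /= -wmul_linl; apply: wmul_ext => // t.
Qed.
Lemma fmul_linr a f g g' : fmul f (a *: g + g') = a *: fmul f g + fmul f g'.
Proof.
apply: evP => s; rewrite ev_lin /ev /= -wmul_linr; apply: wmul_ext => // t.
Qed.
Lemma fmulDl f f' g : fmul (f + f') g = fmul f g + fmul f' g.
Proof. by rewrite -[f]scale1r fmul_linl !scale1r. Qed.
Lemma fmulDr f g g' : fmul f (g + g') = fmul f g + fmul f g'.
Proof. by rewrite -[g]scale1r fmul_linr !scale1r. Qed.
Lemma fmul0l g : fmul 0 g = 0.
Proof. by apply: (@addIr _ (fmul 0 g)); rewrite -fmulDl !add0r. Qed.
Lemma fmul0r g : fmul g 0 = 0.
Proof. by apply: (@addIr _ (fmul g 0)); rewrite -fmulDr !add0r. Qed.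
Lemma fmulZl a f g : fmul (a *: f) g = a *: fmul f g.
Proof. by rewrite -[a *: f]addr0 fmul_linl fmul0l addr0. Qed.
Lemma fmulZr a f g : fmul f (a *: g) = a *: fmul f g.
Proof. by rewrite -[a *: g]addr0 fmul_linr fmul0r addr0. Qed.

Definition fone_fun (s : seq U) : k^o := (s == [::])%:R.
Fact fone_subproof : formal_mem c fone_fun.
Proof.
by split=> [s1 s2 a x y|_ s1 s2 a b x y _ _]; rewrite /fone_fun;
  case: s1 => [|? ?] /=; rewrite ?mulr0 ?addr0.
Qed.
Definition fone : formal := @insub_of _ _ formal_sub _ fone_subproof.

(* The inclusion of U^* as the functions of word length 1. *)
Definition flin_fun (l : {linear U -> k^o}) (s : seq U) : k^o :=
  if s is [:: x] then l x else 0.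
Fact flin_subproof l : formal_mem c (flin_fun l).
Proof.
split=> [s1 s2 a x y|_ s1 s2 a b x y _ _]; case: s1 => [|z [|z' s1]] /=;
  rewrite /flin_fun ?mulr0 ?addr0 //; case: s2 => [|? ?];
  by rewrite ?linearP ?mulr0 ?addr0.
Qed.
Definition flin (l : {linear U -> k^o}) : formal :=
  @insub_of _ _ formal_sub _ (flin_subproof l).
End Formal.

Section Operators.
Variables (k : fieldType) (c c' : flavour) (U U' : superspace k).

(* Both sides carry the topology of a dual of a discrete space: the annihilators
   of finite sets of words form a basis of neighbourhoods of 0. *)
Definition continuous_op (T : formal c U -> formal c' U') : Prop :=
  forall s : seq U', exists L : seq (seq U),
    forall f, (forall t, t \in L -> ev f t = 0) -> ev (T f) s = 0.
End Operators.

Section Der.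
Variables (k : fieldType) (c : flavour) (U : superspace k).
Local Notation F := (formal c U).
Implicit Types (D : F -> F) (f g : F) (a b : bool).

(* Homogeneous continuous derivations of parity [b]. *)
Record hder (b : bool) (D : F -> F) : Prop := Hder {
  hder_lin : linear D;
  hder_cont : continuous_op D;
  hder_homog : forall a f, homog a f -> homog (b (+) a) (D f);
  hder_mul : forall a f g, homog a f ->
    D (fmul f g) = fmul (D f) g + (-1) ^+ (b && a) *: fmul f (D g) }.

Definition is_der (D : F -> F) : Prop :=
  exists D0 D1, [/\ hder false D0, hder true D1 & D = D0 + D1].

(* Parity component of an operator, for the grading of Hom(F, F). *)
Definition component (b : bool) (D : F -> F) (f : F) : F :=
  prt b (D (prt false f)) + prt (~~ b) (D (prt true f)).

Lemma hder_lin0 b D : hder b D -> D 0 = 0.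
Proof.
move=> /hder_lin HD; have := HD 1 0 0; rewrite scaler0 addr0 scale1r.
by move/eqP; rewrite -subr_eq0 opprD addNKr oppr_eq0 => /eqP.
Qed.
Lemma hder_linD b D f g : hder b D -> D (f + g) = D f + D g.
Proof. by move=> /hder_lin HD; rewrite -[f]scale1r HD !scale1r. Qed.
Lemma hder_linZ b D x f : hder b D -> D (x *: f) = x *: D f.
Proof.
by move=> HD; rewrite -[x *: f]addr0 (hder_lin HD) (hder_lin0 HD) addr0.
Qed.
Lemma hder0 b : hder b 0.
Proof.
split=> [x f g|s|a f _|a f g _].
- by change (0 = x *: 0 + 0 :> F); rewrite scaler0 addr0.
- by exists [::] => f _; change (ev (0 : F) s = 0); rewrite ev0.
- exact: homog0.
- by change (0 = fmul 0 g + (-1) ^+ (b && a) *: fmul f 0);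
    rewrite fmul0l fmul0r scaler0 addr0.
Qed.
Lemma hderP b x D D' : hder b D -> hder b D' -> hder b (x *: D + D').
Proof.
move=> HD HD'.
have E f : (x *: D + D') f = x *: D f + D' f by [].
split=> [y f g|s|a f hf|a f g hf]; rewrite ?E.
- rewrite (hder_lin HD) (hder_lin HD').
  by apply: evP => s; rewrite !(evD, evZ); ring.
- have [L HL] := hder_cont HD s; have [L' HL'] := hder_cont HD' s.
  exists (L ++ L') => f Hf; rewrite E ev_lin HL ?HL' ?mulr0 ?addr0 // => t tL;
    by apply: Hf; rewrite mem_cat tL ?orbT.
- by apply: homogD; [apply: homog_scale|]; [exact: hder_homog HD _ _ hf|exact: hder_homog HD' _ _ hf].
- rewrite (hder_mul HD g hf) (hder_mul HD' g hf) fmul_linl fmul_linr.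
  by apply: evP => s; rewrite !(evD, evZ); ring.
Qed.

Lemma component_lin a x D D' f :
  component a (x *: D + D') f = x *: component a D f + component a D' f.
Proof.
rewrite /component !(linearP (prt _)) scalerDr addrACA.
by [].
Qed.
Lemma component_hder a b D : hder b D -> component a D = if a == b then D else 0.
Proof.
move=> HD; apply: funext => f; rewrite /component.
rewrite (homog_prtN _ (hder_homog HD (homog_prt false f))).
rewrite (homog_prtN _ (hder_homog HD (homog_prt true f))).
have <- : (a == b) = (~~ a == b (+) true) by case: (a); case: (b).
rewrite addbF; case: eqP => _; last exact: addr0.
by rewrite -(hder_linD _ _ HD) prtD.
Qed.
Lemma component_der a D0 D1 : hder false D0 -> hder true D1 ->
  component a (D0 + D1) = if a then D1 else D0.
Proof.
move=> H0 H1.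
have -> : component a (D0 + D1) = component a D0 + component a D1.
  apply: funext => f; rewrite /component.
  by rewrite ![(D0 + D1) _]/(D0 _ + D1 _) !linearD /= addrACA.
by rewrite (component_hder a H0) (component_hder a H1);
  case: a; rewrite /= ?add0r ?addr0.
Qed.

Fact is_der0 : is_der 0.
Proof. by exists 0, 0; split; try exact: hder0; rewrite addr0. Qed.
Fact is_derP (x : k) D D' : is_der D -> is_der D' -> is_der (x *: D + D').
Proof.
move=> [D0 [D1 [H0 H1 ->]]] [E0 [E1 [G0 G1 ->]]].
exists (x *: D0 + E0), (x *: D1 + E1); split; try exact: hderP.
by rewrite scalerDr addrACA.
Qed.
Definition der_sub : submodule _ := Submodule is_der0 is_derP.

Lemma hder_is_der b D : hder b D -> is_der D.
Proof.
by case: b => HD; [exists 0, D|exists D, 0]; split => //;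
  by [exact: hder0|rewrite ?add0r ?addr0].
Qed.
Lemma component_hder_sub a D : is_der D -> hder a (component a D).
Proof.
by move=> [D0 [D1 [H0 H1 ->]]]; rewrite component_der //; case: a.
Qed.
Lemma component_is_der a D : is_der D -> is_der (component a D).
Proof. by move=> /(component_hder_sub a) /hder_is_der. Qed.

Definition der_prt a (D : sub_of der_sub) : sub_of der_sub :=
  @insub_of _ _ der_sub _ (component_is_der a (smemV D)).
Lemma val_der_prt a (D : sub_of der_sub) : val (der_prt a D) = component a (val D).
Proof. by []. Qed.
Fact der_prt_linear a : linear (der_prt a).
Proof.
move=> x D D'; apply: val_inj; rewrite linearP !val_der_prt linearP.
by apply: funext => f; exact: component_lin.
Qed.
Fact der_prtK a b (D : sub_of der_sub) : der_prt a (der_prt b D) = if a == b then der_prt b D else 0.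
Proof.
apply: val_inj; rewrite !val_der_prt (component_hder _ (component_hder_sub b (smemV D))).
by case: eqP.
Qed.
Fact der_prtD (D : sub_of der_sub) : der_prt false D + der_prt true D = D.
Proof.
apply: val_inj; change (component false (val D) + component true (val D) = val D).
by have [D0 [D1 [H0 H1 ->]]] := smemV D; rewrite !component_der.
Qed.

Definition Der : superspace k :=
  @Superspace k (sub_of der_sub) (fun a => mklin (der_prt_linear a)) der_prtK der_prtD.

Definition der_app (D : Der) : F -> F := val (D : sub_of der_sub).

Lemma der_appP (D E : Der) : der_app D =1 der_app E -> D = E.
Proof. by move=> DE; apply: val_inj; apply: funext. Qed.
Lemma homog_der a (D : Der) : homog a D -> hder a (der_app D).
Proof. by move=> <-; exact: (component_hder_sub a (smemV D)). Qed.
Lemma der_app_lin x (D E : Der) f : der_app (x *: D + E) f = x *: der_app D f + der_app E f.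
Proof. by rewrite /der_app linearP. Qed.

(* Graded commutator of operators of parities [a] and [b]. *)
Definition hcomm a b D D' f : F := D (D' f) - (-1) ^+ (a && b) *: D' (D f).

Lemma hder_hcomm a b D D' : hder a D -> hder b D' -> hder (a (+) b) (hcomm a b D D').
Proof.
move=> HD HD'; rewrite /hcomm; split=> [x f g|s|e f hf|e f g hf].
- rewrite (hder_lin HD) (hder_lin HD') (hder_lin HD) (hder_lin HD').
  by apply: evP => s; rewrite !(evD, evZ, evN); ring.
- have cont D1 D2 : continuous_op D1 -> continuous_op D2 ->
      exists L : seq (seq U), forall f, (forall t, t \in L -> ev f t = 0) ->
        ev (D1 (D2 f)) s = 0.
    move=> H1 H2; have [L HL] := H1 s.
    have /choice[N HN] t := H2 t.
    exists (flatten [seq N t | t <- L]) => f Hf; apply: HL => t tL.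
    apply: HN => u uN; apply: Hf; apply/flattenP; exists (N t) => //.
    by apply/mapP; exists t.
  have [L HL] := cont _ _ (hder_cont HD) (hder_cont HD').
  have [L' HL'] := cont _ _ (hder_cont HD') (hder_cont HD).
  exists (L ++ L') => f Hf; rewrite addrC -scaleNr ev_lin HL ?HL' ?mulr0 ?addr0 // => t tL;
    by apply: Hf; rewrite mem_cat tL ?orbT.
- apply: homogB; last apply: homog_scale.
    by rewrite -addbA; apply: (hder_homog HD); exact: hder_homog HD' _ _ hf.
  by rewrite [a (+) b]addbC -addbA; apply: (hder_homog HD'); exact: hder_homog HD _ _ hf.
- rewrite (hder_mul HD g hf) (hder_mul HD' g hf).
  rewrite !(hder_linD _ _ HD) !(hder_linD _ _ HD') (hder_linZ _ _ HD) (hder_linZ _ _ HD').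
  rewrite (hder_mul HD _ hf) (hder_mul HD' _ hf).
  rewrite (hder_mul HD _ (hder_homog HD' hf)) (hder_mul HD' _ (hder_homog HD hf)).
  rewrite fmulDl fmulDr -!scaleNr !fmulZl !fmulZr.
  apply: evP => s; rewrite !(evD, evZ, evN).
  by move: a b e {hf HD HD'} => [] [] [] /=; ring.
Qed.
End Der.

Record dgla (k : fieldType) := Dgla {
  dsp :> superspace k;
  dif : {linear dsp -> dsp};
  brk : dsp -> dsp -> dsp;
  brk_linl : forall (a : k) x x' y, brk (a *: x + x') y = a *: brk x y + brk x' y;
  brk_linr : forall (a : k) x y y', brk x (a *: y + y') = a *: brk x y + brk x y';
  dif_homog : forall a x, homog a x -> homog (~~ a) (dif x);
  brk_homog : forall a b x y, homog a x -> homog b y -> homog (a (+) b) (brk x y);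
  brkC : forall a b x y, homog a x -> homog b y ->
    brk x y = - ((-1) ^+ (a && b) *: brk y x);
  brk_jacobi : forall a b x y z, homog a x -> homog b y ->
    brk x (brk y z) = brk (brk x y) z + (-1) ^+ (a && b) *: brk y (brk x z);
  difK : forall x, dif (dif x) = 0;
  dif_brk : forall a x y, homog a x ->
    dif (brk x y) = brk (dif x) y + (-1) ^+ a *: brk x (dif y) }.
Arguments dif {k d}.
Arguments brk {k d}.

Section DerDgla.
Variables (k : fieldType) (c : flavour) (U : superspace k).
Implicit Types (D E : Der c U) (a b : bool).

(* [hcomm a b] of the components of parities [a] of D and [b] of E. *)
Definition hcommD a b D E : Der c U :=
  @insub_of _ _ (der_sub c U) _
    (hder_is_der (hder_hcomm (component_hder_sub a (smemV D))
                             (component_hder_sub b (smemV E)))).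

Definition commutator D E : Der c U :=
  \sum_(a : bool) \sum_(b : bool) hcommD a b D E.

Lemma hcommDE a b D E f :
  der_app (hcommD a b D E) f = hcomm a b (der_app (prt a D)) (der_app (prt b E)) f.
Proof. by []. Qed.

Lemma der_app0 f : der_app (0 : Der c U) f = 0.
Proof. by []. Qed.
Lemma der_appD D E f : der_app (D + E) f = der_app D f + der_app E f.
Proof. by []. Qed.
Lemma der_appN D f : der_app (- D) f = - der_app D f.
Proof. by []. Qed.
Lemma der_appZ x D f : der_app (x *: D) f = x *: der_app D f.
Proof. by []. Qed.
Lemma der_app_linr D x f g :
  der_app D (x *: f + g) = x *: der_app D f + der_app D g.
Proof.
have [D0 [D1 [H0 H1 e]]] := smemV D; rewrite /der_app e.
rewrite ![(D0 + D1) _]/(D0 _ + D1 _) (hder_lin H0) (hder_lin H1).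
by rewrite scalerDr addrACA.
Qed.
Lemma der_app_r0 D : der_app D 0 = 0.
Proof.
have := der_app_linr D (-1) 0 0; rewrite scaler0 addr0 => ->.
by rewrite scaleN1r addNr.
Qed.
Lemma der_app_rD D f g : der_app D (f + g) = der_app D f + der_app D g.
Proof. by rewrite -[f]scale1r der_app_linr !scale1r. Qed.
Lemma der_app_rZ D x f : der_app D (x *: f) = x *: der_app D f.
Proof. by rewrite -[_ *: f]addr0 der_app_linr der_app_r0 addr0. Qed.
Lemma der_app_rN D f : der_app D (- f) = - der_app D f.
Proof. by rewrite -scaleN1r der_app_rZ scaleN1r. Qed.

Lemma hcommD_linl a b x D D' E :
  hcommD a b (x *: D + D') E = x *: hcommD a b D E + hcommD a b D' E.
Proof.
apply: der_appP => f; rewrite der_appD der_appZ !hcommDE linearP /hcomm.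
rewrite !der_app_lin; rewrite der_app_linr; apply: evP => s.
by rewrite !(evD, evZ, evN); ring.
Qed.
Lemma hcommD_linr a b x D E E' :
  hcommD a b D (x *: E + E') = x *: hcommD a b D E + hcommD a b D E'.
Proof.
apply: der_appP => f; rewrite der_appD der_appZ !hcommDE linearP /hcomm.
rewrite !der_app_lin; rewrite der_app_linr; apply: evP => s.
by rewrite !(evD, evZ, evN); ring.
Qed.

Lemma commutator_homog a b D E f : homog a D -> homog b E ->
  der_app (commutator D E) f = hcomm a b (der_app D) (der_app E) f.
Proof.
move=> hD hE; rewrite /commutator.
have z a' b' : der_app (hcommD a' b' D E) f =
    if (a' == a) && (b' == b) then hcomm a b (der_app D) (der_app E) f else 0.
  rewrite hcommDE (homog_prtN _ hD) (homog_prtN _ hE).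
  case: (a' =P a) => [->|_]; case: (b' =P b) => [->|_] //=; rewrite /hcomm;
    by rewrite !der_app0 ?der_app_r0 ?scaler0 subr0.
rewrite !big_bool !der_appD !z; case: (a) (b) => [] [] /=;
  by rewrite ?addr0 ?add0r.
Qed.

Fact comm_linl (x : k) D D' E :
  commutator (x *: D + D') E = x *: commutator D E + commutator D' E.
Proof.
rewrite scaler_sumr -big_split; apply: eq_bigr => a _.
rewrite scaler_sumr -big_split; apply: eq_bigr => b _; exact: hcommD_linl.
Qed.
Fact comm_linr (x : k) D E E' :
  commutator D (x *: E + E') = x *: commutator D E + commutator D E'.
Proof.
rewrite scaler_sumr -big_split; apply: eq_bigr => a _.
rewrite scaler_sumr -big_split; apply: eq_bigr => b _; exact: hcommD_linr.
Qed.
Lemma commDr D E E' : commutator D (E + E') = commutator D E + commutator D E'.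
Proof. by rewrite -[E]scale1r comm_linr !scale1r. Qed.
Lemma hder_homog_der a D : hder a (der_app D) -> homog a D.
Proof.
move=> HD; apply: val_inj; rewrite [LHS]val_der_prt (component_hder _ HD) eqxx.
by [].
Qed.
Fact comm_homog a b D E : homog a D -> homog b E -> homog (a (+) b) (commutator D E).
Proof.
move=> hD hE; apply: hder_homog_der.
have -> : der_app (commutator D E) = hcomm a b (der_app D) (der_app E).
  by apply: funext => f; exact: commutator_homog.
by apply: hder_hcomm; exact: homog_der.
Qed.
Fact commC a b D E : homog a D -> homog b E ->
  commutator D E = - ((-1) ^+ (a && b) *: commutator E D).
Proof.
move=> hD hE; apply: der_appP => f; rewrite der_appN der_appZ.
rewrite (commutator_homog _ hD hE) (commutator_homog _ hE hD) /hcomm.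
by apply: evP => s; rewrite !(evD, evZ, evN); case: (a) (b) => [] [] /=; ring.
Qed.
Lemma comm_jacobi_homog a b e D E G : homog a D -> homog b E -> homog e G ->
  commutator D (commutator E G) = commutator (commutator D E) G +
    (-1) ^+ (a && b) *: commutator E (commutator D G).
Proof.
move=> hD hE hG; apply: der_appP => f; rewrite der_appD der_appZ.
rewrite (commutator_homog _ hD (comm_homog hE hG)).
rewrite (commutator_homog _ (comm_homog hD hE) hG).
rewrite (commutator_homog _ hE (comm_homog hD hG)) /hcomm.
rewrite !(commutator_homog _ hE hG) !(commutator_homog _ hD hE) !(commutator_homog _ hD hG).
rewrite /hcomm !(der_app_rD, der_app_rN, der_app_rZ).
by apply: evP => s; rewrite !(evD, evZ, evN); case: (a) (b) (e) => [] [] [] /=; ring.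
Qed.
Fact comm_jacobi a b D E G : homog a D -> homog b E ->
  commutator D (commutator E G) = commutator (commutator D E) G +
    (-1) ^+ (a && b) *: commutator E (commutator D G).
Proof.
move=> hD hE; rewrite -[G]prtD !commDr scalerDr addrACA.
by congr (_ + _); apply: (comm_jacobi_homog hD hE); exact: homog_prt.
Qed.

Variables (m : Der c U) (m_odd : homog true m)
  (m_sq : forall f, der_app m (der_app m f) = 0).

Fact comm_m_linear : linear (commutator m).
Proof. by move=> x D E; exact: comm_linr. Qed.
Fact comm_mK D : mklin comm_m_linear (mklin comm_m_linear D) = 0.
Proof.
change (commutator m (commutator m D) = 0).
have H a E : homog a E -> commutator m (commutator m E) = 0.
  move=> hD; apply: der_appP => f; rewrite (commutator_homog _ m_odd (comm_homog m_odd hD)).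
  rewrite /hcomm !(commutator_homog _ m_odd hD) /hcomm.
  rewrite !(der_app_rD, der_app_rN, der_app_rZ) !m_sq der_app_r0 der_app0.
  by apply: evP => s; rewrite !(evD, evZ, evN) !ev0; case: (a) => /=; ring.
rewrite -[D]prtD !commDr !(H _ _ (homog_prt _ _)); exact: addr0.
Qed.

Definition der_dgla : dgla k :=
  @Dgla k (Der c U) (mklin comm_m_linear) commutator comm_linl comm_linr
    (fun a D hD => comm_homog m_odd hD) comm_homog commC comm_jacobi comm_mK
    (fun a D E hD => comm_jacobi E m_odd hD).
End DerDgla.

Definition subdgla_closed (k : fieldType) (g : dgla k) (S : g -> Prop) : Prop :=
  [/\ S 0, forall (a : k) x y, S x -> S y -> S (a *: x + y),
      forall a x, S x -> S (prt a x), forall x, S x -> S (dif x) &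
      forall x y, S x -> S y -> S (brk x y)].

Section SubDgla.
Variables (k : fieldType) (g : dgla k) (S : g -> Prop) (cl : subdgla_closed S).

Definition subdgla_sub : submodule g :=
  @Submodule k g S (let: And5 h _ _ _ _ := cl in h) (let: And5 _ h _ _ _ := cl in h).
Let Sprt : forall a x, subdgla_sub x -> subdgla_sub (prt a x).
Proof. by case: cl. Qed.
Let Sdif : forall x, subdgla_sub x -> subdgla_sub (dif x).
Proof. by case: cl. Qed.
Let Sbrk : forall x y, subdgla_sub x -> subdgla_sub y -> subdgla_sub (brk x y).
Proof. by case: cl. Qed.

Definition sdg_sp : superspace k := subsuper Sprt.
Definition sdg_dif (x : sdg_sp) : sdg_sp := insub_of (Sdif (smemV x)).
Definition sdg_brk (x y : sdg_sp) : sdg_sp := insub_of (Sbrk (smemV x) (smemV y)).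

Let sdg_valP (x y : sdg_sp) : val x = val y -> x = y.
Proof. exact: val_inj. Qed.
Let sdg_homog a (x : sdg_sp) : homog a x -> homog a (val x).
Proof. by move=> hx; rewrite /homog -{2}hx. Qed.
Let homog_sdg a (x : sdg_sp) : homog a (val x) -> homog a x.
Proof. by move=> hx; apply: sdg_valP. Qed.

Fact sdg_dif_linear : linear sdg_dif.
Proof. by move=> a x y; apply: sdg_valP; exact: linearP. Qed.

Definition subdgla : dgla k.
Proof.
apply: (@Dgla k sdg_sp (mklin sdg_dif_linear) sdg_brk).
- by move=> a x x' y; apply: sdg_valP; exact: brk_linl.
- by move=> a x y y'; apply: sdg_valP; exact: brk_linr.
- by move=> a x /sdg_homog hx; apply: homog_sdg; exact: dif_homog.
- by move=> a b x y /sdg_homog hx /sdg_homog hy; apply: homog_sdg; exact: brk_homog.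
- by move=> a b x y /sdg_homog hx /sdg_homog hy; apply: sdg_valP; exact: brkC.
- by move=> a b x y z /sdg_homog hx /sdg_homog hy; apply: sdg_valP; exact: brk_jacobi.
- by move=> x; apply: sdg_valP; exact: difK.
- by move=> a x y /sdg_homog hx; apply: sdg_valP; exact: dif_brk.
Defined.
End SubDgla.

Section DglaTheory.
Variables (k : fieldType) (g : dgla k).
Implicit Types x y : g.
Lemma brk0r x : brk x 0 = 0.
Proof.
by have := brk_linr (-1) x 0 0; rewrite scaler0 addr0 scaleN1r addNr.
Qed.
Lemma brk0l x : brk 0 x = 0.
Proof.
by have := brk_linl (-1) 0 0 x; rewrite scaler0 addr0 scaleN1r addNr.
Qed.
Lemma brkDr x y z : brk x (y + z) = brk x y + brk x z.
Proof. by rewrite -[y]scale1r brk_linr !scale1r. Qed.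
Lemma brkDl x y z : brk (x + y) z = brk x z + brk y z.
Proof. by rewrite -[x]scale1r brk_linl !scale1r. Qed.
Lemma brkZr a x y : brk x (a *: y) = a *: brk x y.
Proof. by rewrite -[a *: y]addr0 brk_linr brk0r addr0. Qed.
Lemma brkZl a x y : brk (a *: x) y = a *: brk x y.
Proof. by rewrite -[a *: x]addr0 brk_linl brk0l addr0. Qed.
Lemma brk_sumr I (r : seq I) P x (F : I -> g) :
  brk x (\sum_(i <- r | P i) F i) = \sum_(i <- r | P i) brk x (F i).
Proof. by apply: (big_morph (brk x)); [exact: brkDr|exact: brk0r]. Qed.
Lemma brk_suml I (r : seq I) P x (F : I -> g) :
  brk (\sum_(i <- r | P i) F i) x = \sum_(i <- r | P i) brk (F i) x.
Proof.
apply: (big_morph (fun y => brk y x)); [by move=> y z; exact: brkDl|exact: brk0l].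
Qed.
End DglaTheory.

Record is_dgla_map (k : fieldType) (g h : dgla k) (f : g -> h) : Prop := DglaMap {
  dgm_lin : linear f;
  dgm_prt : forall a x, f (prt a x) = prt a (f x);
  dgm_dif : forall x, f (dif x) = dif (f x);
  dgm_brk : forall x y, f (brk x y) = brk (f x) (f y) }.

Section DirectSum.
Variables (k : fieldType) (g h : dgla k).
Local Notation T := (g * h)%type.

Definition dsum_prt a (x : T) : T := (prt a x.1, prt a x.2).
Fact dsum_prt_linear a : linear (dsum_prt a).
Proof. by move=> c x y; rewrite /dsum_prt !linearP. Qed.
Definition dsum_sp : superspace k.
Proof.
apply: (@Superspace k (g * h)%type (fun a => mklin (dsum_prt_linear a))).
- by move=> a b [x y]; rewrite /= /dsum_prt /= !prtK; case: eqP.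
- by move=> [x y]; congr (_, _); exact: prtD.
Defined.
Definition dsum_dif (x : dsum_sp) : dsum_sp := (dif x.1, dif x.2).
Definition dsum_brk (x y : dsum_sp) : dsum_sp := (brk x.1 y.1, brk x.2 y.2).
Fact dsum_dif_linear : linear dsum_dif.
Proof. by move=> c x y; rewrite /dsum_dif !linearP. Qed.
Lemma dsum_homog a (x : dsum_sp) : homog a x <-> homog a x.1 /\ homog a x.2.
Proof.
rewrite /homog; split=> [e|[e1 e2]]; first by split; rewrite -{2}e.
by case: x e1 e2 => x y /= e1 e2; rewrite /dsum_prt /= e1 e2.
Qed.
Definition dsum : dgla k.
Proof.
apply: (@Dgla k dsum_sp (mklin dsum_dif_linear) dsum_brk).
- by move=> a x x' y; congr (_, _); exact: brk_linl.
- by move=> a x y y'; congr (_, _); exact: brk_linr.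
- by move=> a x /dsum_homog[h1 h2]; apply/dsum_homog; split; exact: dif_homog.
- move=> a b x y /dsum_homog[h1 h2] /dsum_homog[h3 h4]; apply/dsum_homog.
  by split; exact: brk_homog.
- move=> a b x y /dsum_homog[h1 h2] /dsum_homog[h3 h4].
  by congr (_, _); exact: brkC.
- move=> a b x y z /dsum_homog[h1 h2] /dsum_homog[h3 h4].
  by congr (_, _); exact: brk_jacobi.
- by move=> x; congr (_, _); exact: difK.
- by move=> a x y /dsum_homog[h1 h2]; congr (_, _); exact: dif_brk.
Defined.
End DirectSum.

(* h[z,dz]: an element is sum_i p_i z^i + sum_i q_i z^i dz, encoded by the
   finitely supported sequences p = [fz] and q = [fdz]. *)
Section Forms.
Variables (k : fieldType) (h : dgla k).
Implicit Types (p q r : nat -> h).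
Local Notation seqh := (nat -> h).

Definition finsupp_seq p := exists N, forall i, (N <= i)%N -> p i = 0.
Definition form_mem (u : (seqh * seqh)%type) := finsupp_seq u.1 /\ finsupp_seq u.2.

Definition conv p q : seqh := fun n => \sum_(i < n.+1) brk (p i) (q (n - i)%N).
Definition zder p : seqh := fun n => (p n.+1) *+ n.+1.

Fact fin_lin a p q : finsupp_seq p -> finsupp_seq q -> finsupp_seq (a *: p + q).
Proof.
move=> [N HN] [M HM]; exists (maxn N M) => i; rewrite geq_max => /andP[Ni Mi].
by change (a *: p i + q i = 0); rewrite HN // HM // scaler0 addr0.
Qed.
Fact fin0 : finsupp_seq 0. Proof. by exists 0%N. Qed.
Lemma fin_map (f : h -> h) p : f 0 = 0 -> finsupp_seq p -> finsupp_seq (fun i => f (p i)).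
Proof. by move=> f0 [N HN]; exists N => i /HN ->. Qed.
Lemma fin_conv p q : finsupp_seq p -> finsupp_seq q -> finsupp_seq (conv p q).
Proof.
move=> [N HN] [M HM]; exists (N + M)%N => n nNM; apply: big1 => i _.
have [Ni|iN] := leqP N i; first by rewrite HN ?brk0l.
rewrite HM ?brk0r // leq_subRL; last by rewrite -ltnS ltn_ord.
by apply: leq_trans nNM; rewrite leq_add2r ltnW.
Qed.
Lemma fin_zder p : finsupp_seq p -> finsupp_seq (zder p).
Proof. by move=> [N HN]; exists N => i iN; rewrite /zder HN ?mul0rn // ltnW. Qed.

Fact form_mem0 : form_mem 0. Proof. by split; exact: fin0. Qed.
Fact form_memP (a : k) u v : form_mem u -> form_mem v -> form_mem (a *: u + v).
Proof. by move=> [u1 u2] [v1 v2]; split; exact: fin_lin. Qed.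
Definition form_sub : submodule (seqh * seqh)%type := Submodule form_mem0 form_memP.

Definition fz (u : sub_of form_sub) : seqh := (val u).1.
Definition fdz (u : sub_of form_sub) : seqh := (val u).2.

Lemma fin_fz u : finsupp_seq (fz u). Proof. by case: (smemV u). Qed.
Lemma fin_fdz u : finsupp_seq (fdz u). Proof. by case: (smemV u). Qed.
Lemma formP (u v : sub_of form_sub) : fz u =1 fz v -> fdz u =1 fdz v -> u = v.
Proof.
rewrite /fz /fdz => e1 e2; apply: val_inj; case: (val u) (val v) e1 e2 => [u1 u2] [v1 v2] /= e1 e2.
by congr (_, _); exact: funext.
Qed.
Lemma fz_lin a u v i : fz (a *: u + v) i = a *: fz u i + fz v i.
Proof. by rewrite /fz linearP. Qed.
Lemma fdz_lin a u v i : fdz (a *: u + v) i = a *: fdz u i + fdz v i.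
Proof. by rewrite /fdz linearP. Qed.
Lemma fz0 i : fz 0 i = 0. Proof. by rewrite /fz linear0. Qed.
Lemma fdz0 i : fdz 0 i = 0. Proof. by rewrite /fdz linear0. Qed.
Lemma fzD u v i : fz (u + v) i = fz u i + fz v i.
Proof. by rewrite -[u]scale1r fz_lin !scale1r. Qed.
Lemma fdzD u v i : fdz (u + v) i = fdz u i + fdz v i.
Proof. by rewrite -[u]scale1r fdz_lin !scale1r. Qed.
Lemma fzZ a u i : fz (a *: u) i = a *: fz u i.
Proof. by rewrite -[a *: u]addr0 fz_lin fz0 addr0. Qed.
Lemma fdzZ a u i : fdz (a *: u) i = a *: fdz u i.
Proof. by rewrite -[a *: u]addr0 fdz_lin fdz0 addr0. Qed.
Lemma fzN u i : fz (- u) i = - fz u i.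
Proof. by rewrite -[- u]scaleN1r fzZ scaleN1r. Qed.
Lemma fdzN u i : fdz (- u) i = - fdz u i.
Proof. by rewrite -[- u]scaleN1r fdzZ scaleN1r. Qed.

Definition mkform (p q : seqh) (hp : finsupp_seq p) (hq : finsupp_seq q) : sub_of form_sub :=
  @insub_of _ _ form_sub (p, q) (conj hp hq).
Lemma fz_mk p q hp hq : fz (@mkform p q hp hq) = p. Proof. by []. Qed.
Lemma fdz_mk p q hp hq : fdz (@mkform p q hp hq) = q. Proof. by []. Qed.

Definition form_prt a (u : sub_of form_sub) : sub_of form_sub :=
  mkform (fin_map (linear0 (prt a)) (fin_fz u))
         (fin_map (linear0 (prt (~~ a))) (fin_fdz u)).
Lemma fz_prt a u i : fz (form_prt a u) i = prt a (fz u i). Proof. by []. Qed.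
Lemma fdz_prt a u i : fdz (form_prt a u) i = prt (~~ a) (fdz u i). Proof. by []. Qed.
Fact form_prt_linear a : linear (form_prt a).
Proof.
by move=> c u v; apply: formP => i;
  rewrite ?(fz_lin, fz_prt, fdz_lin, fdz_prt) linearP.
Qed.
Fact form_prtK a b u : form_prt a (form_prt b u) = if a == b then form_prt b u else 0.
Proof.
apply: formP => i; rewrite ?(fz_prt, fdz_prt) prtK; last rewrite (inj_eq negb_inj).
  by case: eqP; rewrite ?fz0.
by case: eqP; rewrite ?fdz0.
Qed.
Fact form_prtD u : form_prt false u + form_prt true u = u.
Proof.
by apply: formP => i; rewrite ?(fzD, fdzD) ?(fz_prt, fdz_prt) ?prtD // addrC prtD.
Qed.
Definition form_sp : superspace k :=
  @Superspace k (sub_of form_sub) (fun a => mklin (form_prt_linear a)) form_prtK form_prtD.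

Lemma fin_add p q : finsupp_seq p -> finsupp_seq q -> finsupp_seq (fun i => p i + q i).
Proof. by move=> hp hq; have := fin_lin 1 hp hq; rewrite scale1r. Qed.

(* d(x z^i) = dx z^i + (-1)^|x| i x z^(i-1) dz. *)
Definition form_dif (u : form_sp) : form_sp :=
  mkform (fin_map (linear0 dif) (fin_fz u))
    (fin_add (fin_map (linear0 dif) (fin_fdz u))
             (fin_map (linear0 (@gr k h)) (fin_zder (fin_fz u)))).
(* [x w, y w'] = (-1)^(|w||y|) [x, y] w w' for forms w, w'. *)
Definition form_brk (u v : form_sp) : form_sp :=
  mkform (fin_conv (fin_fz u) (fin_fz v))
    (fin_add (fin_conv (fin_fz u) (fin_fdz v))
       (fin_conv (fin_fdz u) (fin_map (linear0 (@gr k h)) (fin_fz v)))).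

Lemma fz_dif u i : fz (form_dif u) i = dif (fz u i). Proof. by []. Qed.
Lemma fdz_dif u i : fdz (form_dif u) i = dif (fdz u i) + gr (zder (fz u) i).
Proof. by []. Qed.
Lemma fz_brk u v i : fz (form_brk u v) i = conv (fz u) (fz v) i.
Proof. by []. Qed.
Lemma fdz_brk u v i : fdz (form_brk u v) i =
  conv (fz u) (fdz v) i + conv (fdz u) (fun j => gr (fz v j)) i.
Proof. by []. Qed.

Lemma form_homog a (u : form_sp) : homog a u <->
  (forall i, homog a (fz u i)) /\ (forall i, homog (~~ a) (fdz u i)).
Proof.
split=> [e|[e1 e2]]; last by apply: formP => i; [exact: e1|exact: e2].
by split=> i; rewrite /homog -?fz_prt -?fdz_prt -[form_prt a u]/(prt a u) e.
Qed.

Lemma conv_linl a p p' q n : conv (fun i => a *: p i + p' i) q n = a *: conv p q n + conv p' q n.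
Proof.
by rewrite scaler_sumr -big_split; apply: eq_bigr => i _; exact: brk_linl.
Qed.
Lemma conv_linr a p q q' n : conv p (fun i => a *: q i + q' i) n = a *: conv p q n + conv p q' n.
Proof.
by rewrite scaler_sumr -big_split; apply: eq_bigr => i _; exact: brk_linr.
Qed.
Lemma conv_ext p p' q q' n : p =1 p' -> q =1 q' -> conv p q n = conv p' q' n.
Proof. by move=> pp qq; apply: eq_bigr => i _; rewrite pp qq. Qed.
Lemma conv_homog a b p q n : (forall i, homog a (p i)) -> (forall i, homog b (q i)) ->
  homog (a (+) b) (conv p q n).
Proof.
move=> hp hq; rewrite /homog linear_sum; apply: eq_bigr => i _; exact: brk_homog.
Qed.
Lemma conv_rev p q n : conv p q n = \sum_(i < n.+1) brk (p (n - i)%N) (q i).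
Proof.
rewrite /conv (reindex_inj rev_ord_inj) /=; apply: eq_bigr => i _.
by rewrite subSS subKn // -ltnS.
Qed.
Lemma convC a b p q n : (forall i, homog a (p i)) -> (forall i, homog b (q i)) ->
  conv p q n = - ((-1) ^+ (a && b) *: conv q p n).
Proof.
move=> hp hq; rewrite [conv q p n]conv_rev scaler_sumr -sumrN; apply: eq_bigr => i _.
exact: brkC.
Qed.
Lemma conv2 N p q n : (n <= N)%N -> conv p q n =
  \sum_(i < N.+1) \sum_(j < N.+1) if (i + j == n)%N then brk (p i) (q j) else 0.
Proof.
move=> nN; rewrite /conv (big_ord_widen N.+1 (fun i => brk (p i) (q (n - i)%N))) //.
rewrite big_mkcond; apply: eq_bigr => i _; rewrite ltnS.
case: leqP => [iln|nli]; last first.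
  rewrite big1 // => j _; case: eqP => // e.
  by move: nli; rewrite -e ltnNge leq_addr.
have jN : (n - i < N.+1)%N by rewrite ltnS (leq_trans (leq_subr _ _)).
rewrite (bigD1 (Ordinal jN)) //= subnKC // eqxx big1 ?addr0 // => j jne.
case: eqP => // e; case/eqP: jne; apply: val_inj => /=.
by rewrite -e addKn.
Qed.
Let single N (m : nat) (F : nat -> h) : (m <= N)%N ->
  \sum_(i < N.+1) (if (m == i)%N then F i else 0) = F m.
Proof.
move=> mN; have mN' : (m < N.+1)%N by [].
rewrite (bigD1 (Ordinal mN')) //= eqxx big1 ?addr0 // => j jne.
by case: eqP => // e; case/eqP: jne; apply: val_inj.
Qed.
Lemma conv3l p q r n : conv (conv p q) r n =
  \sum_(i < n.+1) \sum_(j < n.+1) \sum_(l < n.+1)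
    if (i + j + l == n)%N then brk (brk (p i) (q j)) (r l) else 0.
Proof.
rewrite (conv2 _ _ (leqnn n)).
transitivity (\sum_(m < n.+1) \sum_(l < n.+1) \sum_(i < n.+1) \sum_(j < n.+1)
    if (i + j == m)%N then if (i + j + l == n)%N then brk (brk (p i) (q j)) (r l) else 0 else 0).
  apply: eq_bigr => m _; apply: eq_bigr => l _; case: eqP => e; last first.
    rewrite big1 // => i _; rewrite big1 // => j _.
    by case: eqP => // ->; case: eqP.
  rewrite (@conv2 n) ?brk_suml; last by rewrite -ltnS ltn_ord.
  apply: eq_bigr => i _; rewrite brk_suml; apply: eq_bigr => j _.
  by case: eqP => e'; rewrite ?brk0l // e' e eqxx.
under eq_bigr do under eq_bigr do under eq_bigr do rewrite -big_mkcond.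
under eq_bigr do rewrite exchange_big.
rewrite exchange_big; apply: eq_bigr => i _ /=.
under eq_bigr do under eq_bigr do rewrite big_mkcond.
under eq_bigr do rewrite exchange_big.
rewrite exchange_big; apply: eq_bigr => j _ /=.
rewrite exchange_big; apply: eq_bigr => l _ /=.
have [ijn|nij] := leqP (i + j) n.
  exact: (single (fun _ => if (i + j + l == n)%N then brk (brk (p i) (q j)) (r l) else 0)).
have -> : (i + j + l == n)%N = false.
  by apply/eqP => e; have := leq_addr l (i + j); rewrite e leqNgt nij.
by apply: big1 => m _; case: eqP.
Qed.
Lemma conv3r p q r n : conv p (conv q r) n =
  \sum_(i < n.+1) \sum_(j < n.+1) \sum_(l < n.+1)
    if (i + j + l == n)%N then brk (p i) (brk (q j) (r l)) else 0.
Proof.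
rewrite (conv2 _ _ (leqnn n)); apply: eq_bigr => i _.
transitivity (\sum_(m < n.+1) \sum_(j < n.+1) \sum_(l < n.+1)
    if (j + l == m)%N then if (i + j + l == n)%N then brk (p i) (brk (q j) (r l)) else 0 else 0).
  apply: eq_bigr => m _; case: eqP => e; last first.
    rewrite big1 // => j _; rewrite big1 // => l _.
    by case: eqP => // jl; rewrite -addnA jl; case: eqP.
  rewrite (@conv2 n) ?brk_sumr; last by rewrite -ltnS ltn_ord.
  apply: eq_bigr => j _; rewrite brk_sumr; apply: eq_bigr => l _.
  by case: eqP => e'; rewrite ?brk0r // -addnA e' e eqxx.
rewrite exchange_big; apply: eq_bigr => j _ /=.
rewrite exchange_big; apply: eq_bigr => l _ /=.
have [jln|njl] := leqP (j + l) n.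
  exact: (single (fun _ => if (i + j + l == n)%N then brk (p i) (brk (q j) (r l)) else 0)).
have -> : (i + j + l == n)%N = false.
  by apply/eqP => e; have := leq_addl i (j + l); rewrite addnA e leqNgt njl.
by apply: big1 => m _; case: eqP.
Qed.
Lemma conv_jacobi a b p q r n : (forall i, homog a (p i)) -> (forall i, homog b (q i)) ->
  conv p (conv q r) n = conv (conv p q) r n + (-1) ^+ (a && b) *: conv q (conv p r) n.
Proof.
move=> hp hq; rewrite conv3l !conv3r [X in _ + _ *: X]exchange_big /=.
rewrite scaler_sumr -big_split; apply: eq_bigr => i _ /=.
rewrite scaler_sumr -big_split; apply: eq_bigr => j _ /=.
rewrite scaler_sumr -big_split; apply: eq_bigr => l _ /=.
rewrite [(j + i)%N]addnC; case: eqP => _; last by rewrite scaler0 addr0.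
exact: brk_jacobi.
Qed.

Lemma zder_lin a p q n : zder (fun i => a *: p i + q i) n = a *: zder p n + zder q n.
Proof. by rewrite /zder mulrnDl scalerMnr. Qed.
Lemma zder_ext p q n : p =1 q -> zder p n = zder q n.
Proof. by rewrite /zder => ->. Qed.
Lemma zder_homog a p n : (forall i, homog a (p i)) -> homog a (zder p n).
Proof. by move=> hp; rewrite /zder -scaler_nat; exact: homog_scale. Qed.
Lemma grD (x y : h) : gr (x + y) = gr x + gr y.
Proof. exact: linearD. Qed.
Lemma grZ a (x : h) : gr (a *: x) = a *: gr x.
Proof. exact: linearZ. Qed.
Lemma gr_brk (x y : h) : gr (brk x y) = brk (gr x) (gr y).
Proof.
have H a b (u v : h) : homog a u -> homog b v -> gr (brk u v) = brk (gr u) (gr v).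
  move=> hu hv; rewrite (gr_homog (brk_homog hu hv)) (gr_homog hu) (gr_homog hv).
  by rewrite brkZl brkZr scalerA -signr_addb.
have E : brk x y = brk (prt false x) (prt false y) + brk (prt false x) (prt true y) +
    (brk (prt true x) (prt false y) + brk (prt true x) (prt true y)).
  by rewrite -!brkDr -brkDl !prtD.
have Dx (u : h) : gr u = gr (prt false u) + gr (prt true u) by rewrite -grD prtD.
rewrite E !grD !(H _ _ _ _ (homog_prt _ _) (homog_prt _ _)) (Dx x) (Dx y).
move: (gr _) (gr _) (gr _) (gr _) => x0 y0 y1 x1.
by rewrite !brkDl !brkDr.
Qed.
Lemma gr_dif (x : h) : dif (gr x) = - gr (dif x).
Proof.
have H a (u : h) : homog a u -> dif (gr u) = - gr (dif u).
  move=> hu; rewrite (gr_homog (dif_homog hu)) (gr_homog hu) linearZ.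
  by case: a hu => _ /=; rewrite ?expr0 ?expr1 ?scaleN1r ?scale1r ?opprK.
by rewrite -{1}[x]prtD grD linearD !(H _ _ (homog_prt _ _)) -opprD -grD -linearD prtD.
Qed.
Lemma convZl a p q n : conv (fun i => a *: p i) q n = a *: conv p q n.
Proof. by rewrite scaler_sumr; apply: eq_bigr => i _; exact: brkZl. Qed.
Lemma convZr a p q n : conv p (fun i => a *: q i) n = a *: conv p q n.
Proof. by rewrite scaler_sumr; apply: eq_bigr => i _; exact: brkZr. Qed.
Lemma convNr p q n : conv p (fun i => - q i) n = - conv p q n.
Proof.
rewrite -[RHS]scaleN1r -convZr; apply: conv_ext => // i; by rewrite scaleN1r.
Qed.
Lemma convDl p p' q n : conv (fun i => p i + p' i) q n = conv p q n + conv p' q n.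
Proof.
rewrite -[conv p q n]scale1r -conv_linl; apply: conv_ext => // i.
by rewrite scale1r.
Qed.
Lemma convDr p q q' n : conv p (fun i => q i + q' i) n = conv p q n + conv p q' n.
Proof.
rewrite -[conv p q n]scale1r -conv_linr; apply: conv_ext => // i.
by rewrite scale1r.
Qed.
Lemma gr_conv p q n : gr (conv p q n) = conv (fun i => gr (p i)) (fun i => gr (q i)) n.
Proof. by rewrite linear_sum; apply: eq_bigr => i _; exact: gr_brk. Qed.
Lemma conv_gr_homog b p q n : (forall i, homog b (q i)) ->
  conv p (fun i => gr (q i)) n = (-1) ^+ b *: conv p q n.
Proof. by move=> hq; rewrite -convZr; apply: conv_ext => // i; exact: gr_homog. Qed.
Lemma conv_gr_homogl b p q n : (forall i, homog b (p i)) ->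
  conv (fun i => gr (p i)) q n = (-1) ^+ b *: conv p q n.
Proof. by move=> hq; rewrite -convZl; apply: conv_ext => // i; exact: gr_homog. Qed.
Lemma conv_dif a p q n : (forall i, homog a (p i)) ->
  dif (conv p q n) = conv (fun i => dif (p i)) q n +
    (-1) ^+ a *: conv p (fun i => dif (q i)) n.
Proof.
move=> hp; rewrite linear_sum scaler_sumr -big_split; apply: eq_bigr => i _.
exact: dif_brk.
Qed.
Lemma zder_conv p q n : zder (conv p q) n = conv (zder p) q n + conv p (zder q) n.
Proof.
have -> : conv (zder p) q n = \sum_(i < n.+2) brk (p i) (q (n.+1 - i)%N) *+ i.
  rewrite big_ord_recl mulr0n add0r; apply: eq_bigr => i _.
  by rewrite /zder -scaler_nat brkZl scaler_nat subSS.
have -> : conv p (zder q) n = \sum_(i < n.+2) brk (p i) (q (n.+1 - i)%N) *+ (n.+1 - i).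
  rewrite [RHS]big_ord_recr /= subnn mulr0n addr0; apply: eq_bigr => i _.
  by rewrite /zder -scaler_nat brkZr scaler_nat subSn // -ltnS ltn_ord.
rewrite -big_split /= /zder /conv -sumrMnl; apply: eq_bigr => i _.
by rewrite -mulrnDr subnKC // -ltnS ltn_ord.
Qed.

Lemma form_dif_linear : linear form_dif.
Proof.
move=> a u v; apply: formP => i; rewrite ?(fz_lin, fdz_lin) !(fz_dif, fdz_dif).
  by rewrite fz_lin linearP.
rewrite fdz_lin (zder_ext _ (fz_lin a u v)) zder_lin !linearP scalerDr.
by rewrite addrACA.
Qed.

Fact form_brk_linl (a : k) (x x' y : form_sp) :
  form_brk (a *: x + x') y = a *: form_brk x y + form_brk x' y.
Proof.
apply: formP => i; rewrite ?(fz_lin, fdz_lin) ?(fz_brk, fdz_brk).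
  by rewrite (conv_ext _ (fz_lin a x x') (frefl _)) conv_linl.
rewrite (conv_ext _ (fz_lin a x x') (frefl _)) (conv_ext _ (fdz_lin a x x') (frefl _)).
by rewrite !conv_linl scalerDr addrACA.
Qed.
Fact form_brk_linr (a : k) (x y y' : form_sp) :
  form_brk x (a *: y + y') = a *: form_brk x y + form_brk x y'.
Proof.
apply: formP => i; rewrite ?(fz_lin, fdz_lin) ?(fz_brk, fdz_brk).
  by rewrite (conv_ext _ (frefl _) (fz_lin a y y')) conv_linr.
have e j : gr (fz (a *: y + y') j) = a *: gr (fz y j) + gr (fz y' j).
  by rewrite fz_lin linearP.
rewrite (conv_ext _ (frefl _) e) (conv_ext _ (frefl _) (fdz_lin a y y')).
by rewrite !conv_linr scalerDr addrACA.
Qed.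

Fact form_dif_homog a (x : form_sp) : homog a x -> homog (~~ a) (form_dif x).
Proof.
move=> /form_homog[h1 h2]; apply/form_homog; split=> i; rewrite ?fz_dif ?fdz_dif.
  exact: dif_homog.
apply: homogD; first exact: dif_homog.
by apply: homog_gr; rewrite negbK; exact: zder_homog.
Qed.
Fact form_brk_homog a b (x y : form_sp) :
  homog a x -> homog b y -> homog (a (+) b) (form_brk x y).
Proof.
move=> /form_homog[h1 h2] /form_homog[h3 h4]; apply/form_homog.
split=> i; rewrite ?fz_brk ?fdz_brk; first exact: conv_homog.
apply: homogD; first by rewrite -addbN; apply: conv_homog.
by rewrite -addNb; apply: conv_homog => // j; exact: homog_gr.
Qed.
Fact form_brkC a b (x y : form_sp) : homog a x -> homog b y ->
  form_brk x y = - ((-1) ^+ (a && b) *: form_brk y x).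
Proof.
move=> /form_homog[h1 h2] /form_homog[h3 h4]; apply: formP => i.
  by rewrite fzN fzZ !fz_brk; exact: convC.
rewrite fdzN fdzZ !fdz_brk (conv_gr_homog _ _ h3) (conv_gr_homog _ _ h1).
rewrite (convC _ h1 h4) (convC _ h2 h3) addrC.
by case: a b {h1 h2 h3 h4} => [] [] /=;
  rewrite ?expr0 ?expr1 ?scaleN1r ?scale1r ?opprD ?opprK ?scale1r.
Qed.
Fact form_jacobi a b (x y z : form_sp) : homog a x -> homog b y ->
  form_brk x (form_brk y z) = form_brk (form_brk x y) z +
    (-1) ^+ (a && b) *: form_brk y (form_brk x z).
Proof.
move=> /form_homog[h1 h2] /form_homog[h3 h4]; apply: formP => i.
  by rewrite fzD fzZ !fz_brk; exact: conv_jacobi.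
rewrite fdzD fdzZ !fdz_brk.
have E u v : conv u (fun j => gr (fz (form_brk v z) j)) i =
    conv u (conv (fun j => gr (fz v j)) (fun j => gr (fz z j))) i.
  by apply: conv_ext => // j; rewrite fz_brk gr_conv.
have E' u v : conv u (fdz (form_brk v z)) i = conv u (conv (fz v) (fdz z)) i +
   conv u (conv (fdz v) (fun j => gr (fz z j))) i.
  by rewrite -convDr; apply: conv_ext => // j; rewrite fdz_brk.
have E2 : conv (fdz (form_brk x y)) (fun j => gr (fz z j)) i =
  conv (conv (fz x) (fdz y)) (fun j => gr (fz z j)) i +
  conv (conv (fdz x) (fun j => gr (fz y j))) (fun j => gr (fz z j)) i.
  by rewrite -convDl; apply: conv_ext => // j; rewrite fdz_brk.
rewrite !E !E' E2 (conv_jacobi _ _ h1 h3) (conv_jacobi _ _ h1 h4).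
rewrite (conv_jacobi (a := ~~ a) (b := b) _ _ h2); last by move=> j; exact: homog_gr.
have F (u w : seqh) : conv u (conv (fun j => gr (fz x j)) w) i =
    (-1) ^+ a *: conv u (conv (fz x) w) i.
  by rewrite -convZr; apply: conv_ext => // j; exact: conv_gr_homogl.
have G (w : seqh) : conv (fun j => gr (fz y j)) w i = (-1) ^+ b *: conv (fz y) w i.
  exact: conv_gr_homogl.
rewrite F G !scalerDr !scalerA -!signr_addb.
have -> : a && ~~ b = a && b (+) a by case: (a); case: (b).
have -> : ~~ a && b (+) b = a && b by case: (a); case: (b).
by rewrite !addrA [LHS](ACl (1*3*5*2*6*4)).
Qed.
Fact form_difK (x : form_sp) : form_dif (form_dif x) = 0.
Proof.
apply: formP => i; first by rewrite fz0 !fz_dif difK.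
rewrite fdz0 fdz_dif fdz_dif linearD difK add0r gr_dif.
have -> : zder (fz (form_dif x)) i = dif (zder (fz x) i) by rewrite /zder fz_dif linearMn.
by rewrite addNr.
Qed.
Fact form_dif_brk a (x y : form_sp) : homog a x ->
  form_dif (form_brk x y) = form_brk (form_dif x) y + (-1) ^+ a *: form_brk x (form_dif y).
Proof.
move=> /form_homog[h1 h2]; apply: formP => i.
  by rewrite fzD fzZ fz_dif !fz_brk (conv_dif _ _ h1).
rewrite fdzD fdzZ fdz_dif !fdz_brk linearD (conv_dif _ _ h1) (conv_dif _ _ h2).
have -> : zder (fz (form_brk x y)) i = zder (conv (fz x) (fz y)) i by [].
rewrite zder_conv grD !gr_conv (conv_gr_homogl _ _ h1).
have -> : conv (fdz (form_dif x)) (fun j => gr (fz y j)) i =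
  conv (fun j => dif (fdz x j)) (fun j => gr (fz y j)) i +
  conv (fun j => gr (zder (fz x) j)) (fun j => gr (fz y j)) i.
  by rewrite -convDl.
have -> : conv (fz x) (fdz (form_dif y)) i =
  conv (fz x) (fun j => dif (fdz y j)) i + conv (fz x) (fun j => gr (zder (fz y) j)) i.
  by rewrite -convDr.
have -> : conv (fdz x) (fun j => dif (gr (fz y j))) i =
   - conv (fdz x) (fun j => gr (fz (form_dif y) j)) i.
  by rewrite -convNr; apply: conv_ext => // j; rewrite gr_dif.
have -> : (-1) ^+ (~~ a) *: - conv (fdz x) (fun j => gr (fz (form_dif y) j)) i =
  (-1) ^+ a *: conv (fdz x) (fun j => gr (fz (form_dif y) j)) i.
  by case: (a); rewrite /= ?expr0 ?expr1 ?scaleN1r ?scale1r ?opprK.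
rewrite !scalerDr !addrA.
by rewrite [LHS](ACl (1*3*5*2*6*4)).
Qed.

Definition forms : dgla k :=
  @Dgla k form_sp (mklin form_dif_linear) form_brk form_brk_linl form_brk_linr
    form_dif_homog form_brk_homog form_brkC form_jacobi form_difK form_dif_brk.
End Forms.

Section Fiber.
Variables (k : fieldType) (g h : dgla k) (f : g -> h) (Hf : is_dgla_map f).

Definition form_at1 (u : forms h) (v : h) : Prop :=
  exists N, (forall i, (N <= i)%N -> fz u i = 0) /\ \sum_(i < N) fz u i = v.

(* Pairs (x, u) with u|_(z=0) = 0 and u|_(z=1) = f x. *)
Definition fiber_mem (x : dsum g (forms h)) : Prop :=
  fz x.2 0 = 0 /\ form_at1 x.2 (f x.1).

Let sum_stable N M (p : nat -> h) : (forall i, (N <= i)%N -> p i = 0) -> (N <= M)%N ->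
  \sum_(i < M) p i = \sum_(i < N) p i.
Proof.
move=> HN NM; rewrite (big_ord_widen M p NM) [RHS]big_mkcond; apply: eq_bigr => i _.
by case: ltnP => // /HN.
Qed.

Fact fiber_closed : subdgla_closed fiber_mem.
Proof.
have f0 : f 0 = 0 by have := dgm_lin Hf (-1) 0 0;
  rewrite scaler0 addr0 scaleN1r addNr.
split.
- split; first exact: fz0.
  exists 0%N; split=> [i _|]; first exact: fz0.
  by rewrite big_ord0 [_.1]/(0 : g) f0.
- move=> a [x u] [y v] [/= u0 [N [HN eN]]] [/= v0 [M [HM eM]]].
  split; first by rewrite /= fz_lin u0 v0 scaler0 addr0.
  exists (maxn N M); split=> [i|].
    by rewrite geq_max => /andP[Ni Mi]; rewrite fz_lin HN ?HM ?scaler0 ?addr0.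
  rewrite (dgm_lin Hf) -eN -eM -(sum_stable HN (leq_maxl N M)) -(sum_stable HM (leq_maxr N M)).
  rewrite scaler_sumr -big_split; apply: eq_bigr => i _; exact: fz_lin.
- move=> a [x u] [/= u0 [N [HN eN]]]; split; first by rewrite /= fz_prt u0 linear0.
  exists N; split=> [i Ni|]; first by rewrite /= fz_prt HN ?linear0.
  by rewrite /= (dgm_prt Hf) -eN linear_sum; apply: eq_bigr => i _; rewrite fz_prt.
- move=> [x u] [/= u0 [N [HN eN]]]; split; first by rewrite /= fz_dif u0 linear0.
  exists N; split=> [i Ni|]; first by rewrite /= fz_dif HN ?linear0.
  by rewrite /= (dgm_dif Hf) -eN linear_sum; apply: eq_bigr => i _; rewrite fz_dif.
- move=> [x u] [y v] [/= u0 [N [HN eN]]] [/= v0 [M [HM eM]]]; split.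
    by rewrite /= fz_brk /conv big_ord1 /= u0 brk0l.
  have Hc i : ((N + M).+1 <= i)%N -> conv (fz u) (fz v) i = 0.
    move=> NMi; apply: big1 => j _; have [Nj|jN] := leqP N j; first by rewrite HN ?brk0l.
    rewrite HM ?brk0r // leq_subRL; last by rewrite -ltnS ltn_ord.
    by apply: leq_trans (ltnW NMi); rewrite leq_add2r ltnW.
  exists (N + M).+1; split=> [i NMi|] /=; first by rewrite fz_brk Hc.
  rewrite (dgm_brk Hf) -eN -eM.
  rewrite -(sum_stable HN (leqW (leq_addr M N))) -(sum_stable HM (leqW (leq_addl N M))).
  transitivity (\sum_(n < (N + M).+1) conv (fz u) (fz v) n); first by apply: eq_bigr.
  under eq_bigr => n _ do rewrite (@conv2 _ _ (N + M)) -1?ltnS ?ltn_ord //.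
  rewrite exchange_big brk_suml; apply: eq_bigr => i _ /=.
  rewrite exchange_big brk_sumr; apply: eq_bigr => j _ /=.
  have [ijn|nij] := ltnP (i + j) (N + M).+1.
    rewrite (bigD1 (Ordinal ijn)) //= eqxx big1 ?addr0 // => n nne.
    by case: eqP => // e; case/eqP: nne; apply: val_inj.
  rewrite big1 => [|n _]; last first.
    by case: eqP => // e; move: nij; rewrite e leqNgt ltn_ord.
  have [Ni|iN] := leqP N i; first by rewrite HN ?brk0l.
  have [Mj|jM] := leqP M j; first by rewrite HM ?brk0r.
  have := leq_trans nij (leq_trans (leq_add (leqnSn i) (leqnSn j)) (leq_add iN jM)).
  by rewrite ltnn.
Qed.

Definition fiber : dgla k := subdgla fiber_closed.
Definition fiber_proj (x : fiber) : g := (val x).1.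
End Fiber.

Section Cochains.
Variables (k : fieldType) (c c' : flavour) (U U' : superspace k).

Definition lin_homog (a : bool) (l : {linear U -> k^o}) : Prop :=
  forall x, l (prt a x) = l x.

(* [u] is the value at [s] of the family of maps dual to the restriction of [T]
   to U^*, where the dual of a map c of parity [b] is l |-> (-1)^(b|l|) (l o c).
   For a continuous linear [T] such a [u] exists, and it is unique since linear
   forms separate the points of U. *)
Definition dual_value (b : bool) (T : formal c U -> formal c' U') (s : seq U')
    (u : U) : Prop :=
  forall (a : bool) (l : {linear U -> k^o}), lin_homog a l ->
    ev (T (flin c l)) s = (-1) ^+ (b && a) * l u.

Definition taylor (b : bool) (T : formal c U -> formal c' U') (s : seq U') : U :=
  xget 0 (dual_value b T s).
End Cochains.

(* The family of multilinear maps U^n -> U identified with a derivation. *)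
Definition cochain (k : fieldType) (c : flavour) (U : superspace k)
    (D : Der c U) (s : seq U) : U :=
  taylor false (der_app (prt false D)) s + taylor true (der_app (prt true D)) s.

Definition no_const (k : fieldType) (c : flavour) (U : superspace k)
    (D : Der c U) : Prop :=
  forall l : {linear U -> k^o}, ev (der_app D (flin c l)) [::] = 0.

(* L-infinity ([Com]) and A-infinity ([Ass]) structures on V. *)
Record infty (k : fieldType) (c : flavour) (V : superspace k) := Infty {
  istr :> Der c (Pi V);
  istr_odd : homog true istr;
  istr_sq : forall f, der_app istr (der_app istr f) = 0;
  istr_noconst : no_const istr }.

(* CE(V,V) for [Com] and Hoch(V,V) for [Ass]. *)
Definition Cplx (k : fieldType) (c : flavour) (V : superspace k)
    (m : infty c V) : dgla k := der_dgla (istr_odd m) (istr_sq m).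

Section Shuffles.
Variables (k : fieldType) (U : superspace k) (M : lmodType k).

(* Sum of +- p z over the shuffles z of w and x (i letters of w precede the first
   letter y of x; the sign is that of moving y across the other letters of w). *)
Fixpoint shuffle_sum (w x : seq U) (p : seq U -> M) : M :=
  if x is y :: x' then
    \sum_(i < (size w).+1)
      (shuffle_sum (drop i w) x' (fun z => p (take i w ++ prt false y :: z)) +
       shuffle_sum (map (@gr k U) (drop i w)) x'
         (fun z => p (take i w ++ prt true y :: z)))
  else p w.

(* Sum of +- p z over all permutations z of w: insert the first letter of w at
   every place of every permutation of the others. *)
Fixpoint symmetric_sum (w : seq U) (p : seq U -> M) : M :=
  if w is x :: w' then symmetric_sum w' (fun z => shuffle_sum [:: x] z p)
  else p [::].
End Shuffles.

(* An L-infinity map V -> W, as an algebra map in the opposite direction. *)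
Record linf_map (k : fieldType) (V W : superspace k) (mV : infty Com V)
    (mW : infty Com W) := LinfMap {
  lm_op :> formal Com (Pi W) -> formal Com (Pi V);
  lm_lin : linear lm_op;
  lm_cont : continuous_op lm_op;
  lm_even : forall a f, lm_op (prt a f) = prt a (lm_op f);
  lm_one : lm_op (fone Com (Pi W)) = fone Com (Pi V);
  lm_mul : forall f g, lm_op (fmul f g) = fmul (lm_op f) (lm_op g);
  lm_chain : forall f, lm_op (der_app mW f) = der_app mV (lm_op f) }.

Record linf_alg (k : fieldType) := LinfAlg {
  la_sp : superspace k;
  la_str :> infty Com la_sp }.

(* The linear part induces a bijection in homology. *)
Definition is_quasi_iso (k : fieldType) (A B : linf_alg k)
    (F : linf_map A B) : Prop :=
  let dA x := cochain A [:: x] in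
  let dB y := cochain B [:: y] in
  let F1 x := taylor false F [:: x] in
  (forall x, dA x = 0 -> (exists y, F1 x = dB y) -> exists z, x = dA z) /\
  (forall y, dB y = 0 -> exists x z, dA x = 0 /\ y = F1 x + dB z).

Record linf_seq (k : fieldType) := LinfSeq {
  ls1 : linf_alg k; ls2 : linf_alg k; ls3 : linf_alg k;
  ls12 : linf_map ls1 ls2;
  ls23 : linf_map ls2 ls3 }.

Definition seq_quasi_iso (k : fieldType) (S T : linf_seq k) : Prop :=
  exists (F1 : linf_map (ls1 S) (ls1 T)) (F2 : linf_map (ls2 S) (ls2 T))
    (F3 : linf_map (ls3 S) (ls3 T)),
  [/\ is_quasi_iso F1, is_quasi_iso F2, is_quasi_iso F3,
      forall f, ls12 S (F2 f) = F1 (ls12 T f) &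
      forall f, ls23 S (F3 f) = F2 (ls23 T f)].

(* Structure maps of a dgla viewed as an L-infinity algebra.  These are the
   signs for which an odd x in S_+(Pi V^* ) (x) g is an L-infinity map V -> g
   exactly when (m_V + d) x + [x, x] / 2 = 0, i.e. the components m_1, m_2 of the
   universal solution x = sum_i t^i e_i, (t^i) being dual to (Pi e_i). *)
Definition dgla_maps (k : fieldType) (g : dgla k) (s : seq (Pi g)) : Pi g :=
  match s with
  | [:: x] => dif (x : g)
  | [:: x; y] => - brk (gr (x : g)) (y : g)
  | _ => 0
  end.

Definition is_dgla_linf (k : fieldType) (g : dgla k) (m : infty Com g) : Prop :=
  forall s, cochain m s = dgla_maps s.

(* A dgla map viewed as an L-infinity map. *)
Definition is_strict (k : fieldType) (V W : superspace k) (mV : infty Com V)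
    (mW : infty Com W) (F : linf_map mV mW) (f : V -> W) : Prop :=
  forall s, s != [::] ->
    taylor false F s = if s is [:: x] then f x : Pi W else 0.

Inductive dgla_fiber_seq (k : fieldType) : linf_seq k -> Prop :=
  DglaFiberSeq (g h : dgla k) (f : g -> h) (Hf : is_dgla_map f)
    (mF : infty Com (fiber Hf)) (mg : infty Com g) (mh : infty Com h)
    (P : linf_map mF mg) (F : linf_map mg mh) of
    is_dgla_linf mF & is_dgla_linf mg & is_dgla_linf mh &
    is_strict P (@fiber_proj k g h f Hf) & is_strict F f :
  dgla_fiber_seq (@LinfSeq k (LinfAlg mF) (LinfAlg mg) (LinfAlg mh) P F).

Definition homotopy_fiber_seq (k : fieldType) (S : linf_seq k) : Prop :=
  exists2 T, dgla_fiber_seq T &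
    clos_refl_sym_trans (linf_seq k) (@seq_quasi_iso k) S T.

(* [V -f-> g -i-> h] is a homotopy fibre sequence, where [f] lists the components
   f_r of an L-infinity map to a dgla and [i] is a map of dglas. *)
Definition dgla_homotopy_fiber_seq (k : fieldType) (V : superspace k)
    (m : infty Com V) (g h : dgla k) (f : seq (Pi V) -> Pi g) (i : g -> h) : Prop :=
  exists (mg : infty Com g) (mh : infty Com h) (F : linf_map m mg) (G : linf_map mg mh),
  [/\ is_dgla_linf mg, is_dgla_linf mh,
      forall w, w != [::] -> taylor false F w = f w, is_strict G i &
      homotopy_fiber_seq
        (@LinfSeq k (LinfAlg m) (LinfAlg mg) (LinfAlg mh) F G)].

(* Even or odd form; it is non-degenerate in the sense that V -> V^* is
   injective. *)
Record inner_product (k : fieldType) (V : superspace k) := InnerProduct {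
  ip :> V -> V -> k;
  ip_parity : bool;
  ip_linl : forall (a : k) x x' y, ip (a *: x + x') y = a * ip x y + ip x' y;
  ip_linr : forall (a : k) x y y', ip x (a *: y + y') = a * ip x y + ip x y';
  ip_homog : forall a b x y, homog a x -> homog b y ->
    a (+) b != ip_parity -> ip x y = 0;
  ip_sym : forall a b x y, homog a x -> homog b y ->
    ip x y = (-1) ^+ (a && b) * ip y x;
  ip_nondeg : forall x, (forall y, ip x y = 0) -> x = 0 }.

Fixpoint homog_word (k : fieldType) (U : superspace k) (a : bool) (s : seq U) : Prop :=
  if s is x :: s' then exists b, homog b x /\ homog_word (b (+) a) s'
  else a = false.

(* <u, v> is evaluated on u, v in Pi V with the Koszul sign (-1)^|u| of
   Pi^-1 (x) Pi^-1.  The condition is invariance under the generator of the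
   cyclic group of the word x_1 ... x_n x_(n+1) = rcons (rcons t x) y. *)
Definition cyclic (k : fieldType) (c : flavour) (V : superspace k)
    (B : inner_product V) (D : Der c (Pi V)) : Prop :=
  let B' (u v : Pi V) := B (gr u) v in
  forall (a b : bool) (t : seq (Pi V)) (x y : Pi V),
    homog_word a (rcons t x) -> homog b y ->
    B' (cochain D (rcons t x)) y =
      (-1) ^+ (a && b) * B' (cochain D (y :: t)) x.

Definition subdgla_val (k : fieldType) (g : dgla k) (S : g -> Prop)
    (cl : subdgla_closed S) (x : subdgla cl) : g := sub_val x.

Definition subdgla_incl (k : fieldType) (g : dgla k) (S T : g -> Prop)
    (clS : subdgla_closed S) (clT : subdgla_closed T)
    (ST : forall x, S x -> T x) (x : subdgla clS) : subdgla clT :=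
  @insub_of _ _ (subdgla_sub clT) (subdgla_val x) (ST _ (smemV x)).
Arguments subdgla_incl {k g S T} clS clT ST x.

(* An A-infinity algebra viewed as an L-infinity algebra.  On invariants, the
   projection from the tensor to the symmetric algebra is symmetrization. *)
Definition is_symmetrization (k : fieldType) (V : superspace k)
    (m : infty Ass V) (mL : infty Com V) : Prop :=
  forall (l : {linear Pi V -> k^o}) (s : seq (Pi V)),
    ev (der_app mL (flin Com l)) s =
      symmetric_sum s (fun z => ev (der_app m (flin Ass l)) z : k^o).

(* Main.v *)
(** Write U = Pi V, let h be the big dgla, g its truncation and j : g -> h the
inclusion.  Constant derivations give an abelian i : U -> h, and pr, minus the
constant term, is a left inverse of i whose kernel is g.  The derived brackets
phi (w_1, ..., w_r) = +-[i w_1, [..., d (i w_r)]] satisfy the Maurer-Cartan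
equation without a source term, mu = - pr phi are the structure maps of V (the
symmetrized ones in the associative case) and f = phi + i mu takes values in g.
The L-infinity map V -> H_j is then explicit: it has the components
(f s, z^|s| phi s + z i (mu s)), plus i (gr x) dz when s = [:: x].  It is a
quasi-isomorphism because applying pr and integrating the dz-part over [0, 1]
inverts its linear part in homology.  The only input special to each case is
that cyclic derivations are closed under the commutator and that the iterated
insertions of the w's into m are the stated formula. *)
Require Import Defs.
From HB Require Import structures.
From mathcomp Require Import all_boot all_order all_algebra.
From mathcomp Require Import boolp classical_sets functions.
From mathcomp Require Import ring.
From Stdlib Require Import Relation_Operators.
Set Implicit Arguments.
Unset Strict Implicit.
Unset Printing Implicit Defensive.
Import GRing.Theory.
Local Open Scope ring_scope.

(** * Linear forms separate points *)

(** The components of the map to [H_j] come from gauge theory. Formally [phi] is the gauge transform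
    of the Maurer-Cartan element 0 by i w. Rescaling w to z w multiplies the r-th component by z^r
    and gives a path of gauge equivalent elements starting at 0, with generator i w dz. The
    correction [i mu] stays linear in z because in the source term a value of [mu] counts as one
    letter. Along dz the equation says that z d/dz counts letters, which is Euler's identity
    [phi_euler]. The obstacle is that V may be infinite-dimensional, while all structures are
    continuous operators on duals. No basis is chosen: continuity leaves finitely many vectors at a
    time, and a finite dual system for these gives Taylor coefficients and the density of
    polynomials in linear forms. Identities between derivations or algebra maps are thereby tested
    on linear forms, where they concern families of multilinear maps. Algebra maps with given
    components are exponentials of nilpotent derivations, which avoids signed sums over partitions.
    Signs are treated on homogeneous words, one letter at a time. *)

Section LinearForms.
Variables (k : fieldType) (V : lmodType k).

(* A maximal subspace avoiding x is a hyperplane complementary to x. *)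
Lemma exists_linear_form (x : V) : x != 0 -> exists l : {linear V -> k^o}, l x = 1.
Proof.
move=> x0.
pose P (M : set V) := (forall (a : k) u v, M u -> M v -> M (a *: u + v)) /\ ~ M x.
have [F FP Ftot|A [[Alin Ax] Amax]] := @Zorn_bigcup V P.
  split=> [a u v [X FX Xu] [Y FY Yv]|[X FX Xx]]; last by case: (FP _ FX).
  by case: (Ftot _ _ FX FY) => XY; [exists Y|exists X] => //=;
    [case: (FP _ FY)|case: (FP _ FX)] => H _; apply: H => //; exact: XY.
(* Membership of 0 is not part of [P], since the union of an empty chain is empty; it follows from
   maximality. *)
have A0 : A 0.
  apply: contrapT => nA0; apply: (Amax [set y | A y \/ y = 0]%classic).
    split=> [y Ay|H]; first by left.
    by apply: nA0; apply: H; right.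
  split=> [a u v|[]//]; last by move/eqP; rewrite (negPf x0).
  case=> [Au|->] [Av|->]; rewrite ?scaler0 ?addr0 ?add0r; [left|left|by left|by right].
    exact: Alin.
  by have := Alin (a - 1) u u Au Au; rewrite scalerBl scale1r subrK.
have AZ a u : A u -> A (a *: u) by move=> Au; rewrite -[_ *: _]addr0; exact: Alin.
have AD u v : A u -> A v -> A (u + v) by move=> Au Av; rewrite -[u]scale1r; exact: Alin.
have coef y : exists a, A (y - a *: x).
  have [Ay|nAy] := pselect (A y); first by exists 0; rewrite scale0r subr0.
  have [[u [c [Au ucx]]]|nB] := pselect (exists u c, A u /\ u + c *: y = x).
    have c0 : c != 0.
      by apply: contra_notN Ax => /eqP c0; rewrite -ucx c0 scale0r addr0.
    exists c^-1; rewrite -ucx scalerDr scalerA mulVf // scale1r opprD addrCA subrr addr0.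
    by rewrite -scaleNr; exact: AZ.
  exfalso; apply: (Amax [set z | exists u c, A u /\ u + c *: y = z]%classic).
    split=> [u Au|H]; first by exists u, 0; rewrite scale0r addr0.
    by apply: nAy; apply: H; exists 0, 1; rewrite add0r scale1r.
  split=> [a _ _ [u [c [Au <-]]] [v [d [Av <-]]]|//].
  exists (a *: u + v), (a * c + d); split; first exact: Alin.
  by rewrite scalerDr scalerA scalerDl addrACA.
have uniq a b y : A (y - a *: x) -> A (y - b *: x) -> a = b.
  move=> Aa Ab; apply/eqP; rewrite -subr_eq0; apply: contra_notT Ax => ab.
  have : A ((a - b)^-1 *: (-1 *: (y - a *: x) + (y - b *: x))) by exact/AZ/Alin.
  by rewrite scaleN1r opprB addrA subrK -scalerBl scalerA mulVf // scale1r.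
have [l lP] := choice coef.
have llin : linear (l : V -> k^o).
  move=> a u v; apply: (uniq _ _ (a *: u + v)) => //.
  change (A (a *: u + v - (a * l u + l v) *: x)).
  by rewrite scalerDl opprD addrACA -scalerA -scalerBr; exact: Alin.
exists (mklin llin) => /=.
by apply: (uniq _ _ x) => //; rewrite scale1r subrr.
Qed.

Lemma linear_form_sep (x y : V) : (forall l : {linear V -> k^o}, l x = l y) -> x = y.
Proof.
move=> H; apply/eqP; rewrite -subr_eq0; apply: contraT => /exists_linear_form[l].
by rewrite linearB H subrr => /esym/eqP; rewrite oner_eq0.
Qed.
End LinearForms.

Section HomogForms.
Variables (k : fieldType) (U : superspace k).
Implicit Types (a b p : bool) (x y : U) (l : {linear U -> k^o}).

(** The Koszul sign (-1)^(p|x|) of moving a symbol of parity [p] across [x], as a linear operator,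
    so that it makes sense for letters that are not homogeneous. *)
Definition gp p x : U := if p then gr x else x.

Lemma gp_linear p : linear (gp p).
Proof. by case: p => a x y; rewrite /gp ?linearP. Qed.
HB.instance Definition _ p := GRing.isLinear.Build k U U *:%R (gp p) (gp_linear p).

Lemma gp_add p q x : gp p (gp q x) = gp (p (+) q) x.
Proof. by case: p; case: q; rewrite /gp ?grK. Qed.
Lemma gp_homog p a x : homog a x -> gp p x = (-1) ^+ (p && a) *: x.
Proof. by case: p => /= hx; [exact: gr_homog|rewrite scale1r]. Qed.
Lemma homog_gp p a x : homog a x -> homog a (gp p x).
Proof. by move=> hx; rewrite (gp_homog _ hx); exact: homog_scale. Qed.
Lemma gp_prt p a x : gp p (prt a x) = prt a (gp p x).
Proof.
by case: p; rewrite /gp // prt_gr (gr_homog (homog_prt a x)).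
Qed.

Fact form_prt_linear p l : linear (fun x => l (prt p x) : k^o).
Proof. by move=> a x y; rewrite !linearP. Qed.
Definition fprt_form p l : {linear U -> k^o} := mklin (form_prt_linear p l).

Lemma fprt_form_homog p l : lin_homog p (fprt_form p l).
Proof. by move=> x /=; rewrite prtK eqxx. Qed.
Lemma fprt_formD l x : l x = fprt_form false l x + fprt_form true l x.
Proof. by rewrite /= -linearD prtD. Qed.
Lemma lin_homogN p l a x : lin_homog p l -> homog a x -> p != a -> l x = 0.
Proof. by move=> hl hx pa; rewrite -hl (homog_prtN _ hx) (negPf pa) linear0. Qed.

Lemma homog_form_sep x y :
  (forall p l, lin_homog p l -> l x = l y) -> x = y.
Proof.
by move=> H; apply: linear_form_sep => l; rewrite (fprt_formD l x) (fprt_formD l y);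
  congr (_ + _); apply: H; exact: fprt_form_homog.
Qed.

(** A finite-rank operator, which [homog_sys] makes even. Such operators stand in for a basis:
    continuity involves finitely many vectors at a time, and it is enough that these are fixed. *)
Definition dual_sum (r : seq (bool * {linear U -> k^o} * U)) (x : U) : U :=
  \sum_(t <- r) t.1.2 x *: t.2.
Definition homog_sys (r : seq (bool * {linear U -> k^o} * U)) :=
  forall i, (i < size r)%N ->
  let t := nth (false, \0 : {linear U -> k^o}, 0) r i in
  lin_homog t.1.1 t.1.2 /\ homog t.1.1 t.2.

Lemma homog_sys_cons t r : homog_sys (t :: r) <->
  (lin_homog t.1.1 t.1.2 /\ homog t.1.1 t.2) /\ homog_sys r.
Proof.
split=> [H|[h0 H] [|i] //]; last exact: H.
by split=> [|i]; [exact: (H 0%N)|exact: (H i.+1)].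
Qed.

Lemma dual_sum_lin r (c : k) x y : dual_sum r (c *: x + y) = c *: dual_sum r x + dual_sum r y.
Proof.
rewrite /dual_sum scaler_sumr -big_split; apply: eq_bigr => t _ /=.
by rewrite linearP scalerDl scalerA.
Qed.
Lemma dual_sum_prt r p x : homog_sys r -> dual_sum r (prt p x) = prt p (dual_sum r x).
Proof.
elim: r => [|t r IH]; first by rewrite /dual_sum !big_nil linear0.
move=> /homog_sys_cons[[hl he] /IH]; rewrite /dual_sum !big_cons linearD linearZ => ->.
congr (_ + _); rewrite (homog_prtN p he).
case: eqP => [->|/eqP pe]; first by rewrite hl.
by rewrite -hl prtK eq_sym (negPf pe) /= scaler0 [t.1.2 0]linear0 scale0r.
Qed.

(** The operator R is corrected by rank one for each homogeneous part x of each vector: if y = x - R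
    x is nonzero, choose l with l y = 1 and add z -> l (z - R z) y, projected to the parity of x.
    The added form vanishes on every vector fixed so far. *)
Lemma dual_system (X : seq U) :
  exists2 r, homog_sys r & forall i, (i < size X)%N -> dual_sum r (nth 0 X i) = nth 0 X i.
Proof.
have step p x r : homog p x -> homog_sys r ->
    exists2 r', homog_sys r' & dual_sum r' x = x /\
      forall y, dual_sum r y = y -> dual_sum r' y = y.
  move=> hx hr; pose y := x - dual_sum r x.
  have [y0|y0] := eqVneq y 0.
    by exists r => //; split=> //; apply/esym/eqP; rewrite -subr_eq0 -/y y0.
  have [l ly] := exists_linear_form y0.
  have hy : homog p y by rewrite /homog /y linearB /= -dual_sum_prt // hx.
  have llin : linear (fun z => l (prt p (z - dual_sum r z)) : k^o).
    by move=> a u v; rewrite dual_sum_lin opprD addrACA -scalerBr !linearP.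
  exists ((p, mklin llin, y) :: r).
    apply/homog_sys_cons; split=> //; split=> // z /=.
    by rewrite dual_sum_prt // -linearB /= prtK eqxx.
  split=> [|z Rz]; rewrite /dual_sum big_cons /= -/(dual_sum r _).
    by rewrite -/y hy ly scale1r /y subrK.
  by rewrite Rz subrr !linear0 scale0r add0r.
elim: X => [|x X [r hr HX]]; first by exists [::].
have [r1 hr1 [H1 K1]] := step false _ r (homog_prt false x) hr.
have [r2 hr2 [H2 K2]] := step true _ r1 (homog_prt true x) hr1.
exists r2 => // -[|i] /= iX; last by apply/K2/K1/HX.
rewrite -[x]prtD -[X in X + _]scale1r dual_sum_lin H2 !scale1r; congr (_ + _).
exact: K2.
Qed.
End HomogForms.

(** * Unshuffle sums *)

Section WordFunctions.
Variables (k : fieldType) (U : superspace k).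
Implicit Types (s t : seq U) (x y : U) (a b p q : bool).

Lemma homog_word_cat a b s t :
  homog_word a s -> homog_word b t -> homog_word (a (+) b) (s ++ t).
Proof.
elim: s a => [|x s IH] a /=; first by move=> ->; rewrite addFb.
by move=> [c [hx hs]] ht; exists c; split => //; rewrite addbA; exact: IH.
Qed.
Lemma homog_word_cons a p x s : homog p x -> homog_word a s -> homog_word (p (+) a) (x :: s).
Proof. by move=> hx hs; exists p; split=> //; rewrite addbA addbb addFb. Qed.
Lemma homog_word_map (f : U -> U) a s : (forall p x, homog p x -> homog p (f x)) ->
  homog_word a s -> homog_word a (map f s).
Proof.
move=> hf; elim: s a => [|x s IH] a //= [p [hx hs]].
by exists p; split; [exact: hf|exact: IH].
Qed.
Lemma homog_word_split a s t : homog_word a (s ++ t) ->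
  exists b, homog_word b s /\ homog_word (a (+) b) t.
Proof.
elim: s a => [|x s IH] a /=; first by exists false; rewrite addbF.
move=> [p [hx /IH[b [hs ht]]]]; exists (p (+) b); split.
  by exists p; split=> //; rewrite addbA addbb.
by move: ht; rewrite addbA [p (+) a]addbC.
Qed.

Section Values.
Variable M : lmodType k.
Implicit Types (f g : seq U -> M).

Definition mlin f := forall s1 s2 (a : k) (x y : U),
  f (s1 ++ (a *: x + y) :: s2) = a *: f (s1 ++ x :: s2) + f (s1 ++ y :: s2).
Definition gsym f := forall s1 s2 (a b : bool) (x y : U),
  homog a x -> homog b y ->
  f (s1 ++ x :: y :: s2) = (-1) ^+ (a && b) *: f (s1 ++ y :: x :: s2).

Lemma mlin_cons f x : mlin f -> mlin (fun t => f (x :: t)).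
Proof. by move=> mf s1 s2 a y z; exact: (mf (x :: s1)). Qed.
Lemma gsym_cons f x : gsym f -> gsym (fun t => f (x :: t)).
Proof. by move=> mf s1 s2 a b y z; exact: (mf (x :: s1)). Qed.
Lemma mlin_hd f (a : k) x y s : mlin f -> f ((a *: x + y) :: s) = a *: f (x :: s) + f (y :: s).
Proof. by move=> mf; exact: (mf [::]). Qed.
Lemma mlin_hd0 f s : mlin f -> f (0 :: s) = 0.
Proof.
move=> mf; have := mlin_hd (-1) 0 0 s mf.
by rewrite scaler0 addr0 scaleN1r addNr.
Qed.
Lemma mlin_hdD f x y s : mlin f -> f ((x + y) :: s) = f (x :: s) + f (y :: s).
Proof. by move=> mf; rewrite -[x]scale1r mlin_hd // !scale1r. Qed.
Lemma mlin_hdZ f (a : k) x s : mlin f -> f ((a *: x) :: s) = a *: f (x :: s).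
Proof. by move=> mf; rewrite -[_ *: _]addr0 mlin_hd // (mlin_hd0 s mf) addr0. Qed.
Lemma mlin_prt f x s : mlin f -> f (prt false x :: s) + f (prt true x :: s) = f (x :: s).
Proof. by move=> mf; rewrite -mlin_hdD // prtD. Qed.
Lemma mlinD f g : mlin f -> mlin g -> mlin (fun s => f s + g s).
Proof. by move=> mf mg s1 s2 a x y; rewrite mf mg scalerDr addrACA. Qed.
Lemma mlinZ c f : mlin f -> mlin (fun s => c *: f s).
Proof. by move=> mf s1 s2 a x y; rewrite mf scalerDr !scalerA mulrC. Qed.
Lemma mlin0 : mlin (fun=> 0).
Proof. by move=> s1 s2 a x y; rewrite scaler0 addr0. Qed.
Lemma gsymD f g : gsym f -> gsym g -> gsym (fun s => f s + g s).
Proof. by move=> sf sg s1 s2 a b x y hx hy; rewrite (sf _ _ _ _ _ _ hx hy) (sg _ _ _ _ _ _ hx hy) scalerDr. Qed.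
(** The letters are split into homogeneous parts one at a time, the finished ones being collected in
    [s1]. Sign identities are reduced in this way to words on which every Koszul sign is a
    constant. *)
Lemma mlin_homog_eq f g : mlin f -> mlin g ->
  (forall a s, homog_word a s -> f s = g s) -> f =1 g.
Proof.
move=> mf mg H; suff G s1 s2 a : homog_word a s1 -> f (s1 ++ s2) = g (s1 ++ s2).
  by move=> s; exact: (G [::] s false).
elim: s2 s1 a => [|x s2 IH] s1 a h1; first by rewrite cats0; exact: H h1.
have E p : f (s1 ++ prt p x :: s2) = g (s1 ++ prt p x :: s2).
  rewrite -cat_rcons; apply: (IH _ (a (+) p)).
  by rewrite -cats1; apply: homog_word_cat => //; exists p; rewrite addbb; split=> //; exact: homog_prt.
by rewrite -[x]prtD -[prt false x]scale1r mf mg !E.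
Qed.

Lemma mlin_gp_homog f p a s : mlin f -> homog_word a s ->
  f (map (gp p) s) = (-1) ^+ (p && a) *: f s.
Proof.
elim: s f a => [|x s IH] f a mf /=; first by move=> ->; rewrite andbF scale1r.
move=> [b [hx hs]]; rewrite (gp_homog _ hx) mlin_hdZ //.
rewrite (IH (fun t => f (x :: t)) _ (mlin_cons x mf) hs) scalerA -signr_addb.
by case: (p); case: (b); case: (a).
Qed.

Lemma gsym_gp f p x y s : mlin f -> gsym f -> homog p x ->
  f (x :: gp p y :: s) = f (y :: x :: s).
Proof.
move=> mf sf hx.
have E b (z : U) : homog b z -> f (x :: gp p z :: s) = f (z :: x :: s).
  move=> hz; rewrite (gp_homog _ hz) (mlin_hdZ _ _ _ (mlin_cons x mf)).
  rewrite (sf [::] s _ _ _ _ hx hz) scalerA -signr_addb addbb scale1r; by [].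
rewrite -[y]prtD linearD (mlin_hdD _ _ _ (mlin_cons x mf)) (mlin_hdD _ _ _ mf).
by rewrite !(E _ _ (homog_prt _ y)).
Qed.

(* Sum over the unshuffles (A, B) of s, with the Koszul sign of s -> A ++ B. *)
Fixpoint unsh s (P : seq U -> seq U -> M) : M :=
  if s is x :: s' then
    unsh s' (fun A B => P (x :: A) B) +
    (unsh s' (fun A B => P A (prt false x :: B)) +
     unsh s' (fun A B => P (map (@gr k U) A) (prt true x :: B)))
  else P [::] [::].

Lemma unsh_ext s P Q : (forall A B, (size A + size B = size s)%N -> P A B = Q A B) ->
  unsh s P = unsh s Q.
Proof.
elim: s P Q => [|x s IH] P Q H /=; first exact: H.
by congr (_ + (_ + _)); apply: IH => A B e; apply: H;
  rewrite /= ?size_map -?e ?addSn ?addnS.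
Qed.
Lemma unsh_lin s c P Q :
  unsh s (fun A B => c *: P A B + Q A B) = c *: unsh s P + unsh s Q.
Proof.
elim: s P Q => [|x s IH] P Q //=.
by rewrite !IH !scalerDr [in RHS]addrACA; congr (_ + _); rewrite addrACA.
Qed.
Lemma unsh0 s : unsh s (fun _ _ => 0) = 0.
Proof. by elim: s => [|x s IH] //=; rewrite !IH !addr0. Qed.
Lemma unshD s P Q : unsh s (fun A B => P A B + Q A B) = unsh s P + unsh s Q.
Proof.
rewrite -[unsh s P]scale1r -unsh_lin; apply: unsh_ext => A B _; by rewrite scale1r.
Qed.
Lemma unshZ s c P : unsh s (fun A B => c *: P A B) = c *: unsh s P.
Proof.
rewrite -[RHS]addr0 -[X in _ + X](unsh0 s) -unsh_lin; apply: unsh_ext => A B _.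
by rewrite addr0.
Qed.
(** Sharpens [unsh_ext]: the summands are compared only on parts A and B of definite parities adding
    up to [q], where Koszul signs are numbers. *)
Lemma unsh_exth q s P Q : homog_word q s ->
  (forall a A B, homog_word a A -> homog_word (a (+) q) B ->
    (size A + size B = size s)%N -> P A B = Q A B) ->
  unsh s P = unsh s Q.
Proof.
elim: s q P Q => [|x s IH] q P Q /=; first by move=> -> H; exact: (H false).
move=> [p [hx hs]] H.
have hp b : homog p (prt b x) by rewrite (homog_prtN b hx); case: eqP => // _; exact: homog0.
have hgr a A : homog_word a A -> homog_word a (map (@gr k U) A).
  by apply: homog_word_map => ? ?; exact: homog_gr.
congr (_ + (_ + _)); apply: (IH _ _ _ hs) => a A B hA hB e.
- apply: (H (p (+) a)) => //=; rewrite -?e //; first exact: homog_word_cons.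
  by move: hB; rewrite addbA [p (+) a]addbC.
- apply: (H a) => //=; rewrite -?e ?addnS //; exists p; split=> //.
  by rewrite addbCA.
- apply: (H a) => //=; rewrite -?e ?size_map ?addnS //; first exact: hgr.
  by exists p; split=> //; rewrite addbCA.
Qed.

Definition bml (P : seq U -> seq U -> M) :=
  (forall B, mlin (fun A => P A B)) /\ (forall A, mlin (P A)).

Lemma mlin_map_gr f : mlin f -> mlin (fun s => f (map (@gr k U) s)).
Proof. by move=> mf s1 s2 a y z; rewrite !map_cat /= linearP; exact: mf. Qed.
Lemma mlin_map_gp p f : mlin f -> mlin (fun s => f (map (gp p) s)).
Proof. by move=> mf s1 s2 a y z; rewrite !map_cat /= linearP; exact: mf. Qed.

Lemma bml_l P x : bml P -> bml (fun A B => P (x :: A) B).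
Proof. by move=> [m1 m2]; split=> [B|A] //; exact: (mlin_cons x (m1 B)). Qed.
Lemma bml_r P x : bml P -> bml (fun A B => P A (x :: B)).
Proof. by move=> [m1 m2]; split=> [B|A] //; exact: (mlin_cons x (m2 A)). Qed.
Lemma bml_gr P : bml P -> bml (fun A B => P (map (@gr k U) A) B).
Proof. by move=> [m1 m2]; split=> [B|A] //; exact: (mlin_map_gr (m1 B)). Qed.
Lemma bml_gp p P : bml P -> bml (fun A B => P (map (gp p) A) B).
Proof. by move=> [m1 m2]; split=> [B|A] //; exact: (mlin_map_gp p (m1 B)). Qed.

Lemma map_gp_false s : map (gp false) s = s.
Proof. by apply: map_id_in => x. Qed.

Lemma unsh_cons p x s P : bml P -> homog p x ->
  unsh (x :: s) P = unsh s (fun A B => P (x :: A) B) +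
     unsh s (fun A B => P (map (gp p) A) (x :: B)).
Proof.
move=> [m1 m2] hx /=; congr (_ + _).
have Z Q : unsh s (fun A B => P (Q A) ((0 : U) :: B)) = 0.
  by rewrite -(unsh0 s); apply: unsh_ext => A B _; rewrite mlin_hd0.
rewrite !(homog_prtN _ hx); case: p hx => hx /=; rewrite Z ?addr0 ?add0r //.
by apply: unsh_ext => A B _; rewrite map_gp_false.
Qed.

Lemma mlin_unsh P : bml P -> mlin (fun s => unsh s P).
Proof.
move=> mP s1; elim: s1 P mP => [|z s1 IH] P mP s2 a x y /=.
  have [m1 m2] := mP; rewrite !scalerDr [RHS]addrACA; congr (_ + _).
    by rewrite -unsh_lin; apply: unsh_ext => A B _; rewrite (mlin_hd _ _ _ _ (m1 B)).
  rewrite [RHS]addrACA; congr (_ + _); rewrite -unsh_lin; apply: unsh_ext => A B _;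
    by rewrite linearP (mlin_hd _ _ _ _ (m2 _)).
rewrite (IH _ (bml_l z mP)) (IH _ (bml_r (prt false z) mP)).
rewrite (IH _ (bml_r (prt true z) (bml_gr mP))) !scalerDr [RHS]addrACA.
by congr (_ + _); rewrite addrACA.
Qed.

Lemma gsym_map_gp p f : gsym f -> gsym (fun s => f (map (gp p) s)).
Proof.
move=> sf s1 s2 a b x y hx hy; rewrite !map_cat /=.
by apply: sf; exact: homog_gp.
Qed.
Lemma gsym_map_gr f : gsym f -> gsym (fun s => f (map (@gr k U) s)).
Proof. exact: (gsym_map_gp true). Qed.

Lemma map_gp_gp p q s : map (gp p) (map (gp q) s) = map (gp (p (+) q)) s.
Proof. by rewrite -map_comp; apply: eq_map => x /=; exact: gp_add. Qed.

(** Exchanging two adjacent letters permutes the four ways to distribute them. If both fall into the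
    same part, the symmetry of [P] gives the sign; if they are separated, the two distributions are
    swapped and the sign comes from [gp]. *)
Lemma gsym_unsh P : bml P -> (forall B, gsym (fun A => P A B)) -> (forall A, gsym (P A)) ->
  gsym (fun s => unsh s P).
Proof.
move=> mP sP1 sP2 s1; elim: s1 P mP sP1 sP2 => [|z s1 IH] P mP sP1 sP2 s2 a b x y hx hy.
  rewrite [[::] ++ _]/= [[::] ++ _]/=.
  have two c d u v : homog c u -> homog d v -> unsh (u :: v :: s2) P =
      unsh s2 (fun A B => P (u :: v :: A) B) +
      unsh s2 (fun A B => P (u :: map (gp d) A) (v :: B)) +
      (unsh s2 (fun A B => P (gp c v :: map (gp c) A) (u :: B)) +
       unsh s2 (fun A B => P (map (gp c) (map (gp d) A)) (u :: v :: B))).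
    move=> hu hv; rewrite (unsh_cons _ mP hu) (unsh_cons _ (bml_l u mP) hv).
    by rewrite (unsh_cons _ (bml_gp c (bml_r u mP)) hv).
  rewrite (two _ _ _ _ hx hy) (two _ _ _ _ hy hx).
  have m1 B := (mP.1 B : mlin (fun A => P A B)).
  have e0 : unsh s2 (fun A B => P (x :: y :: A) B) =
    (-1) ^+ (a && b) *: unsh s2 (fun A B => P (y :: x :: A) B).
    by rewrite -unshZ; apply: unsh_ext => A B _; exact: (sP1 B [::]).
  have e1 : unsh s2 (fun A B => P (x :: map (gp b) A) (y :: B)) =
    (-1) ^+ (a && b) *: unsh s2 (fun A B => P (gp b x :: map (gp b) A) (y :: B)).
    rewrite -unshZ; apply: unsh_ext => A B _.
    by rewrite (gp_homog _ hx) (mlin_hdZ _ _ _ (m1 _)) scalerA andbC -signr_addb addbb scale1r.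
  have e2 : unsh s2 (fun A B => P (gp a y :: map (gp a) A) (x :: B)) =
    (-1) ^+ (a && b) *: unsh s2 (fun A B => P (y :: map (gp a) A) (x :: B)).
    rewrite -unshZ; apply: unsh_ext => A B _.
    by rewrite (gp_homog _ hy) (mlin_hdZ _ _ _ (m1 _)).
  have e3 : unsh s2 (fun A B => P (map (gp a) (map (gp b) A)) (x :: y :: B)) =
    (-1) ^+ (a && b) *: unsh s2 (fun A B => P (map (gp b) (map (gp a) A)) (y :: x :: B)).
    rewrite -unshZ; apply: unsh_ext => A B _; rewrite !map_gp_gp [b (+) a]addbC.
    exact: (sP2 _ [::]).
  rewrite e0 e1 e2 e3 !scalerDr -!addrA; congr (_ + _).
  by rewrite addrCA.
rewrite /= !scalerDr; congr (_ + (_ + _)).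
- by apply: (IH (fun A B => P (z :: A) B)); [exact: bml_l|move=> B; exact: (gsym_cons z (sP1 B))|by []|exact: hx|exact: hy].
- apply: (IH (fun A B => P A (prt false z :: B))); [exact: bml_r|by []| |exact: hx|exact: hy].
  by move=> A; exact: (gsym_cons _ (sP2 A)).
- apply: (IH (fun A B => P (map (@gr k U) A) (prt true z :: B))) => //.
  + exact: (bml_gr (bml_r (prt true z) mP)).
  + by move=> B; exact: (gsym_map_gr (sP1 _)).
  + by move=> A; exact: (gsym_cons _ (sP2 _)).
Qed.

(** Together with [unsh_nill], this absorbs an isolated term into an unshuffle sum as the summand
    with an empty part, so that sums can be compared termwise. *)
Lemma unsh_nilr s (Q : seq U -> M) : mlin Q ->
  unsh s (fun A B => if B is [::] then Q A else 0) = Q s.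
Proof.
elim: s Q => [|x s IH] Q mQ //=.
by rewrite (IH (fun A => Q (x :: A)) (mlin_cons x mQ)) !unsh0 !addr0.
Qed.
Lemma unsh_nill s (Q : seq U -> M) : mlin Q ->
  unsh s (fun A B => if A is [::] then Q B else 0) = Q s.
Proof.
elim: s Q => [|x s IH] Q mQ //=.
rewrite unsh0 add0r (IH (fun B => Q (prt false x :: B)) (mlin_cons _ mQ)).
rewrite -(mlin_prt x s mQ) -[in RHS](IH _ (mlin_cons (prt true x) mQ)).
by congr (_ + _); apply: unsh_ext => -[].
Qed.

Lemma unsh1_eq0 x P : P [:: x] [::] = 0 -> (forall y, P [::] [:: y] = 0) -> unsh [:: x] P = 0.
Proof. by move=> H1 H2; rewrite /= H1 !H2 !addr0. Qed.

(** The unshuffles of s are stable under (A, B) -> (B, A), at the cost of the Koszul sign of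
    exchanging A with B, which the hypothesis supplies. *)
Lemma unsh_flip q s P Q : homog_word q s -> bml P -> bml Q ->
  (forall a b A B, homog_word a A -> homog_word b B -> P A B = (-1) ^+ (a && b) *: Q B A) ->
  unsh s P = unsh s Q.
Proof.
elim: s q P Q => [|x s IH] q P Q /=.
  by move=> _ _ _ /(_ false false [::] [::]); rewrite scale1r; apply.
move=> [p [hx hs]] mP mQ H.
rewrite -/(unsh (x :: s) P) -/(unsh (x :: s) Q) (unsh_cons _ mP hx) (unsh_cons _ mQ hx).
rewrite addrC; congr (_ + _).
  apply: (IH _ _ _ hs); [exact: (bml_gp p (bml_r x mP))|exact: (bml_l x mQ)|].
  move=> a b A B hA hB; rewrite (mlin_gp_homog _ (mP.1 _) hA).
  rewrite (H _ _ _ _ hA (homog_word_cons hx hB)) scalerA -signr_addb.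
  by case: (a); case: (p); case: (b).
apply: (IH _ _ _ hs); [exact: (bml_l x mP)|exact: (bml_gp p (bml_r x mQ))|].
move=> a b A B hA hB; rewrite (mlin_gp_homog _ (mQ.1 _) hB).
rewrite (H _ _ _ _ (homog_word_cons hx hA) hB) scalerA -signr_addb.
by case: (a); case: (p); case: (b).
Qed.
End Values.

Lemma unsh_linear (M N : lmodType k) (h : M -> N) s P : linear h ->
  h (unsh s P) = unsh s (fun A B => h (P A B)).
Proof.
move=> hl; have hD (u v : M) : h (u + v) = h u + h v.
  by rewrite -[u]scale1r hl !scale1r.
by elim: s P => [|x s IH] P //=; rewrite !hD !IH.
Qed.
Lemma mlin_linear (M N : lmodType k) (h : M -> N) f : linear h -> mlin f ->
  mlin (fun s => h (f s)).
Proof. by move=> hl mf s1 s2 a x y; rewrite mf hl. Qed.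
Lemma gsym_linear (M N : lmodType k) (h : M -> N) f : linear h -> gsym f ->
  gsym (fun s => h (f s)).
Proof.
move=> hl sf s1 s2 a b x y hx hy; rewrite (sf _ _ _ _ _ _ hx hy).
have h0 : h 0 = 0 by have := hl (-1) 0 0; rewrite scaler0 addr0 scaleN1r addNr.
by rewrite -[_ *: f _]addr0 hl h0 addr0.
Qed.

(** The factor [f] receives the second part: the sign (-1)^(|A||B|) built into the product turns the
    Koszul sign of s -> A ++ B into that of s -> B ++ A. *)
Lemma wmul_unsh s (f g : seq U -> k^o) :
  wmul Com s f g = unsh s (fun B A => f A * g B : k^o).
Proof. by elim: s f g => [|x s IH] f g //=; rewrite !IH addrA. Qed.

Lemma unsh_cont s (w : seq U -> seq U -> seq U) : exists L : seq (seq U),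
  forall f : seq U -> k^o, (forall t, t \in L -> f t = 0) ->
    unsh s (fun A B => f (w A B)) = 0.
Proof.
elim: s w => [|x s IH] w /=.
  by exists [:: w [::] [::]] => f H; apply: H; rewrite mem_head.
have [L1 H1] := IH (fun A B => w (x :: A) B).
have [L2 H2] := IH (fun A B => w A (prt false x :: B)).
have [L3 H3] := IH (fun A B => w (map (@gr k U) A) (prt true x :: B)).
exists (L1 ++ L2 ++ L3) => f H; rewrite H1 ?H2 ?H3 ?addr0 // => t tL;
  by apply: H; rewrite !mem_cat tL ?orbT.
Qed.
End WordFunctions.

(** * Derivations with given Taylor coefficients *)

Section Products.
Variables (k : fieldType) (U : superspace k).
Implicit Types (f g : seq U -> k^o) (s t : seq U) (x y : U) (b p q : bool).

Definition tw p f : seq U -> k^o := fun t => f (map (gp p) t).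
Definition cparity (W : superspace k) b (c : seq U -> W) :=
  forall a s, homog_word a s -> homog (b (+) a) (c s).

Lemma wmulDl c s f f' g : wmul c s (fun t => f t + f' t) g = wmul c s f g + wmul c s f' g.
Proof.
rewrite -[wmul c s f g]mul1r -wmul_linl; apply: wmul_ext => // t; by rewrite mul1r.
Qed.
Lemma wmulDr c s f g g' : wmul c s f (fun t => g t + g' t) = wmul c s f g + wmul c s f g'.
Proof.
rewrite -[wmul c s f g]mul1r -wmul_linr; apply: wmul_ext => // t; by rewrite mul1r.
Qed.

Lemma ml_tw p f : multilinear f -> multilinear (tw p f).
Proof. exact: (@mlin_map_gp k U k^o p f). Qed.
Lemma sy_tw p f : graded_symmetric f -> graded_symmetric (tw p f).
Proof. exact: (@gsym_map_gp k U k^o p f). Qed.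
Lemma ml_homog_eq f g : multilinear f -> multilinear g ->
  (forall a s, homog_word a s -> f s = g s) -> f =1 g.
Proof. exact: (@mlin_homog_eq k U k^o). Qed.
Lemma mlD f g : multilinear f -> multilinear g -> multilinear (fun s => f s + g s : k^o).
Proof. exact: (@mlinD k U k^o). Qed.
Lemma mlZ (a : k) f : multilinear f -> multilinear (fun s => a * f s : k^o).
Proof. exact: (@mlinZ k U k^o). Qed.
Lemma tw_homog p f a s : multilinear f -> homog_word a s ->
  tw p f s = (-1) ^+ (p && a) * f s.
Proof. exact: (@mlin_gp_homog k U k^o). Qed.
Lemma tw_tw p q f t : tw p (tw q f) t = tw (p (+) q) f t.
Proof. by rewrite /tw map_gp_gp addbC. Qed.
Lemma tw_cons p a f x t : multilinear f -> homog a x ->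
  tw p f (x :: t) = (-1) ^+ (p && a) * tw p (fun u => f (x :: u)) t.
Proof. by rewrite /tw => mf hx; rewrite /= (gp_homog p hx) ml_hdZ. Qed.

Lemma wmul_cons_com p x s f g : multilinear f -> homog p x ->
  wmul Com (x :: s) f g = wmul Com s f (fun t => g (x :: t)) +
    wmul Com s (fun t => f (x :: t)) (tw p g).
Proof.
move=> mf hx; rewrite /= !(homog_prtN _ hx) -addrA; congr (_ + _).
case: p hx => _ /=.
  by rewrite wmul0l ?add0r // => t; exact: ml_hd0.
rewrite [X in _ + X]wmul0l ?addr0 // => [|t]; last exact: ml_hd0.
by apply: wmul_ext => // t; rewrite /tw map_gp_false.
Qed.
Lemma wmul_cons_ass p x s f g : multilinear f -> homog p x ->
  wmul Ass (x :: s) f g = f [::] * g (x :: s) +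
    wmul Ass s (fun t => f (x :: t)) (tw p g).
Proof.
move=> mf hx; rewrite /= !(homog_prtN _ hx) -addrA; congr (_ + _).
case: p hx => _ /=.
  by rewrite wmul0l ?add0r // => t; exact: ml_hd0.
rewrite [X in _ + X]wmul0l ?addr0 // => [|t]; last exact: ml_hd0.
by apply: wmul_ext => // t; rewrite /tw map_gp_false.
Qed.

End Products.

Lemma wmul_map (k : fieldType) (U W : superspace k) (h : U -> W) c s (f g : seq W -> k^o) :
  (forall a x, h (prt a x) = prt a (h x)) -> (forall x, h (gr x) = gr (h x)) ->
  wmul c (map h s) f g = wmul c s (fun t => f (map h t) : k^o) (fun t => g (map h t) : k^o).
Proof.
move=> hp hg; elim: s f g => [|x s IH] f g //=.
rewrite !(IH (fun t => f (_ :: t))); congr (_ + _ + _).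
- by case: c {IH} (IH) => IH //; rewrite IH.
- by apply: wmul_ext => t //; rewrite /= hp.
apply: wmul_ext => t //=; first by rewrite hp.
by congr g; rewrite -!map_comp; apply: eq_map => y /=.
Qed.

Lemma wmul_tw (k : fieldType) (U : superspace k) c p s (f g : seq U -> k^o) :
  tw p (fun t => wmul c t f g : k^o) s = wmul c s (tw p f) (tw p g).
Proof.
have gpC (x : U) : gp p (gr x) = gr (gp p x).
  by rewrite -!/(gp true _) !gp_add addbC.
exact: (wmul_map c s f g (gp_prt p) gpC).
Qed.

(** * Derivations of the completed symmetric algebra *)

Section ComDerivation.
Variables (k : fieldType) (U : superspace k).
Implicit Types (f g : seq U -> k^o) (c : seq U -> U) (s t : seq U) (x y : U) (b p q : bool).

(** The derivation with Taylor coefficients [c]. The twist [tw b] is the dualization sign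
    (-1)^(b|f|), because a homogeneous [f] lives on words of its own parity. *)
Definition com_der b c f : seq U -> k^o := fun s => unsh s (fun A B => tw b f (c A :: B)).

Lemma bml_com_der b c f : mlin c -> multilinear f ->
  @bml _ _ (k^o) (fun A B => tw b f (c A :: B)).
Proof.
move=> mc mf; split=> [B|A]; last exact: (ml_cons (c A) (ml_tw b mf)).
by move=> s1 s2 a x y; rewrite mc (ml_hd _ _ _ _ (ml_tw b mf)).
Qed.
Lemma ml_com_der b c f : mlin c -> multilinear f -> multilinear (com_der b c f).
Proof. move=> mc mf; exact: (mlin_unsh (bml_com_der b mc mf)). Qed.
Lemma sy_com_der b c f : mlin c -> gsym c -> multilinear f -> graded_symmetric f ->
  graded_symmetric (com_der b c f).
Proof.
move=> mc sc mf sf; apply: (gsym_unsh (bml_com_der b mc mf)) => [B|A].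
  move=> s1 s2 p q x y hx hy; rewrite (sc _ _ _ _ _ _ hx hy).
  exact: (ml_hdZ _ _ _ (ml_tw b mf)).
exact: (sy_cons (c A) (sy_tw b sf)).
Qed.
Lemma com_der_ext b c f f' s : f =1 f' -> com_der b c f s = com_der b c f' s.
Proof. by move=> ff; apply: unsh_ext => A B _; rewrite /tw ff. Qed.
Lemma com_der_lin b c a f f' s : com_der b c (fun t => a * f t + f' t) s =
  a * com_der b c f s + com_der b c f' s.
Proof. exact: (@unsh_lin k U (k^o) s a). Qed.
Lemma com_derD b c f f' s : com_der b c (fun t => f t + f' t) s =
  com_der b c f s + com_der b c f' s.
Proof. exact: (@unshD k U (k^o) s). Qed.
Lemma com_derZ b c a f s : com_der b c (fun t => a * f t) s = a * com_der b c f s.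
Proof. exact: (@unshZ k U (k^o) s a). Qed.

(** The first letter is either swallowed by [c], which shifts the parity of [c] by |x|, or it stays
    a letter of [f]; then the symmetry of [f] brings it in front of the value of [c]. *)
Lemma com_der_cons b c f p x s : mlin c -> cparity b c -> multilinear f ->
  graded_symmetric f -> homog p x ->
  com_der b c f (x :: s) = com_der (b (+) p) (fun A => c (x :: A)) (tw p f) s +
    com_der b c (fun t => f (x :: t)) s.
Proof.
move=> mc hc mf sf hx; move: s; apply: ml_homog_eq.
- exact: (ml_cons x (ml_com_der b mc mf)).
- apply: mlD; first exact/(ml_com_der _ (mlin_cons x mc))/ml_tw.
  exact/(ml_com_der _ mc)/ml_cons.
move=> q s hs; rewrite /com_der (unsh_cons _ (bml_com_der b mc mf) hx); congr (_ + _).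
  by apply: unsh_ext => A B _; rewrite tw_tw -addbA addbb addbF.
apply: (unsh_exth hs) => a A B hA hB _.
rewrite (mlin_gp_homog _ mc hA) (ml_hdZ _ _ _ (ml_tw b mf)) /tw /=.
rewrite (sy_hd _ sf (homog_gp b (hc _ _ hA)) (homog_gp b hx)) (gp_homog b hx) (ml_hdZ _ _ _ mf).
by case: (b); case: (p); case: (a) => /=; ring.
Qed.

Lemma com_der_tw b c f p s : mlin c -> cparity b c -> multilinear f ->
  tw p (com_der b c f) s = (-1) ^+ (b && p) * com_der b c (tw p f) s.
Proof.
move=> mc hc mf; move: s; apply: ml_homog_eq.
- exact/ml_tw/ml_com_der.
- exact/mlZ/ml_com_der/ml_tw.
move=> q s hs; rewrite (tw_homog _ (ml_com_der b mc mf) hs) -!com_derZ.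
apply: (unsh_exth hs) => a A B hA hB _.
have hAB : homog_word (b (+) q) (c A :: B).
  exists (b (+) a); split; first exact: hc.
  by rewrite addbACA addbb addFb.
rewrite !(tw_homog _ (mlZ _ _) hAB) ?(tw_homog _ mf hAB) //; last exact: ml_tw.
by case: (b); case: (p); case: (q) => /=; ring.
Qed.

(** Leibniz rule by induction on the word. The induction runs over all [b], [c], [f], [g] at once,
    since the first letter is curried into one of [c], [f], [g] and may change the parity of [c]. *)
Lemma com_der_mul b c f g : mlin c -> gsym c -> cparity b c ->
  multilinear f -> graded_symmetric f -> multilinear g -> graded_symmetric g ->
  forall s, com_der b c (fun t => wmul Com t f g) s =
    wmul Com s (com_der b c f) g + wmul Com s (tw b f) (com_der b c g).
Proof.
move=> mc sc hc mf sf mg sg.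
apply: ml_homog_eq.
- exact/(ml_com_der b mc)/ml_wmul.
- apply: mlD; apply: ml_wmul => //; try exact: ml_com_der; exact: ml_tw.
move=> q s; elim: s q b c f g mc sc hc mf sf mg sg => [|x s IH] q b c f g mc sc hc mf sf mg sg.
  move=> _; rewrite /com_der /unsh /tw [map _ _]/=.
  have hu : homog b (gp b (c [::])) by apply: homog_gp; rewrite -[b]addbF; exact: hc.
  by rewrite (wmul_cons_com _ _ mf hu) /= addrC.
move=> [p [hx hs]].
have mx := mlin_cons x mc; have sx := gsym_cons x sc.
have hx' : cparity (b (+) p) (fun A => c (x :: A)).
  by move=> a A hA; rewrite -addbA; apply: hc; exact: homog_word_cons.
rewrite (com_der_cons _ mc hc (ml_wmul Com mf mg) (sy_wmul mf mg sf sg) hx).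
rewrite (com_der_ext (f := tw p _) _ _ _ (fun t => wmul_tw Com p t f g)).
rewrite (com_der_ext _ _ _ (fun t => wmul_cons_com t g mf hx)) com_derD.
have [mfx mgx] := (ml_cons x mf, ml_cons x mg).
have [sfx sgx] := (sy_cons x sf, sy_cons x sg).
rewrite (IH _ _ _ _ _ mx sx hx' (ml_tw p mf) (sy_tw p sf) (ml_tw p mg) (sy_tw p sg) hs).
rewrite (IH _ _ _ _ _ mc sc hc mf sf mgx sgx hs).
rewrite (IH _ _ _ _ _ mc sc hc mfx sfx (ml_tw p mg) (sy_tw p sg) hs).
rewrite (wmul_cons_com _ _ (ml_com_der b mc mf) hx) (wmul_cons_com _ _ (ml_tw b mf) hx).
rewrite (wmul_ext _ _ (fun t => com_der_cons t mc hc mf sf hx) (frefl _)) wmulDl.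
rewrite (wmul_ext _ _ (frefl _) (fun t => com_der_cons t mc hc mg sg hx)) wmulDr.
rewrite (wmul_ext (f := tw _ (tw _ _)) _ _ (tw_tw _ _ _) (frefl _)) -addbA addbb addbF.
rewrite (wmul_ext _ _ (fun t => tw_cons b t mf hx) (fun t => com_der_tw p t mc hc mg)).
rewrite wmulZl wmulZr.
by case: (b); case: (p) => /=; ring.
Qed.

Lemma com_der_cont b c s : exists L : seq (seq U), forall f,
  (forall t, t \in L -> f t = 0) -> com_der b c f s = 0.
Proof.
have [L HL] := unsh_cont s (fun A B => map (gp b) (c A :: B)).
by exists L => f Hf; exact: HL.
Qed.
End ComDerivation.

(** * Derivations of the completed tensor algebra *)

Section AssDerivation.
Variables (k : fieldType) (U : superspace k).
Implicit Types (f g : seq U -> k^o) (c : seq U -> U) (s t : seq U) (x y : U) (b p q : bool).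

(* Sum of f (c A :: B) over the deconcatenations s = A ++ B. *)
Fixpoint hd_ins c f s : k := f (c [::] :: s) +
  if s is x :: s' then hd_ins (fun A => c (x :: A)) f s' else 0.

(** Letters passed over are moved into [f], and only what remains is twisted: the dualization sign
    and the sign of moving [c] across the prefix combine to (-1)^(b q), with q the parity of the
    inserted value and the letters behind it. *)
Fixpoint ass_der b c f s : k := hd_ins c (tw b f) s +
  if s is x :: s' then ass_der b c (fun t => f (x :: t)) s' else 0.

Lemma ass_der_cons b c f x s :
  ass_der b c f (x :: s) = hd_ins c (tw b f) (x :: s) + ass_der b c (fun t => f (x :: t)) s.
Proof. by []. Qed.

Lemma hd_ins_linc c c1 c2 a f s : multilinear f -> (forall t, c t = a *: c1 t + c2 t) ->
  hd_ins c f s = a * hd_ins c1 f s + hd_ins c2 f s.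
Proof.
move=> mf; elim: s c c1 c2 => [|x s IH] c c1 c2 H /=.
  by rewrite !addr0 H ml_hd.
by rewrite H ml_hd // (IH _ (fun t => c1 (x :: t)) (fun t => c2 (x :: t))) ?mulrDr 1?addrACA.
Qed.
Lemma hd_ins_lin c a f f' s :
  hd_ins c (fun t => a * f t + f' t) s = a * hd_ins c f s + hd_ins c f' s.
Proof.
elim: s c => [|x s IH] c /=; first by rewrite !addr0.
by rewrite IH !mulrDr addrACA.
Qed.
Lemma hd_ins_ext c f f' s : f =1 f' -> hd_ins c f s = hd_ins c f' s.
Proof. by move=> ff; elim: s c => [|x s IH] c /=; rewrite ff ?IH. Qed.
Lemma ml_hd_ins c f : mlin c -> multilinear f -> multilinear (hd_ins c f : _ -> k^o).
Proof.
move=> mc mf s1; elim: s1 c mc => [|z s1 IH] c mc s2 a x y /=.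
  rewrite (ml_hd _ _ _ _ (ml_cons (c [::]) mf)) mulrDr addrACA; congr (_ + _).
  by apply: hd_ins_linc => // t; exact: mlin_hd.
by rewrite (IH _ (mlin_cons z mc)) (ml_cons (c [::]) mf (z :: s1)) mulrDr addrACA.
Qed.

Lemma ass_der_lin b c a f f' s :
  ass_der b c (fun t => a * f t + f' t) s = a * ass_der b c f s + ass_der b c f' s.
Proof.
elim: s f f' => [|x s IH] f f' /=.
  by rewrite /tw !addr0.
rewrite IH mulrDr [RHS]addrACA; congr (_ + _); exact: (hd_ins_lin c a (tw b f) (tw b f') (x :: s)).
Qed.
Lemma ass_der_ext b c f f' s : f =1 f' -> ass_der b c f s = ass_der b c f' s.
Proof.
elim: s f f' => [|x s IH] f f' ff; rewrite /= /tw ff //.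
rewrite (hd_ins_ext _ _ (fun t => ff (map (gp b) t))) (IH (fun t => f (x :: t)) (fun t => f' (x :: t))) // => t.
Qed.
Lemma ass_derZ b c a f s : ass_der b c (fun t => a * f t) s = a * ass_der b c f s.
Proof.
transitivity ((a - 1) * ass_der b c f s + ass_der b c f s); last by ring.
by rewrite -ass_der_lin; apply: ass_der_ext => t; change (a * f t = (a - 1) * f t + f t); ring.
Qed.
Lemma ml_ass_der b c f : mlin c -> multilinear f -> multilinear (ass_der b c f : _ -> k^o).
Proof.
move=> mc mf s1; elim: s1 f mf => [|z s1 IH] f mf s2 a x y.
  rewrite [[::] ++ _]/= [[::] ++ _]/=.
  have := ml_hd_ins mc (ml_tw b mf) [::] s2 a x y; rewrite [[::] ++ _]/= [[::] ++ _]/= => E.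
  rewrite /= -/(hd_ins c (tw b f) (_ :: _)).
  change (hd_ins c (tw b f) ((a *: x + y) :: s2) + ass_der b c (fun t => f ((a *: x + y) :: t)) s2 =
    a * (hd_ins c (tw b f) (x :: s2) + ass_der b c (fun t => f (x :: t)) s2) +
    (hd_ins c (tw b f) (y :: s2) + ass_der b c (fun t => f (y :: t)) s2)).
  rewrite E [in RHS]mulrDr [RHS]addrACA -ass_der_lin; congr (_ + _).
  by apply: ass_der_ext => t; rewrite ml_hd.
have := ml_hd_ins mc (ml_tw b mf) (z :: s1) s2 a x y; rewrite ![(z :: s1) ++ _]/= => E.
change (hd_ins c (tw b f) (z :: s1 ++ (a *: x + y) :: s2) +
    ass_der b c (fun t => f (z :: t)) (s1 ++ (a *: x + y) :: s2) =
  a * (hd_ins c (tw b f) (z :: s1 ++ x :: s2) + ass_der b c (fun t => f (z :: t)) (s1 ++ x :: s2)) +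
  (hd_ins c (tw b f) (z :: s1 ++ y :: s2) + ass_der b c (fun t => f (z :: t)) (s1 ++ y :: s2))).
by rewrite E (IH _ (ml_cons z mf)) [in RHS]mulrDr [RHS]addrACA.
Qed.

Lemma hd_ins_tw b c f p q s : mlin c -> cparity b c -> multilinear f -> homog_word q s ->
  hd_ins c (tw p f) s = (-1) ^+ (p && (b (+) q)) * hd_ins c f s.
Proof.
move=> mc hc mf; elim: s b c q mc hc => [|x s IH] b c q mc hc hs /=.
  rewrite !addr0 (tw_homog p mf (a := b (+) q)) //.
  by exists b; split; [rewrite -[b]addbF; exact: hc|rewrite hs addbF addbb].
rewrite mulrDr; congr (_ + _).
  rewrite (tw_homog p mf (a := b (+) q)) //.
  by exists b; split; [rewrite -[b]addbF; exact: hc|rewrite addbA addbb].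
have [e [hx hs']] := hs.
rewrite (IH (b (+) e) _ (e (+) q)) ?addbA; last exact: hs'; first by rewrite -[b (+) e (+) e]addbA addbb addbF.
  exact: mlin_cons.
by move=> a A hA; rewrite -addbA; apply: hc; exact: homog_word_cons.
Qed.

Lemma ass_der_tw b c f p s : mlin c -> cparity b c -> multilinear f ->
  tw p (ass_der b c f) s = (-1) ^+ (b && p) * ass_der b c (tw p f) s.
Proof.
move=> mc hc mf; move: s; apply: ml_homog_eq.
- exact/ml_tw/ml_ass_der.
- exact/mlZ/ml_ass_der/ml_tw.
move=> q s hs; rewrite (tw_homog _ (ml_ass_der b mc mf) hs).
elim: s q f mf hs => [|x s IH] q f mf hs.
  rewrite /= !addr0 tw_tw addbC -tw_tw.
  rewrite [in RHS](tw_homog p (ml_tw b mf) (a := b (+) q)); last first.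
    by exists b; split; [rewrite -[b]addbF; exact: hc|rewrite hs addbF addbb].
  by rewrite mulrA -signr_addb hs !andbF addbF andbC addbb mul1r.
rewrite !ass_der_cons [in LHS]mulrDr [in RHS]mulrDr; congr (_ + _).
  rewrite (hd_ins_ext c (x :: s) (tw_tw b p f)) addbC.
  rewrite -(hd_ins_ext c (x :: s) (tw_tw p b f)) (hd_ins_tw p mc hc (ml_tw b mf) hs) mulrA.
  by rewrite -signr_addb; case: (b); case: (p); case: (q).
have [e [hx hs']] := hs.
rewrite (ass_der_ext _ _ _ (fun t => tw_cons p t mf hx)).
rewrite ass_derZ mulrCA -(IH _ _ (ml_cons x mf) hs') mulrA -signr_addb.
by case: (p); case: (e); case: (q).
Qed.

(** The cut of the product lies before the inserted value, so that [f] sees the empty word, or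
    behind it. In the second case the value and the letters it replaces differ in parity by [b],
    which changes the product sign by the twist of [g]. *)
Lemma hd_ins_mul b c f g q s : mlin c -> cparity b c -> multilinear f -> multilinear g ->
  homog_word q s ->
  hd_ins c (fun t => wmul Ass t f g) s =
    f [::] * hd_ins c g s + wmul Ass s (hd_ins c f) (tw b g).
Proof.
move=> mc hc mf mg; elim: s b c q mc hc => [|x s IH] b c q mc hc hs.
  have hu : homog b (c [::]) by rewrite -[b]addbF; exact: hc.
  by rewrite /hd_ins !addr0 (wmul_cons_ass _ _ mf hu) /= !addr0.
have hu : homog b (c [::]) by rewrite -[b]addbF; exact: hc.
have [p [hx hs']] := hs.
rewrite [LHS]/= -/(wmul Ass (c [::] :: x :: s) f g) (wmul_cons_ass _ _ mf hu).
have mx := mlin_cons x mc.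
have hx' : cparity (b (+) p) (fun A => c (x :: A)).
  by move=> a A hA; rewrite -addbA; apply: hc; exact: homog_word_cons.
rewrite (IH _ _ _ mx hx' hs') (wmul_cons_ass _ _ (ml_hd_ins mc mf) hx).
rewrite (wmul_cons_ass _ _ (ml_cons _ mf) hx).
rewrite [hd_ins c f [::]]/= [hd_ins c g (x :: s)]/= addr0.
rewrite -/(fun t => hd_ins c f (x :: t)).
have -> : wmul Ass s (fun t => hd_ins c f (x :: t)) (tw p (tw b g)) =
   wmul Ass s (fun t => f (c [::] :: x :: t)) (tw p (tw b g)) +
   wmul Ass s (hd_ins (fun A => c (x :: A)) f) (tw (b (+) p) g).
  rewrite -[X in _ + X](wmul_ext _ _ (frefl _) (fun t => etrans (tw_tw p b g t) _)) -?wmulDl //.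
  by move=> t; rewrite addbC.
ring.
Qed.

Lemma ass_der_mul b c f g : mlin c -> cparity b c -> multilinear f -> multilinear g ->
  forall s, ass_der b c (fun t => wmul Ass t f g) s =
    wmul Ass s (ass_der b c f) g + wmul Ass s (tw b f) (ass_der b c g).
Proof.
move=> mc hc mf mg; apply: ml_homog_eq.
- exact/(ml_ass_der b mc)/ml_wmul.
- apply: mlD; apply: ml_wmul => //; try exact: ml_ass_der; exact: ml_tw.
move=> q s; elim: s q f g mf mg => [|x s IH] q f g mf mg.
  have hu : homog b (gp b (c [::])) by apply: homog_gp; rewrite -[b]addbF; exact: hc.
  move=> _; rewrite /= !addr0 {1}/tw [map _ _]/= (wmul_cons_ass _ _ mf hu) /= /tw /=.
  by rewrite addrC.
move=> hs; have [p [hx hs']] := hs.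
have tt t : tw b (tw b g) t = g t.
  by rewrite tw_tw addbb /tw map_gp_false.
have E : ass_der b c (fun t => wmul Ass t f g) (x :: s) =
  hd_ins c (tw b (fun t => wmul Ass t f g)) (x :: s) +
  ass_der b c (fun t => f [::] * g (x :: t) + wmul Ass t (fun u => f (x :: u)) (tw p g)) s.
  by congr (_ + _); apply: ass_der_ext => t; exact: (wmul_cons_ass t g mf hx).
rewrite E (hd_ins_ext c (x :: s) (fun t => wmul_tw Ass b t f g)) ass_der_lin.
rewrite (hd_ins_mul mc hc (ml_tw b mf) (ml_tw b mg) hs).
rewrite (wmul_ext _ _ (frefl _) tt).
rewrite (IH _ _ _ (ml_cons x mf) (ml_tw p mg) hs').
rewrite (wmul_cons_ass _ _ (ml_ass_der b mc mf) hx) (wmul_cons_ass _ _ (ml_tw b mf) hx).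
rewrite (wmul_cons_ass _ _ (ml_hd_ins mc (ml_tw b mf)) hx).
have -> : wmul Ass s (fun t => ass_der b c f (x :: t)) (tw p g) =
   wmul Ass s (fun t => hd_ins c (tw b f) (x :: t)) (tw p g) +
   wmul Ass s (ass_der b c (fun t => f (x :: t))) (tw p g) by rewrite -wmulDl.
rewrite (wmul_ext _ _ (fun t => tw_cons b t mf hx) (fun t => ass_der_tw p t mc hc mg)).
rewrite wmulZl wmulZr mulrA -signr_addb addbb mul1r ass_der_cons.
have -> : ass_der b c f [::] = hd_ins c (tw b f) [::] by rewrite /= !addr0.
have -> : tw b f [::] = f [::] by [].
by ring.
Qed.

Lemma hd_ins_cont (h : seq U -> seq U) c s : exists L : seq (seq U), forall f,
  (forall t, t \in L -> f t = 0) -> hd_ins c (fun t => f (h t)) s = 0.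
Proof.
elim: s c => [|x s IH] c /=.
  by exists [:: h [:: c [::]]] => f H; rewrite addr0; apply: H; rewrite mem_head.
have [L HL] := IH (fun A => c (x :: A)).
exists (h [:: c [::], x & s] :: L) => f H.
rewrite HL ?addr0; first by apply: H; rewrite mem_head.
by move=> t tL; apply: H; rewrite inE tL orbT.
Qed.
Lemma ass_der_cont b c s : exists L : seq (seq U), forall f,
  (forall t, t \in L -> f t = 0) -> ass_der b c f s = 0.
Proof.
suff: forall h : seq U -> seq U, exists L : seq (seq U), forall f,
    (forall t, t \in L -> f t = 0) -> ass_der b c (fun t => f (h t)) s = 0.
  exact.
elim: s => [|x s IH] h.
  have [L HL] := hd_ins_cont (fun t => h (map (gp b) t)) c [::].
  by exists L => f Hf; rewrite /= !addr0; have := HL f Hf; rewrite /= addr0.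
have [L1 H1] := hd_ins_cont (fun t => h (map (gp b) t)) c (x :: s).
have [L2 H2] := IH (fun t => h (x :: t)).
exists (L1 ++ L2) => f Hf.
have := H1 f; have := H2 f => /(_ _)/esym e2 /(_ _) e1.
change (hd_ins c (tw b (fun t => f (h t))) (x :: s) + ass_der b c (fun t => f (h (x :: t))) s = 0).
rewrite -e2 ?addr0; first apply: e1; by move=> t tL; apply: Hf; rewrite mem_cat tL ?orbT.
Qed.
End AssDerivation.

Section FormalFacts.
Variables (k : fieldType) (c : flavour) (U : superspace k).
Implicit Types (f g : formal c U) (s t : seq U) (x y : U) (a b p q : bool).

Definition mkformal (f : seq U -> k^o) (hf : formal_mem c f) : formal c U :=
  @insub_of _ _ (formal_sub c U) f hf.
Lemma ev_mk (f : seq U -> k^o) (hf : formal_mem c f) s : ev (mkformal hf) s = f s.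
Proof. by []. Qed.
Lemma ev_prt b f s : ev (prt b f) s = wprt b s (ev f).
Proof. by []. Qed.
Lemma ev_fmul f g s : ev (fmul f g) s = wmul c s (ev f) (ev g).
Proof. by []. Qed.
Lemma ev_flin (l : {linear U -> k^o}) s : ev (flin c l) s = flin_fun l s.
Proof. by []. Qed.
Lemma ev_fone s : ev (fone c U) s = (s == [::])%:R.
Proof. by []. Qed.
Lemma evB f g s : ev (f - g) s = ev f s - ev g s.
Proof. by rewrite evD evN. Qed.
Lemma ev_sum I (r : seq I) (F : I -> formal c U) s :
  ev (\sum_(i <- r) F i) s = \sum_(i <- r) ev (F i) s.
Proof. by apply: (big_morph (fun f => ev f s)) => [f g|]; [exact: evD|exact: ev0]. Qed.

Lemma wprt_homog_word (f : seq U -> k^o) a q s : multilinear f -> homog_word q s ->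
  wprt a s f = if a == q then f s else 0.
Proof.
elim: s f a q => [|x s IH] f a q mf; first by move=> ->; case: a.
move=> [p [hx hs]]; rewrite (wprt_homog _ _ mf hx) (IH _ _ _ (ml_cons x mf) hs).
by case: (p); case: (a); case: (q).
Qed.
Lemma homog_formalP a f : homog a f <->
  (forall q s, homog_word q s -> q != a -> ev f s = 0).
Proof.
split=> [hf q s hs qa|H].
  by rewrite -hf ev_prt (wprt_homog_word _ (ev_ml f) hs) eq_sym (negPf qa).
apply: evP; apply: ml_homog_eq; try exact: ev_ml.
move=> q s hs; rewrite ev_prt (wprt_homog_word _ (ev_ml f) hs).
by case: eqP => // /eqP; rewrite eq_sym => /(H _ _ hs) ->.
Qed.
Lemma homog_tw b a f s : homog a f -> tw b (ev f) s = (-1) ^+ (b && a) * ev f s.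
Proof.
move=> hf; move: s; apply: ml_homog_eq; first exact/ml_tw/ev_ml.
  exact/mlZ/ev_ml.
move=> q s hs; rewrite (tw_homog _ (ev_ml f) hs).
by have [->//|qa] := eqVneq q a; rewrite ((homog_formalP a f).1 hf _ _ hs qa) !mulr0.
Qed.
Lemma homog_flin p (l : {linear U -> k^o}) : lin_homog p l -> homog p (flin c l).
Proof.
move=> hl; apply/homog_formalP => q [|x [|y s]] //= [b [hx e]] qp.
apply: (lin_homogN hl hx); move: e qp.
by case: (b); case: (q); case: (p).
Qed.
Lemma homog_fone : homog false (fone c U).
Proof. by apply/homog_formalP => -[] [|x s]. Qed.

Lemma fmul1l g : fmul (fone c U) g = g.
Proof.
apply: evP => s; rewrite ev_fmul; move: s; apply: ml_homog_eq.
- by apply: ml_wmul; exact: ev_ml.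
- exact: ev_ml.
move=> q s hs; elim: s q (ev g) hs (ev_ml g) => [|x s IH] q h hs mh.
  by rewrite /= mul1r.
have [p [hx hs']] := hs.
have Z : wmul c s (fun t => ev (fone c U) (x :: t)) (tw p h) = 0 by rewrite wmul0l.
have := Z; case: (c) (ev_ml (fone c U)) IH => m1 IH; rewrite ?(wmul_cons_com _ _ m1 hx) ?(wmul_cons_ass _ _ m1 hx) => ->.
  by rewrite (IH _ _ hs' (ml_cons x mh)) addr0.
by rewrite addr0 /= mul1r.
Qed.
End FormalFacts.

Lemma char0_eq_opp (k : fieldType) (k_char0 : [pchar k] =i pred0) (v : k) : v = - v -> v = 0.
Proof.
move/eqP; rewrite -subr_eq0 opprK -mulr2n -mulr_natr mulf_eq0 => /orP[/eqP//|].
by rewrite ((pcharf0P k).1 k_char0 2%N).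
Qed.

Section CochainDerivation.
Variables (k : fieldType) (k_char0 : [pchar k] =i pred0) (c : flavour) (U : superspace k).
Implicit Types (f g : formal c U) (s t : seq U) (x y : U) (a b p q : bool).

Record cochain_of_parity b (cc : seq U -> U) : Prop := CochainOfParity {
  cop_ml : mlin cc;
  cop_sy : c = Com -> gsym cc;
  cop_par : cparity b cc }.

Definition der_fun b (cc : seq U -> U) (f : seq U -> k^o) : seq U -> k^o :=
  if c is Com then com_der b cc f else ass_der b cc f.

Section Fixed.
Variables (b : bool) (cc : seq U -> U) (hc : cochain_of_parity b cc).
Let mc := cop_ml hc.
Let pc := cop_par hc.

Lemma der_fun_mem f : formal_mem c (der_fun b cc (ev f)).
Proof.
move: mc (cop_sy hc) (ev_ml f) (@ev_sy _ _ _ f); move: (ev f) => h.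
rewrite /der_fun; case: (c) => hm hs mf sf; split=> //.
- exact: ml_com_der.
- by move=> _; apply: sy_com_der; auto.
- exact: ml_ass_der.
Qed.
Definition der_op f : formal c U := mkformal (der_fun_mem f).

Lemma der_fun_tw p (f : seq U -> k^o) s : multilinear f ->
  tw p (der_fun b cc f) s = (-1) ^+ (b && p) * der_fun b cc (tw p f) s.
Proof.
by rewrite /der_fun; case: (c) => mf; [exact: com_der_tw|exact: (ass_der_tw p s mc pc mf)].
Qed.
Lemma der_funZ (x : k) (f : seq U -> k^o) s :
  der_fun b cc (fun t => x * f t) s = x * der_fun b cc f s.
Proof. by rewrite /der_fun; case: (c); [exact: com_derZ|exact: (ass_derZ b cc x f s)]. Qed.
Lemma der_fun_ext (f f' : seq U -> k^o) s : f =1 f' -> der_fun b cc f s = der_fun b cc f' s.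
Proof. by rewrite /der_fun; case: (c) => ff; [exact: com_der_ext|exact: (ass_der_ext b cc s ff)]. Qed.

Lemma der_fun_lin (x : k) (f f' : seq U -> k^o) s :
  der_fun b cc (fun t => x * f t + f' t) s = x * der_fun b cc f s + der_fun b cc f' s.
Proof.
by rewrite /der_fun; case: (c); [exact: com_der_lin|exact: (ass_der_lin b cc x f f' s)].
Qed.
Lemma der_fun_cont s : exists L : seq (seq U), forall f : seq U -> k^o,
  (forall t, t \in L -> f t = 0) -> der_fun b cc f s = 0.
Proof. by rewrite /der_fun; case: (c); [exact: com_der_cont|exact: ass_der_cont]. Qed.
Lemma der_fun_mul (f g : seq U -> k^o) s :
  multilinear f -> multilinear g -> (c = Com -> graded_symmetric f) ->
  (c = Com -> graded_symmetric g) ->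
  der_fun b cc (fun t => wmul c t f g) s =
    wmul c s (der_fun b cc f) g + wmul c s (tw b f) (der_fun b cc g).
Proof.
move: mc pc (cop_sy hc); rewrite /der_fun.
case: (c) => hm hp hs mf mg sf sg; first by apply: com_der_mul; auto.
exact: (ass_der_mul hm hp mf mg s).
Qed.

Lemma der_op_hder : hder b der_op.
Proof.
split.
- move=> x f g; apply: evP => s; rewrite ev_lin !ev_mk.
  transitivity (der_fun b cc (fun t => x * ev f t + ev g t) s).
    by apply: der_fun_ext => t; exact: (ev_lin x f g t).
  exact: der_fun_lin.
- by move=> s; have [L HL] := der_fun_cont s; exists L => f; exact: HL.
- move=> a f hf; apply/homog_formalP => q s hs qa; rewrite ev_mk.
  (* Twisting all letters by [gr] gives one sign when read off the word and, on a word of the wrong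
     parity, the opposite sign when carried over to [f]; so the value is its own negative. *)
  apply: (char0_eq_opp k_char0).
  have := der_fun_tw true s (ev_ml f); rewrite (tw_homog _ (der_fun_mem f).1 hs).
  rewrite (der_fun_ext _ (fun t => homog_tw true t hf)) der_funZ mulrA -signr_addb.
  move/(congr1 (fun v => (-1) ^+ q * v)); rewrite mulrA -signr_addb addbb mul1r => e; rewrite {}[LHS]e.
  rewrite mulrA -signr_addb; have -> : q (+) (b && true (+) (true && a)) = true.
    by move: qa; case: (q); case: (b); case: (a).
  by rewrite expr1 mulN1r.
- move=> a f g hf; apply: evP => s; rewrite evD evZ !ev_fmul !ev_mk.
  transitivity (wmul c s (der_fun b cc (ev f)) (ev g) +
     wmul c s (tw b (ev f)) (der_fun b cc (ev g))); last first.
    by congr (_ + _); rewrite (wmul_ext _ _ (fun t => homog_tw b t hf) (frefl _)) wmulZl.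
  by apply: der_fun_mul; by [exact: ev_ml|exact: ev_sy].
Qed.
End Fixed.
End CochainDerivation.

(** * Continuous operators are determined by linear forms *)

Section Density.
Variables (k : fieldType) (k_char0 : [pchar k] =i pred0) (U : superspace k).
Implicit Types (s t : seq U) (x y e : U) (a b p q : bool) (l : {linear U -> k^o}).
Implicit Types (r : seq (bool * {linear U -> k^o} * U)).

Lemma wmul_scalar c s (a : k) (g : seq U -> k^o) :
  multilinear g -> wmul c s (fun t => if t is [::] then a else 0) g = a * g s.
Proof.
elim: s g => [|x s IH] g mg //=.
rewrite !(@wmul0l _ _ _ _ (fun=> 0)) // !addr0.
by case: c IH => IH //; rewrite (IH _ (ml_cons x mg)).
Qed.

Lemma wmul_flin_ass p l x s (g : seq U -> k^o) : lin_homog p l -> multilinear g ->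
  wmul Ass (x :: s) (flin_fun l) g = l x * g (map (gp p) s).
Proof.
move=> hl mg; rewrite /= mul0r add0r !wmul_scalar ?mg //; last exact: (ml_gr mg).
rewrite -(hl (prt false x)) -(hl (prt true x)) -(hl x) !prtK; case: p hl => hl /=; rewrite linear0 mul0r ?add0r ?addr0 //.
by rewrite map_gp_false.
Qed.
Lemma wmul_flin_com p l x s (g : seq U -> k^o) : lin_homog p l -> multilinear g ->
  wmul Com (x :: s) (flin_fun l) g =
    wmul Com s (flin_fun l) (fun t => g (x :: t)) + l x * g (map (gp p) s).
Proof.
move=> hl mg; rewrite /= -addrA; congr (_ + _).
rewrite !wmul_scalar ?mg //; last exact: (ml_gr mg).
rewrite -(hl (prt false x)) -(hl (prt true x)) -(hl x) !prtK; case: p hl => hl /=; rewrite linear0 mul0r ?add0r ?addr0 //.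
by rewrite map_gp_false.
Qed.

Definition fixes r x := dual_sum r x == x.
Lemma fixes_gp r p x : homog_sys r -> fixes r x -> fixes r (gp p x).
Proof.
move=> hr /eqP Rx; apply/eqP; case: p => //=.
rewrite /gp /gr -[_ - _]addrC -scaleN1r dual_sum_lin !dual_sum_prt // Rx; by [].
Qed.

(** One letter goes to the linear form, so only words shorter than s matter for the second factor.
    The twist by [gp] keeps letters among the vectors fixed by the dual system. *)
Lemma wmul_flin_congr c r p l s (g g' : seq U -> k^o) : homog_sys r ->
  lin_homog p l -> multilinear g -> multilinear g' ->
  (forall t, (size t < size s)%N -> all (fixes r) t -> g t = g' t) ->
  all (fixes r) s -> wmul c s (flin_fun l) g = wmul c s (flin_fun l) g'.
Proof.
move=> hr hl; have gpf t : all (fixes r) t -> all (fixes r) (map (gp p) t).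
  by rewrite all_map; apply: sub_all => x; exact: fixes_gp.
elim: s g g' => [|x s IH] g g' mg mg' H /=; first by rewrite !mul0r.
move=> /andP[fx fs]; have E : g (map (gp p) s) = g' (map (gp p) s).
  by apply: H; [rewrite size_map|exact: gpf].
have := fs; case: c IH => IH _.
  change (wmul Com (x :: s) (flin_fun l) g = wmul Com (x :: s) (flin_fun l) g').
  rewrite !(wmul_flin_com _ _ hl) // E; congr (_ + _).
  by apply: IH (ml_cons x mg) (ml_cons x mg') _ fs => t ts ft; apply: H; rewrite //= fx.
change (wmul Ass (x :: s) (flin_fun l) g = wmul Ass (x :: s) (flin_fun l) g').
by rewrite !(wmul_flin_ass _ _ hl) // E.
Qed.

(** Contraction with the vector [e]. The twist cancels the one that the product with a linear form
    of parity [p] puts on its second factor. *)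
Definition contract e p (f : seq U -> k^o) : seq U -> k^o := fun t => f (e :: map (gp p) t).

Lemma dual_contract f r x s : multilinear f -> fixes r x ->
  \sum_(t <- r) t.1.2 x * f (t.2 :: s) = f (x :: s).
Proof.
move=> mf /eqP Rx; rewrite -[in RHS]Rx /dual_sum.
elim: r {Rx} => [|t r IH]; first by rewrite !big_nil ml_hd0.
by rewrite !big_cons (ml_hdD _ _ _ mf) (ml_hdZ _ _ _ mf) IH.
Qed.

Lemma dual_expand_ass f r x s : homog_sys r -> multilinear f -> fixes r x ->
  \sum_(t <- r) wmul Ass (x :: s) (flin_fun t.1.2) (contract t.2 t.1.1 f) = f (x :: s).
Proof.
move=> hr mf fx; rewrite -(dual_contract s mf fx).
elim: r hr {fx} => [|t r IH]; first by rewrite !big_nil.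
move=> /homog_sys_cons[[hl he] /IH E]; rewrite !big_cons E; congr (_ + _).
rewrite (wmul_flin_ass _ _ hl); last exact/(ml_tw t.1.1 (ml_cons t.2 mf)).
by rewrite /contract map_gp_gp addbb map_gp_false.
Qed.

(** Euler's formula for homogeneous polynomials: each letter in turn is handed to the linear forms,
    so [f] is recovered once per letter. In the tensor algebra only the first letter is handed over
    and no factor arises. *)
Lemma dual_expand_com f r s : homog_sys r -> multilinear f -> graded_symmetric f ->
  all (fixes r) s ->
  \sum_(t <- r) wmul Com s (flin_fun t.1.2) (contract t.2 t.1.1 f) = (size s)%:R * f s.
Proof.
move=> hr; elim: s f => [|x s IH] f mf sf.
  by move=> _; rewrite mul0r; apply: big1 => t _; rewrite /= mul0r.
move=> /andP[fx fs]; rewrite [size _]/= -[X in X%:R]addn1 natrD mulrDl mul1r.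
rewrite -(IH (fun t => f (x :: t)) (ml_cons x mf) (sy_cons x sf) fs).
rewrite -(dual_contract s mf fx) -big_split /=.
elim: r hr {fx fs IH} => [|t r IH]; first by rewrite !big_nil.
move=> /homog_sys_cons[[hl he] /IH E]; rewrite !big_cons E; congr (_ + _).
have mc : multilinear (contract t.2 t.1.1 f) by exact/(ml_tw t.1.1 (ml_cons t.2 mf)).
change (wmul Com (x :: s) (flin_fun t.1.2) (contract t.2 t.1.1 f) =
  wmul Com s (flin_fun t.1.2) (contract t.2 t.1.1 (fun t => f (x :: t))) +
  t.1.2 x * f (t.2 :: s)).
rewrite (wmul_flin_com _ _ hl mc); congr (_ + _).
  apply: wmul_ext => // u; rewrite /contract /=.
  exact: (gsym_gp (M := k^o) x (map (gp t.1.1) u) mf sf he).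
by rewrite /contract map_gp_gp addbb map_gp_false.
Qed.

Variable c : flavour.
Variable Q : formal c U -> Prop.
Hypotheses (Q1 : Q (fone c U)) (Qlin : forall (a : k) f g, Q f -> Q g -> Q (a *: f + g))
  (Qmul : forall p l g, lin_homog p l -> Q g -> Q (fmul (flin c l) g)).

Fact contract_mem (w : nat -> k) e p (f : formal c U) : homog p e ->
  formal_mem c (fun t => w (size t) * contract e p (ev f) t : k^o).
Proof.
move=> he.
have m1 := ml_tw p (ml_cons e (ev_ml f)).
split=> [s1 s2 a x y|/(ev_sy f) sf s1 s2 a b x y hx hy].
  rewrite [contract _ _ _ _](m1 s1 s2 a x y) !size_cat /= /contract /tw; ring.
rewrite [contract _ _ _ _](sy_tw p (sy_cons e sf) s1 s2 hx hy) !size_cat /= /contract /tw; ring.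
Qed.

Let approx r N : homog_sys r -> forall f : formal c U, exists2 g, Q g &
  forall t, (size t <= N)%N -> all (fixes r) t -> ev f t = ev g t.
Proof.
have Q0 : Q 0 by rewrite -(addNr (fone c U)) -scaleN1r; exact: Qlin.
have QD f g : Q f -> Q g -> Q (f + g) by move=> *; rewrite -[f]scale1r; exact: Qlin.
have QZ (a : k) f : Q f -> Q (a *: f) by move=> *; rewrite -[_ *: _]addr0; exact: Qlin.
move=> hr; elim: N => [|N IH] f.
  exists (ev f [::] *: fone c U); first exact: QZ.
  by move=> [|//] _ _; rewrite evZ ev_fone mulr1.
(* Contraction shortens a word by one letter, so n+1 is the original length and the weight cancels
   Euler's factor. *)
pose w n : k := if c is Com then n.+1%:R^-1 else 1.
have [G QG HG] : exists2 G, Q G & forall s, (size s <= N.+1)%N -> all (fixes r) s ->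
    ev G s = \sum_(t <- r) wmul c s (flin_fun t.1.2)
       (fun u => w (size u) * contract t.2 t.1.1 (ev f) u : k^o).
  suff: forall r', homog_sys r' -> exists2 G, Q G & forall s, (size s <= N.+1)%N ->
    all (fixes r) s -> ev G s = \sum_(t <- r') wmul c s (flin_fun t.1.2)
       (fun u => w (size u) * contract t.2 t.1.1 (ev f) u : k^o) by exact.
  elim=> [|t r' IHr]; first by move=> _; exists 0 => // s _ _; rewrite big_nil ev0.
  move=> /homog_sys_cons[[hl he] /IHr[G QG HG]].
  have [g Qg Hg] := IH (mkformal (contract_mem w f he)).
  exists (fmul (flin c t.1.2) g + G); first by apply: QD => //; exact: Qmul hl Qg.
  move=> s sN fs; rewrite evD big_cons HG // ev_fmul; congr (_ + _).
  apply: (wmul_flin_congr _ hr hl (ev_ml g)) => // [|u us fu].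
    exact: (contract_mem w f he).1.
  by rewrite -Hg // -ltnS (leq_trans us).
exists (ev f [::] *: fone c U + G); first by apply: QD => //; exact: QZ.
move=> [|x s] sN fs; rewrite evD evZ ev_fone HG //.
  by rewrite mulr1 big1 ?addr0 // => t _ /=; rewrite mul0r.
rewrite mulr0 add0r.
have mf := ev_ml f; have := @ev_sy _ _ _ f; rewrite /w.
move: (ev f) mf => h mf; case: (c) => sf.
  pose f' : seq U -> k^o := fun t => (size t)%:R^-1 * h t.
  have mf' : multilinear f'.
    by move=> s1 s2 a y z; rewrite /f' !size_cat /= mf; ring.
  have sf' : graded_symmetric f'.
    by move=> s1 s2 a b y z hy hz; rewrite /f' !size_cat /= (sf _ _ _ _ _ _ _ hy hz) //; ring.
  have := dual_expand_com hr mf' sf' fs; rewrite /f' mulrA mulfV ?mul1r; last first.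
    by rewrite ((pcharf0P k).1 k_char0).
  move=> <-; apply: eq_bigr => t _; apply: wmul_ext => // u.
  by rewrite /contract /= size_map.
have /andP[fx _] := fs; rewrite -(dual_expand_ass s hr mf fx).
by apply: eq_bigr => t _; apply: wmul_ext => // u; rewrite mul1r.
Qed.

(* The polynomials in linear forms are dense. *)
Lemma formal_dense (L : seq (seq U)) (f : formal c U) :
  exists2 g, Q g & forall t, t \in L -> ev f t = ev g t.
Proof.
have [r hr Hr] := dual_system (flatten L).
have [g Qg Hg] := approx (\max_(t <- L) size t) hr f.
exists g => // t tL; apply: Hg; first exact: leq_bigmax_seq.
apply/allP => x xt; have xL : x \in flatten L by apply/flattenP; exists t.
have ix : (index x (flatten L) < size (flatten L))%N by rewrite index_mem.
by apply/eqP; rewrite -[x in LHS](nth_index 0 xL) Hr // nth_index.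
Qed.
End Density.

(** At a given word both operators see finitely many values of their argument, which by
    [formal_dense] may be replaced by a polynomial in linear forms. The last hypothesis is the
    induction step for products; a Leibniz rule or multiplicativity supplies it once linear forms
    are settled. *)
Lemma continuous_op_ext (k : fieldType) (k_char0 : [pchar k] =i pred0) (c c' : flavour)
    (U U' : superspace k) (T T' : formal c U -> formal c' U') :
  linear T -> linear T' -> continuous_op T -> continuous_op T' ->
  T (fone c U) = T' (fone c U) ->
  (forall p l g, lin_homog p l -> T g = T' g ->
     T (fmul (flin c l) g) = T' (fmul (flin c l) g)) ->
  T =1 T'.
Proof.
move=> lT lT' cT cT' T1 Tmul f; apply: evP => s.
have [L HL] := cT s; have [L' HL'] := cT' s.
have Qlin (a : k) g h : T g = T' g -> T h = T' h -> T (a *: g + h) = T' (a *: g + h).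
  by move=> e e'; rewrite lT lT' e e'.
have [g Tg Hg] := formal_dense k_char0 (Q := fun g => T g = T' g) T1 Qlin Tmul (L ++ L') f.
have TB (S : formal c U -> formal c' U') : linear S -> S (f - g) = S f - S g.
  by move=> lS; rewrite addrC -scaleN1r lS scaleN1r addrC.
have E1 : ev (T (f - g)) s = 0.
  by apply: HL => t tL; rewrite evB Hg ?subrr // mem_cat tL.
have E2 : ev (T' (f - g)) s = 0.
  by apply: HL' => t tL; rewrite evB Hg ?subrr // mem_cat tL orbT.
move: E1 E2; rewrite !TB // !evB Tg => /eqP + /eqP; rewrite !subr_eq0.
by move=> /eqP -> /eqP ->.
Qed.

(** * Existence of Taylor coefficients *)

Section Taylor.
Variables (k : fieldType) (c c' : flavour) (U U' : superspace k).
Implicit Types (T : formal c U -> formal c' U') (b : bool) (s : seq U').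

Lemma lin_form_gpE (a b : bool) (l : {linear U -> k^o}) x : lin_homog a l ->
  l (gp b x) = (-1) ^+ (b && a) * l x.
Proof.
move=> hl; rewrite -hl -[l x]hl -gp_prt (gp_homog b (homog_prt a x)).
by rewrite linearZ.
Qed.

Lemma taylor_unique b T s u : dual_value b T s u -> taylor b T s = u.
Proof.
move=> hu; have ht : dual_value b T s (taylor b T s).
  by apply: (@xgetPex _ 0 (dual_value b T s)); exists u.
apply: homog_form_sep => a l hl; apply: (can_inj (signrMK (b && a))).
by rewrite -ht // -hu.
Qed.

Lemma flin_lin (x : k) (l l' : {linear U -> k^o}) (l'' : {linear U -> k^o}) :
  (forall y, l'' y = x * l y + l' y) -> flin c l'' = x *: flin c l + flin c l'.
Proof.
move=> H; apply: evP => -[|y [|z s]]; rewrite ev_lin !ev_flin /= ?mulr0 ?addr0 //.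
Qed.

(** The substance of V** = V for discrete V: by continuity the functional l -> T l (s) depends on
    the values of l at finitely many vectors, and a dual system for these turns it into evaluation
    at an explicit vector. Hence [xget] does not fall back on its default. *)
Lemma taylor_dual b T s : linear T -> continuous_op T -> dual_value b T s (taylor b T s).
Proof.
move=> lT /(_ s)[L HL].
suff [u hu] : exists u, dual_value b T s u by rewrite (taylor_unique hu).
have T0 : T 0 = 0 by have := lT (-1) 0 0; rewrite scaler0 addr0 scaleN1r addNr.
have TD f g : T (f + g) = T f + T g by rewrite -[f]scale1r lT !scale1r.
have TZ (x : k) f : T (x *: f) = x *: T f by rewrite -[_ *: f]addr0 lT T0 addr0.
have [r hr Hr] := dual_system (flatten L).
exists (\sum_(t <- r) ((-1) ^+ (b && t.1.1) * ev (T (flin c t.1.2)) s) *: t.2).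
move=> a l hl.
have El (x : U) : dual_sum r x = x -> l x = \sum_(t <- r) l t.2 * t.1.2 x.
  move=> Rx; rewrite -[in LHS]Rx /dual_sum linear_sum; apply: eq_bigr => t _.
  by rewrite linearZ mulrC.
have E : ev (T (flin c l)) s = ev (T (\sum_(t <- r) l t.2 *: flin c t.1.2)) s.
  have TB f g : T (f - g) = T f - T g by rewrite TD -scaleN1r TZ scaleN1r.
  apply/eqP; rewrite -subr_eq0 -evB -TB; apply/eqP/HL => t tL.
  rewrite evB ev_sum; apply/eqP; rewrite subr_eq0; apply/eqP.
  have -> : \sum_(i <- r) ev (l i.2 *: flin c i.1.2) t =
      \sum_(i <- r) l i.2 * flin_fun i.1.2 t.
    by apply: eq_bigr => i _; rewrite evZ.
  rewrite ev_flin; case: t tL => [|x [|y t]] tL /=.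
  - by rewrite big1 // => i _; rewrite mulr0.
  - have xL : x \in flatten L by apply/flattenP; exists [:: x]; rewrite ?mem_head.
    have ix : (index x (flatten L) < size (flatten L))%N by rewrite index_mem.
    by apply: El; rewrite -[x in LHS](nth_index 0 xL) Hr // nth_index.
  - by rewrite big1 // => i _; rewrite mulr0.
rewrite E linear_sum /=.
have -> : T (\sum_(t <- r) l t.2 *: flin c t.1.2) = \sum_(t <- r) l t.2 *: T (flin c t.1.2).
  by rewrite (big_morph T TD T0); apply: eq_bigr => t _; exact: TZ.
rewrite ev_sum mulr_sumr.
elim: r hr {Hr E El} => [|t r IH]; first by rewrite !big_nil.
move=> /homog_sys_cons[[_ he] /IH IHr]; rewrite !big_cons IHr; congr (_ + _).
rewrite evZ linearZ /=.
have [<-|ta] := eqVneq t.1.1 a; last first.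
  by rewrite (lin_homogN hl he) ?mul0r ?scaler0 ?mulr0 // eq_sym.
change (l t.2 * ev (T (flin c t.1.2)) s = (-1) ^+ (b && t.1.1) *
  ((-1) ^+ (b && t.1.1) * ev (T (flin c t.1.2)) s * l t.2)).
by rewrite -mulrA signrMK mulrC.
Qed.

End Taylor.

Section Cochains.
Variables (k : fieldType) (k_char0 : [pchar k] =i pred0) (c : flavour) (U : superspace k).
Implicit Types (D E : Der c U) (a b p q : bool) (s t : seq U) (x y : U).

Lemma fmul1r (f : formal c U) : fmul f (fone c U) = f.
Proof.
apply: evP => s; rewrite ev_fmul; move: s; apply: ml_homog_eq.
- by apply: ml_wmul; exact: ev_ml.
- exact: ev_ml.
move=> q s hs; elim: s q (ev f) hs (ev_ml f) => [|x s IH] q h hs mh.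
  by rewrite /= mulr1.
have [p [hx hs']] := hs.
have E : tw p (ev (fone c U)) =1 ev (fone c U) by case.
have E0 : wmul c s h (fun t => ev (fone c U) (x :: t)) = 0 by rewrite wmul0r.
have := IH _ _ hs' (ml_cons x mh); have := E0.
case: (c) E => E E0' IH'.
  by rewrite (wmul_cons_com _ _ mh hx) E0' add0r; exact: etrans (wmul_ext _ _ (frefl _) E) IH'.
by rewrite (wmul_cons_ass _ _ mh hx) [ev _ (_ :: _)]/= mulr0 add0r; exact: etrans (wmul_ext _ _ (frefl _) E) IH'.
Qed.

Lemma hder_one b (D : formal c U -> formal c U) : hder b D -> D (fone c U) = 0.
Proof.
move=> HD; have := hder_mul HD (fone c U) (homog_fone c U).
rewrite !fmul1l fmul1r andbF scale1r => /eqP.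
by rewrite -subr_eq0 opprD addNKr oppr_eq0 => /eqP.
Qed.

(** A linear form sees only words of length one, so [cc] has to take the whole word. *)
Lemma der_fun_flin a b (l : {linear U -> k^o}) (cc : seq U -> U) s :
  cochain_of_parity c b cc -> lin_homog a l ->
  der_fun c b cc (flin_fun l) s = (-1) ^+ (b && a) * l (cc s).
Proof.
move=> [mc _ _] hl; rewrite -(lin_form_gpE b (cc s) hl) /der_fun; case: (c).
  have mQ : @mlin k U k^o (fun A => l (gp b (cc A))).
    apply: (mlin_linear (h := fun x => l (gp b x))) => // y u v.
    by rewrite !linearP.
  by rewrite -(unsh_nilr s mQ); apply: unsh_ext => A [].
have Z1 c0 (f : seq U -> k^o) t : (forall z w, f (z :: w) = 0) -> hd_ins c0 f t = 0.
  by move=> f0; elim: t c0 => [|x t IH] c0 /=; rewrite f0 ?IH addr0.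
have Z2 t : ass_der b cc (fun=> 0) t = 0.
  elim: t => [|x t IH]; first by rewrite /= !addr0.
  by rewrite ass_der_cons Z1 // IH addr0.
have H c0 t : hd_ins c0 (tw b (flin_fun l)) t = l (gp b (c0 t)).
  elim: t c0 => [|x t IH] c0 /=; first by rewrite addr0.
  by rewrite (IH (fun A => c0 (x :: A))) add0r.
case: s => [|x s]; first by rewrite /= /tw !addr0.
rewrite ass_der_cons H; case: s => [|y s]; first by rewrite /= /tw [map _ _]/= /flin_fun !addr0.
rewrite ass_der_cons Z1 ?add0r //.
by rewrite -[RHS]addr0 -(Z2 s); congr (_ + _); apply: ass_der_ext => -[].
Qed.

Lemma der_app_cont D : continuous_op (der_app D).
Proof.
have [D0 [D1 [H0 H1 e]]] := smemV D; move=> s.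
have [L HL] := hder_cont H0 s; have [L' HL'] := hder_cont H1 s.
exists (L ++ L') => f Hf; rewrite /der_app e [X in ev X]/(D0 f + D1 f) evD HL ?HL' ?addr0 // => t tL;
  by apply: Hf; rewrite mem_cat tL ?orbT.
Qed.
Lemma der_app_linear D : linear (der_app D).
Proof. by move=> x f g; exact: der_app_linr. Qed.

Lemma taylor_der_lin b (x : k) D E s :
  taylor b (der_app (x *: D + E)) s = x *: taylor b (der_app D) s + taylor b (der_app E) s.
Proof.
apply: taylor_unique => a l hl.
rewrite der_app_lin ev_lin !(taylor_dual b s (@der_app_linear _) (@der_app_cont _) hl).
by rewrite linearP; change (x * ((-1) ^+ (b && a) * l (taylor b (der_app D) s)) + (-1) ^+ (b && a) * l (taylor b (der_app E) s) = (-1) ^+ (b && a) * (x * l (taylor b (der_app D) s) + l (taylor b (der_app E) s))); ring.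
Qed.
Lemma cochain_lin (x : k) D E s : cochain (x *: D + E) s = x *: cochain D s + cochain E s.
Proof. by rewrite /cochain !linearP !taylor_der_lin scalerDr addrACA. Qed.
Lemma cochain0 s : cochain (0 : Der c U) s = 0.
Proof.
have := cochain_lin (-1) 0 0 s; by rewrite scaler0 addr0 scaleN1r addNr.
Qed.
Lemma cochainD D E s : cochain (D + E) s = cochain D s + cochain E s.
Proof. by rewrite -[D]scale1r cochain_lin !scale1r. Qed.
Lemma cochainZ (x : k) D s : cochain (x *: D) s = x *: cochain D s.
Proof. by rewrite -[x *: D]addr0 cochain_lin cochain0 addr0. Qed.

Lemma taylor_der0 b s : taylor b (der_app (0 : Der c U)) s = 0.
Proof.
have := taylor_der_lin b (-1) 0 0 s; by rewrite scaler0 addr0 scaleN1r addNr.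
Qed.

Lemma cochain_homog b D s : homog b D -> cochain D s = taylor b (der_app D) s.
Proof.
move=> hD; rewrite /cochain !(homog_prtN _ hD).
by case: b hD => _ /=; rewrite taylor_der0 ?add0r ?addr0.
Qed.
Lemma cochainE a b D (l : {linear U -> k^o}) s : homog b D -> lin_homog a l ->
  ev (der_app D (flin c l)) s = (-1) ^+ (b && a) * l (cochain D s).
Proof.
move=> hD; rewrite (cochain_homog s hD); move: a l; rewrite -/(dual_value _ _ _ _).
by apply: taylor_dual; [exact: der_app_linear|exact: der_app_cont].
Qed.
Lemma cochain_unique b D s u : homog b D ->
  (forall a l, lin_homog a l -> ev (der_app D (flin c l)) s = (-1) ^+ (b && a) * l u) ->
  cochain D s = u.
Proof. by move=> hD hu; rewrite (cochain_homog s hD); exact: taylor_unique. Qed.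

(** Tested against homogeneous linear forms l, multilinearity and symmetry are those of the formal
    function D l, and the parity is that of D. *)
Lemma cochain_parity b D : homog b D -> cochain_of_parity c b (cochain D).
Proof.
move=> hD; split.
- move=> s1 s2 x u v; apply: homog_form_sep => a l hl.
  rewrite linearP; apply: (can_inj (signrMK (b && a))).
  change ((-1) ^+ (b && a) * l (cochain D (s1 ++ (x *: u + v) :: s2)) = (-1) ^+ (b && a) *
     (x * l (cochain D (s1 ++ u :: s2)) + l (cochain D (s1 ++ v :: s2)))).
  by rewrite mulrDr mulrCA -!(cochainE _ hD hl) ev_ml.
- move=> e s1 s2 p q u v hu hv; apply: homog_form_sep => a l hl.
  rewrite linearZ; apply: (can_inj (signrMK (b && a))).
  change ((-1) ^+ (b && a) * l (cochain D (s1 ++ u :: v :: s2)) = (-1) ^+ (b && a) *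
     ((-1) ^+ (p && q) * l (cochain D (s1 ++ v :: u :: s2)))).
  by rewrite mulrCA -!(cochainE _ hD hl) (ev_sy _ e s1 s2 hu hv).
- move=> a s hs; apply: homog_form_sep => p l hl; apply: (can_inj (signrMK (b && p))).
  have [e|ne] := eqVneq p (b (+) a); first by rewrite -e hl.
  rewrite (lin_homogN hl (homog_prt _ _) ne) mulr0 -(cochainE _ hD hl).
  apply/esym; have := hder_homog (homog_der hD) (homog_flin c hl).
  move/homog_formalP => /(_ a s hs); apply; apply: contraNneq ne => ->.
  by case: (b); case: (p).
Qed.

(** Both sides kill the unit, obey the same Leibniz rule and agree on linear forms. This makes a
    derivation computable from its coefficients. *)
Lemma der_appE b D f : forall hD : homog b D,
  der_app D f = der_op (cochain_parity hD) f.
Proof.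
move=> hD; have H1 := homog_der hD; have H2 := der_op_hder k_char0 (cochain_parity hD).
move: f; apply: (continuous_op_ext k_char0).
- exact: hder_lin H1.
- exact: hder_lin H2.
- exact: hder_cont H1.
- exact: hder_cont H2.
- by rewrite (hder_one H1) (hder_one H2).
- move=> p l g hl E; have hf := homog_flin c hl.
  rewrite (hder_mul H1 _ hf) (hder_mul H2 _ hf) E; congr (fmul _ _ + _).
  apply: evP => s; rewrite (cochainE _ hD hl) ev_mk -(der_fun_flin s (cochain_parity hD) hl).
  exact: der_fun_ext.
Qed.
Lemma ev_der_app b D f s : homog b D ->
  ev (der_app D f) s = der_fun c b (cochain D) (ev f) s.
Proof. by move=> hD; rewrite (der_appE f hD). Qed.

Lemma der_inj b D E : homog b D -> homog b E -> cochain D =1 cochain E -> D = E.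
Proof.
move=> hD hE /funext e; apply: der_appP => f; apply: evP => s.
by rewrite (ev_der_app f s hD) (ev_der_app f s hE) e.
Qed.

Section Make.
Variables (b : bool) (cc : seq U -> U) (hc : cochain_of_parity c b cc).
Definition mkder : Der c U := @insub_of _ _ (der_sub c U) _ (hder_is_der (der_op_hder k_char0 hc)).
Lemma mkderE f s : ev (der_app mkder f) s = der_fun c b cc (ev f) s.
Proof. by []. Qed.
Lemma mkder_homog : homog b mkder.
Proof. apply: hder_homog_der; exact: (der_op_hder k_char0 hc). Qed.
Lemma cochain_mkder s : cochain mkder s = cc s.
Proof.
apply: (cochain_unique mkder_homog) => a l hl.
by rewrite mkderE -(der_fun_flin s hc hl); exact: der_fun_ext.
Qed.
End Make.
End Cochains.

(** * L-infinity maps with given components *)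

Section AlgebraMaps.
Variable k : fieldType.

Record alg_map (U U' : superspace k) (T : formal Com U -> formal Com U') : Prop := AlgMap {
  am_lin : linear T;
  am_cont : continuous_op T;
  am_homog : forall a f, homog a f -> homog a (T f);
  am_one : T (fone Com U) = fone Com U';
  am_mul : forall f g, T (fmul f g) = fmul (T f) (T g) }.

Lemma continuous_comp (c c' c'' : flavour) (U U' U'' : superspace k)
    (T : formal c U -> formal c' U') (T' : formal c' U' -> formal c'' U'') :
  continuous_op T -> continuous_op T' -> continuous_op (fun f => T' (T f)).
Proof.
move=> cT cT' s; have [L HL] := cT' s; have /choice[N HN] t := cT t.
exists (flatten [seq N t | t <- L]) => f Hf; apply: HL => t tL.
apply: HN => u uN; apply: Hf; apply/flattenP; exists (N t) => //.
by apply/mapP; exists t.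
Qed.

Lemma alg_map_comp (U U' U'' : superspace k) (T : formal Com U -> formal Com U')
    (T' : formal Com U' -> formal Com U'') :
  alg_map T -> alg_map T' -> alg_map (fun f => T' (T f)).
Proof.
move=> hT hT'; split.
- by move=> a f g; rewrite (am_lin hT) (am_lin hT').
- exact: continuous_comp (am_cont hT) (am_cont hT').
- by move=> a f /(am_homog hT)/(am_homog hT').
- by rewrite (am_one hT) (am_one hT').
- by move=> f g; rewrite (am_mul hT) (am_mul hT').
Qed.

Section Pull.
Variables (U U' : superspace k) (h : {linear U' -> U}).
Hypothesis hp : forall a x, h (prt a x) = prt a (h x).

Lemma pull_gr x : h (gr x) = gr (h x).
Proof. by rewrite /gr linearB !hp. Qed.
Lemma pull_homog a x : homog a x -> homog a (h x).
Proof. by move=> hx; rewrite /homog -hp hx. Qed.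
Lemma pull_word a s : homog_word a s -> homog_word a (map h s).
Proof.
elim: s a => [|x s IH] a //= [p [hx hs]].
by exists p; split; [exact: pull_homog|exact: IH].
Qed.

Fact pull_mem (f : formal Com U) : formal_mem Com (fun s => ev f (map h s) : k^o).
Proof.
split=> [s1 s2 a x y|_ s1 s2 a b x y hx hy].
  by rewrite !map_cat /= linearP; exact: ev_ml.
rewrite !map_cat /=; apply: ev_sy => //; exact: pull_homog.
Qed.
Definition pull (f : formal Com U) : formal Com U' := mkformal (pull_mem f).

Lemma pull_alg_map : alg_map pull.
Proof.
split.
- by move=> a f g; apply: evP => s; rewrite ev_lin !ev_mk ev_lin.
- by move=> s; exists [:: map h s] => f; apply; rewrite mem_head.
- move=> a f /homog_formalP hf; apply/homog_formalP => q s hs qa.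
  by rewrite ev_mk (hf q) //; exact: pull_word.
- by apply: evP => -[].
- move=> f g; apply: evP => s; rewrite ev_mk !ev_fmul.
  by rewrite (wmul_map Com s (ev f) (ev g) hp pull_gr).
Qed.

Lemma unsh_map (M : lmodType k) s (P : seq U -> seq U -> M) :
  unsh (map h s) P = unsh s (fun A B => P (map h A) (map h B)).
Proof.
elim: s P => [|x s IH] P //=.
rewrite !IH; congr (_ + (_ + _)); apply: unsh_ext => A B _ /=; first by rewrite hp.
rewrite hp; congr P; rewrite -!map_comp; apply: eq_map => y /=.
by rewrite pull_gr.
Qed.
End Pull.
End AlgebraMaps.

Section SumSpace.
Variables (k : fieldType) (U W : superspace k).
Definition sum_prt a (x : U * W) : U * W := (prt a x.1, prt a x.2).
Fact sum_prt_linear a : linear (sum_prt a).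
Proof. by move=> c x y; rewrite /sum_prt !linearP. Qed.
Fact sum_prtK a b x : sum_prt a (sum_prt b x) = if a == b then sum_prt b x else 0.
Proof. by rewrite /sum_prt /= !prtK; case: eqP. Qed.
Fact sum_prtD x : sum_prt false x + sum_prt true x = x.
Proof. by case: x => x y; congr (_, _); exact: prtD. Qed.
Definition sum_space : superspace k :=
  @Superspace k (U * W)%type (fun a => mklin (sum_prt_linear a)) sum_prtK sum_prtD.

Fact sum_snd_linear : linear (fun x : sum_space => x.2 : W).
Proof. by []. Qed.
Definition sum_snd : {linear sum_space -> W} := mklin sum_snd_linear.
Fact sum_fst_linear : linear (fun x : sum_space => x.1 : U).
Proof. by []. Qed.
Definition sum_fst : {linear sum_space -> U} := mklin sum_fst_linear.
Fact sum_inl_linear : linear (fun x : U => (x, 0) : sum_space).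
Proof. by move=> a x y; congr (_, _); change (0 = a *: 0 + 0 :> W); rewrite scaler0 addr0. Qed.
Definition sum_inl : {linear U -> sum_space} := mklin sum_inl_linear.
Fact sum_inr_linear : linear (fun x : W => (0, x) : sum_space).
Proof. by move=> a x y; congr (_, _); change (0 = a *: 0 + 0 :> U); rewrite scaler0 addr0. Qed.
Definition sum_inr : {linear W -> sum_space} := mklin sum_inr_linear.

Lemma sum_snd_prt a x : sum_snd (prt a x) = prt a (sum_snd x).
Proof. by []. Qed.
Lemma sum_fst_prt a x : sum_fst (prt a x) = prt a (sum_fst x).
Proof. by []. Qed.
Lemma sum_inl_prt a x : sum_inl (prt a x) = prt a (sum_inl x).
Proof. by congr (_, _); rewrite linear0. Qed.
Lemma sum_inr_prt a x : sum_inr (prt a x) = prt a (sum_inr x).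
Proof. by congr (_, _); rewrite linear0. Qed.
End SumSpace.

(** * Exponentials of locally nilpotent even derivations *)

Section Exponential.
Variables (k : fieldType) (k_char0 : [pchar k] =i pred0) (X : superspace k).
Variables (D : formal Com X -> formal Com X) (HD : hder false D).
Hypothesis nilD : forall n f s, (size s < n)%N -> ev (iter n D f) s = 0.

Definition divpow n f : formal Com X := (n`!%:R : k)^-1 *: iter n D f.

Let natr_neq0 n : n.+1%:R != 0 :> k.
Proof. by rewrite ((pcharf0P k).1 k_char0). Qed.

Lemma divpowS n f : D (divpow n f) = n.+1%:R *: divpow n.+1 f.
Proof.
rewrite /divpow (hder_linZ _ _ HD) iterS scalerA factS natrM invfM mulrA mulfV ?mul1r //.
Qed.
Lemma divpow_nil n f s : (size s < n)%N -> ev (divpow n f) s = 0.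
Proof. by move=> sn; rewrite evZ nilD ?mulr0. Qed.
(** Dividing by n! removes the binomial coefficients of the Leibniz rule. In the induction step D
    raises one of the two exponents, and the weights i and n + 1 - i of the two contributions add up
    to n + 1. *)
Lemma divpow_mul n f g :
  divpow n (fmul f g) = \sum_(i < n.+1) fmul (divpow i f) (divpow (n - i) g).
Proof.
elim: n => [|n IH].
  by rewrite big_ord1 /divpow /= invr1 !scale1r.
apply: (scalerI (natr_neq0 n)); rewrite -divpowS IH.
have DD (f1 f2 : formal Com X) : D (f1 + f2) = D f1 + D f2 by exact: hder_linD HD.
rewrite (big_morph D DD (hder_lin0 HD)).
have Dmul (f1 f2 : formal Com X) : D (fmul f1 f2) = fmul (D f1) f2 + fmul f1 (D f2).
  rewrite -{1}[f1]prtD fmulDl DD !(hder_mul HD _ (homog_prt _ _)) /= expr0 !scale1r.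
  by rewrite addrACA -!fmulDl -DD prtD.
under eq_bigr do rewrite Dmul !divpowS fmulZl fmulZr.
rewrite big_split /=.
have -> : \sum_(i < n.+1) i.+1%:R *: fmul (divpow i.+1 f) (divpow (n - i) g) =
    \sum_(i < n.+2) i%:R *: fmul (divpow i f) (divpow (n.+1 - i) g).
  by rewrite [RHS]big_ord_recl scale0r add0r; apply: eq_bigr => i _; rewrite subSS.
have -> : \sum_(i < n.+1) (n - i).+1%:R *: fmul (divpow i f) (divpow (n - i).+1 g) =
    \sum_(i < n.+2) (n.+1 - i)%:R *: fmul (divpow i f) (divpow (n.+1 - i) g).
  rewrite [RHS]big_ord_recr /= subnn scale0r addr0; apply: eq_bigr => i _.
  by rewrite subSn // -ltnS.
rewrite -big_split scaler_sumr; apply: eq_bigr => i _ /=.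
by rewrite -scalerDl -natrD subnKC // -ltnS.
Qed.

Fact fexp_mem f : formal_mem Com
  (fun s => \sum_(n < (size s).+1) ev (divpow n f) s : k^o).
Proof.
split=> [s1 s2 a x y|_ s1 s2 a b x y hx hy]; rewrite !size_cat /= mulr_sumr.
  by rewrite -big_split; apply: eq_bigr => n _; exact: ev_ml.
by apply: eq_bigr => n _; exact: ev_sy.
Qed.
Definition fexp f : formal Com X := mkformal (fexp_mem f).

Lemma fexpE N f s : (size s <= N)%N -> ev (fexp f) s = \sum_(n < N.+1) ev (divpow n f) s.
Proof.
move=> sN; rewrite ev_mk (big_ord_widen N.+1 (fun n => ev (divpow n f) s)) //.
rewrite big_mkcond; apply: eq_bigr => n _; case: ltnP => // sn.
by rewrite divpow_nil.
Qed.

Lemma divpow_lin n a f g : divpow n (a *: f + g) = a *: divpow n f + divpow n g.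
Proof.
rewrite /divpow; have -> : iter n D (a *: f + g) = a *: iter n D f + iter n D g.
  by elim: n => //= n ->; exact: hder_lin HD _ _ _.
by rewrite scalerDr !scalerA mulrC.
Qed.

Lemma iter_cont n : continuous_op (iter n D).
Proof.
elim: n => [|n IH]; first by move=> s; exists [:: s] => f; apply; rewrite mem_head.
exact: (continuous_comp IH (hder_cont HD)).
Qed.

Lemma sum_antidiag (N : nat) (a : nat -> nat -> k) :
  (forall i j, (N < i + j)%N -> a i j = 0) ->
  \sum_(i < N.+1) \sum_(j < N.+1) a i j = \sum_(n < N.+1) \sum_(i < n.+1) a i (n - i)%N.
Proof.
move=> Ha.
have E n : (n <= N)%N -> \sum_(i < n.+1) a i (n - i)%N =
    \sum_(i < N.+1) \sum_(j < N.+1) if (i + j == n)%N then a i j else 0.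
  move=> nN; rewrite (big_ord_widen N.+1 (fun i => a i (n - i)%N)) // big_mkcond.
  apply: eq_bigr => i _; rewrite ltnS; case: leqP => [iln|nli]; last first.
    by rewrite big1 // => j _; case: eqP => // e; move: nli; rewrite -e ltnNge leq_addr.
  have jN : (n - i < N.+1)%N by rewrite ltnS (leq_trans (leq_subr _ _)).
  rewrite (bigD1 (Ordinal jN)) //= subnKC // eqxx big1 ?addr0 // => j jne.
  by case: eqP => // e; case/eqP: jne; apply: val_inj => /=; rewrite -e addKn.
under [RHS]eq_bigr => n _ do rewrite E -1?ltnS ?ltn_ord //.
rewrite [RHS]exchange_big.
apply: eq_bigr => i _; rewrite [RHS]exchange_big; apply: eq_bigr => j _ /=.
have [ijN|Nij] := leqP (i + j) N; last first.
  by rewrite Ha // big1 // => n _; case: eqP.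
have ijN' : (i + j < N.+1)%N by [].
rewrite (bigD1 (Ordinal ijN')) //= eqxx big1 ?addr0 // => n ne.
by case: eqP => // e; case/eqP: ne; apply: val_inj.
Qed.

Lemma wmul_suml I (r : seq I) (F : I -> seq X -> k^o) g s :
  wmul Com s (fun t => \sum_(i <- r) F i t) g = \sum_(i <- r) wmul Com s (F i) g.
Proof.
elim: r => [|i r IH]; first by rewrite big_nil wmul0l // => t; rewrite big_nil.
by rewrite big_cons -IH -wmulDl; apply: wmul_ext => // t; rewrite big_cons.
Qed.
Lemma wmul_sumr I (r : seq I) (F : I -> seq X -> k^o) g s :
  wmul Com s g (fun t => \sum_(i <- r) F i t) = \sum_(i <- r) wmul Com s g (F i).
Proof.
elim: r => [|i r IH]; first by rewrite big_nil wmul0r // => t; rewrite big_nil.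
by rewrite big_cons -IH -wmulDr; apply: wmul_ext => // t; rewrite big_cons.
Qed.

Lemma fexp_alg_map : alg_map fexp.
Proof.
split.
- move=> a f g; apply: evP => s; rewrite ev_lin !ev_mk mulr_sumr -big_split.
  by apply: eq_bigr => n _; rewrite divpow_lin ev_lin.
- move=> s; have /choice[L HL] n := @iter_cont n s.
  exists (flatten [seq L n | n <- iota 0 (size s).+1]) => f Hf; rewrite ev_mk big1 // => n _.
  rewrite evZ HL ?mulr0 // => t tL; apply: Hf; apply/flattenP; exists (L n) => //.
  by apply/mapP; exists (n : nat) => //; rewrite mem_iota /= add0n.
- move=> a f hf; apply/homog_formalP => q s hs qa; rewrite ev_mk big1 // => n _.
  have hn : homog a (iter n D f) by elim: (n : nat) => //= m; exact: hder_homog HD _ _.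
  by rewrite evZ ((homog_formalP _ _).1 hn q) ?mulr0.
- apply: evP => s; rewrite ev_mk big_ord_recl big1 ?addr0 => [|n _].
    by rewrite /divpow invr1 scale1r.
  rewrite /divpow iterSr (hder_one HD).
  have -> : iter n D 0 = 0 by elim: (n : nat) => //= m ->; exact: hder_lin0 HD.
  by rewrite scaler0 ev0.
- move=> f g; apply: evP => s; pose N := size s.
  have EN h t : (size t <= N)%N -> ev (fexp h) t = \sum_(n < N.+1) ev (divpow n h) t.
    exact: fexpE.
  rewrite EN // ev_fmul wmul_unsh.
  transitivity (wmul Com s (fun t => \sum_(i < N.+1) ev (divpow i f) t : k^o)
      (fun t => \sum_(j < N.+1) ev (divpow j g) t : k^o)); last first.
    rewrite wmul_unsh; apply: (@unsh_ext k X k^o) => A B e /=.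
    by rewrite !EN // /N -e ?leq_addl ?leq_addr.
  rewrite wmul_suml; under [RHS]eq_bigr do rewrite wmul_sumr.
  (* Terms with i + j > N vanish: the parts of s have total length N, so one of them is shorter than
     its exponent. *)
  rewrite (@sum_antidiag N (fun i j => wmul Com s (ev (divpow i f)) (ev (divpow j g)))).
    by apply: eq_bigr => n _; rewrite divpow_mul ev_sum; apply: eq_bigr.
  move=> i j ij; rewrite wmul_unsh; apply: etrans (@unsh0 k X k^o s); apply: (@unsh_ext k X k^o) => A B e /=.
  have [Ai|iA] := ltnP (size B) i; first by rewrite [ev (divpow i f) B]divpow_nil // mul0r.
  rewrite [ev (divpow j g) A]divpow_nil ?mulr0 //.
  by rewrite -(ltn_add2l (size B)) addnC e (leq_trans ij) // leq_add2r.
Qed.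
End Exponential.

Section FromComponents.
Variables (k : fieldType) (k_char0 : [pchar k] =i pred0) (U U' : superspace k).
Variable F : seq U -> U'.
Hypotheses (mF : mlin F) (sF : gsym F) (pF : cparity false F) (F0 : F [::] = 0).

Local Notation X := (sum_space U U').

(* The derivation with this cochain is locally nilpotent, and its exponential,
   restricted to U, is the algebra map with components F. *)
Definition graph_cochain (s : seq X) : X := sum_inr U U' (F (map (sum_fst U U') s)).

Lemma graph_cochainP : cochain_of_parity Com false graph_cochain.
Proof.
split=> [s1 s2 a x y|_ s1 s2 a b x y hx hy|a s hs]; rewrite /graph_cochain ?map_cat ?map_cons.
- by rewrite linearP mF linearP.
- by rewrite (sF _ _ (a := a) (b := b)) ?linearZ //; exact: (pull_homog (@sum_fst_prt k U U')).
- apply: (pull_homog (@sum_inr_prt k U U')); apply: pF.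
  exact: (pull_word (@sum_fst_prt k U U')).
Qed.

Let D := der_op graph_cochainP.
Let HD := der_op_hder k_char0 graph_cochainP.

Lemma mlin_in0 (M : lmodType k) (V : superspace k) (f : seq V -> M) s1 s2 : mlin f -> f (s1 ++ 0 :: s2) = 0.
Proof.
move=> mf; have := mf s1 s2 (-1) 0 0.
by rewrite scaler0 addr0 scaleN1r addNr.
Qed.

Lemma graph_cochain_inr s1 s2 (w : U') : graph_cochain (s1 ++ sum_inr U U' w :: s2) = 0.
Proof.
by rewrite /graph_cochain map_cat map_cons [sum_fst U U' _](_ : _ = 0) // (mlin_in0 _ _ mF) linear0.
Qed.

Fact front_mem c (V : superspace k) (w : V) (f : formal c V) :
  formal_mem c (fun t => ev f (w :: t) : k^o).
Proof. by split=> [|e]; [exact/ml_cons/ev_ml|exact/sy_cons/ev_sy]. Qed.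
Definition front c (V : superspace k) (w : V) (f : formal c V) : formal c V :=
  mkformal (front_mem w f).

(** [graph_cochain] depends on the U-components only, so a letter of [U'] is never fed into it and
    passes through the even derivation D without a sign. *)
Lemma D_front (w : U') f : front (sum_inr U U' w) (D f) = D (front (sum_inr U U' w) f).
Proof.
apply: evP => s; rewrite !ev_mk /der_fun.
have H p (v : U') : homog p v -> com_der false graph_cochain (ev f) (sum_inr U U' v :: s) =
    com_der false graph_cochain (fun t => ev f (sum_inr U U' v :: t)) s.
  move=> hv; have hv' := pull_homog (@sum_inr_prt k U U') hv.
  rewrite (com_der_cons _ (cop_ml graph_cochainP) (cop_par graph_cochainP) (ev_ml f) (ev_sy f erefl) hv').
  rewrite -[RHS]add0r; congr (_ + _).
  apply: etrans (@unsh0 k X k^o s); apply: (@unsh_ext k X k^o) => A B _.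
  by rewrite (graph_cochain_inr [::]) (ml_hd0 _ (ml_tw _ (ml_tw _ (ev_ml f)))).
have mD := ml_com_der false (cop_ml graph_cochainP) (ev_ml f).
rewrite -[w]prtD linearD (ml_hdD _ _ _ mD) !(H _ _ (homog_prt _ _)) -com_derD.
by apply: com_der_ext => t; rewrite -(ml_hdD _ _ _ (ev_ml f)) -linearD ?prtD.
Qed.
Lemma D_iter_front n (w : U') f :
  front (sum_inr U U' w) (iter n D f) = iter n D (front (sum_inr U U' w) f).
Proof. by elim: n => //= n <-; rewrite D_front. Qed.

Lemma D_iterE n f s : ev (iter n.+1 D f) s =
  unsh s (fun A B => ev (iter n D (front (graph_cochain A) f)) B : k^o).
Proof.
rewrite iterS ev_mk; apply: (@unsh_ext k X k^o) => A B _.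
by rewrite /tw map_gp_false -D_iter_front.
Qed.

(** Each application must consume a letter, since [F [::]] is 0, and the values it produces lie in
    [U'] and are never consumed again. *)
Lemma D_nilp n f s : (size s < n)%N -> ev (iter n D f) s = 0.
Proof.
elim: n f s => [//|n IH] f s sn; rewrite D_iterE.
apply: etrans (@unsh0 k X k^o s); apply: (@unsh_ext k X k^o) => A B e.
case: A e => [|x A] e; last by apply: IH; move: sn; rewrite -e /=; rewrite ltnS; apply: leq_trans; rewrite ltnS leq_addl.
have -> : front (graph_cochain [::]) f = 0.
  apply: evP => t; rewrite ev_mk ev0 /graph_cochain [map _ _]/= F0 linear0.
  exact: (ml_hd0 t (ev_ml f)).
have -> : iter n D 0 = 0 by elim: (n) => //= m ->; exact: hder_lin0 HD.
by rewrite ev0.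
Qed.

Definition from_components (f : formal Com U') : formal Com U :=
  pull (@sum_inl_prt k U U') (fexp D (pull (@sum_snd_prt k U U') f)).

Lemma from_components_alg_map : alg_map from_components.
Proof.
apply: (@alg_map_comp k _ _ _ (fun f => fexp D (pull (@sum_snd_prt k U U') f))).
  apply: alg_map_comp; first exact: pull_alg_map.
  exact: (fexp_alg_map k_char0 HD D_nilp).
exact: pull_alg_map.
Qed.

(* n! times the contribution of the partitions of the word into n blocks. *)
Fixpoint blocks n (f : seq U' -> k^o) (s : seq U) : k^o :=
  if n is n'.+1 then unsh s (fun A B => blocks n' (fun t => f (F A :: t)) B)
  else if s is [::] then f [::] else 0.

Lemma D_iter_blocks n f s :
  ev (iter n D (pull (@sum_snd_prt k U U') f)) (map (sum_inl U U') s) = blocks n (ev f) s.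
Proof.
elim: n f s => [|n IH] f s.
  rewrite [iter _ _ _]/= ev_mk -map_comp; case: s => [//|x s] /=.
  exact: (ml_hd0 _ (ev_ml f)).
rewrite D_iterE unsh_map; last exact: sum_inl_prt.
rewrite /=; apply: (@unsh_ext k U k^o) => A B _.
have -> : graph_cochain (map (sum_inl U U') A) = sum_inr U U' (F A).
  by rewrite /graph_cochain -map_comp map_id.
have -> : front (sum_inr U U' (F A)) (pull (@sum_snd_prt k U U') f) =
    pull (@sum_snd_prt k U U') (front (F A) f) by apply: evP => t; rewrite !ev_mk.
exact: IH.
Qed.

Lemma from_componentsE f s :
  ev (from_components f) s = \sum_(n < (size s).+1) (n`!%:R : k)^-1 * blocks n (ev f) s.
Proof.
rewrite !ev_mk size_map; apply: eq_bigr => n _.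
by rewrite evZ D_iter_blocks.
Qed.

Lemma blocks_vanish n f s : (forall t, size t = n -> f t = 0) -> blocks n f s = 0.
Proof.
elim: n f s => [|n IH] f s H /=; first by case: s => // ; apply: H.
apply: etrans (@unsh0 k U k^o s); apply: (@unsh_ext k U k^o) => A B _.
by apply: IH => t e; apply: H; rewrite /= e.
Qed.
Lemma ml_components f : multilinear f -> @mlin k U k^o (fun A => f [:: F A]).
Proof. by move=> mf s1 s2 a x y; rewrite mF (ml_hd _ _ _ _ mf). Qed.
Lemma blocks1 f s : multilinear f -> blocks 1 f s = f [:: F s].
Proof.
by move=> mf; rewrite /= -(unsh_nilr s (ml_components mf)); apply: (@unsh_ext k U k^o) => A [].
Qed.
Lemma blocks2 f s : multilinear f -> blocks 2 f s = unsh s (fun A B => f [:: F A; F B] : k^o).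
Proof.
move=> mf; change (unsh s (fun A B => blocks 1 (fun t => f (F A :: t)) B) =
  unsh s (fun A B => f [:: F A; F B] : k^o)).
apply: (@unsh_ext k U k^o) => A B _; exact/blocks1/ml_cons.
Qed.
Lemma blocks_nilp n f s : multilinear f -> (size s < n)%N -> blocks n f s = 0.
Proof.
elim: n f s => [//|n IH] f s mf sn /=.
apply: etrans (@unsh0 k U k^o s); apply: (@unsh_ext k U k^o) => A B e.
case: A e => [|x A] e.
  rewrite F0; apply: blocks_vanish => t _; exact: ml_hd0.
apply: IH; first exact: ml_cons.
by move: sn; rewrite -e /= ltnS; apply: leq_trans; rewrite ltnS leq_addl.
Qed.

Lemma from_components_short f s : (forall t, (2 < size t)%N -> ev f t = 0) -> ev f [::] = 0 ->
  ev (from_components f) s = ev f [:: F s] + (2%:R : k)^-1 * unsh s (fun A B => ev f [:: F A; F B] : k^o).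
Proof.
move=> f3 f0; have mf := ev_ml f.
rewrite from_componentsE -(blocks1 _ mf) -(blocks2 _ mf).
(* The sum is extended by two terms, which vanish by [blocks_nilp], so that n = 0, 1, 2 can be split
   off even for short words. *)
have E : \sum_(n < (size s).+1) (n`!%:R : k)^-1 * blocks n (ev f) s =
    \sum_(n < (size s).+3) (n`!%:R : k)^-1 * blocks n (ev f) s.
  rewrite [RHS]big_ord_recr [X in _ = X + _]big_ord_recr.
  rewrite !(@blocks_nilp (nat_of_ord _) _ _ mf) //.
  rewrite !mulr0 /= !addr0; exact: eq_bigr.
rewrite E !big_ord_recl [\sum_(i < _) _]big1 ?addr0 => [|i _]; last first.
  by rewrite blocks_vanish ?mulr0 // => t e; apply: f3; rewrite e.
have -> : blocks (ord0 : 'I_(size s).+3) (ev f) s = 0 by case: (s).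
by rewrite mulr0 add0r /= invr1 mul1r.
Qed.

Lemma from_components_flin (l : {linear U' -> k^o}) s :
  ev (from_components (flin Com l)) s = l (F s).
Proof.
rewrite from_components_short //; last by move=> [|x [|y t]].
rewrite [X in _ * X](_ : _ = 0) ?mulr0 ?addr0 //.
exact: (@unsh0 k U k^o s).
Qed.
End FromComponents.

Section LinfMaps.
Variables (k : fieldType) (k_char0 : [pchar k] =i pred0).

Lemma ev_com_der (U : superspace k) b p (D : Der Com U) (f : formal Com U) s :
  homog b D -> homog p f ->
  ev (der_app D f) s = (-1) ^+ (b && p) * unsh s (fun A B => ev f (cochain D A :: B) : k^o).
Proof.
move=> hD hf; rewrite (ev_der_app k_char0 f s hD).
rewrite -[RHS](@unshZ k U k^o); apply: (@unsh_ext k U k^o) => A B _.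
exact: homog_tw.
Qed.

Lemma unsh_form (U W : superspace k) (l : {linear W -> k^o}) s (P : seq U -> seq U -> W) :
  l (unsh s P) = unsh s (fun A B => l (P A B)).
Proof. by apply: unsh_linear => a x y; rewrite linearP. Qed.

(** The square of an odd derivation is again a derivation, the mixed terms of the Leibniz rule
    cancelling, so it vanishes as soon as it kills linear forms. There it is the quadratic relation
    between the coefficients. *)
Lemma der_sq0 (U : superspace k) (D : Der Com U) : homog true D ->
  (forall s, unsh s (fun A B => cochain D (cochain D A :: B)) = 0) ->
  forall f, der_app D (der_app D f) = 0.
Proof.
move=> hD H; have HD := homog_der hD.
apply: (continuous_op_ext k_char0 (T' := fun=> 0)).
- by move=> a f g; rewrite !(hder_lin HD).
- by move=> a f g; rewrite scaler0 addr0.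
- exact: continuous_comp (hder_cont HD) (hder_cont HD).
- by move=> s; exists [::] => f _; rewrite ev0.
- by rewrite !(hder_one HD) (hder_lin0 HD).
move=> p l g hl E; have hf := homog_flin Com hl.
have E0 : der_app D (der_app D (flin Com l)) = 0.
  apply: evP => s; rewrite ev0 (ev_com_der s hD (hder_homog HD hf)).
  transitivity ((-1) ^+ (true && (true (+) p)) * ((-1) ^+ (true && p) *
     l (unsh s (fun A B => cochain D (cochain D A :: B))))); last first.
    by rewrite H linear0 !mulr0.
  rewrite unsh_form; congr (_ * _); rewrite -[RHS](@unshZ k U k^o).
  by apply: (@unsh_ext k U k^o) => A B _; exact: (cochainE _ hD hl).
rewrite (hder_mul HD _ hf) (hder_linD _ _ HD) (hder_linZ _ _ HD).
rewrite (hder_mul HD _ (hder_homog HD hf)) (hder_mul HD _ hf) E E0.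
rewrite fmul0l fmul0r scaler0 add0r addr0 -scalerDl.
by case: (p) => /=; rewrite ?expr0 ?expr1 ?addNr ?subrr scale0r.
Qed.

Variables (V W : superspace k) (mV : infty Com V) (mW : infty Com W).

Lemma alg_map_prt (U U' : superspace k) (T : formal Com U -> formal Com U') a f :
  alg_map T -> T (prt a f) = prt a (T f).
Proof.
move=> hT; have TD f1 f2 : T (f1 + f2) = T f1 + T f2.
  by rewrite -[f1]scale1r (am_lin hT) !scale1r.
rewrite -{2}[f]prtD TD linearD.
rewrite !(homog_prtN _ (am_homog hT (homog_prt _ f))).
by case: a; rewrite /= ?add0r ?addr0.
Qed.

(** Both composites of [T] with the differentials obey the Leibniz rule along [T], so compatibility
    has to be tested on linear forms only. *)
Lemma linf_map_of_alg_map (T : formal Com (Pi W) -> formal Com (Pi V)) :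
  alg_map T ->
  (forall p l s, lin_homog p l ->
    ev (T (der_app mW (flin Com l))) s = ev (der_app mV (T (flin Com l))) s) ->
  exists F : linf_map mV mW, lm_op F = T.
Proof.
move=> hT H; suff chain f : T (der_app mW f) = der_app mV (T f).
  by exists (LinfMap (am_lin hT) (am_cont hT) (fun a f => alg_map_prt a f hT) (am_one hT) (am_mul hT) chain).
have HV := homog_der (istr_odd mV); have HW := homog_der (istr_odd mW).
move: f; apply: (continuous_op_ext k_char0).
- by move=> a f g; rewrite (hder_lin HW) (am_lin hT).
- by move=> a f g; rewrite (am_lin hT) (hder_lin HV).
- exact: continuous_comp (hder_cont HW) (am_cont hT).
- exact: continuous_comp (am_cont hT) (hder_cont HV).
- rewrite (hder_one HW) (am_one hT) (hder_one HV).
  by have := am_lin hT (-1) 0 0; rewrite scaler0 addr0 scaleN1r addNr.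
move=> p l g hl E; have hf := homog_flin Com hl.
rewrite (hder_mul HW _ hf) (am_mul hT) (hder_mul HV _ (am_homog hT hf)).
have TL (x : k) f1 f2 : T (f1 + x *: f2) = T f1 + x *: T f2.
  by rewrite addrC (am_lin hT) addrC.
rewrite TL !(am_mul hT) E; congr (fmul _ _ + _).
by apply: evP => s; exact: H hl.
Qed.

Lemma linf_map_of_components (F : seq (Pi V) -> Pi W) :
  mlin F -> gsym F -> cparity false F -> F [::] = 0 ->
  (forall t, (2 < size t)%N -> cochain mW t = 0) -> cochain mW [::] = 0 ->
  (forall s, cochain mW [:: F s] + (2%:R : k)^-1 *: unsh s (fun A B => cochain mW [:: F A; F B]) =
     unsh s (fun A B => F (cochain mV A :: B))) ->
  exists Phi : linf_map mV mW, forall l s, ev (Phi (flin Com l)) s = l (F s).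
Proof.
move=> mF sF pF F0 m3 m0 H.
have hT := from_components_alg_map k_char0 mF sF pF F0.
have Tl := from_components_flin mF sF pF F0.
have [p l s hl|Phi ePhi] := linf_map_of_alg_map hT; last by exists Phi => l s; rewrite ePhi.
have hlW t : ev (der_app mW (flin Com l)) t = (-1) ^+ p * l (cochain mW t).
  exact: (cochainE t (istr_odd mW) hl).
rewrite (from_components_short mF sF pF F0); first last.
- by rewrite hlW m0 linear0 mulr0.
- by move=> t t2; rewrite hlW m3 // linear0 mulr0.
rewrite (ev_com_der s (istr_odd mV) (am_homog hT (homog_flin Com hl))).
transitivity ((-1) ^+ p * l (unsh s (fun A B => F (cochain mV A :: B)))); last first.
  congr (_ * _); rewrite unsh_form; apply: (@unsh_ext k _ k^o) => A B _.
  by rewrite Tl.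
rewrite -H linearD linearZ unsh_form hlW [RHS]mulrDr; congr (_ + _).
rewrite mulrCA; congr (_ * _); rewrite -[RHS](@unshZ k _ k^o).
by apply: (@unsh_ext k _ k^o) => A B _; rewrite hlW.
Qed.

Lemma taylor_of_flin (U U' : superspace k) (T : formal Com U -> formal Com U') s u :
  (forall l : {linear U -> k^o}, ev (T (flin Com l)) s = l u) -> taylor false T s = u.
Proof. by move=> H; apply: taylor_unique => a l _; rewrite H mul1r. Qed.

Section Strict.
Variable (h : {linear (Pi V) -> (Pi W)}).
Hypothesis (hp : forall a x, h (prt a x) = prt a (h x)).

Lemma linf_map_of_strict : (forall s, h (cochain mV s) = cochain mW (map h s)) ->
  exists Phi : linf_map mV mW, lm_op Phi = pull hp.
Proof.
move=> H; apply: (linf_map_of_alg_map (pull_alg_map hp)) => p l s hl.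
rewrite ev_mk (cochainE _ (istr_odd mW) hl) -H.
have lh : linear (fun x => l (h x) : k^o) by move=> a x y; rewrite !linearP.
have -> : pull hp (flin Com l) = flin Com (mklin lh).
  by apply: evP => -[|x [|y t]].
have hl' : lin_homog p (mklin lh) by move=> x /=; rewrite hp hl.
by rewrite (cochainE _ (istr_odd mV) hl').
Qed.
End Strict.
End LinfMaps.

Section Composition.
Variables (k : fieldType) (V1 V2 V3 : superspace k).
Variables (m1 : infty Com V1) (m2 : infty Com V2) (m3 : infty Com V3).

Lemma linf_map_comp (F : linf_map m1 m2) (G : linf_map m2 m3) :
  exists H : linf_map m1 m3, forall f, H f = F (G f).
Proof.
have hl : linear (fun f => F (G f)) by move=> a f g; rewrite !lm_lin.
have hc := continuous_comp (@lm_cont _ _ _ _ _ G) (@lm_cont _ _ _ _ _ F).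
have he a f : F (G (prt a f)) = prt a (F (G f)) by rewrite !lm_even.
have h1 : F (G (fone Com _)) = fone Com _ by rewrite !lm_one.
have hm f g : F (G (fmul f g)) = fmul (F (G f)) (F (G g)) by rewrite !lm_mul.
have hch f : F (G (der_app m3 f)) = der_app m1 (F (G f)) by rewrite !lm_chain.
by exists (LinfMap hl hc he h1 hm hch).
Qed.

Lemma linf_map_id : exists H : linf_map m1 m1, forall f, H f = f.
Proof.
have hl : linear (fun f : formal Com (Pi V1) => f) by [].
have hc : continuous_op (fun f : formal Com (Pi V1) => f).
  by move=> s; exists [:: s] => f; apply; rewrite mem_head.
by exists (@LinfMap _ _ _ m1 m1 id hl hc (fun _ _ => erefl) erefl (fun _ _ => erefl) (fun _ => erefl)).
Qed.
End Composition.

(** * Dglas as L-infinity algebras *)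

Section DglaLinf.
Variables (k : fieldType) (k_char0 : [pchar k] =i pred0) (g : dgla k).
Implicit Types (x y z : Pi g) (a b : bool).

(** The binary operation of [dgla_maps]. Seen on [Pi g] it is graded symmetric and odd, and
    therefore fits into unshuffle sums. *)
Definition m2 (x y : g) : g := - brk (gr x) y.

Lemma m2_linl (c : k) (x x' y : g) : m2 (c *: x + x') y = c *: m2 x y + m2 x' y.
Proof. by rewrite /m2 linearP brk_linl opprD scalerN. Qed.
Lemma m2_linr (c : k) (x y y' : g) : m2 x (c *: y + y') = c *: m2 x y + m2 x y'.
Proof. by rewrite /m2 brk_linr opprD scalerN. Qed.
Lemma m2_0l (y : g) : m2 0 y = 0.
Proof. by rewrite /m2 linear0 brk0l oppr0. Qed.
Lemma m2_0r (y : g) : m2 y 0 = 0.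
Proof. by rewrite /m2 brk0r oppr0. Qed.
Lemma m2Dl (x x' y : g) : m2 (x + x') y = m2 x y + m2 x' y.
Proof. by rewrite -[x]scale1r m2_linl !scale1r. Qed.
Lemma m2Dr (x y y' : g) : m2 x (y + y') = m2 x y + m2 x y'.
Proof. by rewrite -[y]scale1r m2_linr !scale1r. Qed.
Lemma m2Zl (c : k) (x y : g) : m2 (c *: x) y = c *: m2 x y.
Proof. by rewrite -[_ *: x]addr0 m2_linl m2_0l addr0. Qed.
Lemma m2Zr (c : k) (x y : g) : m2 x (c *: y) = c *: m2 x y.
Proof. by rewrite -[_ *: y]addr0 m2_linr m2_0r addr0. Qed.

(* Parities below are those of Pi g, i.e. opposite to those of g. *)
Lemma homog_Pi a (x : g) : @homog k (Pi g) a x = @homog k g (~~ a) x.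
Proof. by []. Qed.
Lemma m2_homogE a x y : homog a x -> m2 x y = (-1) ^+ a *: (brk (x : g) (y : g) : g).
Proof.
rewrite homog_Pi => hx; rewrite /m2 (gr_homog hx) brkZl -scaleNr.
by congr (_ *: _); case: a {hx}; rewrite /= ?expr0 ?expr1 ?opprK.
Qed.
Lemma m2_sym a b x y : homog a x -> homog b y ->
  m2 x y = (-1) ^+ (a && b) *: m2 y x.
Proof.
move=> hx hy; rewrite (m2_homogE _ hx) (m2_homogE _ hy).
rewrite (brkC (x := x : g) (y := y : g) hx hy) -scaleNr !scalerA.
congr (_ *: _); case: a {hx}; case: b {hy}; rewrite /= ?expr0 ?expr1; ring.
Qed.
Lemma m2_homog a b x y : homog a x -> homog b y -> @homog k (Pi g) (~~ (a (+) b)) (m2 x y).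
Proof.
move=> hx hy; change (@homog k g (~~ ~~ (a (+) b)) (m2 x y)).
have -> : ~~ ~~ (a (+) b) = ~~ a (+) ~~ b by case: (a); case: (b).
by apply: homogN; apply: brk_homog => //; exact: (homog_gr (V := g)).
Qed.
Lemma dif_m2 a x y : homog a x ->
  dif (m2 x y) = - (m2 (dif (x : g)) y + (-1) ^+ a *: m2 x (dif (y : g))).
Proof.
move=> hx; rewrite (m2_homogE _ hx) linearZ_LR.
rewrite (dif_brk (x := x : g) (y : g) hx) (m2_homogE (a := ~~ a)); last first.
  by rewrite homog_Pi; exact: (dif_homog (x := x : g) hx).
rewrite (m2_homogE _ hx) scalerDr !scalerA opprD -!scaleNr.
by congr (_ *: _ + _ *: _); case: a {hx}; rewrite /= ?expr0 ?expr1; ring.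
Qed.
(* The graded Jacobi identity, as the derivation property of m2 x. *)
Lemma m2_jacobi a b x y z : homog a x -> homog b y ->
  m2 x (m2 y z) = (-1) ^+ (~~ a) *: m2 (m2 x y) z + (-1) ^+ (~~ a && ~~ b) *: m2 y (m2 x z).
Proof.
move=> hx hy; rewrite !(m2_homogE _ hx) !(m2_homogE _ hy).
rewrite (m2_homogE (a := ~~ (a (+) b)) (x := (-1) ^+ a *: (brk (x : g) y : g))); last first.
  by rewrite -(m2_homogE _ hx); exact: m2_homog.
rewrite !brkZr !brkZl !scalerA (brk_jacobi (x := x : g) (y := y : g) z hx hy).
rewrite scalerDr !scalerA.
congr (_ *: _ + _ *: _); case: a {hx}; case: b {hy}; rewrite /= ?expr0 ?expr1; ring.
Qed.

Lemma mlin_dgla_maps : mlin (@dgla_maps k g).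
Proof.
move=> [|z [|z' s1]] [|w [|w' s2]] c x y //=; rewrite ?scaler0 ?addr0 //.
- exact: (linearP dif).
- exact: m2_linl.
- exact: m2_linr.
all: by case: s1 => [|? ?] /=; rewrite ?scaler0 ?addr0.
Qed.
Lemma gsym_dgla_maps : gsym (@dgla_maps k g).
Proof.
move=> [|z s1] s2 a b x y hx hy; last first.
  by case: s1 => [|? [|? ?]] /=; rewrite scaler0.
case: s2 => [|w s2] /=; last by rewrite scaler0.
exact: m2_sym.
Qed.
Lemma cparity_dgla_maps : cparity true (@dgla_maps k g).
Proof.
move=> a [|x [|y [|z s]]] /=.
- by move=> _; exact: homog0.
- move=> [b [hx]]; case: b a hx => [] [] //= hx _; exact: (dif_homog (x := x : g) hx).
- move=> [b [hx [d [hy e]]]].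
  have -> : ~~ a = ~~ (b (+) d) by move: e; case: (a); case: (b); case: (d).
  exact: m2_homog.
- by move=> _; exact: homog0.
Qed.

(** With four or more letters, either the inner or the outer word has more than two. Lengths one,
    two and three give d d = 0, the Leibniz rule and the Jacobi identity. *)
Lemma dgla_maps_sq s :
  unsh s (fun A B => dgla_maps ((dgla_maps A : Pi g) :: B) : Pi g) = 0.
Proof.
have bm : @bml k (Pi g) (Pi g) (fun A B => dgla_maps ((dgla_maps A : Pi g) :: B)).
  split=> [B s1 s2 c x y|A].
    by rewrite mlin_dgla_maps (mlin_hd _ _ _ _ mlin_dgla_maps).
  exact: (mlin_cons _ mlin_dgla_maps).
move: s; apply: mlin_homog_eq; first exact: mlin_unsh.
  exact: mlin0.
move=> q s hs.
have [s4|] := ltnP 3 (size s).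
  apply: etrans (unsh0 _ s); apply: unsh_ext => A B e.
  have [A3|A3] := ltnP 2 (size A).
    have -> : dgla_maps A = 0 by case: A A3 {e} => [|? [|? [|? ?]]].
    exact: (mlin_hd0 _ mlin_dgla_maps).
  have : (1 < size B)%N.
    by rewrite -(ltn_add2l (size A)) e; apply: leq_ltn_trans s4; rewrite addn1.
  by case: B {e} => [|? [|? ?]].
case: s hs => [|x [|y [|z [|? ?]]]] //.
- by move=> _ _; rewrite /unsh /= linear0.
- move=> [a [hx _]] _; rewrite (unsh_cons _ bm hx) /=.
  by rewrite difK add0r; exact: m2_0l.
- move=> [a [hx [b [hy _]]]] _.
  rewrite (unsh_cons _ bm hx) (unsh_cons _ (bml_l x bm) hy).
  rewrite (unsh_cons _ (bml_gp a (bml_r x bm)) hy) /= addr0.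
  change (dif (m2 x y) + m2 (dif (x : g)) y + m2 (dif (gp a y : g)) x = 0).
  rewrite (dif_m2 _ hx) (gp_homog _ hy) linearZ_LR m2Zl.
  rewrite (m2_sym (x := dif (y : g)) (a := ~~ b) (b := a) _ hx); last first.
    by rewrite homog_Pi; exact: (dif_homog (x := y : g) hy).
  rewrite scalerA -signr_addb opprD [_ - _ + m2 (dif _) _]addrAC addNr add0r.
  have -> : a && b (+) ~~ b && a = a by case: (a); case: (b).
  by rewrite addNr.
- move=> [a [hx [b [hy [e [hz _]]]]]] _.
  rewrite (unsh_cons _ bm hx) (unsh_cons _ (bml_l x bm) hy).
  rewrite (unsh_cons _ (bml_gp a (bml_r x bm)) hy).
  rewrite (unsh_cons _ (bml_l y (bml_l x bm)) hz).
  rewrite (unsh_cons _ (bml_gp b (bml_r y (bml_l x bm))) hz).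
  rewrite (unsh_cons _ (bml_l y (bml_gp a (bml_r x bm))) hz).
  rewrite (unsh_cons _ (bml_gp b (bml_r y (bml_gp a (bml_r x bm)))) hz).
  cbv beta iota zeta delta [unsh dgla_maps map].
  change (dif 0 + m2 (m2 x y) z + (m2 (m2 x (gp b z)) y + 0) +
    (m2 (m2 (gp a y) (gp a z)) x + 0 + (0 + 0)) = 0 :> g).
  rewrite linear0 add0r !addr0 !(gp_homog _ hz) (gp_homog _ hy) !m2Zr !m2Zl.
  rewrite (m2_sym (x := m2 x z) (m2_homog hx hz) hy).
  rewrite (m2_sym (x := m2 y z) (m2_homog hy hz) hx) (m2_jacobi z hx hy).
  rewrite !scalerDr !scalerA -!signr_addb addrACA.
  set c1 := (-1) ^+ _; set c2 := (-1) ^+ _; set c3 := (-1) ^+ _.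
  have -> : c1 = -1 by rewrite /c1; case: (a); case: (b); case: (e) => /=; ring.
  have -> : c3 = - c2 by rewrite /c3 /c2; case: (a); case: (b); case: (e) => /=; ring.
  by rewrite scaleN1r scaleNr !subrr addr0.
Qed.

Lemma dgla_linf_exists : exists m : infty Com g, is_dgla_linf m.
Proof.
have hc : @cochain_of_parity k Com (Pi g) true (@dgla_maps k g).
  split; [exact: mlin_dgla_maps|by move=> _; exact: gsym_dgla_maps|exact: cparity_dgla_maps].
have hm := mkder_homog k_char0 hc.
have cm s : cochain (mkder k_char0 hc) s = dgla_maps s by exact: cochain_mkder.
have sq : forall f, der_app (mkder k_char0 hc) (der_app (mkder k_char0 hc) f) = 0.
  apply: (der_sq0 k_char0 hm) => s; rewrite -[RHS](dgla_maps_sq s).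
  by apply: unsh_ext => A B _; rewrite !cm.
have nc : no_const (mkder k_char0 hc).
  by move=> l; change (l (@gr k (Pi g) 0) = 0); rewrite !linear0.
by exists (Infty hm sq nc).
Qed.
End DglaLinf.

(** * Derived brackets *)

Section DerivedBrackets.
Variables (k : fieldType) (k_char0 : [pchar k] =i pred0) (V : superspace k) (h : dgla k).
Variables (i : {linear (Pi V) -> h}) (pr : {linear h -> (Pi V)}).
Hypotheses (i_prt : forall a x, i (prt a x) = prt a (i x))
  (pr_prt : forall a x, pr (prt a x) = prt a (pr x))
  (i_abelian : forall x y, brk (i x) (i y) = 0)
  (prK : forall w, pr (i w) = w)
  (ker_dif : forall x, pr x = 0 -> pr (dif x) = 0)
  (ker_brk : forall x y, pr x = 0 -> pr y = 0 -> pr (brk x y) = 0).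
Implicit Types (s : seq (Pi V)) (x y : Pi V) (a b p q : bool).

Lemma i_homog a x : homog a x -> @homog k (Pi h) (~~ a) (i x).
Proof. by rewrite homog_Pi negbK /homog -i_prt => ->. Qed.
Lemma i_gr x : i (gr x) = gr (i x).
Proof. by rewrite /gr linearB !i_prt. Qed.
Lemma pr_homog a (x : h) : homog a x -> homog a (pr x).
Proof. by rewrite /homog -pr_prt => ->. Qed.
Lemma pr_gr (x : h) : pr (gr x) = gr (pr x).
Proof. by rewrite /gr linearB !pr_prt. Qed.
Lemma m2_i x y : m2 (i x) (i y) = 0.
Proof. by rewrite /m2 -i_gr i_abelian oppr0. Qed.
Lemma gr_m2 (x y : h) : gr (m2 x y) = m2 (gr x) (gr y).
Proof. by rewrite /m2 linearN /= gr_brk. Qed.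

Lemma dif_i_homog a x : homog a x -> @homog k (Pi h) a (dif (i x)).
Proof.
move=> hx; rewrite homog_Pi; apply: dif_homog.
by rewrite /homog -i_prt hx.
Qed.

(* phi (w_1, ..., w_r) = +-[i w_1, [i w_2, ... d (i w_r)]], the derived bracket. *)
Fixpoint phi s : h :=
  if s is x :: s' then (if s' is [::] then dif (i x) else 0) + m2 (i x) (phi s') else 0.

Lemma phi1 x : phi [:: x] = dif (i x).
Proof. by rewrite /= m2_0r addr0. Qed.
Lemma phi_cons2 x y s : phi (x :: y :: s) = m2 (i x) (phi (y :: s)).
Proof. by rewrite [LHS]/= add0r. Qed.

Lemma phi_cons_cat z s1 x s2 : phi (z :: s1 ++ x :: s2) = m2 (i z) (phi (s1 ++ x :: s2)).
Proof. by case: s1 => [|w s1]; rewrite ?cat0s ?cat_cons phi_cons2. Qed.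

Lemma mlin_phi : @mlin k (Pi V) h phi.
Proof.
move=> s1; elim: s1 => [|z s1 IH] s2 a x y.
  rewrite /= linearP m2_linl scalerDr [RHS]addrACA; congr (_ + _).
  by case: s2 => [|? ?]; rewrite ?linearP ?scaler0 ?addr0.
by rewrite !cat_cons !phi_cons_cat (IH s2 a x y) m2_linr.
Qed.

Lemma phi_homog : @cparity k (Pi V) (Pi h) false phi.
Proof.
move=> a s; elim: s a => [|x s IH] a hs; first exact: homog0.
have [p [hx hs']] := hs; case: s IH hs hs' => [|y s] IH hs hs'.
  rewrite phi1; have -> : a = p by move: hs'; rewrite /=; case: (a); case: (p).
  exact: dif_i_homog.
rewrite phi_cons2; have -> : false (+) a = ~~ (~~ p (+) (false (+) (p (+) a))).
  by case: (a); case: (p).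
exact: m2_homog (i_homog hx) (IH _ hs').
Qed.

Lemma m2_i_swap a b x y (u : h) : homog a x -> homog b y ->
  m2 (i x) (m2 (i y) u) = (-1) ^+ (a && b) *: m2 (i y) (m2 (i x) u).
Proof.
move=> hx hy; rewrite (m2_jacobi _ (i_homog hx) (i_homog hy)) m2_i m2_0l scaler0 add0r.
by rewrite !negbK.
Qed.
Lemma m2_dif_i_swap a b x y : homog a x -> homog b y ->
  m2 (i x) (dif (i y)) = (-1) ^+ (a && b) *: m2 (i y) (dif (i x)).
Proof.
move=> hx hy; have := dif_m2 (i y) (i_homog hx).
rewrite m2_i linear0 (m2_sym (dif_i_homog hx) (i_homog hy)) => /esym/eqP.
rewrite oppr_eq0 addr_eq0 => /eqP/(congr1 (fun v => (-1) ^+ a *: v)) e.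
have -> : m2 (i x) (dif (i y)) = (-1) ^+ a *: - ((-1) ^+ (~~ a) *: m2 (i x) (dif (i y))).
  by rewrite -scalerN scalerA -scaleN1r -!scalerA scalerA; case: (a); rewrite /= ?expr0 ?expr1 ?scaleN1r ?scale1r ?opprK ?mulN1r ?mul1r ?mulr1 ?scaleN1r ?scale1r ?opprK.
by rewrite -e scalerA -signr_addb; case: (a); case: (b).
Qed.

(** Neighbouring brackets commute up to sign by the Jacobi identity, because the image of [i] is
    abelian; for the last two letters one differentiates [i x, i y] = 0. *)
Lemma gsym_phi : @gsym k (Pi V) h phi.
Proof.
move=> s1; elim: s1 => [|z s1 IH] s2 a b x y hx hy.
  rewrite !cat0s; case: s2 => [|z s2]; rewrite !phi_cons2.
    by rewrite !phi1; exact: m2_dif_i_swap.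
  exact: m2_i_swap.
by rewrite !cat_cons !phi_cons_cat -m2Zr; congr (m2 _ _); exact: IH.
Qed.

Let bmlp : @bml k (Pi V) h (fun A B => m2 (phi A) (phi B)).
Proof.
split=> [B|A] s1 s2 a x y; rewrite mlin_phi ?m2_linl ?m2_linr //.
Qed.

Lemma scale_half_double (x : h) : (2%:R : k)^-1 *: (x + x) = x.
Proof.
rewrite -mulr2n -scaler_nat scalerA mulVf ?scale1r //.
by rewrite ((pcharf0P k).1 k_char0).
Qed.

Lemma m2_linear_r (u : h) : linear (m2 u).
Proof. by move=> a x y; exact: m2_linr. Qed.

Lemma m2Mnr (x y : h) n : m2 x (y *+ n) = m2 x y *+ n.
Proof. by rewrite -!scaler_nat m2Zr. Qed.

(** Induction on the word. Each of the two places for the first letter x contributes the bracket of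
    d (i x) with [phi s], and after halving they cancel against the same term of d (phi (x :: s)).
    What remains is, by the derivation property of [m2 (i x)], this operator applied to the equation
    for s. *)
Lemma phi_mc s : dif (phi s) + (2%:R : k)^-1 *: unsh s (fun A B => m2 (phi A) (phi B)) = 0.
Proof.
have ml : @mlin k (Pi V) h (fun s => dif (phi s) + (2%:R : k)^-1 *: unsh s (fun A B => m2 (phi A) (phi B))).
  apply: mlinD; last exact/mlinZ/mlin_unsh.
  by apply: (mlin_linear (h := dif)) mlin_phi => a x y; rewrite linearP.
move: s; apply: mlin_homog_eq => //; first exact: mlin0.
move=> q s; elim: s q => [|x s IH] q.
  by rewrite /= linear0 m2_0l scaler0 addr0.
move=> [p [hx hs]].
have hix := i_homog hx; have hdx := dif_i_homog hx.
have Ed : dif (phi (x :: s)) = - m2 (dif (i x)) (phi s) + (-1) ^+ p *: m2 (i x) (dif (phi s)).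
  rewrite [phi _]/= linearD (dif_m2 _ hix) opprD.
  have -> : dif (if s is [::] then dif (i x) else 0) = 0.
    by case: (s) => [|? ?]; rewrite ?difK ?linear0.
  by rewrite add0r -scaleNr; congr (_ + _ *: _); case: (p); rewrite /= ?expr0 ?expr1 ?opprK.
have E1 : unsh s (fun A B => m2 (phi (x :: A)) (phi B)) =
    m2 (dif (i x)) (phi s) + unsh s (fun A B => m2 (m2 (i x) (phi A)) (phi B)).
  have mQ : @mlin k (Pi V) h (fun B => m2 (dif (i x)) (phi B)).
    exact: (mlin_linear (m2_linear_r _) mlin_phi).
  rewrite -(unsh_nill s mQ) -unshD; apply: unsh_ext => A B _.
  by rewrite [phi (x :: A)]/= m2Dl; case: (A) => [|? ?] //; rewrite m2_0l.
have E2 : unsh s (fun A B => m2 (phi (map (gp p) A)) (phi (x :: B))) =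
    m2 (dif (i x)) (phi s) +
    unsh s (fun A B => m2 (phi (map (gp p) A)) (m2 (i x) (phi B))).
  have mQ : @mlin k (Pi V) h (fun A => m2 (dif (i x)) (phi A)).
    exact: (mlin_linear (m2_linear_r _) mlin_phi).
  rewrite -(unsh_nilr s mQ) -unshD; apply: (unsh_exth hs) => a A B hA hB _.
  rewrite [phi (x :: B)]/= m2Dr; congr (_ + _).
  case: (B) => [|? ?]; last by rewrite m2_0r.
  rewrite (mlin_gp_homog _ mlin_phi hA) m2Zl (m2_sym (phi_homog hA) hdx) scalerA.
  by rewrite -signr_addb; case: (a); case: (p); rewrite /= ?expr0 ?scale1r.
have E3 : unsh s (fun A B => m2 (m2 (i x) (phi A)) (phi B)) +
    unsh s (fun A B => m2 (phi (map (gp p) A)) (m2 (i x) (phi B))) =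
    (-1) ^+ p *: m2 (i x) (unsh s (fun A B => m2 (phi A) (phi B))).
  rewrite (unsh_linear _ _ (m2_linear_r (i x))) -unshZ -unshD.
  apply: (unsh_exth hs) => a A B hA hB _.
  rewrite (mlin_gp_homog _ mlin_phi hA) m2Zl (m2_jacobi _ hix (phi_homog hA)).
  rewrite scalerDr !scalerA -!signr_addb.
  by congr (_ + _ *: _); case: (a); case: (p); rewrite /= ?expr0 ?expr1 ?scale1r.
rewrite (unsh_cons _ bmlp hx) E1 E2 Ed addrACA E3 scalerDr scale_half_double.
rewrite addrACA addNr add0r scalerA mulrC -scalerA -scalerDr -m2Zr -m2Dr.
by rewrite (IH _ hs) m2_0r scaler0.
Qed.

Definition mu s : Pi V := - pr (phi s).

Lemma mu0 : mu [::] = 0.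
Proof. by rewrite /mu linear0 oppr0. Qed.
Lemma mlin_mu : mlin mu.
Proof.
apply: (mlin_linear (h := fun x : h => - pr x : Pi V)) mlin_phi => a x y.
by rewrite linearP opprD scalerN.
Qed.
Lemma gsym_mu : gsym mu.
Proof.
apply: (gsym_linear (h := fun x : h => - pr x : Pi V)) gsym_phi => a x y.
by rewrite linearP opprD scalerN.
Qed.
Lemma mu_homog : cparity true mu.
Proof.
move=> a s hs; apply: homogN; apply: pr_homog.
by have := phi_homog hs; rewrite homog_Pi addFb.
Qed.
Lemma i_mu_homog a s : homog_word a s -> @homog k (Pi h) a (i (mu s)).
Proof. by move=> /mu_homog/i_homog; rewrite addTb negbK. Qed.

Definition phi_ker s : h := phi s + i (mu s).

Lemma pr_phi_ker s : pr (phi_ker s) = 0.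
Proof. by rewrite /phi_ker linearD prK /mu subrr. Qed.
Lemma mlin_phi_ker : @mlin k (Pi V) h phi_ker.
Proof.
apply: mlinD mlin_phi _; apply: (mlin_linear (h := i)) mlin_mu => a x y.
by rewrite linearP.
Qed.
Lemma gsym_phi_ker : @gsym k (Pi V) h phi_ker.
Proof.
apply: gsymD gsym_phi _; apply: (gsym_linear (h := i)) gsym_mu => a x y.
by rewrite linearP.
Qed.
Lemma phi_ker_homog : @cparity k (Pi V) (Pi h) false phi_ker.
Proof. by move=> a s hs; apply: (@homogD k (Pi h)); [exact: phi_homog|exact: i_mu_homog]. Qed.

Lemma unsh_phi_mu s : unsh s (fun A B => phi (mu A :: B)) =
  dif (i (mu s)) + unsh s (fun A B => m2 (i (mu A)) (phi B)).
Proof.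
have mQ : @mlin k (Pi V) h (fun A => dif (i (mu A))).
  by apply: (mlin_linear (h := fun x => dif (i x))) mlin_mu => a x y; rewrite !linearP.
rewrite -(unsh_nilr s mQ) -unshD; apply: unsh_ext => A B _ /=.
by case: B.
Qed.

Lemma bml_i_mu : @bml k (Pi V) h (fun A B => m2 (i (mu A)) (phi B)).
Proof.
by split=> [B|A] s1 s2 a x y; rewrite ?mlin_mu ?mlin_phi ?linearP ?m2_linl ?m2_linr.
Qed.
Lemma bml_mu_i : @bml k (Pi V) h (fun A B => m2 (phi A) (i (mu B))).
Proof.
by split=> [B|A] s1 s2 a x y; rewrite ?mlin_mu ?mlin_phi ?linearP ?m2_linl ?m2_linr.
Qed.

(** The bracket of [i mu] with itself vanishes, and the two mixed terms agree after exchanging the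
    parts. *)
Lemma unsh_phi_ker q s : homog_word q s ->
  unsh s (fun A B => m2 (phi_ker A) (phi_ker B)) =
    unsh s (fun A B => m2 (phi A) (phi B)) +
    (unsh s (fun A B => m2 (i (mu A)) (phi B)) + unsh s (fun A B => m2 (i (mu A)) (phi B))).
Proof.
move=> hs; have flip : unsh s (fun A B => m2 (phi A) (i (mu B))) =
    unsh s (fun A B => m2 (i (mu A)) (phi B)).
  apply: (unsh_flip hs bml_mu_i bml_i_mu) => a b A B hA hB.
  exact: m2_sym (phi_homog hA) (i_mu_homog hB).
rewrite -[X in X + unsh _ _]flip -!unshD; apply: unsh_ext => A B _.
by rewrite /phi_ker !(m2Dl, m2Dr) m2_i addr0 -addrA.
Qed.

(* Applying pr to the Maurer-Cartan equation of phi = phi_ker - i mu. *)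
Lemma mu_sq s : unsh s (fun A B => mu (mu A :: B)) = 0.
Proof.
have prl : linear (fun x : h => - pr x : Pi V).
  by move=> a x y; rewrite linearP opprD scalerN.
have ml1 : mlin (fun s => unsh s (fun A B => mu (mu A :: B))).
  apply: mlin_unsh; split=> [B|A]; last exact: mlin_cons mlin_mu.
  by move=> s1 s2 a x y; rewrite mlin_mu (mlin_hd _ _ _ _ mlin_mu).
move: s; apply: mlin_homog_eq => //; first exact: mlin0.
move=> q s hs.
rewrite -[LHS](unsh_linear s (fun A B => phi (mu A :: B)) prl) unsh_phi_mu.
have phiE : phi s = phi_ker s - i (mu s) by rewrite /phi_ker addrK.
have E : unsh s (fun A B => m2 (phi A) (phi B)) =
    unsh s (fun A B => m2 (phi_ker A) (phi_ker B)) -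
    (unsh s (fun A B => m2 (i (mu A)) (phi B)) + unsh s (fun A B => m2 (i (mu A)) (phi B))).
  by rewrite (unsh_phi_ker hs) addrK.
have := congr1 pr (phi_mc s); rewrite linear0 E phiE scalerBr scale_half_double linearB.
rewrite linearD linearB /= ker_dif ?pr_phi_ker // sub0r linearB linearZ /=.
have -> : pr (unsh s (fun A B => m2 (phi_ker A) (phi_ker B))) = 0.
  apply: etrans (unsh0 _ s); rewrite (unsh_linear (h := pr)); last by move=> a x y; by rewrite linearP.
  apply: unsh_ext => A B _; rewrite /m2 linearN /= ker_brk ?oppr0 ?pr_phi_ker //.
  by rewrite pr_gr pr_phi_ker linear0.
by rewrite scaler0 sub0r -opprD -linearD.
Qed.

(** The sum of [i (mu (mu A :: B))] vanishes by [mu_sq], so the source reduces to that of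
    [phi (mu A :: B)]. By [unsh_phi_mu] this is d (i mu) plus the bracket of [i mu] with [phi],
    exactly what [i mu] adds to the Maurer-Cartan expression of [phi]. *)
Lemma phi_ker_mc s : dif (phi_ker s) + (2%:R : k)^-1 *: unsh s (fun A B => m2 (phi_ker A) (phi_ker B)) =
  unsh s (fun A B => phi_ker (mu A :: B)).
Proof.
have bmc : @bml k (Pi V) h (fun A B => m2 (phi_ker A) (phi_ker B)).
  by split=> [B|A] s1 s2 a x y; rewrite mlin_phi_ker ?m2_linl ?m2_linr.
have ml1 : @mlin k (Pi V) h (fun s => unsh s (fun A B => phi_ker (mu A :: B))).
  apply: mlin_unsh; split=> [B|A]; last exact: mlin_cons mlin_phi_ker.
  by move=> s1 s2 a x y; rewrite mlin_mu (mlin_hd _ _ _ _ mlin_phi_ker).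
move: s; apply: mlin_homog_eq => //.
  apply: mlinD; last exact/mlinZ/mlin_unsh.
  by apply: (mlin_linear (h := dif)) mlin_phi_ker => a x y; rewrite linearP.
move=> q s hs.
have -> : unsh s (fun A B => phi_ker (mu A :: B)) =
    unsh s (fun A B => phi (mu A :: B)).
  rewrite unshD -[X in _ + X](unsh_linear s (fun A B => mu (mu A :: B)) (h := i)); last first.
    by move=> a x y; by rewrite linearP.
  by rewrite mu_sq linear0 addr0.
rewrite (unsh_phi_ker hs) scalerDr scale_half_double unsh_phi_mu /phi_ker linearD /= addrACA phi_mc add0r.
by [].
Qed.

(** The coefficients of the Euler derivation: the identity in arity one. *)
Definition unit_word s : Pi V := if s is [:: x] then x else 0.

Lemma mlin_unit : mlin unit_word.
Proof.
move=> [|z [|? ?]] [|w ?] a x y //=; by rewrite scaler0 addr0.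
Qed.
Lemma gsym_unit : gsym unit_word.
Proof.
by move=> [|z [|? ?]] s2 a b x y hx hy /=; rewrite scaler0.
Qed.
Lemma unit_homog : cparity false unit_word.
Proof.
move=> a [|x [|y s]] hs; [exact: homog0| |exact: homog0].
by have [p [hx e]] := hs; move: e hx; case: (p); case: (a).
Qed.

(** Every letter can be brought to the front of the iterated bracket, which reproduces [phi s] once
    per letter. A single letter is the exception, [phi] of the empty rest being 0; the subtracted
    term accounts for it. This is the z-derivative needed for [wform]. *)
Lemma phi_euler s : unsh s (fun A B => m2 (i (unit_word A)) (phi B)) =
  phi s *+ size s - dif (i (unit_word s)).
Proof.
have bmu : @bml k (Pi V) h (fun A B => m2 (i (unit_word A)) (phi B)).
  by split=> [B|A] s1 s2 a x y; rewrite ?mlin_unit ?mlin_phi ?linearP ?m2_linl ?m2_linr.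
have ml1 : @mlin k (Pi V) h (fun s => phi s *+ size s - dif (i (unit_word s))).
  apply: mlinD.
    by move=> s1 s2 a x y; rewrite !size_cat /= mlin_phi mulrnDl scalerMnr.
  apply: (mlin_linear (h := fun x => - dif (i x))) mlin_unit => a x y.
  by rewrite [i _]linearP [dif _]linearP /= opprD scalerN.
move: s; apply: mlin_homog_eq => //; first exact: mlin_unsh.
move=> q s; elim: s q => [|x s IH] q.
  by rewrite /= !linear0 m2_0l ?subr0 ?addr0.
move=> [p [hx hs]].
have hix := i_homog hx.
rewrite (unsh_cons _ bmu hx).
have E1 : unsh s (fun A B => m2 (i (unit_word (x :: A))) (phi B)) = m2 (i x) (phi s).
  have mQ : @mlin k (Pi V) h (fun B => m2 (i x) (phi B)).
    exact: (mlin_linear (m2_linear_r _) mlin_phi).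
  rewrite -(unsh_nill s mQ); apply: unsh_ext => A B _.
  by case: A => [|? ?] //=; rewrite linear0 m2_0l.
have E2 : unsh s (fun A B => m2 (i (unit_word (map (gp p) A))) (phi (x :: B))) =
    m2 (i (unit_word (map (gp p) s))) (dif (i x)) +
    m2 (i x) (unsh s (fun A B => m2 (i (unit_word A)) (phi B))).
  have mQ : @mlin k (Pi V) h (fun A => m2 (i (unit_word (map (gp p) A))) (dif (i x))).
    apply: (mlin_linear (h := fun y => m2 (i y) (dif (i x)))).
      by move=> a y z; rewrite linearP m2_linl.
    exact: (mlin_map_gp p mlin_unit).
  rewrite (unsh_linear _ _ (m2_linear_r (i x))) -(unsh_nilr s mQ) -unshD.
  apply: (unsh_exth hs) => a A B hA hB _.
  rewrite [phi (x :: B)]/= m2Dr; congr (_ + _).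
    by case: (B) => [|? ?] //; rewrite m2_0r.
  rewrite (mlin_gp_homog _ mlin_unit hA) linearZ m2Zl.
  rewrite (m2_i_swap _ hx (unit_homog hA)).
  by [].
rewrite E1 E2 (IH _ hs).
case: s hs {IH E1 E2} => [|y [|z s]] hs.
- by rewrite /= !linear0 m2_0l m2_0r !addr0 mulr1n subrr ?subr0 ?m2_0r ?addr0 ?m2_0r.
- have [b [hy _]] := hs.
  rewrite phi_cons2 !phi1 /= mulr1n subrr m2_0r addr0 [i 0]linear0 [dif 0]linear0 subr0.
  rewrite (gp_homog _ hy) linearZ m2Zl -(m2_dif_i_swap hx hy).
  by rewrite mulr2n.
- rewrite phi_cons2 [unit_word _]/= [unit_word _]/= [i 0]linear0 [dif 0]linear0 m2_0l add0r !subr0.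
  by rewrite m2Mnr -mulrS -!phi_cons2.
Qed.
End DerivedBrackets.

(** * The map to the homotopy fiber *)

Section Monomials.
Variables (k : fieldType) (h : dgla k).
Implicit Types (x y : h) (n m r : nat).

Definition delta n x : nat -> h := fun m => if m == n then x else 0.
Lemma fin_delta n x : finsupp_seq (delta n x).
Proof. by exists n.+1 => m nm; rewrite /delta gtn_eqF. Qed.
(* x z^n and x z^n dz. *)
Definition zm n x : forms h := mkform (fin_delta n x) (@fin0 k h).
Definition dzm n x : forms h := mkform (@fin0 k h) (fin_delta n x).

Lemma fz_zm n x r : fz (zm n x) r = if r == n then x else 0. Proof. by []. Qed.
Lemma fdz_zm n x r : fdz (zm n x) r = 0. Proof. by []. Qed.
Lemma fz_dzm n x r : fz (dzm n x) r = 0. Proof. by []. Qed.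
Lemma fdz_dzm n x r : fdz (dzm n x) r = if r == n then x else 0. Proof. by []. Qed.

Lemma zm_linear n : linear (zm n).
Proof.
by move=> a x y; apply: formP => r; rewrite ?fz_lin ?fdz_lin ?fz_zm ?fdz_zm;
  try case: eqP; rewrite ?scaler0 ?addr0.
Qed.
Lemma dzm_linear n : linear (dzm n).
Proof.
by move=> a x y; apply: formP => r; rewrite ?fz_lin ?fdz_lin ?fz_dzm ?fdz_dzm;
  try case: eqP; rewrite ?scaler0 ?addr0.
Qed.
HB.instance Definition _ n := GRing.isLinear.Build k h (forms h) *:%R (zm n) (zm_linear n).
HB.instance Definition _ n := GRing.isLinear.Build k h (forms h) *:%R (dzm n) (dzm_linear n).

Lemma conv_delta n m x y r :
  conv (delta n x) (delta m y) r = if r == (n + m)%N then brk x y else 0.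
Proof.
rewrite /conv /delta; case: eqP => [->|rnm].
  have nm : (n < (n + m).+1)%N by rewrite ltnS leq_addr.
  rewrite (bigD1 (Ordinal nm)) //= eqxx addKn eqxx big1 ?addr0 // => t tn.
  by case: eqP => // e; [case/eqP: tn; apply: val_inj|rewrite brk0l].
apply: big1 => t _; case: eqP => tn; last by rewrite brk0l.
case: eqP => rm; last by rewrite brk0r.
by case: rnm; rewrite -tn -rm subnKC // -ltnS.
Qed.
Lemma conv0l (q : nat -> h) r : conv (fun=> 0) q r = 0.
Proof. by apply: big1 => t _; rewrite brk0l. Qed.
Lemma conv0r (q : nat -> h) r : conv q (fun=> 0) r = 0.
Proof. by apply: big1 => t _; rewrite brk0r. Qed.

Lemma fz_gr (u : forms h) r : fz (gr u) r = gr (fz u r).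
Proof. by rewrite /gr fzD fzN. Qed.
Lemma fdz_gr (u : forms h) r : fdz (gr u) r = - gr (fdz u r).
Proof. by rewrite /gr fdzD fdzN opprB. Qed.

Lemma fz_m2 (u v : forms h) r : fz (m2 u v) r = - conv (fun t => gr (fz u t)) (fz v) r.
Proof.
rewrite /m2 fzN fz_brk; congr (- _); apply: conv_ext => // t; exact: fz_gr.
Qed.
Lemma fdz_m2 (u v : forms h) r : fdz (m2 u v) r =
  conv (fun t => gr (fdz u t)) (fun t => gr (fz v t)) r - conv (fun t => gr (fz u t)) (fdz v) r.
Proof.
rewrite /m2 fdzN fdz_brk opprD addrC.
have -> : conv (fz (gr u)) (fdz v) r = conv (fun t => gr (fz u t)) (fdz v) r.
  by apply: conv_ext => // t; exact: fz_gr.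
congr (_ - _); rewrite (conv_ext (p' := fun t => -1 *: gr (fdz u t)) _ _ (frefl _)) => [|t]; last first.
  by rewrite fdz_gr scaleN1r.
by rewrite convZl scaleN1r opprK.
Qed.
Lemma gr_delta n x r : gr (delta n x r) = delta n (gr x) r.
Proof. by rewrite /delta; case: eqP; rewrite ?linear0. Qed.

Lemma m2_zz n m x y : m2 (zm n x) (zm m y) = zm (n + m) (m2 x y).
Proof.
apply: formP => r; rewrite ?fz_m2 ?fdz_m2 ?fz_zm ?fdz_zm.
  rewrite (conv_ext _ (gr_delta n x) (frefl _)) conv_delta.
  by case: eqP; rewrite ?oppr0.
rewrite (conv_ext (p' := fun=> 0) _ _ (frefl _)) => [|t]; last by rewrite fdz_zm linear0.
rewrite conv0l sub0r (conv_ext (q' := fun=> 0) _ (frefl _)) => [|t]; last by [].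
by rewrite conv0r oppr0.
Qed.
Lemma m2_zd n m x y : m2 (zm n x) (dzm m y) = dzm (n + m) (m2 x y).
Proof.
apply: formP => r; rewrite ?fz_m2 ?fdz_m2 ?fz_dzm ?fdz_dzm.
  by rewrite (conv_ext (q' := fun=> 0) _ (frefl _)) // conv0r oppr0.
rewrite (conv_ext (p' := fun=> 0) _ _ (frefl _)) => [|t]; last by rewrite fdz_zm linear0.
rewrite conv0l sub0r (conv_ext _ (gr_delta n x) (frefl _)) conv_delta.
by case: eqP; rewrite ?oppr0.
Qed.
Lemma m2_dz n m x y : m2 (dzm n x) (zm m y) = - dzm (n + m) (m2 x (gr y)).
Proof.
rewrite -linearN; apply: formP => r; rewrite ?fz_m2 ?fdz_m2 ?fz_dzm ?fdz_dzm.
  rewrite (conv_ext (p' := fun=> 0) _ _ (frefl _)) => [|t]; last by rewrite fz_dzm linear0.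
  by rewrite conv0l oppr0.
rewrite (conv_ext _ (gr_delta n x) (gr_delta m y)) conv_delta.
rewrite (conv_ext (q' := fun=> 0) _ (frefl _)) // conv0r subr0 /m2 opprK.
by [].
Qed.
Lemma m2_dd n m x y : m2 (dzm n x) (dzm m y) = 0.
Proof.
apply: formP => r; rewrite ?fz_m2 ?fdz_m2 ?fz0 ?fdz0.
  by rewrite (conv_ext (q' := fun=> 0) _ (frefl _)) // conv0r oppr0.
rewrite (conv_ext (q' := fun=> 0) _ (frefl _)) => [|t]; last by rewrite fz_dzm linear0.
rewrite conv0r sub0r (conv_ext (p' := fun=> 0) _ _ (frefl _)) => [|t]; last by rewrite fz_dzm linear0.
by rewrite conv0l oppr0.
Qed.
Lemma dif_dzm n x : dif (dzm n x) = dzm n (dif x).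
Proof.
apply: formP => r; first by rewrite [LHS]fz_dif fz_dzm linear0.
rewrite [LHS]fdz_dif !fdz_dzm /zder fz_dzm mul0rn linear0 addr0.
by case: eqP; rewrite ?linear0.
Qed.
Lemma dif_zm n x : dif (zm n x) = zm n (dif x) + dzm n.-1 (gr x *+ n).
Proof.
apply: formP => r.
  rewrite [LHS]fz_dif fzD fz_dzm !fz_zm addr0.
  by case: eqP; rewrite ?linear0.
rewrite [LHS]fdz_dif fdzD fdz_dzm !fdz_zm /zder fz_zm linear0 !add0r.
case: n => [|n] /=; first by rewrite mul0rn linear0; case: eqP; rewrite ?mulr0n.
rewrite eqSS; case: eqP => [->|_]; last by rewrite mul0rn linear0.
by rewrite raddfMn.
Qed.
Lemma homog_zm a n x : @homog k (Pi h) a x -> @homog k (Pi (forms h)) a (zm n x).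
Proof.
move=> hx; apply: (iffLR (iff_sym (form_homog (~~ a) (zm n x)))); split=> r.
  by rewrite fz_zm; case: eqP => // _; exact: homog0.
by rewrite fdz_zm; exact: homog0.
Qed.
Lemma homog_dzm a n x : @homog k (Pi h) (~~ a) x -> @homog k (Pi (forms h)) a (dzm n x).
Proof.
move=> hx; apply: (iffLR (iff_sym (form_homog (~~ a) (dzm n x)))); split=> r.
  by rewrite fz_dzm; exact: homog0.
by rewrite fdz_dzm; case: eqP => // _; exact: homog0.
Qed.
End Monomials.

Lemma cancel_three (Z : zmodType) (a1 a2 a3 a4 a5 t : Z) :
  a1 + a2 + (a3 + a4) + a5 + (- a1 + t - (a2 + a5)) = a3 + t + a4.
Proof.
rewrite opprD !addrA [LHS](ACl ((1*6)*(2*8)*(5*9)*3*7*4)) /= !subrr !add0r.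
by [].
Qed.

Section FiberMap.
Variables (k : fieldType) (k_char0 : [pchar k] =i pred0) (V : superspace k) (g h : dgla k).
Variables (j : g -> h) (Hj : is_dgla_map j) (j_inj : injective j).
Variables (i : {linear (Pi V) -> h}) (pr : {linear h -> (Pi V)}).
Hypotheses (i_prt : forall a x, i (prt a x) = prt a (i x))
  (pr_prt : forall a x, pr (prt a x) = prt a (pr x))
  (i_abelian : forall x y, brk (i x) (i y) = 0)
  (prK : forall w, pr (i w) = w)
  (pr_j : forall x, pr (j x) = 0) (ker_pr : forall y, pr y = 0 -> exists x, j x = y).
Variable f : seq (Pi V) -> Pi g.
Local Notation phi := (phi i).
Local Notation mu := (mu i pr).
Local Notation phi_ker := (phi_ker i pr).
Hypothesis jf : forall s, j (f s) = phi_ker s.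
Implicit Types (s : seq (Pi V)) (a b p q : bool).

Lemma ker_dif x : pr x = 0 -> pr (dif x) = 0.
Proof. by move=> /ker_pr[y <-]; rewrite -(dgm_dif Hj) pr_j. Qed.
Lemma ker_brk x y : pr x = 0 -> pr y = 0 -> pr (brk x y) = 0.
Proof. by move=> /ker_pr[x' <-] /ker_pr[y' <-]; rewrite -(dgm_brk Hj) pr_j. Qed.

Let mphi := mlin_phi i.
Let mmu := mlin_mu i pr.
Let musq := mu_sq k_char0 i_prt pr_prt i_abelian prK ker_dif ker_brk.

(** The dz-term is the generator of the path; [gr] is the sign of moving dz to the right of
    [i x]. *)
Definition wform s : forms h :=
  zm (size s) (phi s) + zm 1 (i (mu s)) + dzm 0 (i (gr (unit_word s))).

Lemma wform_m2 A B : m2 (wform A) (wform B) =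
  zm (size A + size B) (m2 (phi A) (phi B)) +
  (zm (size A).+1 (m2 (phi A) (i (mu B))) + zm (size B).+1 (m2 (i (mu A)) (phi B))) +
  (dzm (size A) (m2 (phi A) (i (gr (unit_word B)))) -
   dzm (size B) (m2 (i (gr (unit_word A))) (gr (phi B)))).
Proof.
set R := (X in _ = X); rewrite /wform !(m2Dl, m2Dr) !(m2_zz, m2_zd, m2_dz, m2_dd) !(m2_i i_prt i_abelian).
rewrite -(i_gr i_prt (mu B)) (m2_i i_prt i_abelian) !linear0 ?oppr0 !addr0 !addn0 !add0n addn1 add1n.
by rewrite {}/R -!addrA; congr (_ + (_ + _)); rewrite addrCA.
Qed.

Lemma bml_zm n (P : seq (Pi V) -> seq (Pi V) -> h) (sz : seq (Pi V) -> seq (Pi V) -> nat) :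
  bml P -> (forall A A' B B', size A = size A' -> size B = size B' -> sz A B = sz A' B') ->
  @bml k (Pi V) (forms h) (fun A B => zm (sz A B + n) (P A B)).
Proof.
move=> [m1 m2'] hsz; split=> [B|A] s1 s2 a x y.
  by rewrite m1 linearP; congr (_ *: zm _ _ + zm _ _); congr (_ + _)%N; apply: hsz; rewrite ?size_cat.
by rewrite m2' linearP; congr (_ *: zm _ _ + zm _ _); congr (_ + _)%N; apply: hsz; rewrite ?size_cat.
Qed.
Lemma bml_dzm (P : seq (Pi V) -> seq (Pi V) -> h) (sz : seq (Pi V) -> seq (Pi V) -> nat) :
  bml P -> (forall A A' B B', size A = size A' -> size B = size B' -> sz A B = sz A' B') ->
  @bml k (Pi V) (forms h) (fun A B => dzm (sz A B) (P A B)).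
Proof.
move=> [m1 m2'] hsz; split=> [B|A] s1 s2 a x y.
  by rewrite m1 linearP; congr (_ *: dzm _ _ + dzm _ _); apply: hsz; rewrite ?size_cat.
by rewrite m2' linearP; congr (_ *: dzm _ _ + dzm _ _); apply: hsz; rewrite ?size_cat.
Qed.

Lemma mlin_zm (P : seq (Pi V) -> h) (sz : seq (Pi V) -> nat) :
  mlin P -> (forall A A', size A = size A' -> sz A = sz A') ->
  @mlin k (Pi V) (forms h) (fun A => zm (sz A) (P A)).
Proof.
move=> mP hsz s1 s2 a x y; rewrite mP linearP.
by congr (_ *: zm _ _ + zm _ _); apply: hsz; rewrite !size_cat.
Qed.
Lemma mlin_i_gr_unit : @mlin k (Pi V) h (fun s => i (gr (unit_word s))).
Proof.
apply: (mlin_linear (h := fun x => i (gr x))) (@mlin_unit k V) => a x y.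
by rewrite !linearP.
Qed.
Lemma mlin_wform : @mlin k (Pi V) (forms h) wform.
Proof.
apply: mlinD; first apply: mlinD.
- exact: mlin_zm.
- apply: (mlin_linear (h := fun x => zm 1 (i x))) mmu => a x y; by rewrite !linearP.
- apply: (mlin_linear (h := dzm 0)) mlin_i_gr_unit => a x y; by rewrite linearP.
Qed.
Lemma gsym_wform : @gsym k (Pi V) (forms h) wform.
Proof.
apply: gsymD; first apply: gsymD.
- move=> s1 s2 a b x y hx hy; rewrite (gsym_phi i_prt i_abelian _ _ hx hy) linearZ.
  by rewrite !size_cat.
- apply: (gsym_linear (h := fun x => zm 1 (i x))) (gsym_mu pr i_prt i_abelian) => a x y; by rewrite !linearP.
- apply: (gsym_linear (h := fun x => dzm 0 (i (gr x)))) (@gsym_unit k V) => a x y; by rewrite !linearP.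
Qed.
Lemma wform_homog : @cparity k (Pi V) (Pi (forms h)) false wform.
Proof.
move=> a s hs; apply: (@homogD k (Pi (forms h))); first apply: (@homogD k (Pi (forms h))).
- by apply: homog_zm; exact: phi_homog.
- by apply: homog_zm; exact: i_mu_homog.
- apply: homog_dzm; apply: (i_homog i_prt); exact: (homog_gr (unit_homog hs)).
Qed.

(** The part without dz repeats [phi_ker_mc] with powers of z, which match because |A| + |B| = |s|.
    In the dz-part the derivative of the term with z^|s| cancels against the bracket with the
    generator by [phi_euler], and the derivative of the term with [i mu] is the dz-part of the
    source. *)
Lemma wform_mc s : dif (wform s) + (2%:R : k)^-1 *: unsh s (fun A B => m2 (wform A) (wform B)) =
  unsh s (fun A B => wform (mu A :: B)).
Proof.
have bw : @bml k (Pi V) (forms h) (fun A B => m2 (wform A) (wform B)).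
  by split=> [B|A] s1 s2 a x y; rewrite mlin_wform ?m2_linl ?m2_linr.
move: s; apply: mlin_homog_eq.
- apply: mlinD; last exact/mlinZ/mlin_unsh.
  by apply: (mlin_linear (h := dif)) mlin_wform => a x y; rewrite linearP.
- apply: mlin_unsh; split=> [B|A]; last exact: mlin_cons mlin_wform.
  by move=> s1 s2 a x y; rewrite mmu (mlin_hd _ _ _ _ mlin_wform).
move=> q s hs.
pose T := unsh s (fun A B => zm (size B).+1 (m2 (i (mu A)) (phi B))).
pose dT := unsh s (fun A B => - dzm (size B) (m2 (i (gr (unit_word A))) (gr (phi B)))).
(* Only a single letter A contributes, so the exponent |B| is |s| - 1 and leaves the sum. *)
have EdT : dT = - dzm (size s).-1 (gr (phi s) *+ size s - gr (dif (i (unit_word s)))).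
  rewrite -raddfMn -linearB -(phi_euler i_prt i_abelian).
  rewrite (unsh_linear (h := fun x => - dzm (size s).-1 (gr x))); last first.
    by move=> a x y; rewrite [gr _]linearP [dzm _ _]linearP /= opprD scalerN.
  apply: unsh_ext => A B e; rewrite gr_m2 -(i_gr i_prt).
  case: A e => [|x [|? ?]] e /=; rewrite ?linear0 ?m2_0l ?linear0 ?oppr0 //.
  by rewrite -e.
have flip1 : unsh s (fun A B => zm (size A).+1 (m2 (phi A) (i (mu B)))) = T.
  apply: (unsh_flip hs).
  - have := @bml_zm 1 _ (fun A _ => size A) (bml_mu_i i pr) (fun A A' _ _ e _ => e).
    by under eq_fun => A do under eq_fun => B do rewrite addn1.
  - have := @bml_zm 1 _ (fun _ B => size B) (bml_i_mu i pr) (fun _ _ _ _ _ e => e).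
    by under eq_fun => A do under eq_fun => B do rewrite addn1.
  move=> a b A B hA hB; rewrite -linearZ /=; congr (zm _ _).
  exact: m2_sym (phi_homog i_prt hA) (i_mu_homog i_prt pr_prt hB).
have flip2 : unsh s (fun A B => dzm (size A) (m2 (phi A) (i (gr (unit_word B))))) = dT.
  apply: (unsh_flip hs).
  - apply: (bml_dzm (sz := fun A _ => size A)) => //.
    by split=> [B|A] s1 s2 a x y; rewrite ?mphi ?mlin_i_gr_unit ?m2_linl ?m2_linr.
  - suff [m1 m2'] : @bml k (Pi V) (forms h) (fun A B => dzm (size B) (m2 (i (gr (unit_word A))) (gr (phi B)))).
      split=> [B|A].
        by apply: (mlin_linear (h := fun x : forms h => - x)) (m1 B) => a x y; rewrite opprD scalerN.
      by apply: (mlin_linear (h := fun x : forms h => - x)) (m2' A) => a x y; rewrite opprD scalerN.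
    apply: (bml_dzm (sz := fun _ B => size B)) => //.
    by split=> [B|A] s1 s2 a x y; rewrite ?mphi ?mlin_i_gr_unit ?linearP ?m2_linl ?m2_linr.
  move=> a b A B hA hB; rewrite scalerN -linearZ -linearN /=; congr (dzm _ _).
  have hp := phi_homog i_prt hA.
  have hu := i_homog i_prt (homog_gr (unit_homog hB)).
  rewrite (m2_sym hp hu) (gr_homog (V := h) (a := ~~ a)) ?m2Zr; last exact: hp.
  rewrite scalerA -signr_addb -scaleNr; congr (_ *: _).
  by case: (a); case: (b); rewrite /= ?expr0 ?expr1 ?opprK.
have E : unsh s (fun A B => m2 (wform A) (wform B)) =
   zm (size s) (unsh s (fun A B => m2 (phi A) (phi B))) + (T + T) + (dT + dT).
  rewrite -{1}flip1 -{1}flip2 (unsh_linear (h := zm (size s))); last exact: zm_linear.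
  rewrite -!unshD; apply: unsh_ext => A B e.
  by rewrite wform_m2 e.
have ER : unsh s (fun A B => wform (mu A :: B)) =
    zm 1 (dif (i (mu s))) + T + dzm 0 (i (gr (mu s))).
  rewrite /wform !unshD; congr (_ + _); last first.
    have mQ : @mlin k (Pi V) (forms h) (fun A => dzm 0 (i (gr (mu A)))).
      by apply: (mlin_linear (h := fun x => dzm 0 (i (gr x)))) mmu => a x y; rewrite !linearP.
    rewrite -(unsh_nilr s mQ); apply: unsh_ext => A B _.
    by case: B => [|? ?] //=; rewrite !linear0.
  rewrite [X in _ + X](_ : _ = 0) ?addr0; last first.
    rewrite -(unsh_linear (h := fun x => zm 1 (i x))); last by move=> a x y; rewrite !linearP.
    by rewrite musq !linear0.
  have mQ : @mlin k (Pi V) (forms h) (fun A => zm 1 (dif (i (mu A)))).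
    by apply: (mlin_linear (h := fun x => zm 1 (dif (i x)))) mmu => a x y; rewrite !linearP.
  rewrite -(unsh_nilr s mQ) -unshD; apply: unsh_ext => A B _.
  rewrite [phi _]/= linearD; congr (_ + _).
  by case: B => [|? ?] //=; rewrite linear0.
rewrite E ER 2!scalerDr !(scale_half_double k_char0) EdT.
have difD (u v : forms h) : dif (u + v) = dif u + dif v by exact: linearD.
have -> : dif (wform s) = zm (size s) (dif (phi s)) + dzm (size s).-1 (gr (phi s) *+ size s) +
   (zm 1 (dif (i (mu s))) + dzm 0 (gr (i (mu s)))) + dzm 0 (dif (i (gr (unit_word s)))).
  by rewrite /wform 2!difD !dif_zm dif_dzm mulr1n.
have -> : (2%:R : k)^-1 *: zm (size s) (unsh s (fun A B => m2 (phi A) (phi B))) =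
    - zm (size s) (dif (phi s)).
  apply/eqP; rewrite -addr_eq0 -linearZ -linearD /= addrC.
  by rewrite (phi_mc k_char0 i_prt) linear0.
(* In the last term the exponent may be replaced by 0, because [unit_word s] is 0 unless s has one
   letter. *)
have -> : dzm (size s).-1 (gr (phi s) *+ size s - gr (dif (i (unit_word s)))) =
    dzm (size s).-1 (gr (phi s) *+ size s) + dzm 0 (dif (i (gr (unit_word s)))).
  rewrite linearB /=; congr (_ + _); rewrite (i_gr i_prt) gr_dif linearN /=.
  case: (s) => [|x [|y t]] //=; by rewrite ![i 0]linear0 ![dif 0]linear0 ![gr 0]linear0 !linear0.
rewrite !(i_gr i_prt).
exact: cancel_three.
Qed.
End FiberMap.

Section DglaMapFacts.
Variables (k : fieldType) (g h : dgla k) (j : g -> h) (Hj : is_dgla_map j).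

Lemma dgmD x y : j (x + y) = j x + j y.
Proof. by rewrite -[x]scale1r (dgm_lin Hj) !scale1r. Qed.
Lemma dgm0 : j 0 = 0.
Proof. by have := dgm_lin Hj (-1) 0 0; rewrite scaler0 addr0 scaleN1r addNr. Qed.
Lemma dgmZ (c : k) x : j (c *: x) = c *: j x.
Proof. by rewrite -[_ *: x]addr0 (dgm_lin Hj) dgm0 addr0. Qed.
Lemma dgmN x : j (- x) = - j x.
Proof. by rewrite -scaleN1r dgmZ scaleN1r. Qed.
Lemma dgm_gr x : j (gr x) = gr (j x).
Proof. by rewrite /gr dgmD dgmN !(dgm_prt Hj). Qed.
Lemma dgm_m2 x y : j (m2 x y) = m2 (j x) (j y).
Proof. by rewrite /m2 dgmN (dgm_brk Hj) dgm_gr. Qed.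

Definition fib1 (x : fiber Hj) : g := (val x).1.
Definition fib2 (x : fiber Hj) : forms h := (val x).2.
Lemma fib_inj (x y : fiber Hj) : fib1 x = fib1 y -> fib2 x = fib2 y -> x = y.
Proof.
move=> e1 e2; apply: val_inj; move: e1 e2; rewrite /fib1 /fib2.
by case: (val x) => a1 a2; case: (val y) => b1 b2 /= -> ->.
Qed.
Lemma fib1_map : is_dgla_map fib1. Proof. by split. Qed.
Lemma fib2_map : is_dgla_map (h := forms h) fib2.
Proof.
split.
- move=> a x y; rewrite /fib2 (_ : val (a *: x + y) = a *: val x + val y); last exact: linearP.
  by case: (val x) => x1 x2; case: (val y).
- move=> a x; have e : val (prt a x) = @dsum_prt k g (forms h) a (val x) by [].
  by rewrite /fib2 e.
- move=> x; have e : val (dif x) = @dsum_dif k g (forms h) (val x) by [].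
  by rewrite /fib2 e.
- move=> x y; have e : val (brk x y) = @dsum_brk k g (forms h) (val x) (val y) by [].
  by rewrite /fib2 e.
Qed.
End DglaMapFacts.

Section FiberSequence.
Variables (k : fieldType) (k_char0 : [pchar k] =i pred0) (V : superspace k) (g h : dgla k).
Variables (j : g -> h) (Hj : is_dgla_map j) (j_inj : injective j).
Variables (i : {linear (Pi V) -> h}) (pr : {linear h -> (Pi V)}).
Hypotheses (i_prt : forall a x, i (prt a x) = prt a (i x))
  (pr_prt : forall a x, pr (prt a x) = prt a (pr x))
  (i_abelian : forall x y, brk (i x) (i y) = 0)
  (prK : forall w, pr (i w) = w)
  (pr_j : forall x, pr (j x) = 0) (ker_pr : forall y, pr y = 0 -> exists x, j x = y).
Variable f : seq (Pi V) -> Pi g.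
Local Notation phi := (phi i).
Local Notation mu := (mu i pr).
Local Notation phi_ker := (phi_ker i pr).
Local Notation wform := (wform i pr).
Hypothesis jf : forall s, j (f s) = phi_ker s.

Lemma fiber_point_mem s : @fiber_mem k g h j (f s : g, wform s).
Proof.
split.
  rewrite /= /wform !fzD !fz_zm fz_dzm /=.
  by case: s => [|x s] /=; rewrite !addr0.
(* Both exponents that occur, |s| and 1, lie below this bound. *)
exists (size s).+2; split=> [n sn|].
  rewrite /wform !fzD !fz_zm fz_dzm !addr0.
  by rewrite !gtn_eqF ?addr0 // (leq_trans _ sn).
rewrite /= jf /phi_ker; under eq_bigr do rewrite /wform !fzD !fz_zm fz_dzm addr0.
rewrite big_split /=; congr (_ + _).
  have ss : (size s < (size s).+2)%N by [].
  rewrite (bigD1 (Ordinal ss)) //= eqxx big1 ?addr0 // => n ne.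
  by case: eqP => // e; case/eqP: ne; apply: val_inj.
have s1 : (1 < (size s).+2)%N by [].
rewrite (bigD1 (Ordinal s1)) //= big1 ?addr0 // => n ne.
by case: eqP => // e; case/eqP: ne; apply: val_inj.
Qed.

Definition fiber_point s : fiber Hj :=
  @insub_of k (dsum g (forms h)) (subdgla_sub (fiber_closed Hj)) (f s : g, wform s)
    (fiber_point_mem s).
Lemma fib1_point s : fib1 (fiber_point s) = f s. Proof. by []. Qed.
Lemma fib2_point s : fib2 (fiber_point s) = wform s. Proof. by []. Qed.

(** Of [f] only [j (f s)] is given; injectivity of [j] transports multilinearity, and below symmetry
    and parity, from [phi_ker]. *)
Lemma mlin_f : @mlin k (Pi V) g f.
Proof.
by move=> s1 s2 a x y; apply: j_inj; rewrite (dgm_lin Hj) !jf (mlin_phi_ker i pr).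
Qed.
Lemma gsym_f : @gsym k (Pi V) g f.
Proof.
move=> s1 s2 a b x y hx hy; apply: j_inj; rewrite (dgmZ Hj) !jf.
exact: (gsym_phi_ker pr i_prt i_abelian).
Qed.
Lemma f_homog : @cparity k (Pi V) (Pi g) false f.
Proof.
move=> a s hs; rewrite homog_Pi; apply: j_inj; rewrite (dgm_prt Hj) jf.
have := phi_ker_homog i_prt pr_prt hs; by rewrite homog_Pi.
Qed.
Lemma f0 : f [::] = 0.
Proof.
by apply: j_inj; rewrite jf (dgm0 Hj) /phi_ker mu0 linear0 addr0.
Qed.

Lemma mlin_point : @mlin k (Pi V) (fiber Hj) fiber_point.
Proof.
move=> s1 s2 a x y; apply: fib_inj.
  by rewrite (dgm_lin (fib1_map Hj)) !fib1_point mlin_f.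
by rewrite (dgm_lin (fib2_map Hj)) !fib2_point mlin_wform.
Qed.
Lemma gsym_point : @gsym k (Pi V) (fiber Hj) fiber_point.
Proof.
move=> s1 s2 a b x y hx hy; apply: fib_inj.
  by rewrite (dgmZ (fib1_map Hj)) !fib1_point (gsym_f _ _ hx hy).
by rewrite (dgmZ (fib2_map Hj)) !fib2_point (gsym_wform pr i_prt i_abelian _ _ hx hy).
Qed.
Lemma point_homog : @cparity k (Pi V) (Pi (fiber Hj)) false fiber_point.
Proof.
move=> a s hs; rewrite homog_Pi; apply: fib_inj.
  by rewrite (dgm_prt (fib1_map Hj)) fib1_point; exact: (f_homog hs).
by rewrite (dgm_prt (fib2_map Hj)) fib2_point; exact: (wform_homog i_prt pr_prt hs).
Qed.
Lemma point0 : fiber_point [::] = 0.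
Proof.
apply: fib_inj; first by rewrite fib1_point f0.
rewrite fib2_point (dgm0 (fib2_map Hj)).
by rewrite /wform /= mu0 !linear0 !addr0.
Qed.

Lemma point_mc s : dif (fiber_point s) +
    (2%:R : k)^-1 *: unsh s (fun A B => m2 (fiber_point A) (fiber_point B)) =
  unsh s (fun A B => fiber_point (mu A :: B)).
Proof.
apply: fib_inj.
  have h1 := fib1_map Hj; have l1 := dgm_lin h1.
  rewrite (dgmD h1) (dgmZ h1) (dgm_dif h1) !(unsh_linear (h := @fib1 _ _ _ _ Hj)) //.
  apply: j_inj; rewrite (dgmD Hj) (dgmZ Hj) (dgm_dif Hj) fib1_point.
  rewrite !(unsh_linear (h := j)); try exact: dgm_lin Hj.
  rewrite jf; have := phi_ker_mc k_char0 i_prt pr_prt i_abelian prK (ker_dif Hj pr_j ker_pr) (ker_brk Hj pr_j ker_pr) s.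
  move=> E; apply: etrans (etrans _ E) _.
    congr (_ + _ *: _); apply: unsh_ext => A B _.
    by rewrite (dgm_m2 h1) (dgm_m2 Hj) !fib1_point !jf.
  by apply: unsh_ext => A B _; rewrite fib1_point jf.
have h1 := fib2_map Hj; have l1 := dgm_lin h1.
rewrite (dgmD h1) (dgmZ h1) (dgm_dif h1) !(unsh_linear (h := @fib2 _ _ _ _ Hj)) //.
rewrite fib2_point; have := wform_mc k_char0 Hj i_prt pr_prt i_abelian prK pr_j ker_pr s.
move=> E; apply: etrans (etrans _ E) _.
  by congr (_ + _ *: _).
by apply: unsh_ext => A B _; rewrite fib2_point.
Qed.
End FiberSequence.

(** * The quasi-isomorphism *)

Section QuasiIso.
Variables (k : fieldType) (k_char0 : [pchar k] =i pred0) (V : superspace k) (g h : dgla k).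
Variables (j : g -> h) (Hj : is_dgla_map j) (j_inj : injective j).
Variables (i : {linear (Pi V) -> h}) (pr : {linear h -> (Pi V)}).
Hypotheses (i_prt : forall a x, i (prt a x) = prt a (i x))
  (pr_prt : forall a x, pr (prt a x) = prt a (pr x))
  (i_abelian : forall x y, brk (i x) (i y) = 0)
  (prK : forall w, pr (i w) = w)
  (pr_j : forall x, pr (j x) = 0) (ker_pr : forall y, pr y = 0 -> exists x, j x = y).
Variable f : seq (Pi V) -> Pi g.
Local Notation mu := (mu i pr).
Local Notation wform := (wform i pr).
Hypothesis jf : forall s, j (f s) = phi_ker i pr s.
Local Notation point := (fiber_point Hj jf).

(* The integral over [0, 1] of a form whose dz-part vanishes beyond z^N. *)
Definition integral N (q : nat -> h) : h := \sum_(r < N) (r.+1%:R : k)^-1 *: q r.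

Let natr_neq0 n : n.+1%:R != 0 :> k.
Proof. by rewrite ((pcharf0P k).1 k_char0). Qed.

Lemma integral_linear (M : lmodType k) (T : {linear h -> M}) N q :
  T (integral N q) = \sum_(r < N) (r.+1%:R : k)^-1 *: T (q r).
Proof. by rewrite linear_sum; apply: eq_bigr => r _; rewrite linearZ. Qed.
Lemma integral_zder N (q : nat -> h) : (forall r, (N <= r)%N -> q r = 0) ->
  integral N (zder q) = \sum_(r < N) q r - q 0.
Proof.
move=> Hq; have -> : \sum_(r < N) q r = \sum_(r < N.+1) q r.
  by rewrite big_ord_recr /= Hq ?addr0.
rewrite big_ord_recl addrC addKr; apply: eq_bigr => r _.
by rewrite /zder -scaler_nat scalerA mulVf ?scale1r.
Qed.
Lemma integralD N q q' : integral N (fun r => q r + q' r) = integral N q + integral N q'.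
Proof. by rewrite -big_split; apply: eq_bigr => r _; rewrite scalerDr. Qed.

Lemma form_bound (u : forms h) : exists N, forall r, (N <= r)%N -> fz u r = 0 /\ fdz u r = 0.
Proof.
have [N HN] := fin_fz u; have [M HM] := fin_fdz u.
exists (maxn N M) => r; rewrite geq_max => /andP[Nr Mr].
by rewrite HN ?HM.
Qed.
Lemma form_at1_bound (u : forms h) v N : form_at1 u v ->
  (forall r, (N <= r)%N -> fz u r = 0) -> \sum_(r < N) fz u r = v.
Proof.
move=> [M [HM <-]] HN.
have st n n' (p : nat -> h) : (forall r, (n <= r)%N -> p r = 0) -> (n <= n')%N ->
    \sum_(r < n') p r = \sum_(r < n) p r.
  move=> Hn nn'; rewrite (big_ord_widen n' p nn') [RHS]big_mkcond; apply: eq_bigr => r _.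
  by case: ltnP => // /Hn.
by rewrite -(st N (maxn N M)) ?leq_maxl // (st M) ?leq_maxr.
Qed.

(** The kernel of [pr] is the image of the dgla map [j], hence a subcomplex, so d descends to
    [Pi V]. The induced differential is the unary part of [mu] up to sign. *)
Lemma pr_dif (x : h) : pr (dif x) = pr (dif (i (pr x))).
Proof.
rewrite -[x in LHS](subrK (i (pr x))) linearD linearD /= (ker_dif Hj pr_j ker_pr) ?add0r //.
by rewrite linearB /= prK subrr.
Qed.
Lemma mu1 x : mu [:: x] = - pr (dif (i x)).
Proof. by rewrite /mu phi1. Qed.
Lemma mu1_gr x : mu [:: gr x] = - gr (mu [:: x]).
Proof.
rewrite !mu1 (i_gr i_prt) gr_dif [pr (- _)]linearN /= (pr_gr pr_prt).
by rewrite [gr (- _)]linearN.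
Qed.

Lemma fdz_point1 x r : fdz (fib2 (point [:: x])) r = if r == 0%N then i (gr x) else 0.
Proof. by rewrite fib2_point /wform !fdzD !fdz_zm fdz_dzm !add0r. Qed.

(** Stokes' formula on [0, 1]: the boundary value at 0 vanishes, the one at 1 is [j (fib1 y)], and
    [gr] is the sign that the differential of forms puts on the dz-part. *)
Lemma fiber_integral (y : fiber Hj) N : (forall r, (N <= r)%N -> fz (fib2 y) r = 0) ->
  integral N (fun r => fdz (dif (fib2 y)) r) =
    dif (integral N (fdz (fib2 y))) + gr (j (fib1 y)).
Proof.
move=> HN; have [y0 y1] : fiber_mem j (val y) := smemV y.
rewrite -[LHS]/(integral N (fun r => dif (fdz (fib2 y) r) + gr (zder (fz (fib2 y)) r))).
rewrite integralD; congr (_ + _); first by rewrite integral_linear.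
rewrite -(form_at1_bound y1 HN) -[LHS](integral_linear (@gr k h)) integral_zder //.
by rewrite [fz (fib2 y) 0]y0 subr0.
Qed.

(** Integrating the dz-parts expresses [i (gr x)] as d of the integral plus an element of the image
    of [j], which [pr] kills. So x is [mu] of the projected integral, up to [gr]. *)
Lemma point_inj x (y : fiber Hj) : point [:: x] = dif y -> exists z, x = mu [:: z].
Proof.
move=> e; have [N HN] := form_bound (fib2 y).
have e2 r : fdz (dif (fib2 y)) r = if r == 0%N then i (gr x) else 0.
  by rewrite -(dgm_dif (fib2_map Hj)) -e fdz_point1.
(* One more than the bound, so that the constant coefficient, the only one in the dz-part of a
   point, is in range. *)
have := @fiber_integral y N.+1 (fun r Nr => (HN r (ltnW Nr)).1).
rewrite {1}/integral big_ord_recl big1 => [|r _]; last by rewrite e2 scaler0.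
rewrite addr0 e2 eqxx invr1 scale1r => /(congr1 pr).
rewrite prK linearD /= pr_dif (pr_gr pr_prt) pr_j linear0 addr0 => /(congr1 (@gr k (Pi V))).
rewrite grK => ->; exists (gr (pr (integral N.+1 (fdz (fib2 y))))).
by rewrite mu1_gr mu1 linearN opprK.
Qed.

Lemma dif_point1 x : mu [:: x] = 0 -> dif (point [:: x]) = 0.
Proof.
move=> mx; have := point_mc k_char0 Hj j_inj i_prt pr_prt i_abelian prK pr_j ker_pr jf [:: x].
have u0 : point [::] = 0 by apply: point0.
have mp : mlin (fiber_point Hj jf) by exact: mlin_point.
have -> : unsh [:: x] (fun A B => m2 (point A) (point B)) = 0.
  by apply: unsh1_eq0 => [|y]; rewrite u0; [exact: m2_0r|exact: m2_0l].
have -> : unsh [:: x] (fun A B => point (mu A :: B)) = 0.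
  by apply: unsh1_eq0 => [|y]; rewrite ?mx ?mu0; exact: (mlin_hd0 _ mp).
by rewrite scaler0 addr0.
Qed.

(** The primitive in z of the dz-part, taken to vanish at 0, has the total integral as its value at
    1. The hypothesis places this value in the image of [j], so the primitive belongs to an element
    of the fiber; closedness of [y] makes the other components agree. *)
Lemma fiber_exact (y : fiber Hj) : dif y = 0 ->
  (forall N, (forall r, (N <= r)%N -> fz (fib2 y) r = 0 /\ fdz (fib2 y) r = 0) ->
     pr (integral N (fdz (fib2 y))) = 0) ->
  exists z, y = dif z.
Proof.
move=> dy H; have [N HN] := form_bound (fib2 y).
have dy2 : dif (fib2 y) = 0 by rewrite -(dgm_dif (fib2_map Hj)) dy (dgm0 (fib2_map Hj)).
have [g' jg'] := ker_pr (H N HN).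
have [y0 y1] : fiber_mem j (val y) := smemV y.
have HN1 r (Nr : (N <= r)%N) := (HN r Nr).1.
have Ed : dif (integral N (fdz (fib2 y))) = - gr (j (fib1 y)).
  apply/eqP; rewrite -addr_eq0 -fiber_integral // dy2 /integral big1 // => r _.
  by rewrite fdz0 scaler0.
(* The shift by one and the inverse of n+1 integrate z^n dz; [gr] undoes the sign in the
   differential of forms. *)
pose v n : h := if n is n'.+1 then (n'.+1%:R : k)^-1 *: gr (fdz (fib2 y) n') else 0.
have hv : finsupp_seq v by exists N.+1 => -[|r] //= Nr; rewrite (HN r Nr).2 linear0 scaler0.
pose V2 : forms h := mkform hv (@fin0 k h).
have mem : @fiber_mem k g h j (gr g' : g, V2).
  split=> //; exists N.+1; split=> [r Nr|].
    by case: r Nr => //= r Nr; rewrite /V2 fz_mk /= (HN r Nr).2 linear0 scaler0.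
  rewrite /= (dgm_gr Hj) jg' big_ord_recl add0r integral_linear.
  by apply: eq_bigr.
exists (@insub_of k (dsum g (forms h)) (subdgla_sub (fiber_closed Hj)) (gr g' : g, V2) mem : fiber Hj).
apply: fib_inj.
  rewrite (dgm_dif (fib1_map Hj)); apply: j_inj; rewrite (dgm_dif Hj).
  change (j (fib1 y) = dif (j (gr g'))).
  by rewrite (dgm_gr Hj) jg' gr_dif Ed [gr (- _)]linearN /= opprK grK.
rewrite (dgm_dif (fib2_map Hj)); change (fib2 y = dif V2).
have Hd r : dif (fdz (fib2 y) r) = - gr (zder (fz (fib2 y)) r).
  apply/eqP; rewrite -addr_eq0; apply/eqP.
  by rewrite -[LHS]/(fdz (dif (fib2 y)) r) dy2 fdz0.
apply: formP => r.
  change (fz (fib2 y) r = dif (v r)); case: r => [|r] /=; first by rewrite linear0; exact: y0.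
  rewrite linearZ /= gr_dif Hd [gr (- _)]linearN /= opprK grK /zder -scaler_nat scalerA mulVf ?scale1r //.
change (fdz (fib2 y) r = dif (0 : h) + gr (zder v r)).
rewrite linear0 add0r /zder /= -scaler_nat scalerA mulfV ?scale1r // grK.
by [].
Qed.

(** Subtracting the point of [gr w] makes the projected integral vanish, so that [fiber_exact]
    applies; that it is a cycle follows from [fiber_integral]. The dz-part of a point contains [gr],
    which is why [gr w] is taken and not [w]. *)
Lemma point_surj (y : fiber Hj) : dif y = 0 ->
  exists x z, mu [:: x] = 0 /\ y = point [:: x] + dif z.
Proof.
move=> dy; have [N HN] := form_bound (fib2 y).
have dy2 : dif (fib2 y) = 0 by rewrite -(dgm_dif (fib2_map Hj)) dy (dgm0 (fib2_map Hj)).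
have HN1 M r (NM : (N <= M)%N) (Nr : (M <= r)%N) := (HN r (leq_trans NM Nr)).1.
have Ed : dif (integral N (fdz (fib2 y))) = - gr (j (fib1 y)).
  apply/eqP; rewrite -addr_eq0 -fiber_integral ?dy2 /integral ?big1 // => r *.
    by rewrite fdz0 scaler0.
  exact: HN1 (leqnn N) _.
pose w := pr (integral N (fdz (fib2 y))).
have mx : mu [:: gr w] = 0.
  by rewrite mu1_gr mu1 /w -pr_dif Ed [pr (- _)]linearN /= (pr_gr pr_prt) pr_j [gr 0]linear0 !oppr0 [gr 0]linear0 oppr0.
exists (gr w).
have [|M HM|z e] := @fiber_exact (y - point [:: gr w]).
- have difB (a b : fiber Hj) : dif (a - b) = dif a - dif b by exact: linearB.
  by rewrite difB dy dif_point1 ?subr0.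
- have E r : fdz (fib2 (y - point [:: gr w])) r =
      fdz (fib2 y) r + (- (if r == 0%N then i w else 0)).
    rewrite (dgmD (fib2_map Hj)) (dgmN (fib2_map Hj)) fdzD fdzN fdz_point1 grK.
    by [].
  have st n n' q : (forall r, (n <= r)%N -> q r = 0) -> (n <= n')%N ->
      integral n' q = integral n q.
    move=> Hn nn'; rewrite /integral (big_ord_widen n' (fun r => (r.+1%:R : k)^-1 *: q r) nn').
    rewrite [RHS]big_mkcond; apply: eq_bigr => r _.
    by case: ltnP => // /Hn ->; rewrite scaler0.
  (* A common bound, plus one so that the constant coefficient is counted. *)
  pose L := (maxn N M).+1.
  rewrite -(st M L) ?leqW ?leq_maxr //; last by move=> r /HM[].
  rewrite [integral L _](_ : _ = integral L (fun r => fdz (fib2 y) r + (- (if r == 0%N then i w else 0)))); last first.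
    by apply: eq_bigr => r _; rewrite E.
  rewrite integralD (st N L) ?leqW ?leq_maxl //; last by move=> r /HN[].
  rewrite linearD /= [integral L _](_ : _ = - i w); last first.
    rewrite /integral big_ord_recl big1 => [|r _]; last by rewrite oppr0 scaler0.
    by rewrite addr0 /= invr1 scale1r.
  by rewrite linearN /= prK /w subrr.
- by exists z; split=> //; rewrite -e addrC subrK.
Qed.
End QuasiIso.

Section StrictMaps.
Variables (k : fieldType) (k_char0 : [pchar k] =i pred0).

Lemma strict_of_dgla_map (g h : dgla k) (j : g -> h) (Hj : is_dgla_map j)
    (mg : infty Com g) (mh : infty Com h) : is_dgla_linf mg -> is_dgla_linf mh ->
  exists F : linf_map mg mh,
    (forall (l : {linear Pi h -> k^o}) s, ev (F (flin Com l)) s = flin_fun l (map j s)) /\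
    is_strict F j.
Proof.
move=> Hg Hh.
pose jP : {linear Pi g -> Pi h} := @mklin k (Pi g) (Pi h) j (dgm_lin Hj).
have hp a x : jP (prt a x) = prt a (jP x) by exact: dgm_prt Hj (~~ a) x.
have [s|F eF] := @linf_map_of_strict k k_char0 g h mg mh jP hp.
  rewrite Hg Hh; case: s => [|x [|y [|z s]]] /=; try exact: dgm0 Hj.
    exact: dgm_dif Hj x.
  exact: dgm_m2 Hj x y.
have E (l : {linear Pi h -> k^o}) s : ev (F (flin Com l)) s = flin_fun l (map j s).
  by rewrite eF.
exists F; split=> // s s0; apply: taylor_of_flin => l; rewrite E.
by case: s s0 => [|x [|y s]] //= _; rewrite linear0.
Qed.

Lemma quasi_iso_id (A : linf_alg k) (F : linf_map A A) :
  (forall f, F f = f) -> is_quasi_iso F.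
Proof.
move=> HF; have T x : taylor false F [:: x] = x.
  by apply: taylor_of_flin => l; rewrite HF.
split=> [x _ [y]|y dy]; first by rewrite T => ->; exists y.
exists y, 0; split=> //; rewrite T.
have [mc _ _] := cochain_parity (istr_odd A).
by rewrite (mlin_hd0 _ mc) addr0.
Qed.
End StrictMaps.

Section AbstractTheorem.
Variables (k : fieldType) (k_char0 : [pchar k] =i pred0) (V : superspace k) (g h : dgla k).
Variables (j : g -> h) (Hj : is_dgla_map j) (j_inj : injective j).
Variables (i : {linear (Pi V) -> h}) (pr : {linear h -> (Pi V)}).
Hypotheses (i_prt : forall a x, i (prt a x) = prt a (i x))
  (pr_prt : forall a x, pr (prt a x) = prt a (pr x))
  (i_abelian : forall x y, brk (i x) (i y) = 0)
  (prK : forall w, pr (i w) = w)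
  (pr_j : forall x, pr (j x) = 0) (ker_pr : forall y, pr y = 0 -> exists x, j x = y).
Variable f : seq (Pi V) -> Pi g.
Hypothesis jf : forall s, j (f s) = phi_ker i pr s.

(** One morphism of sequences suffices: [fiber_point] on V and identities on the other two terms.
    The map to g is defined as the composite with the projection of the fiber, so the first square
    commutes by construction; its components are [f], the first coordinate of [fiber_point]. *)
Theorem derived_fiber_seq (mV : infty Com V) : (forall s, cochain mV s = mu i pr s) ->
  dgla_homotopy_fiber_seq mV f j.
Proof.
move=> hmV.
have [mg Hg] := dgla_linf_exists k_char0 g.
have [mh Hh] := dgla_linf_exists k_char0 h.
have [mF HF] := dgla_linf_exists k_char0 (fiber Hj).
have [G [_ HG]] := strict_of_dgla_map k_char0 Hj Hg Hh.
have [P [EP HP]] := strict_of_dgla_map k_char0 (fib1_map Hj) HF Hg.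
pose u : seq (Pi V) -> Pi (fiber Hj) := fiber_point Hj jf.
have mu_ : mlin u by exact: mlin_point.
have su : gsym u by exact: gsym_point.
have pu : cparity false u by exact: point_homog.
have u0 : u [::] = 0 by exact: point0.
have [||s|F1 EF1] := @linf_map_of_components k k_char0 V (fiber Hj) mV mF u mu_ su pu u0.
- by move=> [|? [|? [|? ?]]] //; rewrite HF.
- by rewrite HF.
- rewrite HF; have := point_mc k_char0 Hj j_inj i_prt pr_prt i_abelian prK pr_j ker_pr jf s.
  move=> E; apply: etrans (etrans _ E) _.
    by congr (_ + _ *: _); apply: unsh_ext => A B _; rewrite HF.
  by apply: unsh_ext => A B _; rewrite hmV.
have [F EF] := linf_map_comp F1 P.
have EFl l s : ev (F (flin Com l)) s = l (f s).
  rewrite EF; have fl : linear (fun x : Pi (fiber Hj) => l (fib1 x) : k^o).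
    by move=> a x y; rewrite (dgm_lin (fib1_map Hj)) linearP.
  have -> : P (flin Com l) = flin Com (mklin fl).
    by apply: evP => -[|x [|y t]]; rewrite EP.
  by rewrite EF1.
exists mg, mh, F, G; split=> //.
  by move=> w _; apply: taylor_of_flin => l; exact: EFl.
exists (@LinfSeq k (LinfAlg mF) (LinfAlg mg) (LinfAlg mh) P G).
  exact: (DglaFiberSeq HF Hg Hh HP HG).
apply: rst_step.
have [I2 EI2] := linf_map_id mg.
have [I3 EI3] := linf_map_id mh.
exists F1, I2, I3; split.
- have T1 x : taylor false F1 [:: x] = u [:: x].
    by apply: taylor_of_flin => l; rewrite EF1.
  split=> [x|y].
    rewrite T1 => _ [y]; rewrite HF => /(point_inj k_char0 i_prt pr_prt prK pr_j ker_pr)[z ->].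
    by exists z; rewrite hmV.
  rewrite HF => /(point_surj k_char0 j_inj i_prt pr_prt i_abelian prK pr_j ker_pr jf)[x [z [mx ->]]].
  by exists x, z; rewrite hmV T1 HF.
- exact: (@quasi_iso_id k (LinfAlg mg)).
- exact: (@quasi_iso_id k (LinfAlg mh)).
- by move=> f'; rewrite /= EI2 EF.
- by move=> f'; rewrite /= EI3 EI2.
Qed.
End AbstractTheorem.

(** * Constant derivations and insertions *)

Section ConstantDerivations.
Variables (k : fieldType) (k_char0 : [pchar k] =i pred0) (c : flavour) (U : superspace k).
Implicit Types (D E : Der c U) (a b p q : bool) (s t : seq U).

Lemma cochain_prt a q D s : homog_word q s ->
  cochain (prt a D) s = prt (a (+) q) (cochain D s).
Proof.
move=> hs; rewrite -[in RHS](prtD D) cochainD linearD.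
have H e : homog (e (+) q) (cochain (prt e D) s).
  exact: (cop_par (cochain_parity (homog_prt e D)) hs).
rewrite !(homog_prtN _ (H _)).
by case: a; case: (q); rewrite /= ?addr0 ?add0r.
Qed.

Lemma mlin_cochain D : mlin (cochain D).
Proof.
move=> s1 s2 a x y; rewrite -(prtD D) !cochainD.
rewrite !(cop_ml (cochain_parity (homog_prt _ D))).
by rewrite [in RHS]scalerDr [LHS]addrACA.
Qed.
Lemma ev_der_nil p D (l : {linear U -> k^o}) : lin_homog p l ->
  ev (der_app D (flin c l)) [::] = (-1) ^+ p * l (cochain D [::]).
Proof.
move=> hl; rewrite -(prtD D) der_appD evD !(cochainE _ (homog_prt _ D) hl) /=.
rewrite [in RHS]cochainD [in RHS]linearD mulrDr !mul1r; congr (_ + _).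
have h0 : homog false (cochain (prt false D) [::]).
  exact: (cop_par (cochain_parity (homog_prt false D)) (a := false)).
case: p hl => hl /=; last by rewrite expr0 mul1r.
by rewrite (lin_homogN hl h0) ?mulr0.
Qed.

Lemma no_constP D : no_const D <-> cochain D [::] = 0.
Proof.
split=> [H|H l].
  apply: homog_form_sep => p l hl; rewrite linear0.
  by apply: (can_inj (signrMK p)); rewrite mulr0 -ev_der_nil.
have -> : flin c l = flin c (fprt_form false l) + flin c (fprt_form true l).
  rewrite -[X in X + _]scale1r; apply: flin_lin => y.
  by rewrite mul1r -fprt_formD.
rewrite der_app_rD evD !(ev_der_nil _ (@fprt_form_homog _ _ _ l)) H.
by rewrite !linear0 !mulr0 addr0.
Qed.

Definition const_cochain (w : U) (s : seq U) : U := if s is [::] then w else 0.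

Lemma const_cochainP b w : homog b w -> cochain_of_parity c b (const_cochain w).
Proof.
move=> hw; split.
- by move=> [|? ?] s2 a x y; rewrite /= scaler0 addr0.
- by move=> _ [|? ?] s2 a1 a2 x y _ _; rewrite /= scaler0.
- move=> a [|x s] /=; first by move=> ->; rewrite addbF.
  by move=> _; exact: homog0.
Qed.

Definition dconst_part b w : Der c U := mkder k_char0 (const_cochainP (homog_prt b w)).
Definition dconst w : Der c U := dconst_part false w + dconst_part true w.

Lemma dconst_part_homog b w : homog b (dconst_part b w).
Proof. exact: mkder_homog. Qed.
Lemma cochain_dconst_part b w s : cochain (dconst_part b w) s = const_cochain (prt b w) s.
Proof. exact: cochain_mkder. Qed.
Lemma cochain_dconst w s : cochain (dconst w) s = const_cochain w s.
Proof.
rewrite cochainD !cochain_dconst_part /const_cochain.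
by case: s => [|? ?]; rewrite ?prtD ?addr0.
Qed.
Lemma dconst_prt a w : prt a (dconst w) = dconst_part a w.
Proof.
rewrite /dconst [LHS]linearD !(homog_prtN _ (dconst_part_homog _ w)).
by case: a; rewrite /= ?addr0 ?add0r.
Qed.
Lemma dconst_homog b w : homog b w -> homog b (dconst w).
Proof.
move=> hw; have Z : dconst_part (~~ b) w = 0.
  apply: (der_inj k_char0 (b := ~~ b)); [exact: dconst_part_homog|exact: homog0|].
  move=> s; rewrite cochain_dconst_part cochain0 (homog_prtN _ hw).
  by case: (b); case: s.
rewrite /homog dconst_prt /dconst.
by case: b Z {hw} => /= ->; rewrite ?add0r ?addr0.
Qed.
Lemma dconst_part_linear b : linear (dconst_part b).
Proof.
move=> a x y; apply: (der_inj k_char0 (b := b)).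
- exact: dconst_part_homog.
- by apply: homogD; [apply: homog_scale|]; exact: dconst_part_homog.
- move=> s; rewrite cochain_lin !cochain_dconst_part linearP.
  by case: s => [|? ?] //=; rewrite scaler0 addr0.
Qed.
Lemma dconst_linear : linear dconst.
Proof.
by move=> a x y; rewrite /dconst !dconst_part_linear scalerDr addrACA.
Qed.

Definition insert_first (M : lmodType k) (w : U) (s : seq U) (P : seq U -> M) : M :=
  if c is Com then P (w :: s) else shuffle_sum [:: w] s P.

Lemma shuffle_nill (M : lmodType k) (s : seq U) (P : seq U -> M) : mlin P ->
  shuffle_sum [::] s P = P s.
Proof.
elim: s P => [//|x s IH] P mP /=; rewrite big_ord_recl big_ord0 addr0 /=.
rewrite (IH _ (mlin_cons _ mP)) (IH _ (mlin_cons _ mP)).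
exact: mlin_prt.
Qed.
Lemma shuffle_cons (M : lmodType k) (w0 : U) w x s (P : seq U -> M) :
  shuffle_sum (w0 :: w) (x :: s) P = shuffle_sum w (x :: s) (fun z => P (w0 :: z)) +
    (shuffle_sum (w0 :: w) s (fun z => P (prt false x :: z)) +
     shuffle_sum (map (@gr k U) (w0 :: w)) s (fun z => P (prt true x :: z))).
Proof. by rewrite [LHS]/= big_ord_recl addrC. Qed.
Lemma shuffle_ext (M : lmodType k) (w s : seq U) (P Q : seq U -> M) :
  P =1 Q -> shuffle_sum w s P = shuffle_sum w s Q.
Proof.
elim: s w P Q => [|x s IH] w P Q PQ /=; first exact: PQ.
by apply: eq_bigr => n _; congr (_ + _); apply: IH => z.
Qed.
Lemma shuffle_lin (M : lmodType k) (a : k) (w s : seq U) (P Q : seq U -> M) :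
  shuffle_sum w s (fun z => a *: P z + Q z) = a *: shuffle_sum w s P + shuffle_sum w s Q.
Proof.
elim: s w P Q => [|x s IH] w P Q //=.
rewrite scaler_sumr -big_split; apply: eq_bigr => n _ /=.
by rewrite !IH scalerDr addrACA.
Qed.
Lemma shuffle0 (M : lmodType k) (w s : seq U) : shuffle_sum w s (fun=> 0 : M) = 0.
Proof.
by elim: s w => [|x s IH] w //=; apply: big1 => n _; rewrite !IH addr0.
Qed.
Lemma shuffleZ (M : lmodType k) (a : k) (w s : seq U) (P : seq U -> M) :
  shuffle_sum w s (fun z => a *: P z) = a *: shuffle_sum w s P.
Proof.
rewrite -[RHS]addr0 -[X in _ + X](shuffle0 M w s) -shuffle_lin.
by apply: shuffle_ext => z; rewrite addr0.
Qed.
Lemma shuffleD (M : lmodType k) (w s : seq U) (P Q : seq U -> M) :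
  shuffle_sum w s (fun z => P z + Q z) = shuffle_sum w s P + shuffle_sum w s Q.
Proof.
rewrite -[shuffle_sum w s P]scale1r -shuffle_lin.
by apply: shuffle_ext => z; rewrite scale1r.
Qed.
Lemma shuffle_linear (M N : lmodType k) (T : M -> N) (w s : seq U) (P : seq U -> M) :
  linear T -> T (shuffle_sum w s P) = shuffle_sum w s (fun z => T (P z)).
Proof.
move=> lT; elim: s w P => [|x s IH] w P //=.
have TD u v : T (u + v) = T u + T v by rewrite -[u]scale1r lT !scale1r.
have T0 : T 0 = 0 by have := lT (-1) 0 0; rewrite scaler0 addr0 scaleN1r addNr.
rewrite (big_morph T TD T0); apply: eq_bigr => n _.
by rewrite TD !IH.
Qed.

Lemma mlin_shufflel (M : lmodType k) s (P : seq U -> M) : mlin P ->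
  mlin (fun w => shuffle_sum w s P).
Proof.
elim: s P => [|y s IH] P mP; first by move=> s1 s2 a x z /=; exact: mP.
move=> s1; elim: s1 P mP => [|w0 s1 IH1] P mP s2 a x z.
  rewrite !cat0s !shuffle_cons !scalerDr [RHS]addrACA; congr (_ + _).
    rewrite -shuffle_lin; apply: shuffle_ext => u; exact: mlin_hd.
  rewrite [RHS]addrACA; congr (_ + _); first exact: (IH _ (mlin_cons _ mP) [::]).
  rewrite !map_cons linearP; exact: (IH _ (mlin_cons _ mP) [::]).
rewrite !cat_cons !shuffle_cons !scalerDr [RHS]addrACA; congr (_ + _).
  exact: (IH1 _ (mlin_cons w0 mP)).
rewrite [RHS]addrACA; congr (_ + _); first exact: (IH _ (mlin_cons _ mP) (w0 :: s1)).
rewrite !map_cons !map_cat !map_cons linearP.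
exact: (IH _ (mlin_cons _ mP) (gr w0 :: map (@gr k U) s1)).
Qed.

Lemma shuffle_cons_homog (M : lmodType k) b p (w : seq U) w0 y s (P : seq U -> M) :
  mlin P -> homog_word b (w0 :: w) -> homog p y ->
  shuffle_sum (w0 :: w) (y :: s) P = shuffle_sum w (y :: s) (fun z => P (w0 :: z)) +
    (-1) ^+ (b && p) *: shuffle_sum (w0 :: w) s (fun z => P (y :: z)).
Proof.
move=> mP hw hy; rewrite shuffle_cons; congr (_ + _).
have Z w' : shuffle_sum w' s (fun z => P ((0 : U) :: z)) = 0.
  by rewrite -(shuffle0 M w' s); apply: shuffle_ext => z; rewrite mlin_hd0.
rewrite !(homog_prtN _ hy); case: p hy => hy /=; rewrite Z ?add0r ?addr0.
  have := mlin_gp_homog true (mlin_shufflel s (mlin_cons y mP)) hw; rewrite andbC => <-.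
  by [].
by rewrite andbF scale1r.
Qed.

Lemma mlin_catl (M : lmodType k) u (P : seq U -> M) : mlin P ->
  mlin (fun s => P (u ++ s)).
Proof. by move=> mP s1 s2 a x y; rewrite !catA; exact: mP. Qed.

Lemma mlin_shuffler (M : lmodType k) w (P : seq U -> M) : mlin P ->
  mlin (fun s => shuffle_sum w s P).
Proof.
move=> mP s1; elim: s1 w P mP => [|y s1 IH] w P mP s2 a x z.
  rewrite !cat0s /= scaler_sumr -big_split; apply: eq_bigr => n _ /=.
  rewrite scalerDr [RHS]addrACA -!shuffle_lin.
  by congr (_ + _); apply: shuffle_ext => u; rewrite linearP mP.
rewrite !cat_cons /= scaler_sumr -big_split; apply: eq_bigr => n _ /=.
rewrite scalerDr [RHS]addrACA; congr (_ + _); apply: IH.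
- exact: (mlin_cons _ (mlin_catl _ mP)).
- exact: (mlin_cons _ (mlin_catl _ mP)).
Qed.

End ConstantDerivations.

Section ConstantCommutator.
Variables (k : fieldType) (k_char0 : [pchar k] =i pred0) (c : flavour) (U : superspace k).
Implicit Types (D E : Der c U) (a b p q : bool) (s t : seq U).
Local Notation dconst := (dconst k_char0 c).

Lemma insert_first_linear (M N : lmodType k) (T : M -> N) w s (P : seq U -> M) :
  linear T -> T (insert_first c w s P) = insert_first c w s (fun z => T (P z)).
Proof. by rewrite /insert_first; case: c => // lT; exact: shuffle_linear. Qed.
Lemma insert_firstZ (M : lmodType k) (x : k) w s (P : seq U -> M) :
  insert_first c w s (fun z => x *: P z) = x *: insert_first c w s P.
Proof. by rewrite /insert_first; case: c => //; exact: shuffleZ. Qed.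
Lemma insert_first_ext (M : lmodType k) w s (P Q : seq U -> M) :
  P =1 Q -> insert_first c w s P = insert_first c w s Q.
Proof. by move=> PQ; rewrite /insert_first; case: c => //; exact: shuffle_ext. Qed.
Lemma mlin_insert_first (M : lmodType k) w (P : seq U -> M) :
  mlin P -> mlin (fun s => insert_first c w s P).
Proof.
rewrite /insert_first => mP; case: c; first exact: mlin_cons.
exact: mlin_shuffler.
Qed.
Lemma insert_first_linl (M : lmodType k) (x : k) w w' s (P : seq U -> M) : mlin P ->
  insert_first c (x *: w + w') s P = x *: insert_first c w s P + insert_first c w' s P.
Proof.
rewrite /insert_first => mP; case: c; first exact: mlin_hd.
exact: (mlin_shufflel s mP [::] [::]).
Qed.

(** A constant swallows no letters: in the symmetric algebra only the unshuffle with empty first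
    part remains, and in the tensor algebra [w] is inserted at every position. *)
Lemma der_fun_const b w (f : seq U -> k^o) s : homog b w -> multilinear f ->
  der_fun c b (const_cochain w) f s = insert_first c w s (tw b f : seq U -> k^o).
Proof.
move=> hw mf; move: s; apply: ml_homog_eq.
- have [mc _ _] := const_cochainP c hw.
  by rewrite /der_fun; case: c; [exact: ml_com_der|exact: ml_ass_der].
- by apply: mlin_insert_first; exact: ml_tw.
move=> q s hs; rewrite /der_fun /insert_first; case: c.
  have mQ : @mlin k U k^o (fun B => tw b f (w :: B)) by exact: (ml_cons w (ml_tw b mf)).
  rewrite -(unsh_nill s mQ) /com_der; apply: unsh_ext => -[|x A] B _ //=.
  by apply: ml_hd0; exact: ml_tw.
have Z (g : seq U -> k^o) t : multilinear g -> hd_ins (fun=> 0) g t = 0.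
  by move=> mg; elim: t => [|x t IH] /=; rewrite ml_hd0 ?IH ?addr0.
elim: s q f mf hs => [|y s IH] q f mf /=; first by rewrite !addr0.
move=> [p [hy hs]]; rewrite -/(ass_der _ _ _ _) Z ?addr0; last exact: ml_tw.
have mtf := ml_tw b mf.
rewrite (IH _ _ (ml_cons y mf) hs).
have hwb : homog_word b [:: w] by exists b; split; rewrite ?addbb.
rewrite -/(shuffle_sum [:: w] (y :: s) (tw b f : seq U -> k^o)).
rewrite (shuffle_cons_homog s mtf hwb hy).
congr (_ + _).
  by rewrite shuffle_nill //; exact: mlin_cons.
rewrite -shuffleZ; apply: shuffle_ext => z.
by rewrite (tw_cons b z mf hy); exact/esym/signrMK.
Qed.

Lemma dconst_flin b w p (l : {linear U -> k^o}) : homog b w -> lin_homog p l ->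
  der_app (dconst w) (flin c l) = ((-1) ^+ (b && p) * l w) *: fone c U.
Proof.
move=> hw hl; apply: evP => s; rewrite evZ (cochainE _ (dconst_homog k_char0 c hw) hl).
rewrite cochain_dconst -mulrA; congr (_ * _).
by case: s => [|? ?] /=; rewrite ?mulr1 // linear0 mulr0.
Qed.

(** A constant derivation sends linear forms to scalars, which D kills, so only the composite that
    applies D first survives. Bracketing with a constant thus inserts a letter. *)
Lemma cochain_comm_const a b D w s : homog a D -> homog b w ->
  cochain (commutator D (dconst w)) s = - insert_first c w s (cochain D).
Proof.
move=> hD hw; have hE := dconst_homog k_char0 c hw.
apply: (cochain_unique (comm_homog hD hE)) => p l hl.
rewrite (commutator_homog _ hD hE) /hcomm evB evZ (dconst_flin hw hl) der_app_rZ.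
rewrite (hder_one (homog_der hD)) scaler0 ev0 sub0r.
rewrite (ev_der_app k_char0 _ _ hE).
have hf : homog (a (+) p) (der_app D (flin c l)).
  exact: (hder_homog (homog_der hD) (homog_flin c hl)).
have -> : cochain (dconst w) = const_cochain w by apply: funext => t; exact: cochain_dconst.
rewrite (der_fun_const s hw (ev_ml _)) linearN mulrN; congr (- _).
rewrite (insert_first_linear w s _ (linearP l)) -[LHS](@insert_firstZ k^o) -[RHS](@insert_firstZ k^o).
apply: (@insert_first_ext k^o) => z /=.
rewrite (homog_tw b z hf) (cochainE _ hD hl) -[_ *: _]/(_ * _) -[RHS]/(_ * _) !mulrA -!signr_addb.
by congr (_ * _); case: (a) (b) (p) => [] [] [].
Qed.

Lemma comm_const_const (v w : U) : commutator (dconst v) (dconst w) = 0.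
Proof.
have H a b (x y : U) : homog a x -> homog b y -> commutator (dconst x) (dconst y) = 0.
  move=> hx hy; have hD := dconst_homog k_char0 c hx.
  have hE := dconst_homog k_char0 c hy.
  apply: (der_inj k_char0 (comm_homog hD hE) (homog0 _ _)) => s.
  rewrite cochain0; apply: (cochain_unique (comm_homog hD hE)) => p l hl.
  rewrite (commutator_homog _ hD hE) /hcomm (dconst_flin hx hl) (dconst_flin hy hl).
  rewrite !der_app_rZ (hder_one (homog_der hD)) (hder_one (homog_der hE)).
  by rewrite !scaler0 subr0 ev0 linear0 mulr0.
have dD u u' : dconst (u + u') = dconst u + dconst u'.
  by rewrite -[u]scale1r dconst_linear !scale1r.
have H1 b y : homog b y -> commutator (dconst v) (dconst y) = 0.
  move=> hy; rewrite -(prtD v) dD -[X in commutator (X + _)]scale1r comm_linl.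
  by rewrite !(H _ _ _ _ (homog_prt _ _) hy) scaler0 addr0.
rewrite -(prtD w) dD (commDr _ (dconst (prt false w))).
by rewrite !(H1 _ _ (homog_prt _ _)) addr0.
Qed.

End ConstantCommutator.

(** * Commutation and associativity of shuffles *)

Section ShuffleIdentities.
Variables (k : fieldType) (U : superspace k) (M : lmodType k).
Implicit Types (P Q : seq U -> M) (a b p q : bool) (s t : seq U) (x y : U).

Lemma shuffle1_cons b p w y s P : mlin P -> homog b w -> homog p y ->
  shuffle_sum [:: w] (y :: s) P = P [:: w, y & s] +
    (-1) ^+ (b && p) *: shuffle_sum [:: w] s (fun z => P (y :: z)).
Proof.
move=> mP hw hy; have hb : homog_word b [:: w] by exists b; rewrite addbb.
by rewrite (shuffle_cons_homog s mP hb hy) shuffle_nill //; exact: mlin_cons.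
Qed.

Lemma mlin_shuffle (N : lmodType k) w s (P : seq U -> seq U -> N) :
  (forall z, mlin (P z)) -> mlin (fun t => shuffle_sum w s (fun z => P z t)).
Proof.
move=> mP s1 s2 a x y; rewrite -shuffle_lin; apply: shuffle_ext => z; exact: mP.
Qed.

Lemma homog_prtW a b x : homog a x -> homog a (prt b x).
Proof. by move=> hx; rewrite (homog_prtN _ hx); case: eqP => // _; exact: homog0. Qed.
Lemma homog_word_gr a s : homog_word a s -> homog_word a (map (@gr k U) s).
Proof.
elim: s a => [|x s IH] a //= [b [hx hs]]; exists b; split; first exact: homog_gr.
exact: IH.
Qed.

Lemma shuffle_exth a b w s P Q : homog_word a w -> homog_word b s ->
  (forall z, homog_word (a (+) b) z -> P z = Q z) ->
  shuffle_sum w s P = shuffle_sum w s Q.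
Proof.
elim: s a b w P Q => [|y s IHs] a b w P Q.
  by move=> hw -> PQ; apply: PQ; rewrite addbF.
move=> hw hs; elim: w a P Q hw => [|w0 w IHw] a P Q hw PQ.
  move: hs => [p [hy hs]]; rewrite /= !big_ord_recl !big_ord0 /=.
  congr (_ + _ + _); apply: (IHs _ _ _ _ _ hw hs) => z hz; apply: PQ; exists p;
    by split; [exact: homog_prtW|rewrite addbCA].
rewrite !shuffle_cons; congr (_ + _).
  have [p [hw0 hw']] := hw; apply: (IHw _ _ _ hw') => z hz.
  by apply: PQ; exists p; rewrite addbA.
move: hs => [p [hy hs]]; congr (_ + _).
  apply: (IHs _ _ _ _ _ hw hs) => z hz; apply: PQ; exists p.
  by split; [exact: homog_prtW|rewrite addbCA].
apply: (IHs _ _ _ _ _ (homog_word_gr hw) hs) => z hz; apply: PQ; exists p.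
by split; [exact: homog_prtW|rewrite addbCA].
Qed.

(** Both orders of insertion produce the same words, with signs differing by the exchange of the two
    letters. The induction expands each side by the first letter of the resulting word. *)
Lemma shuffle1C b p v w s P : mlin P -> homog b v -> homog p w ->
  shuffle_sum [:: w] s (fun z => shuffle_sum [:: v] z P) =
    (-1) ^+ (b && p) *: shuffle_sum [:: v] s (fun z => shuffle_sum [:: w] z P).
Proof.
move=> mP hv hw; move: s; apply: mlin_homog_eq.
- by apply: mlin_shuffler; exact: mlin_shuffler.
- by apply: mlinZ; apply: mlin_shuffler; exact: mlin_shuffler.
move=> q s; elim: s q P mP => [|y s IH] q P mP hs.
  rewrite ![shuffle_sum _ [::] _]/= -!/(shuffle_sum [:: _] [:: _] P).
  rewrite (shuffle1_cons [::] mP hv hw) (shuffle1_cons [::] mP hw hv).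
  rewrite !scalerDr !scalerA andbC -signr_addb addbb scale1r.
  by rewrite addrC.
move: hs => [r [hy hs]].
have m1 x := mlin_shuffler [:: x] mP.
rewrite (shuffle1_cons s (m1 v) hw hy) (shuffle1_cons s (m1 w) hv hy).
rewrite (shuffle1_cons (y :: s) mP hv hw) (shuffle1_cons (y :: s) mP hw hv).
rewrite (shuffle1_cons s (mlin_cons w mP) hv hy) (shuffle1_cons s (mlin_cons v mP) hw hy).
have E x b' : homog b' x -> forall z, shuffle_sum [:: x] (y :: z) P =
    P [:: x, y & z] + (-1) ^+ (b' && r) *: shuffle_sum [:: x] z (fun t => P (y :: t)).
  by move=> hx z; exact: shuffle1_cons.
rewrite (shuffle_ext _ _ (E v b hv)) (shuffle_ext _ _ (E w p hw)) !shuffleD !shuffleZ.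
rewrite (IH _ _ (mlin_cons y mP) hs).
rewrite !scalerDr !scalerA -!signr_addb [RHS](AC (1*2*2) (2*(1*4)*(3*5))).
by case: (b) (p) (r) => [] [] []; rewrite /= ?scale1r.
Qed.

(** Associativity of the shuffle product, by a double induction that follows which word supplies the
    first letter. It converts successive insertions, as brackets produce them, into permutations
    shuffled with the other inputs. *)
Lemma shuffle_assoc w z s P : mlin P ->
  shuffle_sum [:: w] z (fun u => shuffle_sum u s P) =
    shuffle_sum z s (fun v => shuffle_sum [:: w] v P).
Proof.
move=> mP; have mG u := mlin_shufflel u mP.
have mH := mlin_shuffler [:: w] mP.
pose L w z s P := shuffle_sum [:: w] z (fun u => shuffle_sum u s P).
pose R w z s P := shuffle_sum z s (fun v => shuffle_sum [:: w] v P).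
have mLz w' s' Q : mlin Q -> mlin (fun z => L w' z s' Q).
  by move=> mQ; apply: mlin_shuffler; exact: mlin_shufflel.
have mRz w' s' Q : mlin Q -> mlin (fun z => R w' z s' Q).
  by move=> mQ; apply: mlin_shufflel; exact: mlin_shuffler.
have mLs w' z' Q : mlin Q -> mlin (fun s => L w' z' s Q).
  by move=> mQ; apply: mlin_shuffle => u; exact: mlin_shuffler.
have mRs w' z' Q : mlin Q -> mlin (fun s => R w' z' s Q).
  by move=> mQ; apply: mlin_shuffler; exact: mlin_shuffler.
have lL w1 w2 z' s' Q : mlin Q -> L (w1 + w2) z' s' Q = L w1 z' s' Q + L w2 z' s' Q.
  move=> mQ; have := mlin_shufflel z' (mlin_shufflel s' mQ) [::] [::] 1 w1 w2.
  by rewrite !scale1r.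
have lR w1 w2 z' s' Q : mlin Q -> R (w1 + w2) z' s' Q = R w1 z' s' Q + R w2 z' s' Q.
  move=> mQ; rewrite /R -shuffleD; apply: shuffle_ext => v.
  by have := mlin_shufflel v mQ [::] [::] 1 w1 w2; rewrite !scale1r.
suff H b w' z' q s' r Q : homog b w' -> homog_word q z' -> homog_word r s' -> mlin Q ->
    L w' z' s' Q = R w' z' s' Q.
  rewrite -/(L w z s P) -/(R w z s P) -(prtD w) lL // lR //.
  by congr (_ + _); move: z; apply: mlin_homog_eq; auto => q z hz; move: s;
    apply: mlin_homog_eq; auto => r s hs; apply: (H _ _ _ _ _ _ _ (homog_prt _ _) hz hs).
clear; elim: s' r b w' z' q Q => [|y s IHs] r b w z q P hw hz hs mP //.
move: hs => [p [hy hs]]; elim: z q P hz mP => [|x z IHz] q P hz mP.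
  rewrite /R shuffle_nill //; exact: mlin_shuffler.
move: (hz) => [a [hx hz']].
have hw1 : homog_word b [:: w] by exists b; rewrite addbb.
have hwz : homog_word (b (+) q) [:: w, x & z] by exists b; split; rewrite // addbA addbb.
have mG t := mlin_shufflel t mP; have mPy := mlin_cons y mP.
have mH := mlin_shuffler [:: w] mP.
have eL : L w (x :: z) s (fun t => P (y :: t)) = shuffle_sum [:: w, x & z] s (fun t => P (y :: t)) +
    (-1) ^+ (b && a) *: shuffle_sum [:: w] z (fun u => shuffle_sum (x :: u) s (fun t => P (y :: t))).
  by rewrite /L (shuffle1_cons _ (mlin_shufflel s mPy) hw hx).
(* The three terms are sorted by the first letter of the shuffled word: w, x or y. *)
have -> : L w (x :: z) (y :: s) P = shuffle_sum (x :: z) (y :: s) (fun t => P (w :: t)) +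
    (-1) ^+ (b && a) *: R w z (y :: s) (fun t => P (x :: t)) +
    (-1) ^+ ((b (+) q) && p) *: R w (x :: z) s (fun t => P (y :: t)).
  rewrite -(IHs _ _ _ _ _ _ hw hz hs mPy) eL -(IHz _ _ hz' (mlin_cons x mP)).
  rewrite /L (shuffle1_cons _ (mG _) hw hx) (shuffle_cons_homog s mP hwz hy).
  have -> : shuffle_sum [:: w] z (fun u => shuffle_sum (x :: u) (y :: s) P) =
     shuffle_sum [:: w] z (fun u => shuffle_sum u (y :: s) (fun t => P (x :: t)) +
       (-1) ^+ ((b (+) q) && p) *: shuffle_sum (x :: u) s (fun t => P (y :: t))).
    apply: (shuffle_exth hw1 hz') => u hu.
    have hxu : homog_word (b (+) q) (x :: u) by exists a; split; rewrite // addbCA.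
    by rewrite (shuffle_cons_homog s mP hxu hy).
  rewrite shuffleD shuffleZ !scalerDr !scalerA [_ ^+ (b && a) * _]mulrC.
  exact: (AC (2*2) ((1*3)*(2*4))).
rewrite /R (shuffle_cons_homog s mH hz hy).
have -> : shuffle_sum z (y :: s) (fun u => shuffle_sum [:: w] (x :: u) P) =
    shuffle_sum z (y :: s) (fun u => P [:: w, x & u] +
      (-1) ^+ (b && a) *: shuffle_sum [:: w] u (fun t => P (x :: t))).
  by apply: shuffle_ext => u; exact: shuffle1_cons.
have -> : shuffle_sum (x :: z) s (fun u => shuffle_sum [:: w] (y :: u) P) =
    shuffle_sum (x :: z) s (fun u => P [:: w, y & u] +
      (-1) ^+ (b && p) *: shuffle_sum [:: w] u (fun t => P (y :: t))).
  by apply: shuffle_ext => u; exact: shuffle1_cons.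
rewrite !shuffleD !shuffleZ (shuffle_cons_homog s (mlin_cons w mP) hz hy) !scalerDr !scalerA -!signr_addb.
rewrite [RHS](AC (2*2) ((1*3)*2*4)).
congr (_ + _ *: _).
by case: (b) (q) (p) => [] [] [].
Qed.

End ShuffleIdentities.

Section Insertions.
Variables (k : fieldType) (c : flavour) (U : superspace k) (M : lmodType k).
Implicit Types (P Q : seq U -> M) (a b p q : bool) (s t : seq U) (x y w : U).

Fixpoint insert_all s P : seq U -> M :=
  if s is w :: s' then insert_all s' (fun t => insert_first c w t P) else P.

Lemma insert_all_ext s P Q : P =1 Q -> insert_all s P =1 insert_all s Q.
Proof.
elim: s P Q => [|w s IH] P Q PQ //=; apply: IH => t; exact: insert_first_ext.
Qed.

Lemma insert_firstC b p v w t P : mlin P -> (c = Com -> gsym P) -> homog b v -> homog p w ->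
  insert_first c w t (fun z => insert_first c v z P) =
    (-1) ^+ (b && p) *: insert_first c v t (fun z => insert_first c w z P).
Proof.
rewrite /insert_first => mP sP hv hw; case: c sP => sP; last exact: shuffle1C.
exact: (sP erefl [::] t _ _ _ _ hv hw).
Qed.
Lemma gsym_insert_first w P : (c = Com -> gsym P) ->
  c = Com -> gsym (fun t => insert_first c w t P).
Proof. by rewrite /insert_first; case: c => // sP _; apply: gsym_cons; exact: sP. Qed.

Lemma insert_all_linear (a : k) s P Q t :
  insert_all s (fun z => a *: P z + Q z) t = a *: insert_all s P t + insert_all s Q t.
Proof.
elim: s P Q t => [|w s IH] P Q t //=; rewrite -IH; apply: insert_all_ext => z.
by rewrite /insert_first; case: c => //; exact: shuffle_lin.
Qed.

Lemma insert_all0 s t : insert_all s (fun=> 0) t = 0.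
Proof.
rewrite -[RHS](addNr (insert_all s (fun=> 0) t)) -scaleN1r -insert_all_linear.
apply: insert_all_ext => z.
by rewrite scaler0 addr0.
Qed.

Lemma insert_allZ (a : k) s P t : insert_all s (fun z => a *: P z) t = a *: insert_all s P t.
Proof.
rewrite -[RHS]addr0 -[X in _ + X](insert_all0 s t) -insert_all_linear.
by apply: insert_all_ext => z; rewrite addr0.
Qed.

(** [insert_all] applies the first letter directly to [P], while in [phi] it is the outermost
    bracket; commuting insertions up to sign reconciles the two orders. *)
Lemma insert_all_first p q w s t P : mlin P -> (c = Com -> gsym P) ->
  homog p w -> homog_word q s ->
  insert_all s (fun z => insert_first c w z P) t =
    (-1) ^+ (p && q) *: insert_first c w t (insert_all s P).
Proof.
move=> mP sP hw; elim: s q P mP sP => [|v s IH] q P mP sP /=.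
  by move=> ->; rewrite andbF scale1r.
move=> [b [hv hs]].
rewrite (insert_all_ext _ (fun z => insert_firstC z mP sP hw hv)) insert_allZ.
rewrite (IH _ _ (mlin_insert_first _ v mP) (gsym_insert_first v sP) hs).
rewrite scalerA -signr_addb.
by congr (_ *: _); case: (p) (b) (q) => [] [] [].
Qed.

Lemma mlin_insert_all P t : mlin P -> mlin (fun s => insert_all s P t).
Proof.
move=> mP s1; elim: s1 P mP => [|v s1 IH] P mP s2 a x y.
  rewrite /= -insert_all_linear; apply: insert_all_ext => z; exact: insert_first_linl.
exact: (IH _ (mlin_insert_first _ v mP)).
Qed.
End Insertions.

Lemma insert_all_com (k : fieldType) (U : superspace k) (M : lmodType k) s t (P : seq U -> M) :
  insert_all Com s P t = P (s ++ t).
Proof. by elim: s P => [|w s IH] P //=; rewrite IH. Qed.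

Lemma symmetric_sum_ext (k : fieldType) (U : superspace k) (M : lmodType k) s (P Q : seq U -> M) :
  P =1 Q -> symmetric_sum s P = symmetric_sum s Q.
Proof.
elim: s P Q => [|w s IH] P Q PQ /=; first exact: PQ.
by apply: IH => z; exact: shuffle_ext.
Qed.

Lemma insert_all_ass (k : fieldType) (U : superspace k) (M : lmodType k) s t (P : seq U -> M) :
  mlin P -> insert_all Ass s P t = symmetric_sum s (fun z => shuffle_sum z t P).
Proof.
elim: s P t => [|w s IH] P t mP /=; first by rewrite shuffle_nill.
rewrite (IH _ t (mlin_insert_first Ass w mP)).
by apply: symmetric_sum_ext => z; rewrite -shuffle_assoc.
Qed.

(** * Taylor coefficients of the derived brackets *)

Section PhiCochain.
Variables (k : fieldType) (k_char0 : [pchar k] =i pred0) (c : flavour) (V : superspace k).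
Variable m : infty c V.
Implicit Types (w x : Pi V) (s t : seq (Pi V)) (p q : bool).

Fact neg_dconst_linear : linear (fun w : Pi V => - dconst k_char0 c w : Cplx m).
Proof. by move=> a x y; rewrite dconst_linear opprD scalerN. Qed.
(** The sign compensates the minus in [cochain_comm_const], so that the derived brackets have the
    structure maps of m as coefficients without a sign. *)
Definition neg_dconst : {linear Pi V -> Cplx m} := mklin neg_dconst_linear.

Lemma neg_dconst_homog p w : homog p w -> @homog k (Cplx m) p (neg_dconst w).
Proof. by move=> hw; apply: homogN; exact: dconst_homog. Qed.
Lemma neg_dconst_prt p w : neg_dconst (prt p w) = @prt k (Cplx m) p (neg_dconst w).
Proof.
rewrite -[in RHS](prtD w) linearD [in RHS]linearD.
by rewrite !(homog_prtN _ (neg_dconst_homog (homog_prt _ _))); case: p; rewrite ?addr0 ?add0r.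
Qed.
Lemma cochain_neg_dconst w s :
  cochain (neg_dconst w : Der c (Pi V)) s = - const_cochain w s.
Proof.
rewrite -[neg_dconst w]/(- dconst k_char0 c w) -scaleN1r [LHS]cochainZ scaleN1r.
by rewrite cochain_dconst.
Qed.
Lemma brk_neg_dconst w x : @brk k (Cplx m) (neg_dconst w) (neg_dconst x) = 0.
Proof.
rewrite -[neg_dconst w]/(- (dconst k_char0 c w : Cplx m)).
rewrite -[neg_dconst x]/(- (dconst k_char0 c x : Cplx m)).
by rewrite -scaleN1r -[X in brk _ X]scaleN1r brkZl brkZr [brk _ _](comm_const_const k_char0 c) !scaler0.
Qed.

Lemma cochain_m2_const p q w (D : Cplx m) t : homog p w -> homog (~~ q) D ->
  cochain (m2 (neg_dconst w) D : Cplx m) t =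
    (-1) ^+ (p && q) *: insert_first c w t (cochain (D : Der c (Pi V))).
Proof.
move=> hw hD; have hi := neg_dconst_homog hw.
rewrite /m2 (gr_homog hi) brkZl -scaleNr.
rewrite -[neg_dconst w]/(- (dconst k_char0 c w : Cplx m)) -scaleN1r brkZl scalerA.
rewrite (brkC (dconst_homog k_char0 c hw : @homog k (Cplx m) p _) hD).
rewrite -scaleNr scalerA [LHS]cochainZ [brk _ _](_ : _ = commutator D (dconst k_char0 c w)) //.
rewrite (cochain_comm_const k_char0 t hD hw) scalerN -scaleNr; congr (_ *: _).
by case: (p) (q) => [] [] /=; ring.
Qed.

Lemma mlin_mcochain : mlin (cochain m).
Proof. exact: (cop_ml (cochain_parity (istr_odd m))). Qed.
Lemma gsym_mcochain : c = Com -> gsym (cochain m).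
Proof. exact: (cop_sy (cochain_parity (istr_odd m))). Qed.

Lemma cochain_phi s t : s != [::] ->
  cochain (phi neg_dconst s : Cplx m) t = insert_all c s (cochain m) t.
Proof.
(* At the empty word [phi] is 0, whereas [insert_all] returns the coefficient of m itself. The
   patched function is still multilinear, so homogeneous words suffice. *)
pose G s := if s is [::] then 0 else insert_all c s (cochain m) t.
suff E : (fun s => cochain (phi neg_dconst s : Cplx m) t) =1 G by rewrite E; case: s.
apply: mlin_homog_eq.
- apply: (mlin_linear (h := fun D : Cplx m => cochain D t)); last exact: mlin_phi.
  by move=> a x y; exact: cochain_lin.
- have mI := mlin_insert_all c t mlin_mcochain.
  by move=> [|v s1] s2 a x y; [exact: (mI [::])|exact: (mI (v :: s1))].
move=> q; case=> [|w s1]; first by rewrite /= cochain0.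
rewrite /G => {G s}; elim: s1 q w t => [|v s1 IH] q w t [p [hw hs]].
  rewrite phi1 -[neg_dconst w]/(- (dconst k_char0 c w : Cplx m)) linearN.
  rewrite -scaleN1r [LHS]cochainZ scaleN1r [dif _](_ : _ = commutator m (dconst k_char0 c w)) //.
  by rewrite (cochain_comm_const k_char0 t (istr_odd m) hw) opprK.
have {}hs : homog_word (p (+) q) (v :: s1) by [].
have hphi := phi_homog neg_dconst_prt hs.
rewrite phi_cons2 (cochain_m2_const (q := p (+) q) t hw hphi).
rewrite [RHS](insert_all_first t mlin_mcochain gsym_mcochain hw hs).
by congr (_ *: _); apply: insert_first_ext => z; exact: (IH _ _ _ hs).
Qed.
End PhiCochain.

(** * Cyclic derivations *)

Section Forms.
Variables (k : fieldType) (U : superspace k).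
Implicit Types (cc : seq U -> U) (a b p q d : bool) (s t : seq U) (x y u v : U).

(** Suspension turns a graded symmetric inner product on V into such a form on [Pi V]; cyclic
    derivations are the symplectic ones for it. *)
Record skew_form (be : U -> U -> k) (e : bool) : Prop := SkewForm {
  sf_linl : forall (a : k) x x' y, be (a *: x + x') y = a * be x y + be x' y;
  sf_linr : forall (a : k) x y y', be x (a *: y + y') = a * be x y + be x y';
  sf_homog : forall a b x y, homog a x -> homog b y -> a (+) b != e -> be x y = 0;
  sf_skew : forall a b x y, homog a x -> homog b y ->
    be x y = - ((-1) ^+ (a && b) * be y x) }.

Variables (be : U -> U -> k) (e : bool) (He : skew_form be e).

Definition cyclic_cochain cc := forall a b t x y,
  homog_word a (rcons t x) -> homog b y ->
  be (cc (rcons t x)) y = (-1) ^+ (a && b) * be (cc (y :: t)) x.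

Let L1 := sf_linl He.
Let L2 := sf_linr He.
Lemma sf0l y : be 0 y = 0.
Proof. by have := L1 (-1) 0 0 y; rewrite scaler0 addr0 mulN1r addNr. Qed.
Lemma sf0r y : be y 0 = 0.
Proof. by have := L2 (-1) y 0 0; rewrite scaler0 addr0 mulN1r addNr. Qed.
Lemma sfZl (a : k) x y : be (a *: x) y = a * be x y.
Proof. by rewrite -[a *: x]addr0 L1 sf0l addr0. Qed.
Lemma sfZr (a : k) x y : be x (a *: y) = a * be x y.
Proof. by rewrite -[a *: y]addr0 L2 sf0r addr0. Qed.
Lemma sfDl x x' y : be (x + x') y = be x y + be x' y.
Proof. by rewrite -[x]scale1r L1 mul1r scale1r. Qed.
Lemma sfDr x y y' : be x (y + y') = be x y + be x y'.
Proof. by rewrite -[y]scale1r L2 mul1r scale1r. Qed.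

Lemma sf_sign p q u v (s1 s2 : bool) : homog p u -> homog q v ->
  (p (+) q = e -> s1 = s2) -> (-1) ^+ s1 * be u v = (-1) ^+ s2 * be u v.
Proof.
move=> hu hv H; have [pq|pq] := eqVneq (p (+) q) e; first by rewrite H.
by rewrite (sf_homog He hu hv pq) !mulr0.
Qed.

Lemma sf_prtl p q u v : homog q v -> be (prt p u) v = (p (+) q == e)%:R * be u v.
Proof.
move=> hv; rewrite -[in RHS](prtD u) sfDl; have H a := sf_homog He (homog_prt a u) hv.
have [pq|pq] := eqVneq (p (+) q) e.
  rewrite mul1r; case: p pq => pq; first by rewrite (H false) ?add0r // -pq; case: (q).
  by rewrite (H true) ?addr0 // -pq; case: (q).
by rewrite mul0r; exact: H.
Qed.

Lemma cyclic_cochain_lin (a : k) c1 c2 : cyclic_cochain c1 -> cyclic_cochain c2 ->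
  cyclic_cochain (fun s => a *: c1 s + c2 s).
Proof.
move=> h1 h2 p q t x y ht hy; rewrite !L1 (h1 _ _ _ _ _ ht hy) (h2 _ _ _ _ _ ht hy).
by ring.
Qed.
Lemma cyclic_cochain0 : cyclic_cochain (fun=> 0).
Proof. by move=> p q t x y _ _; rewrite !sf0l mulr0. Qed.

Lemma homog_word_rcons a t x : homog_word a (rcons t x) ->
  exists p q, [/\ homog p x, homog_word q t & a = p (+) q].
Proof.
rewrite -cats1 => /homog_word_split[q [ht [p [hx e0]]]]; exists p, q; split=> //.
by move: e0; case: (p); case: (q); case: (a).
Qed.

Lemma cyclic_cochain_prt c (D : Der c U) p :
  cyclic_cochain (cochain D) -> cyclic_cochain (cochain (prt p D)).
Proof.
move=> H a b t x y hs hy; have [q [r [hx ht ea]]] := homog_word_rcons hs.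
rewrite (cochain_prt p D hs) (cochain_prt p D (homog_word_cons hy ht)).
rewrite (sf_prtl _ _ hy) (sf_prtl _ _ hx) (H _ _ _ _ _ hs hy).
rewrite mulrCA; congr (_ * (_ * _)); rewrite ea.
by congr ((_ == _)%:R); case: (p) (q) (r) (b) => [] [] [] [].
Qed.
End Forms.

Section CyclicCommutator.
Variables (k : fieldType) (k_char0 : [pchar k] =i pred0) (U : superspace k).
Variables (be : U -> U -> k) (e : bool) (He : skew_form be e).
Implicit Types (a b p q d f : bool) (s t : seq U) (x y u v : U).

Let L1 := sf_linl He.
Let L2 := sf_linr He.

(* An associative derivation is cyclic exactly when it annihilates this tensor. *)
Definition omega_fun (s : seq U) : k^o := if s is [:: u; v] then be u v else 0.
Fact omega_mem : formal_mem Ass omega_fun.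
Proof.
split=> // -[|u [|v s1]] [|w s2] a x y; rewrite /omega_fun /= ?mulr0 ?addr0 //.
- by case: s2 => [|? ?]; rewrite ?L1 ?mulr0 ?addr0.
- by case: s1 => [|? ?]; rewrite ?mulr0 ?addr0.
by case: s1 => [|? ?]; rewrite ?mulr0 ?addr0.
Qed.
Definition omega : formal Ass U := mkformal omega_mem.
Lemma ev_omega s : ev omega s = omega_fun s.
Proof. exact: ev_mk. Qed.

(** The form needs exactly two arguments, so the inserted value takes either all letters but the
    last or all letters but the first. *)
Lemma der_omega d p (D : Der Ass U) x s : homog d D -> homog p x ->
  ev (der_app D omega) (x :: s) =
    be (gp d (cochain D (belast x s))) (gp d (last x s)) + be x (gp d (cochain D s)).
Proof.
move=> hD hx; rewrite (ev_der_app k_char0 _ _ hD) /der_fun ass_der_cons.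
have mc : mlin (cochain D) by exact: mlin_cochain.
congr (_ + _).
  move: (cochain D) => c; elim: s c x {mc hx} => [|y s IH] c x /=; first by rewrite /tw /= !addr0.
  rewrite -[RHS](IH (fun A => c (x :: A))) /= {1}/tw /=.
  by case: s {IH} => [|z s]; rewrite /= add0r.
pose l : {linear U -> k^o} := @mklin k U k^o (be x) (fun (z : k) u v => L2 z x u v).
have hl : lin_homog (p (+) e) l.
  move=> u; rewrite -[in RHS](prtD u) [RHS](sfDr He).
  have H a : a (+) p != e -> be x (prt a u) = 0.
    by rewrite addbC => ae; exact: (sf_homog He hx (homog_prt a u) ae).
  rewrite -[LHS]/(be x _); case E: (p (+) e).
    by rewrite (H false) ?add0r //; move: E; case: (p); case: (e).
  by rewrite (H true) ?addr0 //; move: E; case: (p); case: (e).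
rewrite -[RHS]/(l (gp d (cochain D s))) (lin_form_gpE _ _ hl).
rewrite -(der_fun_flin (c := Ass) s (cochain_parity hD) hl).
by rewrite /der_fun; apply: ass_der_ext => t; rewrite ev_mk; case: t => [|u [|v t]].
Qed.

Lemma der_omega_nil d (D : Der Ass U) : homog d D -> ev (der_app D omega) [::] = 0.
Proof.
move=> hD; rewrite (ev_der_app k_char0 _ _ hD); apply: (etrans (addr0 _)).
by apply: (etrans (addr0 _)); rewrite /tw ev_omega.
Qed.

(** On a word y t x the two terms of [der_omega] become, by skewness, the two sides of the cyclicity
    condition up to a common sign; a one-letter word gives 0 by skewness alone. Annihilating a fixed
    tensor is visibly stable under commutators. *)
Lemma cyclic_der_omega d (D : Der Ass U) : homog d D ->
  cyclic_cochain be (cochain D) <-> der_app D omega = 0.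
Proof.
move=> hD; have par := cop_par (cochain_parity hD).
have key a b t x y : homog_word a (rcons t x) -> homog b y ->
    ev (der_app D omega) (y :: rcons t x) =
      (-1) ^+ (d && e) * (be (cochain D (y :: t)) x -
        (-1) ^+ (a && b) * be (cochain D (rcons t x)) y).
  move=> hs hy; rewrite (der_omega _ hD hy) belast_rcons last_rcons mulrBr.
  have [p [q [hx ht ea]]] := homog_word_rcons hs.
  have h1 := par _ _ (homog_word_cons hy ht); have h2 := par _ _ hs.
  rewrite (gp_homog _ h1) (gp_homog _ h2) (gp_homog _ hx).
  rewrite (sfZl He) !(sfZr He) (sf_skew He hy h2) mulrA -signr_addb !mulrN !mulrA -!signr_addb.
  congr (_ - _).
    by rewrite (sf_sign He h1 hx (s2 := d && e)) // => <-; case: (d) (b) (p) (q) => [] [] [] [].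
  rewrite (sf_sign He h2 hy (s2 := (d && e) (+) (a && b))) // => <-; rewrite ea.
  by case: (d) (b) (p) (q) => [] [] [] [].
split=> [H|H a b t x y hs hy]; last first.
  have := key _ _ _ _ _ hs hy; rewrite H ev0 => /esym/(canRL (signrMK _)).
  by rewrite mulr0 => /subr0_eq ->; rewrite signrMK.
apply: evP; apply: ml_homog_eq; [exact: ev_ml|exact: ev_ml|].
move=> q [|y s] hs; rewrite ev0; first exact: der_omega_nil hD.
have [b [hy hs']] := hs; case: (lastP s) hs' => [|t x] hs'.
  rewrite (der_omega _ hD hy) /=.
  have h0 : homog d (cochain D [::]) by rewrite -[d]addbF; exact: (par false [::]).
  rewrite (gp_homog _ h0) (gp_homog _ hy) (sfZl He) !(sfZr He) (sf_skew He hy h0) mulrN.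
  rewrite !mulrA -!signr_addb; apply/eqP; rewrite subr_eq0; apply/eqP.
  by congr (_ * _); case: (d) (b) => [] [].
by rewrite (key _ _ _ _ _ hs' hy) (H _ _ _ _ _ hs' hy) signrMK subrr mulr0.
Qed.

Lemma cyclic_comm_ass d f (D E : Der Ass U) : homog d D -> homog f E ->
  cyclic_cochain be (cochain D) -> cyclic_cochain be (cochain E) ->
  cyclic_cochain be (cochain (commutator D E)).
Proof.
move=> hD hE /(cyclic_der_omega hD) eD /(cyclic_der_omega hE) eE.
apply/(cyclic_der_omega (comm_homog hD hE)).
by rewrite (commutator_homog _ hD hE) /hcomm eD eE !der_app_r0 scaler0 subr0.
Qed.



Lemma gsym_rcons (M : lmodType k) (P : seq U -> M) p q x s : gsym P ->
  homog p x -> homog_word q s -> P (x :: s) = (-1) ^+ (p && q) *: P (rcons s x).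
Proof.
move=> sP hx; elim: s q P sP => [|y s IH] q P sP /=; first by move=> ->; rewrite andbF scale1r.
move=> [b [hy hs]]; rewrite (sP [::] s _ _ _ _ hx hy) /= (IH _ _ (gsym_cons y sP) hs) scalerA.
by rewrite -signr_addb; congr (_ *: _); case: (p) (b) (q) => [] [] [].
Qed.

(** The inputs of a symmetric cochain can be reordered freely, so rotation may be traded for the
    exchange of one input with the last argument of the form. *)
Lemma cyclic_swap cc : gsym cc -> cyclic_cochain be cc <->
  forall b p q y u s, homog b y -> homog p u -> homog_word q s ->
    be (cc (u :: s)) y = (-1) ^+ ((p && q) (+) (p && b) (+) (q && b)) * be (cc (y :: s)) u.
Proof.
move=> sc; split=> [H b p q y u s hy hu hs|H a b s u y hs hy].
  have hsu : homog_word (q (+) p) (rcons s u).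
    by rewrite -cats1; apply: (homog_word_cat hs); exists p; rewrite addbb.
  rewrite (gsym_rcons sc hu hs) (sfZl He) (H _ _ _ _ _ hsu hy) mulrA -signr_addb.
  by congr (_ * _); case: (p) (b) (q) => [] [] [].
have [p [q [hu hs' ->]]] := homog_word_rcons hs.
have -> : cc (rcons s u) = (-1) ^+ (p && q) *: cc (u :: s).
  by rewrite (gsym_rcons sc hu hs') scalerA -signr_addb addbb scale1r.
rewrite (sfZl He) (H _ _ _ _ _ _ hy hu hs') mulrA -signr_addb.
by congr (_ * _); case: (p) (b) (q) => [] [] [].
Qed.

Lemma cochain_comm_com d f (D E : Der Com U) s : homog d D -> homog f E ->
  cochain (commutator D E) s =
    (-1) ^+ (d && f) *: unsh s (fun A B => cochain E (cochain D A :: B)) -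
      unsh s (fun A B => cochain D (cochain E A :: B)).
Proof.
move=> hD hE; apply: (cochain_unique (comm_homog hD hE)) => q l hl.
have comp d' f' (D' E' : Der Com U) : homog d' D' -> homog f' E' ->
    ev (der_app D' (der_app E' (flin Com l))) s =
    (-1) ^+ ((d' && (f' (+) q)) (+) (f' && q)) *
      l (unsh s (fun A B => cochain E' (cochain D' A :: B))).
  move=> hD' hE'; have hf := hder_homog (homog_der hE') (homog_flin Com hl).
  rewrite (ev_com_der k_char0 s hD' hf) signr_addb -mulrA; congr (_ * _).
  rewrite unsh_form -[RHS](@unshZ k U k^o); apply: (@unsh_ext k U k^o) => A B _.
  exact: (cochainE _ hE' hl).
rewrite (commutator_homog _ hD hE) /hcomm evB evZ (comp _ _ _ _ hD hE) (comp _ _ _ _ hE hD).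
rewrite linearB linearZ mulrBr !mulrA -!signr_addb.
by congr (_ * _ - _ * _); case: (d) (f) (q) => [] [] [].
Qed.

Lemma mlin_be_l cc v : mlin cc -> @mlin k U k^o (fun s => be (cc s) v).
Proof. by move=> mc s1 s2 a x y; rewrite mc L1. Qed.
Lemma mlin_be_r cc v : mlin cc -> @mlin k U k^o (fun s => be v (cc s)).
Proof. by move=> mc s1 s2 a x y; rewrite mc L2. Qed.
Lemma gsym_be_l cc v : gsym cc -> @gsym k U k^o (fun s => be (cc s) v).
Proof. by move=> sc s1 s2 a b x y hx hy; rewrite (sc _ _ _ _ _ _ hx hy) (sfZl He). Qed.
Lemma gsym_be_r cc v : gsym cc -> @gsym k U k^o (fun s => be v (cc s)).
Proof. by move=> sc s1 s2 a b x y hx hy; rewrite (sc _ _ _ _ _ _ hx hy) (sfZr He). Qed.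

(* Up to sign, be ([D, E] s) y is a graded symmetric function of the whole word
   y :: s, namely the unshuffle sum of be (D A) (E B). *)
Lemma cyclic_comm_com d f (D E : Der Com U) : homog d D -> homog f E ->
  cyclic_cochain be (cochain D) -> cyclic_cochain be (cochain E) ->
  cyclic_cochain be (cochain (commutator D E)).
Proof.
move=> hD hE.
have [mD sD pD] := cochain_parity hD; have {}sD := sD erefl.
have [mE sE pE] := cochain_parity hE; have {}sE := sE erefl.
move=> /(cyclic_swap sD) cD /(cyclic_swap sE) cE.
have sC := cop_sy (cochain_parity (comm_homog hD hE)) erefl; apply/(cyclic_swap sC).
(* The twist by [f] is the sign of moving E across the letters fed to D. *)
pose P A B : k^o := be (cochain D (map (gp f) A)) (cochain E B).
have mP : bml P.
  split=> [B|A]; last exact: mlin_be_r.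
  exact: (mlin_map_gp f (mlin_be_l (cochain E B) mD)).
have sK : gsym (fun s => unsh s P).
  apply: (gsym_unsh mP) => [B|A]; last exact: gsym_be_r.
  have sD' := gsym_be_l (cochain E B) sD.
  move=> s1 s2 a b x y hx hy; rewrite /P !map_cat /=.
  by apply: sD'; exact: homog_gp.
have key b q y s : homog b y -> homog_word q s ->
    be (cochain (commutator D E) s) y = - ((-1) ^+ (b && q) * unsh (y :: s) P).
  move=> hy hs; rewrite (cochain_comm_com s hD hE) (unsh_cons s mP hy).
  pose ly : {linear U -> k^o} := @mklin k U k^o (fun u => be u y) (fun (z : k) u v => L1 z u v y).
  (* The identities [e1] and [e2] use the cyclicity of E and of D, respectively, to exchange y with
     the inserted value; in [e2] the two parts also change roles. *)
  have e1 : (-1) ^+ (d && f) * unsh s (fun A B => ly (cochain E (cochain D A :: B))) =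
      - ((-1) ^+ (b && q) * unsh s (fun A B => P (map (gp b) A) (y :: B))).
    rewrite -mulNr.
    rewrite -[LHS](@unshZ k U k^o) -[RHS](@unshZ k U k^o).
    apply: (@unsh_exth k U k^o q) => // a A B hA hB _.
    have hu := pD _ _ hA; rewrite -[LHS]/(_ * be _ _) -[RHS]/(_ * be _ _).
    rewrite (cE _ _ _ _ _ _ hy hu hB).
    rewrite (sf_skew He (pE _ _ (homog_word_cons hy hB)) hu) map_gp_gp.
    rewrite (mlin_gp_homog (M := k^o) _ (mlin_be_l _ mD) hA) -[_ *: _]/(_ * _).
    rewrite !mulrN !mulrA !mulNr -!signr_addb.
    by congr (- (_ * _)); case: (d) (f) (b) (q) (a) => [] [] [] [] [].
  have e2 : unsh s (fun A B => ly (cochain D (cochain E A :: B))) =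
      (-1) ^+ (b && q) * unsh s (fun A B => P (y :: A) B).
    pose Q A B : k^o := P (y :: map (gp b) A) (map (gp b) B).
    transitivity (unsh s Q : k); last first.
      rewrite -[RHS](@unshZ k U k^o); apply: (@unsh_exth k U k^o q) => // a A B hA hB _.
      rewrite /Q (mlin_gp_homog b (mlin_cons y (mP.1 _)) hA).
      rewrite (mlin_gp_homog b (mP.2 (y :: A)) hB) scalerA -signr_addb.
      by congr (_ *: _); case: (b) (q) (a) => [] [] [].
    apply: (@unsh_flip k U k^o q s _ _ hs).
    - split=> [B|A]; last exact: (mlin_cons _ (mlin_be_l y mD)).
      by move=> s1 s2 a u v; rewrite mE (mlin_hd _ _ _ _ mD) -[LHS]/(be _ _) L1.
    - split=> [B|A]; first exact: (mlin_map_gp b (mlin_cons y (mP.1 _))).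
      exact: (mlin_map_gp b (mP.2 _)).
    move=> a c A B hA hB; rewrite -[LHS]/(be _ _) (cD _ _ _ _ _ _ hy (pE _ _ hA) hB) /Q.
    rewrite (mlin_gp_homog b (mlin_cons y (mP.1 _)) hB) (mlin_gp_homog b (mP.2 (y :: B)) hA).
    rewrite /P (mlin_gp_homog (M := k^o) f (mlin_be_l _ mD) (homog_word_cons hy hB)).
    rewrite !scalerA -!signr_addb -[RHS]/(_ * _); congr (_ * _).
    by case: (f) (b) (a) (c) => [] [] [] [].
  rewrite -[LHS]/(ly _) linearB linearZ -[X in X - _]/(_ * ly _).
  by rewrite !unsh_form e1 e2 mulrDr opprD addrC.
move=> b p q y u s hy hu hs.
rewrite (key _ _ _ _ hy (homog_word_cons hu hs)) (key _ _ _ _ hu (homog_word_cons hy hs)).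
rewrite (sK [::] s _ _ _ _ hu hy) -[_ *: _]/(_ * _) !mulrN !mulrA -!signr_addb.
by congr (- (_ * _)); case: (b) (p) (q) => [] [] [].
Qed.
End CyclicCommutator.

Section Subalgebras.
Variables (k : fieldType) (k_char0 : [pchar k] =i pred0) (c : flavour) (V : superspace k).
Variable m : infty c V.
Implicit Types (S : Der c (Pi V) -> Prop) (D E : Der c (Pi V)).

(** Bilinearity and stability under parity projections reduce brackets to homogeneous elements; the
    differential is the bracket with m, itself a member of [S]. *)
Lemma subdgla_closed_cplx S : S 0 ->
  (forall (a : k) D E, S D -> S E -> S (a *: D + E)) ->
  (forall a D, S D -> S (prt a D)) ->
  (forall a b D E, homog a D -> homog b E -> S D -> S E -> S (commutator D E)) ->
  S m -> @subdgla_closed k (Cplx m) S.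
Proof.
move=> S0 SP Sp Sc Sm.
have SD D E : S D -> S E -> S (D + E).
  by move=> hD hE; rewrite -[D]scale1r; exact: SP.
have SC D E : S D -> S E -> S (commutator D E).
  move=> hD hE; rewrite -(prtD D) -[prt false D]scale1r comm_linl scale1r.
  have H a : S (commutator (prt a D) E).
    rewrite -(prtD E) commDr; apply: SD;
      by apply: Sc (homog_prt _ _) (homog_prt _ _) (Sp _ _ hD) (Sp _ _ hE).
  exact: SD.
by split=> // D hD; exact: SC.
Qed.

Lemma no_const_comm a b D E : homog a D -> homog b E ->
  no_const D -> no_const E -> no_const (commutator D E).
Proof.
move=> hD hE /no_constP cD /no_constP cE l; rewrite (commutator_homog _ hD hE) /hcomm evB evZ.
have Z d F (f : formal c (Pi V)) : homog d F -> cochain F [::] = 0 -> ev (der_app F f) [::] = 0.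
  move=> hF F0; rewrite (ev_der_app k_char0 _ _ hF) /der_fun.
  case: (c) f F hF F0 => f F hF F0.
    by rewrite /com_der /= /tw /= F0 linear0 (ml_hd0 _ (ev_ml f)).
  apply: (etrans (addr0 _)); apply: (etrans (addr0 _)).
  by rewrite /tw /= F0 linear0 (ml_hd0 _ (ev_ml f)).
by rewrite (Z _ _ _ hD cD) (Z _ _ _ hE cE) mulr0 subr0.
Qed.

Lemma no_const_closed : @subdgla_closed k (Cplx m) (@no_const k c (Pi V)).
Proof.
apply: subdgla_closed_cplx.
- by apply/no_constP; rewrite cochain0.
- move=> a D E /no_constP hD /no_constP hE; apply/no_constP.
  by rewrite cochain_lin hD hE scaler0 addr0.
- by move=> a D /no_constP hD; apply/no_constP; rewrite (cochain_prt a D (q := false)) // hD linear0.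
- exact: no_const_comm.
- exact: istr_noconst.
Qed.

Variable B : inner_product V.
Definition susp_form (u v : Pi V) : k := B (gr u) v.
Lemma susp_form_skew : skew_form susp_form (ip_parity B).
Proof.
rewrite /susp_form; split=> [a x x' y|a x y y'|a b x y hx hy ab|a b x y hx hy].
- by rewrite linearP ip_linl.
- by rewrite ip_linr.
- rewrite (ip_homog (i := B) (a := ~~ a) (b := ~~ b)) //; first exact: (@homog_gr k (Pi V) a x).
  by move: ab; case: (a); case: (b).
- have Z (s : k) (u v : V) : B (s *: u) v = s * B u v.
    have B0 : B 0 v = 0 by have := ip_linl B (-1) 0 0 v; rewrite scaler0 addr0 mulN1r addNr.
    by rewrite -[s *: u]addr0 ip_linl B0 addr0.
  rewrite (gr_homog (V := Pi V) hx) (gr_homog (V := Pi V) hy) !Z (@ip_sym k V B (~~ a) (~~ b) x y hx hy) !mulrA -!signr_addb -mulNr.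
  by congr (_ * _); case: (a) (b) => [] [] /=; rewrite ?opprK; ring.
Qed.

Lemma cyclicP D : cyclic B D <-> cyclic_cochain susp_form (cochain D).
Proof. by []. Qed.

Lemma cyclic_closed : cyclic B m -> @subdgla_closed k (Cplx m) (fun D => cyclic B D).
Proof.
have He := susp_form_skew; move=> cm; apply: subdgla_closed_cplx => //.
- apply/cyclicP; have -> : cochain (0 : Der c (Pi V)) = fun=> 0.
    by apply: funext => s; exact: cochain0.
  exact: (cyclic_cochain0 He).
- move=> a D E /cyclicP hD /cyclicP hE; apply/cyclicP.
  have -> : cochain (a *: D + E) = fun s => a *: cochain D s + cochain E s.
    by apply: funext => s; exact: cochain_lin.
  exact: (cyclic_cochain_lin He).
- by move=> a D hD; exact: (cyclic_cochain_prt He).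
- move=> a b D E hD hE; case: (c) D E hD hE => D E hD hE.
    exact: (cyclic_comm_com k_char0 He hD hE).
  exact: (cyclic_comm_ass k_char0 He hD hE).
Qed.

Lemma cyclic_no_const_closed : cyclic B m ->
  @subdgla_closed k (Cplx m) (fun D => cyclic B D /\ no_const D).
Proof.
move=> cm; have [z1 l1 p1 d1 b1] := cyclic_closed cm.
have [z2 l2 p2 d2 b2] := no_const_closed.
split=> [//|a x y [] ? ? [] ? ?|a x [] ? ?|x [] ? ?|x y [] ? ? [] ? ?]; split; auto.
Qed.

(** Cyclicity constrains coefficients of positive arity only, and these vanish for a constant. So
    the section by constants is available in the cyclic complex too. *)
Lemma cyclic_neg_dconst w : cyclic B (neg_dconst k_char0 m w).
Proof.
have He := susp_form_skew; apply/cyclicP => a b t x y _ _.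
have Z z s : cochain (neg_dconst k_char0 m w : Der c (Pi V)) (z :: s) = 0.
  by rewrite cochain_neg_dconst oppr0.
case: t => [|z t]; rewrite ?rcons_cons !Z;
  by rewrite !(sf0l He) mulr0.
Qed.
End Subalgebras.

(** * The four fiber sequences *)

Section Instances.
Variables (k : fieldType) (k_char0 : [pchar k] =i pred0) (c : flavour) (V : superspace k).
Variables (m : infty c V) (g h : dgla k) (j : g -> h) (v : h -> Cplx m).
Hypotheses (Hj : is_dgla_map j) (Hv : is_dgla_map v).
Hypotheses (j_inj : injective j) (v_inj : injective v).
Hypotheses (v_const : forall w, exists y, v y = neg_dconst k_char0 m w)
  (v_j : forall x, cochain (v (j x) : Der c (Pi V)) [::] = 0)
  (v_ker : forall y, cochain (v y : Der c (Pi V)) [::] = 0 -> exists x, j x = y).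

(** The injection [v] into the full complex lets one argument serve both full and cyclic complexes:
    coefficients are computed in [Cplx m] and transported back. *)
Lemma exists_section : exists i : {linear Pi V -> h}, forall w, v (i w) = neg_dconst k_char0 m w.
Proof.
have [i hi] := choice v_const.
have li : linear i by move=> a x y; apply: v_inj; rewrite (dgm_lin Hv) !hi linearP.
by exists (mklin li).
Qed.

Fact const_part_linear : linear (fun y : h => - cochain (v y : Der c (Pi V)) [::] : Pi V).
Proof. by move=> a x y; rewrite (dgm_lin Hv) cochain_lin opprD scalerN. Qed.
Definition const_part : {linear h -> Pi V} := mklin const_part_linear.

Lemma const_part_prt a x : const_part (prt a x) = prt a (const_part x).
Proof.
rewrite -[LHS]/(- cochain (v (prt a x) : Der c (Pi V)) [::]) (dgm_prt Hv).
by rewrite (cochain_prt a _ (q := false)) // addbF [in RHS]linearN.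
Qed.

Section WithSection.
Variables (i : {linear Pi V -> h}) (hi : forall w, v (i w) = neg_dconst k_char0 m w).

Lemma section_prt a x : i (prt a x) = prt a (i x).
Proof. by apply: v_inj; rewrite (dgm_prt Hv) !hi neg_dconst_prt. Qed.
Lemma section_abelian x y : brk (i x) (i y) = 0.
Proof. by apply: v_inj; rewrite (dgm_brk Hv) !hi brk_neg_dconst (dgm0 Hv). Qed.
Lemma section_const_part w : const_part (i w) = w.
Proof.
rewrite -[LHS]/(- cochain (v (i w) : Der c (Pi V)) [::]) hi.
by rewrite cochain_neg_dconst opprK.
Qed.
Lemma const_part_j x : const_part (j x) = 0.
Proof. by rewrite -[LHS]/(- cochain (v (j x) : Der c (Pi V)) [::]) v_j oppr0. Qed.
Lemma const_part_ker y : const_part y = 0 -> exists x, j x = y.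
Proof.
rewrite -[const_part y]/(- cochain (v y : Der c (Pi V)) [::]) => /eqP.
by rewrite oppr_eq0 => /eqP; exact: v_ker.
Qed.
Lemma v_phi s : v (phi i s) = phi (neg_dconst k_char0 m) s.
Proof.
elim: s => [|x s IH]; first exact: (dgm0 Hv).
case: s IH => [|y s] IH; first by rewrite !phi1 (dgm_dif Hv) hi.
by rewrite !phi_cons2 (dgm_m2 Hv) hi IH.
Qed.
Lemma mu_insert_all s : mu i const_part s = insert_all c s (cochain m) [::].
Proof.
case: s => [|x s].
  by rewrite mu0; apply/esym/no_constP; exact: istr_noconst.
rewrite /mu -[const_part _]/(- cochain (v (phi i (x :: s)) : Der c (Pi V)) [::]) opprK v_phi.
exact: cochain_phi.
Qed.
End WithSection.

(** On nonempty words the correction [i mu] has no coefficient, so [f] has those of [phi], namely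
    iterated insertions into m. *)
Theorem fiber_seq_of_cochains (mV : infty Com V) :
  (forall s, cochain mV s = insert_all c s (cochain m) [::]) ->
  exists f : seq (Pi V) -> Pi g,
    (forall w x, w != [::] -> x != [::] ->
      cochain (v (j (f w)) : Der c (Pi V)) x = insert_all c w (cochain m) x) /\
    dgla_homotopy_fiber_seq mV f j.
Proof.
move=> HmV; have [i hi] := exists_section.
have [f jf] := choice (fun s => const_part_ker (pr_phi_ker (section_const_part hi) s)).
exists f; split=> [w x w0 x0|]; last first.
  apply: (derived_fiber_seq k_char0 Hj j_inj (section_prt hi) const_part_prt
    (section_abelian hi) (section_const_part hi) const_part_j const_part_ker jf).
  by move=> s; rewrite HmV (mu_insert_all hi).
rewrite jf /phi_ker (dgmD Hv) (v_phi hi) hi [LHS]cochainD (cochain_phi _ _ _ w0).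
rewrite cochain_neg_dconst.
by case: x x0 => //= z x _; rewrite oppr0 addr0.
Qed.

(** The square-zero condition is [mu_sq], so in the associative case the symmetrized structure is
    obtained without a separate computation. *)
Theorem exists_linf_of_insertions : exists mV : infty Com V,
  forall s, cochain mV s = insert_all c s (cochain m) [::].
Proof.
have [i hi] := exists_section.
pose mm := mu i const_part.
have hc : cochain_of_parity Com true mm.
  split.
  - exact: mlin_mu.
  - by move=> _; exact: (gsym_mu const_part (section_prt hi) (section_abelian hi)).
  - exact: (mu_homog (section_prt hi) const_part_prt).
pose D := mkder k_char0 hc.
have cD : cochain D = mm by apply: funext => s; exact: cochain_mkder.
have hD : homog true D := mkder_homog k_char0 hc.
have sq : forall f, der_app D (der_app D f) = 0.
  apply: (der_sq0 k_char0 hD) => s; rewrite cD.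
  exact: (mu_sq k_char0 (section_prt hi) const_part_prt (section_abelian hi)
    (section_const_part hi) (ker_dif Hj const_part_j const_part_ker)
    (ker_brk Hj const_part_j const_part_ker)).
have nc : no_const D by apply/no_constP; rewrite cD; exact: mu0.
exists (Infty hD sq nc) => s.
by rewrite -(mu_insert_all hi) -/mm -cD.
Qed.
End Instances.

Section Symmetrization.
Variables (k : fieldType) (V : superspace k).

Lemma symmetric_sum_linear (U : superspace k) (M N : lmodType k) (T : M -> N) s (P : seq U -> M) :
  linear T -> T (symmetric_sum s P) = symmetric_sum s (fun z => T (P z)).
Proof.
move=> lT; elim: s P => [|x s IH] P //=.
by rewrite IH; apply: symmetric_sum_ext => z; exact: shuffle_linear.
Qed.
Lemma symmetric_sum_lin (U : superspace k) (M : lmodType k) (a : k) s (P Q : seq U -> M) :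
  symmetric_sum s (fun z => a *: P z + Q z) = a *: symmetric_sum s P + symmetric_sum s Q.
Proof.
elim: s P Q => [|x s IH] P Q //=.
by rewrite -IH; apply: symmetric_sum_ext => z; exact: shuffle_lin.
Qed.

(** For homogeneous l both sides carry the same dualization sign, and by [insert_all_ass] inserting
    all letters into the empty word sums over permutations. A general form is the sum of its two
    parity components. *)
Lemma symmetrization_of_cochain (m : infty Ass V) (mL : infty Com V) :
  (forall s, cochain mL s = insert_all Ass s (cochain m) [::]) -> is_symmetrization m mL.
Proof.
move=> H l s.
have E p l' : lin_homog p l' -> ev (der_app mL (flin Com l')) s =
      symmetric_sum s (fun z => ev (der_app m (flin Ass l')) z : k^o).
  move=> hl; rewrite (cochainE _ (istr_odd mL) hl) H (insert_all_ass s [::] (mlin_mcochain m)).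
  have lT : linear (fun u => (-1) ^+ (true && p) * l' u : k^o).
    move=> a u u'; rewrite linearP [LHS]mulrDr; congr (_ + _).
    exact: mulrCA.
  apply: (etrans (symmetric_sum_linear s (cochain m) lT)).
  by apply: symmetric_sum_ext => z; rewrite (cochainE _ (istr_odd m) hl).
have el c : flin c l = flin c (fprt_form false l) + flin c (fprt_form true l).
  rewrite -[X in X + _]scale1r; apply: flin_lin => y.
  by rewrite mul1r -fprt_formD.
rewrite !el der_app_rD evD !(E _ _ (@fprt_form_homog _ _ _ l)).
rewrite -[X in X + _]mul1r.
rewrite -[LHS](@symmetric_sum_lin (Pi V) k^o 1 s).
apply: (@symmetric_sum_ext k (Pi V) k^o) => z.
by rewrite der_app_rD evD scale1r.
Qed.
End Symmetrization.

Section Inclusions.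
Variables (k : fieldType) (g : dgla k) (S T : g -> Prop).
Variables (clS : subdgla_closed S) (clT : subdgla_closed T) (ST : forall x, S x -> T x).

Lemma subdgla_val_inj : injective (@subdgla_val k g S clS).
Proof. exact: val_inj. Qed.
Lemma subdgla_val_map : is_dgla_map (@subdgla_val k g S clS).
Proof. by split=> // a x y; exact: linearP. Qed.
Lemma subdgla_incl_inj : injective (subdgla_incl clS clT ST).
Proof. by move=> x y /(congr1 (@subdgla_val k g T clT)) /subdgla_val_inj. Qed.
End Inclusions.

Lemma subdgla_incl_map (k : fieldType) (g : dgla k) (S T : g -> Prop)
    (clS : subdgla_closed S) (clT : subdgla_closed T) (ST : forall x, S x -> T x) :
  is_dgla_map (subdgla_incl clS clT ST).
Proof.
by split=> [a x y|a x|x|x y]; apply: (@subdgla_val_inj k g T clT).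
Qed.

Section TruncatedComplexes.
Variables (k : fieldType) (k_char0 : [pchar k] =i pred0) (c : flavour) (V : superspace k).
Variable m : infty c V.

Let cl := no_const_closed k_char0 m.

Lemma const_neg_dconst (w : Pi V) : exists y : Cplx m, y = neg_dconst k_char0 m w.
Proof. by exists (neg_dconst k_char0 m w). Qed.

Fact id_dgla_map : is_dgla_map (fun x : Cplx m => x).
Proof. by split. Qed.

Fact no_const_val (x : subdgla cl) :
  cochain (subdgla_val x : Der c (Pi V)) [::] = 0.
Proof. by apply/no_constP; exact: (smemV x). Qed.
Fact no_const_onto (y : Cplx m) : cochain (y : Der c (Pi V)) [::] = 0 ->
  exists x : subdgla cl, subdgla_val x = y.
Proof. by move=> /no_constP hy; exists (@insub_of k (Cplx m) (subdgla_sub cl) y hy). Qed.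

Lemma exists_insertions_linf : exists mL : infty Com V,
  forall s, cochain mL s = insert_all c s (cochain m) [::].
Proof.
exact: (exists_linf_of_insertions (subdgla_val_map cl) id_dgla_map (fun x y e => e)
  const_neg_dconst no_const_val no_const_onto).
Qed.

Lemma fiber_seq_full (mL : infty Com V) :
  (forall s, cochain mL s = insert_all c s (cochain m) [::]) ->
  exists f : seq (Pi V) -> Pi (subdgla cl),
    (forall w x, w != [::] -> x != [::] ->
      cochain (subdgla_val (f w)) x = insert_all c w (cochain m) x) /\
    dgla_homotopy_fiber_seq mL f (@subdgla_val k _ _ cl).
Proof.
exact: (fiber_seq_of_cochains (subdgla_val_map cl) id_dgla_map
  (@subdgla_val_inj _ _ _ cl) (fun x y e => e) const_neg_dconst no_const_val no_const_onto).
Qed.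

Variables (B : inner_product V) (Bm : cyclic B m).
Let clB := cyclic_closed k_char0 Bm.
Let clbar := cyclic_no_const_closed k_char0 Bm.

Lemma fiber_seq_cyclic (mL : infty Com V) :
  (forall s, cochain mL s = insert_all c s (cochain m) [::]) ->
  exists f : seq (Pi V) -> Pi (subdgla clbar),
    (forall w x, w != [::] -> x != [::] ->
      cochain (subdgla_val (f w)) x = insert_all c w (cochain m) x) /\
    dgla_homotopy_fiber_seq mL f (subdgla_incl clbar clB (fun D => @proj1 _ _)).
Proof.
apply: (fiber_seq_of_cochains (subdgla_incl_map clbar clB _) (subdgla_val_map clB)
  (@subdgla_incl_inj _ _ _ _ clbar clB _) (@subdgla_val_inj _ _ _ clB)).
- move=> w; exists (@insub_of k (Cplx m) (subdgla_sub clB) _ (cyclic_neg_dconst k_char0 m B w)).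
  by [].
- by move=> x; apply/no_constP; exact: (proj2 (smemV x)).
- move=> y /no_constP hy.
  exists (@insub_of k (Cplx m) (subdgla_sub clbar) (subdgla_val y) (conj (smemV y) hy)).
  exact: (@subdgla_val_inj _ _ _ clB).
Qed.
End TruncatedComplexes.

Theorem theorem4p7 (k : fieldType) (k_char0 : [pchar k] =i pred0)
    (V : superspace k) :
  (forall m : infty Com V,
    exists (cl : @subdgla_closed k (Cplx m) (@no_const k Com (Pi V)))
      (f : seq (Pi V) -> Pi (subdgla cl)),
      (forall w x : seq (Pi V), w != [::] -> x != [::] ->
        cochain (subdgla_val (f w)) x = cochain m (w ++ x)) /\
      @dgla_homotopy_fiber_seq k V m (subdgla cl) (Cplx m) f (@subdgla_val k _ _ cl)) /\
  (forall (B : inner_product V) (m : infty Com V), cyclic B m ->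
    exists (clbar : @subdgla_closed k (Cplx m)
              (fun D => cyclic B D /\ no_const D))
      (cl : @subdgla_closed k (Cplx m) (fun D => cyclic B D))
      (f : seq (Pi V) -> Pi (subdgla clbar)),
      (forall w x : seq (Pi V), w != [::] -> x != [::] ->
        cochain (subdgla_val (f w)) x = cochain m (w ++ x)) /\
      @dgla_homotopy_fiber_seq k V m (subdgla clbar) (subdgla cl) f
        (subdgla_incl clbar cl (fun D => @proj1 _ _))) /\
  (forall m : infty Ass V,
    exists (mL : infty Com V)
      (cl : @subdgla_closed k (Cplx m) (@no_const k Ass (Pi V)))
      (f : seq (Pi V) -> Pi (subdgla cl)),
      [/\ is_symmetrization m mL,
        (forall w x : seq (Pi V), w != [::] -> x != [::] ->
          cochain (subdgla_val (f w)) x =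
            symmetric_sum w (fun z => shuffle_sum z x (cochain m))) &
        @dgla_homotopy_fiber_seq k V mL (subdgla cl) (Cplx m) f (@subdgla_val k _ _ cl)]) /\
  (forall (B : inner_product V) (m : infty Ass V), cyclic B m ->
    exists (mL : infty Com V)
      (clbar : @subdgla_closed k (Cplx m)
        (fun D => cyclic B D /\ no_const D))
      (cl : @subdgla_closed k (Cplx m) (fun D => cyclic B D))
      (f : seq (Pi V) -> Pi (subdgla clbar)),
      [/\ is_symmetrization m mL,
        (forall w x : seq (Pi V), w != [::] -> x != [::] ->
          cochain (subdgla_val (f w)) x =
            symmetric_sum w (fun z => shuffle_sum z x (cochain m))) &
        @dgla_homotopy_fiber_seq k V mL (subdgla clbar) (subdgla cl) f
          (subdgla_incl clbar cl (fun D => @proj1 _ _))]).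

Proof.
(* Commutative insertion is concatenation, so m is its own derived structure and [mL] is m itself in
   the two commutative cases. *)
have EC m s x : insert_all Com s (cochain m) x = cochain m (s ++ x).
  exact: insert_all_com.
split; last split; last split.
- move=> m; exists (no_const_closed k_char0 m).
  have [s|f [ef sf]] := fiber_seq_full k_char0 (mL := m) (m := m).
    by rewrite EC cats0.
  by exists f; split=> // w x w0 x0; rewrite ef ?EC.
- move=> B m Bm; exists (cyclic_no_const_closed k_char0 Bm), (cyclic_closed k_char0 Bm).
  have [s|f [ef sf]] := fiber_seq_cyclic k_char0 Bm (mL := m).
    by rewrite EC cats0.
  by exists f; split=> // w x w0 x0; rewrite ef ?EC.
- move=> m; have [mL HL] := exists_insertions_linf k_char0 m.
  exists mL, (no_const_closed k_char0 m).
  have [f [ef sf]] := fiber_seq_full k_char0 HL.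
  exists f; split=> // [|w x w0 x0]; first exact: symmetrization_of_cochain.
  by rewrite ef ?insert_all_ass //; exact: mlin_mcochain.
- move=> B m Bm; have [mL HL] := exists_insertions_linf k_char0 m.
  exists mL, (cyclic_no_const_closed k_char0 Bm), (cyclic_closed k_char0 Bm).
  have [f [ef sf]] := fiber_seq_cyclic k_char0 Bm HL.
  exists f; split=> // [|w x w0 x0]; first exact: symmetrization_of_cochain.
  by rewrite ef ?insert_all_ass //; exact: mlin_mcochain.
Qed.
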